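(* Let $(S_t,t\ge0)$ be a drift-free subordinator whose Lévy measure $\nu$ has a continuous density on $]0,\infty[$ and satisfies conditions (L) and (R) stated in the context, and let $m_j=\int_0^\infty y^j\,\nu(\mathrm{d}y)$. For $r\ge1$ let $K_{n,r}$ be the number of parts equal to $r$ in the regenerative composition $\mathcal C_n$ derived from $(S_t)$ (so $K_{n,r}=0$ for $r>n$). Then, as $n\to\infty$, the random sequence $$\left(\frac{K_{n,r}-\mathbb E K_{n,r}}{\sqrt{\log n}},\; r=1,2,\ldots\right)$$ converges in law (in the sense of convergence of finite-dimensional distributions) to a centred multivariate Gaussian sequence with covariance matrix $$\left(\frac{m_2}{m_1^3}\,\frac{1}{ij}+1(i=j)\,\frac{1}{j\,m_1}\right)_{i,j=1}^\infty,$$ where $1(i=j)$ equals $1$ if $i=j$ and $0$ otherwise.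
   Context: The subordinator has no killing. Condition (L): there are constants $c\in\mathbb R$ and $\epsilon>0$ such that $\nu[y,\infty]=-\log y+c-\gamma+O(y^{\epsilon})$ as $y\downarrow0$, where $\gamma=-\Gamma'(1)$ is Euler's constant. Condition (R): there is $\epsilon>0$ such that $\nu[y,\infty]=O(e^{-\epsilon y})$ as $y\to\infty$. Construction of the composition: let $\widetilde S_t=1-\exp(-S_t)$, and let $\widetilde{\mathcal R}\subset[0,1]$ be the closed range of $(\widetilde S_t,t\ge0)$. The gaps of $\widetilde{\mathcal R}$ are the open interval components of $[0,1]\setminus\widetilde{\mathcal R}$. Let $u_1,\dots,u_n$ be i.i.d. uniform on $[0,1]$, independent of $(S_t)$. Two sample points are in the same block iff they fall in the same gap (almost surely every sample point falls in a gap). The composition $\mathcal C_n$ of $n$ is the sequence of sizes of the nonempty blocks, ordered from left to right. Thus $K_{n,r}$ is the number of gaps containing exactly $r$ sample points. *)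

(* Defs.v *)
From HB Require Import structures.
From mathcomp Require Import all_boot all_order all_algebra.
From mathcomp Require Import all_classical all_reals all_analysis.

Set Implicit Arguments.
Unset Strict Implicit.
Unset Printing Implicit Defensive.

Import Order.TTheory GRing.Theory Num.Theory.
Import numFieldNormedType.Exports.

Local Open Scope classical_set_scope.
Local Open Scope ring_scope.

Section probability_notions.
Context {d : measure_display} {T : measurableType d} {R : realType}.
Variable P : probability T R.

(* Equality with [mu] is required on measurable sets only: the values of a
   measure on other sets carry no meaning. *)
Definition has_law (X : T -> R) (mu : set R -> \bar R) : Prop :=
  measurable_fun setT X /\
  forall B : set R, measurable B -> P (X @^-1` B) = mu B.

(* The [B i] may be [setT], so the product rule over the whole index set
   contains the one over each of its subsets. *)
Definition mutually_independent n (X : 'I_n -> T -> R) : Prop :=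
  forall B : 'I_n -> set R, (forall i, measurable (B i)) ->
    P (\bigcap_(i in [set: 'I_n]) (X i @^-1` B i)) =
    (\prod_(i < n) P (X i @^-1` B i))%E.

Definition generated_sigma_algebra (I : Type) (D : set I) (X : I -> T -> R) :
    set (set T) :=
  <<s \bigcup_(i in D) preimage_set_system setT (X i) measurable >>.

Definition independent_sigma_algebras (F G : set (set T)) : Prop :=
  forall A B : set T, F A -> G B -> P (A `&` B) = (P A * P B)%E.

(* [normal_prob m 0] is not the degenerate law at [m]. *)
Definition gaussian_law (m s : R) : set R -> \bar R :=
  if s == 0 then \d_m else normal_prob m s.

Definition gaussian_sequence (Z : nat -> T -> R) : Prop :=
  forall k (a : 'I_k -> R), exists m s : R,
    has_law (fun w => \sum_(i < k) a i * Z i w) (gaussian_law m s).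

Definition centred_gaussian_sequence (Sigma : nat -> nat -> R)
    (Z : nat -> T -> R) : Prop :=
  [/\ gaussian_sequence Z,
      forall i, ('E_P[Z i] = 0)%E &
      forall i j, covariance P (Z i) (Z j) = (Sigma i j)%:E].

End probability_notions.

(* Every finite tuple of coordinates of [X n] converges in law to the same tuple
   of coordinates of [Z], tested on bounded continuous functions. *)
Definition fdd_converges {d d' : measure_display} {T : measurableType d}
    {T' : measurableType d'} {R : realType}
    (P : probability T R) (X : nat -> nat -> T -> R)
    (Q : probability T' R) (Z : nat -> T' -> R) : Prop :=
  (forall n i, measurable_fun setT (X n i)) /\
  forall k (r : 'I_k -> nat) (f : 'rV[R]_k -> R),
    continuous f -> (exists M : R, forall x, `|f x| <= M) ->
    ('E_P[fun w => f (\row_i X n (r i) w)])%E @[n --> \oo]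
      --> ('E_Q[fun w => f (\row_i Z (r i) w)])%E.

(* Makes the Landau notations available at +oo, as they are for nbhs and
   eventually. *)
Canonical pinfty_filter_on (R : numFieldType) :=
  FilterType (pinfty_nbhs R) _.

Section levy_measures.
Context {R : realType}.
Local Notation leb := (@lebesgue_measure R).

Definition Gamma (x : R) : R :=
  \int[leb]_(t in `]0, +oo[%classic) (t `^ (x - 1) * expR (- t)).

Definition euler_gamma : R := - derive1 Gamma 1.

Variable nu : {measure set R -> \bar R}.

(* Lévy measure of a subordinator that is not killed: a measure on
   ]0, +oo[, without mass at infinity. *)
Definition levy_measure : Prop :=
  nu `]-oo, 0]%classic = 0%E /\
  (\int[nu]_(y in `]0%R, +oo[%classic) (Num.min 1 y)%:E < +oo)%E.

Definition continuous_density : Prop := exists f : R -> R,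
  [/\ {in `]0, +oo[, continuous f},
      forall y : R, 0 < y -> 0 <= f y &
      forall B : set R, measurable B -> B `<=` `]0, +oo[%classic ->
        nu B = (\int[leb]_(y in B) (f y)%:E)%E].

(* A finite quantity for [0 < y] when [nu] is a Lévy measure. *)
Definition levy_tail (y : R) : R := fine (nu `[y, +oo[%classic).

Definition condition_L : Prop := exists c eps : R, 0 < eps /\
  (levy_tail = (fun y => - ln y + c - euler_gamma)
     +O_ (0^'+) (fun y => y `^ eps)).

Definition condition_R : Prop := exists eps : R, 0 < eps /\
  levy_tail =O_ (pinfty_nbhs R) (fun y => expR (- eps * y)).

Definition levy_moment (j : nat) : R :=
  \int[nu]_(y in `]0, +oo[%classic) (y ^+ j).

Definition laplace_exponent (rho : R) : R :=
  \int[nu]_(y in `]0, +oo[%classic) (1 - expR (- rho * y)).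

(* Indices start at 1. *)
Definition limit_covariance (i j : nat) : R :=
  levy_moment 2 / levy_moment 1 ^+ 3 * (i * j)%:R^-1
  + (i == j)%:R * (j%:R * levy_moment 1)^-1.

End levy_measures.

Section subordinators.
Context {d : measure_display} {T : measurableType d} {R : realType}.
Variables (P : probability T R) (S : R -> T -> R).

(* Only the times [0 <= t] are meaningful. The values are real numbers, so the
   subordinator is not killed. *)
Record subordinator : Prop := {
  subordinator_measurable : forall t : R, 0 <= t -> measurable_fun setT (S t) ;
  subordinator0 : forall w, S 0 w = 0 ;
  subordinator_nondecreasing :
    forall w (s t : R), 0 <= s -> s <= t -> S s w <= S t w ;
  subordinator_right_continuous :
    forall w (t : R), 0 <= t -> S s w @[s --> t^'+] --> S t w ;
  subordinator_independent_increments :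
    forall n (t : nat -> R), 0 <= t 0 -> {homo t : i j / (i <= j)%N >-> i <= j} ->
      mutually_independent P (fun (i : 'I_n) w => S (t i.+1) w - S (t i) w) ;
  subordinator_stationary_increments :
    forall s t : R, 0 <= s -> 0 <= t ->
      has_law P (fun w => S (s + t) w - S s w)
                (fun B => P (S t @^-1` B))
}.

(* Lévy-Khintchine formula with zero drift and zero killing rate. *)
Definition driftfree_with_levy_measure (nu : {measure set R -> \bar R}) : Prop :=
  levy_measure nu /\
  forall t rho : R, 0 <= t -> 0 <= rho ->
    ('E_P[fun w => expR (- rho * S t w)] =
      (expR (- t * laplace_exponent nu rho))%:E)%E.

End subordinators.

Section composition.
Context {R : realType}.

Definition closed_range (s : R -> R) : set R :=
  closure [set 1 - expR (- s t) | t in `[0, +oo[%classic].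

Definition gaps (s : R -> R) : set (set R) :=
  let A := `[0, 1]%classic `\` closed_range s in
  [set connected_component A x | x in A].

Variables (s : R -> R) (n : nat) (u : 'I_n -> R).

Definition same_gap (i j : 'I_n) : Prop :=
  exists G, [/\ gaps s G, G (u i) & G (u j)].

(* An index whose sample point lies in no gap (an event of probability 0)
   yields [set0], which is discarded. *)
Definition blocks : {set {set 'I_n}} :=
  ([set [set j | `[< same_gap i j >]] | i : 'I_n] :\ finset.set0)%SET.

Definition left_of (B C : {set 'I_n}) : bool :=
  (B == C) || [forall i in B, forall j in C, u i < u j].

Definition composition : seq nat :=
  [seq #|(B : {set 'I_n})| | B <- sort left_of (enum blocks)].

Definition parts_equal (r : nat) : nat := count_mem r composition.

End composition.

Section samples.
Context {d : measure_display} {T : measurableType d} {R : realType}.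
Variables (P : probability T R) (S : R -> T -> R).

Definition iid_uniform n (u : 'I_n -> T -> R) : Prop :=
  (forall i, has_law P (u i) (uniform_prob (@ltr01 R))) /\
  mutually_independent P u.

Definition independent_of_process n (u : 'I_n -> T -> R) : Prop :=
  independent_sigma_algebras P
    (generated_sigma_algebra setT u)
    (generated_sigma_algebra [set t : R | 0 <= t] S).

(* [K_{n,r}] as a real random variable. *)
Definition part_count n (u : 'I_n -> T -> R) (r : nat) (w : T) : R :=
  (parts_equal (S ^~ w) (u ^~ w) r)%:R.

Definition normalised_part_count n (u : 'I_n -> T -> R) (r : nat) (w : T) : R :=
  (part_count u r w - fine ('E_P[part_count u r])%E) / Num.sqrt (ln n%:R).

End samples.

(* Main.v *)
(* Put z(m) = exp(t a_m) and let G(n) be the mean of the product of z(#|B|) over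
   the blocks B of the composition, which is the moment generating function of
   the sum of the a_r K_{n,r} at t. Removing the leftmost gap of the range gives
     sum_(1 <= m <= n) q(n, m) (z(m) G(n - m) - G(n)) = 0,
     q(n, m) = C(n, m) \int (1 - e^-y)^m e^-((n - m) y) nu(dy);
   this is obtained by discretising time along a dyadic grid.
   By (L), q(n, m) tends to 1/m at a polynomial rate. For small s the function
   f_s(n) = prod_(1 <= j <= n) (1 - s/j)^-1, of order n^s, satisfies
     sum_m q(n, m) (f_s(n) - f_s(n - m)) = Phi(s) f_s(n) + O(s n^-delta),
   where Phi(s) = m_1 s - m_2 s^2 / 2 + O(s^3) is the Laplace exponent. Put
   A_1 = sum_m a_m / m and s = t A_1 / m_1 + t^2 b. Up to a multiple of
   t (n + 1)^-delta, f_s is a supersolution or a subsolution of the recursion for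
   small t > 0, according to the side of a critical value on which b lies, so
   that comparison gives the asymptotics of G(n) for t = 1 / sqrt(log n).
   Convergence of all moment generating functions implies convergence in law, and
   the Gaussian limit is built on [0, 1] from binary digits. *)

From HB Require Import structures.
Require Import Defs.
From mathcomp Require Import all_boot all_order all_algebra.
From mathcomp Require Import all_classical all_reals all_analysis.
From mathcomp Require Import measurable_realfun.
From mathcomp Require Import ring lra zify.

Set Implicit Arguments.
Unset Strict Implicit.
Unset Printing Implicit Defensive.

Import Order.TTheory GRing.Theory Num.Theory.
Import numFieldNormedType.Exports.

Local Open Scope classical_set_scope.
Local Open Scope ring_scope.

(** Moment generating functions keep all weights z(m) positive, so that the recursion obeys a
    maximum principle and G can be compared with approximate solutions. Origin of f_s: the number of
    points left after a jump y is binomial with parameter x = e^-y, so that a function close to n^s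
    has mean close to x^s n^s, and integrating (1 - x^s) n^s against nu gives Phi(s) n^s. The
    product f_s is preferred to n^s because j (f_s(j) - f_s(j - 1)) = s f_s(j) turns its binomial
    mean into the solution of a first-order equation with the tiny error term (1 - x)^n. What is
    left is of order n^-delta and is absorbed by the barrier (n + 1)^-delta, whose own drift is
    strictly negative. The tilt contributes t A_1 + t^2 A_2 / 2 + O(t^3), with A_2 = sum_m a_m^2 /
    m, to be matched by Phi(s): the first order forces s = t A_1 / m_1, the second the critical
    value b = A_2 / (2 m_1) + m_2 A_1^2 / (2 m_1^3). As f_s(n) is about e^(s log n), this b is half
    the limiting variance. *)

Section exp_bounds.
Context {R : realType}.
Implicit Types x u : R.

Lemma expR_series_le (n : nat) x : 0 <= x -> series (exp_coeff x) n <= expR x.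
Proof.
move=> x0; rewrite /expR.
apply: nondecreasing_cvgn_le; last exact: is_cvg_series_exp_coeff.
apply/nondecreasing_seqP => m; rewrite /series/= big_nat_recr//= lerDl.
exact: exp_coeff_ge0.
Qed.

Lemma exp_term_le (n : nat) x : 0 <= x -> x ^+ n / n`!%:R <= expR x.
Proof.
move=> x0; apply: le_trans (expR_series_le n.+1 x0).
rewrite /series/= big_nat_recr//= -[leLHS]add0r lerD//.
by apply: sumr_ge0 => i _; exact: exp_coeff_ge0.
Qed.

Lemma series_diff_le (c : nat -> R) x (N n : nat) : (N <= n)%N ->
  (forall i, `|c i| <= `|x| ^+ i / i`!%:R) ->
  `|series c n - series c N| <= \sum_(N <= i < n) `|x| ^+ i / i`!%:R.
Proof.
move=> Nn hc; rewrite /series/= (big_cat_nat (n := N))//= addrAC subrr add0r.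
by apply: le_trans (ler_norm_sum _ _ _) _; apply: ler_sum => i _; exact: hc.
Qed.

(** Shifting the index by [N] and using (i + N)! >= i! leaves an exponential series. Only domination
    of the coefficients is assumed, so that the exponential and the sine are covered at once. *)
Lemma exp_dominated_tail (c : nat -> R) x l (N : nat) :
  series c @ \oo --> l ->
  (forall i, `|c i| <= `|x| ^+ i / i`!%:R) ->
  `|l - series c N| <= `|x| ^+ N * expR `|x|.
Proof.
move=> cl hc.
have cv : `|series c n - series c N| @[n --> \oo] --> `|l - series c N|.
  by apply: cvg_norm; apply: cvgB => //; exact: cvg_cst.
apply: (cvgr_to_le cv); exists N => // n /= Nn.
apply: le_trans (series_diff_le Nn hc) _.
have -> : \sum_(N <= i < n) `|x| ^+ i / i`!%:R =
    \sum_(0 <= i < n - N) `|x| ^+ (i + N) / (i + N)`!%:R.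
  by rewrite -{1}[N]add0n big_addn.
apply: le_trans (_ : \sum_(0 <= i < n - N) `|x| ^+ N * (`|x| ^+ i / i`!%:R) <= _).
  apply: ler_sum => i _; rewrite exprD (mulrC (_ ^+ i)) -mulrA ler_wpM2l ?exprn_ge0// ler_wpM2l ?exprn_ge0//.
  rewrite lef_pV2 ?posrE ?ltr0n ?fact_gt0// ler_nat.
  elim: (N) => [|m IHm]; first by rewrite addn0.
  by rewrite addnS factS (leq_trans IHm)// leq_pmull.
rewrite -mulr_sumr ler_wpM2l ?exprn_ge0//.
apply: le_trans (expR_series_le (n - N) (normr_ge0 x)).
rewrite /series/=; apply: ler_sum => i _.
by rewrite exp_coeffE/= mulrC.
Qed.

(** Writing |x|^i as 2^-i (2 |x|)^i makes the remainder geometrically small in [N] against a fixed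
    exponential weight, as the polynomial approximation of the sine requires. *)
Lemma exp_dominated_tail2 (c : nat -> R) x l (N : nat) :
  series c @ \oo --> l ->
  (forall i, `|c i| <= `|x| ^+ i / i`!%:R) ->
  `|l - series c N| <= 2 ^- N * expR (2 * `|x|).
Proof.
move=> cl hc.
have cv : `|series c n - series c N| @[n --> \oo] --> `|l - series c N|.
  by apply: cvg_norm; apply: cvgB => //; exact: cvg_cst.
apply: (cvgr_to_le cv); exists N => // n /= Nn.
apply: le_trans (series_diff_le Nn hc) _.
apply: le_trans (_ : \sum_(N <= i < n) 2 ^- N * ((2 * `|x|) ^+ i / i`!%:R) <= _).
  rewrite [leLHS]big_nat_cond [leRHS]big_nat_cond.
  apply: ler_sum => i /andP[/andP[Ni _] _]; rewrite mulrA.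
  rewrite ler_wpM2r ?invr_ge0// exprMn mulrA ler_peMl ?exprn_ge0//.
  rewrite mulrC ler_pdivlMr ?exprn_gt0// mul1r.
  by rewrite ler_weXn2l// ler1n.
rewrite -mulr_sumr ler_wpM2l ?invr_ge0 ?exprn_ge0//.
have x2 : 0 <= 2 * `|x| by rewrite mulr_ge0.
apply: le_trans (expR_series_le n x2).
rewrite /series/= [leRHS](big_cat_nat (n := N))//=.
rewrite -[leLHS]add0r lerD//.
  by apply: sumr_ge0 => i _; exact: exp_coeff_ge0.
Qed.

Lemma exp_coeff_norm x i : `|exp_coeff x i| <= `|x| ^+ i / i`!%:R.
Proof. by rewrite exp_coeffE/= mulrC normrM normrX normfV normr_nat. Qed.

Lemma sin_coeff_norm x i : `|sin_coeff x i| <= `|x| ^+ i / i`!%:R.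
Proof.
rewrite sin_coeffE/= !normrM normrX normfV normr_nat normrX normrN1 expr1n mulr1.
rewrite mulrC ler_wpM2l ?exprn_ge0//.
by rewrite normr_nat; case: (odd i); rewrite ?mul1r// mul0r invr_ge0.
Qed.

Lemma expR_taylor (N : nat) x :
  `|expR x - series (exp_coeff x) N| <= `|x| ^+ N * expR `|x|.
Proof.
by apply: exp_dominated_tail; [exact: is_cvg_series_exp_coeff|exact: exp_coeff_norm].
Qed.

Lemma expR_taylor1 x : `|expR x - 1| <= `|x| * expR `|x|.
Proof.
have := expR_taylor 1 x.
by rewrite /series/= big_nat1 exp_coeffE/= expr0 mulr1 fact0 invr1 expr1.
Qed.

Lemma expR_taylor2 x : `|expR x - (1 + x)| <= `|x| ^+ 2 * expR `|x|.
Proof.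
have := expR_taylor 2 x.
rewrite /series/= big_nat_recr//= big_nat1 exp_coeffE/= expr0 mulr1 fact0 invr1.
by rewrite expr1 mul1r.
Qed.

Lemma expR_taylor3 x :
  `|expR x - (1 + x + x ^+ 2 / 2)| <= `|x| ^+ 3 * expR `|x|.
Proof.
have := expR_taylor 3 x.
rewrite /series/= 2?big_nat_recr//= big_nat1 exp_coeffE/= expr0 mulr1 fact0 invr1.
by rewrite expr1 mul1r (mulrC (2`!%:R^-1)).
Qed.

Lemma sin_series_approx (N : nat) x :
  `|sin x - series (sin_coeff x) N| <= 2 ^- N * expR (2 * `|x|).
Proof.
apply: exp_dominated_tail2; last exact: sin_coeff_norm.
by rewrite unlock; exact: is_cvg_series_sin_coeff.
Qed.

Lemma sin_taylor x : `|sin x - x| <= `|x| ^+ 2 * expR `|x|.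
Proof.
have : `|sin x - series (sin_coeff x) 2| <= `|x| ^+ 2 * expR `|x|.
  apply: exp_dominated_tail; last exact: sin_coeff_norm.
  by rewrite unlock; exact: is_cvg_series_sin_coeff.
rewrite /series/= big_nat_recr//= big_nat1 sin_coeffE/=.
by rewrite !mul0r add0r !expr0 expr1 !mul1r invr1 mul1r.
Qed.

End exp_bounds.

(** * Convergence of moment generating functions *)

Section exponential_approximation.
Context {R : realType} (k : nat).
Implicit Types (x : 'rV[R]_k) (b e : R) (h g : 'rV[R]_k -> R).

Definition dotr (a x : 'rV[R]_k) : R := \sum_i a 0 i * x 0 i.
Definition norm1 x : R := \sum_i `|x 0 i|.
Definition exp_poly (p : seq (R * 'rV[R]_k)) x : R :=
  \sum_(q <- p) q.1 * expR (dotr q.2 x).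

Lemma norm1_ge0 x : 0 <= norm1 x.
Proof. by apply: sumr_ge0. Qed.

Lemma norm1_coord x i : `|x 0 i| <= norm1 x.
Proof.
by rewrite /norm1 (bigD1 i)//= lerDl; apply: sumr_ge0.
Qed.

Lemma dotrDl (a a' x : 'rV[R]_k) : dotr (a + a') x = dotr a x + dotr a' x.
Proof. by rewrite /dotr -big_split/=; apply: eq_bigr => i _; rewrite mxE mulrDl. Qed.

(** Approximability by exponential polynomials in the uniform norm weighted by
    [expR (- b * norm1 x)]. The growth bound is recorded as well because products need it. *)
Definition exp_approx b h :=
  (exists C, forall x, `|h x| <= C * expR (b * norm1 x)) /\
  forall e, 0 < e ->
    exists p, forall x, `|h x - exp_poly p x| <= e * expR (b * norm1 x).

Lemma exp_approx_mono b b' h : b <= b' -> exp_approx b h -> exp_approx b' h.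
Proof.
move=> bb [[C hC] ha].
have le x : expR (b * norm1 x) <= expR (b' * norm1 x).
  by rewrite ler_expR ler_wpM2r// norm1_ge0.
split.
  exists `|C| => x; apply: le_trans (hC x) _.
  apply: le_trans (_ : `|C| * expR (b * norm1 x) <= _).
    by rewrite ler_wpM2r ?expR_ge0// ler_norm.
  by rewrite ler_wpM2l.
move=> e e0; have [p hp] := ha _ e0; exists p => x.
by apply: le_trans (hp x) _; rewrite ler_wpM2l// ltW.
Qed.

Lemma exp_approx_eq b h g : h =1 g -> exp_approx b h -> exp_approx b g.
Proof. by move=> /funext ->. Qed.

Lemma exp_approx_ext b h g : exp_approx b h -> h =1 g -> exp_approx b g.
Proof. by move=> hh /funext <-. Qed.

Lemma exp_approx_cst c : exp_approx 0 (fun=> c).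
Proof.
split; first by exists `|c| => x; rewrite mul0r expR0 mulr1.
move=> e e0; exists [:: (c, 0)] => x.
rewrite /exp_poly big_seq1/= /dotr big1 ?expR0 ?mulr1 ?subrr ?normr0.
  by rewrite mulr_ge0 ?ltW// expR_gt0.
by move=> i _; rewrite mxE mul0r.
Qed.

Lemma exp_polyM p q x : exp_poly p x * exp_poly q x =
  exp_poly [seq (u.1 * v.1, u.2 + v.2) | u <- p, v <- q] x.
Proof.
rewrite /exp_poly big_allpairs_dep/= big_distrl/=; apply: eq_bigr => u _.
rewrite big_distrr/=; apply: eq_bigr => v _.
by rewrite dotrDl expRD mulrACA.
Qed.

Lemma exp_approxD b h g :
  exp_approx b h -> exp_approx b g -> exp_approx b (fun x => h x + g x).
Proof.
move=> [[C hC] hh] [[D gD] hg]; split.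
  exists (C + D) => x; apply: le_trans (ler_normD _ _) _.
  by rewrite mulrDl lerD.
move=> e e0; have e20 : 0 < e / 2 by rewrite divr_gt0.
have [p hp] := hh _ e20; have [q hq] := hg _ e20.
exists (p ++ q) => x; rewrite /exp_poly big_cat/= -/(exp_poly p x) -/(exp_poly q x).
rewrite opprD addrACA; apply: le_trans (ler_normD _ _) _.
by rewrite [e]splitr mulrDl lerD.
Qed.

Lemma exp_approxM b b' h g : exp_approx b h -> exp_approx b' g ->
  exp_approx (b + b') (fun x => h x * g x).
Proof.
move=> [[C hC] hh] [[D gD] hg].
have EE x : expR ((b + b') * norm1 x) = expR (b * norm1 x) * expR (b' * norm1 x).
  by rewrite mulrDl expRD.
split.
  exists (`|C| * `|D|) => x; rewrite normrM EE mulrACA.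
  apply: ler_pM => //.
    by apply: le_trans (hC x) _; rewrite ler_wpM2r ?expR_ge0// ler_norm.
  by apply: le_trans (gD x) _; rewrite ler_wpM2r ?expR_ge0// ler_norm.
move=> e e0.
pose K := `|C| + `|D| + 1.
have K0 : 0 < K by rewrite ltr_wpDl// addr_ge0.
have K1 : 1 <= K by rewrite lerDr addr_ge0.
(* The cap at 1 bounds the approximant of [g] by [K] times its weight. *)
pose e' := Num.min 1 (e / (2 * K)).
have e'0 : 0 < e' by rewrite lt_min ltr01 divr_gt0// mulr_gt0.
have e'1 : e' <= 1 by rewrite ge_min lexx.
have e'K : K * e' <= e / 2.
  have : e' <= e / (2 * K) by rewrite ge_min lexx orbT.
  by rewrite invfM mulrA ler_pdivlMr// mulrC.
have [p hp] := hh _ e'0; have [q hq] := hg _ e'0.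
exists [seq (u.1 * v.1, u.2 + v.2) | u <- p, v <- q] => x.
rewrite -exp_polyM EE.
set P := exp_poly p x; set Q := exp_poly q x; set A := expR _; set B := expR _.
have A0 : 0 <= A by exact: expR_ge0.
have B0 : 0 <= B by exact: expR_ge0.
have hx : `|h x| <= K * A.
  apply: le_trans (hC x) _; rewrite ler_wpM2r// /K -addrA.
  by apply: le_trans (ler_norm _) _; rewrite lerDl addr_ge0.
have hQ : `|Q| <= K * B.
  rewrite -[Q](subrK (g x)) (le_trans (ler_normD _ _))// distrC.
  apply: le_trans (lerD (hq x) (gD x)) _; rewrite -mulrDl ler_wpM2r//.
  rewrite /K addrC lerD//; apply: le_trans (ler_norm _) _; by rewrite lerDr.
have -> : h x * g x - P * Q = h x * (g x - Q) + Q * (h x - P) by ring.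
apply: le_trans (ler_normD _ _) _; rewrite !normrM.
have h1 : `|h x| * `|g x - Q| <= K * A * (e' * B) by apply: ler_pM => //; exact: hq.
have h2 : `|Q| * `|h x - P| <= K * B * (e' * A) by apply: ler_pM => //; exact: hp.
apply: le_trans (lerD h1 h2) _.
have -> : K * A * (e' * B) + K * B * (e' * A) = (K * e') * 2 * (A * B) by ring.
rewrite ler_wpM2r ?mulr_ge0//.
by apply: le_trans (_ : e / 2 * 2 <= _); [rewrite ler_wpM2r|rewrite divfK].
Qed.

Lemma exp_approx_lim b h :
  (forall e, 0 < e -> exists g, exp_approx b g /\
     forall x, `|h x - g x| <= e * expR (b * norm1 x)) -> exp_approx b h.
Proof.
move=> H; split.
  have [g [[[C gC] _] hg]] := H 1 ltr01; exists (1 + C) => x.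
  rewrite -[h x](subrK (g x)) (le_trans (ler_normD _ _))// mulrDl lerD//.
move=> e e0; have e20 : 0 < e / 2 by rewrite divr_gt0.
have [g [[_ gg] hg]] := H _ e20; have [p hp] := gg _ e20.
exists p => x; rewrite -[h x](subrK (g x)) -addrA.
by rewrite (le_trans (ler_normD _ _))// [e]splitr mulrDl lerD.
Qed.

Lemma sqr_le_expR b (t : R) : 0 < b -> `|t| ^+ 2 <= 2 / b ^+ 2 * expR (b * `|t|).
Proof.
move=> b0; have := @exp_term_le R 2 (b * `|t|).
rewrite mulr_ge0 ?(ltW b0)// => /(_ isT); rewrite (_ : 2`! = 2)%N// exprMn => H.
rewrite mulrAC ler_pdivlMr ?exprn_gt0// mulrC.
by move: H; rewrite ler_pdivrMr// [X in _ <= X]mulrC.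
Qed.

(** The difference quotient (e^(h t) - 1) / h is an exponential polynomial. Its error is at most h
    t^2 e^(h |t|): one half of [b] absorbs the exponential, since h <= b / 2, and the other half the
    square. *)
Lemma exp_approx_coord b i : 0 < b -> exp_approx b (fun x => x 0 i).
Proof.
move=> b0; split.
  exists b^-1 => x; rewrite ler_pdivlMl//.
  apply: le_trans (_ : b * norm1 x <= _).
    by rewrite ler_pM2l// norm1_coord.
  by apply: le_trans (expR_ge1Dx _); rewrite lerDr.
move=> e e0.
pose h := Num.min (b / 2) (e * (b / 2) ^+ 2 / 2).
have b20 : 0 < b / 2 by rewrite divr_gt0.
have h0 : 0 < h by rewrite lt_min b20/= !mulr_gt0// exprn_gt0.
have hb : h <= b / 2 by rewrite ge_min lexx.
have he : h * (2 / (b / 2) ^+ 2) <= e.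
  have : h <= e * (b / 2) ^+ 2 / 2 by rewrite ge_min lexx orbT.
  rewrite ler_pdivlMr// => hh.
  by rewrite mulrA ler_pdivrMr ?exprn_gt0.
exists [:: (h^-1, \row_j (h *+ (j == i))); (- h^-1, 0)] => x.
rewrite /exp_poly big_cons big_seq1/=.
have -> : dotr 0 x = 0 by rewrite /dotr big1// => j _; rewrite mxE mul0r.
have -> : dotr (\row_j (h *+ (j == i))) x = h * x 0 i.
  rewrite /dotr (bigD1 i)//= mxE eqxx mulr1n big1 ?addr0// => j /negPf ji.
  by rewrite mxE ji mulr0n mul0r.
rewrite expR0 mulr1; set t := x 0 i.
have -> : t - (h^-1 * expR (h * t) - h^-1) = - h^-1 * (expR (h * t) - (1 + h * t)).
  by field; rewrite gt_eqF.
have hV : 0 < h^-1 by rewrite invr_gt0.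
rewrite normrM normrN (gtr0_norm hV) ler_pdivrMl//.
apply: le_trans (expR_taylor2 _) _; rewrite normrM (gtr0_norm h0).
have tx : `|t| <= norm1 x by exact: norm1_coord.
apply: le_trans (_ : h ^+ 2 * `|t| ^+ 2 * expR (b / 2 * norm1 x) <= _).
  rewrite exprMn ler_wpM2l ?mulr_ge0 ?exprn_ge0 ?(ltW h0)//.
  by rewrite ler_expR ler_pM// (ltW h0).
apply: le_trans (_ : h ^+ 2 * (2 / (b / 2) ^+ 2 * expR (b / 2 * norm1 x)) * expR (b / 2 * norm1 x) <= _).
  rewrite ler_wpM2r ?expR_ge0// ler_wpM2l ?exprn_ge0 ?(ltW h0)//.
  apply: le_trans (sqr_le_expR _ b20) _.
  rewrite ler_wpM2l ?divr_ge0 ?exprn_ge0 ?(ltW b20)//.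
  by rewrite ler_expR ler_wpM2l// (ltW b20).
have -> : h ^+ 2 * (2 / (b / 2) ^+ 2 * expR (b / 2 * norm1 x)) * expR (b / 2 * norm1 x)
  = h * (h * (2 / (b / 2) ^+ 2)) * (expR (b / 2 * norm1 x) * expR (b / 2 * norm1 x)) by ring.
rewrite -expRD -mulrDl -splitr -[leLHS]mulrA ler_wpM2l ?(ltW h0)//.
by rewrite ler_wpM2r ?expR_ge0.
Qed.

Lemma exp_approx_coordX b i n : 0 < b -> exp_approx b (fun x => x 0 i ^+ n).
Proof.
elim: n b => [|n IH] b b0.
  apply: exp_approx_eq (exp_approx_mono (ltW b0) (exp_approx_cst 1)) => x.
  by rewrite expr0.
have b20 : 0 < b / 2 by rewrite divr_gt0.
rewrite [b]splitr; apply: exp_approx_eq (exp_approxM (exp_approx_coord i b20) (IH _ b20)) => x.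
by rewrite exprS.
Qed.

Lemma exp_approxZ b c h : exp_approx b h -> exp_approx b (fun x => c * h x).
Proof.
move=> hh; rewrite -[b]add0r; exact: exp_approxM (exp_approx_cst c) hh.
Qed.

Lemma exp_approx_sum b (I : Type) (s : seq I) (F : I -> 'rV[R]_k -> R) : 0 <= b ->
  (forall i, exp_approx b (F i)) -> exp_approx b (fun x => \sum_(i <- s) F i x).
Proof.
move=> b0 hF; elim: s => [|i s IH].
  by apply: exp_approx_eq (exp_approx_mono b0 (exp_approx_cst 0)) => x; rewrite big_nil.
by apply: exp_approx_eq (exp_approxD (hF i) IH) => x; rewrite big_cons.
Qed.

(** The Taylor polynomials of the sine converge in the weighted norm, their remainder being at most
    2^-N e^(2 c |x_i|). *)
Lemma exp_approx_sin (c : R) i : 0 < c ->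
  exp_approx (2 * c) (fun x => sin (c * x 0 i)).
Proof.
move=> c0; have c20 : 0 < 2 * c by rewrite mulr_gt0.
apply: exp_approx_lim => e e0.
have [N hN] : exists N : nat, 2 ^- N <= e.
  have : 2 ^- n @[n --> \oo] --> (0 : R).
    under eq_fun do rewrite -exprVn.
    by apply: cvg_expr; rewrite ger0_norm ?invr_ge0// invf_lt1// ltr1n.
  by move=> /cvgr0_norm_le/(_ _ e0)[N _ /(_ N (leqnn N))]; rewrite ger0_norm ?invr_ge0 ?exprn_ge0//; exists N.
exists (fun x => series (sin_coeff (c * x 0 i)) N); split.
  rewrite /series/=; apply: exp_approx_sum => [|j]; first exact: ltW.
  apply: exp_approx_eq (exp_approxZ ((odd j)%:R * (-1) ^+ j.-1./2 / j`!%:R * c ^+ j) (exp_approx_coordX i j c20)) => x.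
  by rewrite sin_coeffE/= exprMn mulrA.
move=> x; apply: le_trans (sin_series_approx _ _) _.
rewrite normrM (gtr0_norm c0) mulrA.
apply: ler_pM; rewrite ?invr_ge0 ?exprn_ge0 ?expR_ge0//.
by rewrite ler_expR ler_pM2l// norm1_coord.
Qed.

End exponential_approximation.

(** * Binomial means and Bernstein approximation *)

Section binomial_expectation.
Context {R : realFieldType}.
Implicit Types (y : R) (g : nat -> R) (m : nat).

(** The probability that a binomial variable with parameters [m] and [y] equals [j]. The expectation
    [bin_mean] is a Bernstein polynomial in [y]. *)
Definition bin_weight m y j : R := 'C(m, j)%:R * y ^+ j * (1 - y) ^+ (m - j).

Definition bin_mean m y g : R := \sum_(j < m.+1) bin_weight m y j * g j.

Lemma bin_weight_ge0 m y j : 0 <= y <= 1 -> 0 <= bin_weight m y j.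
Proof.
by move=> /andP[y0 y1]; rewrite !mulr_ge0// exprn_ge0// subr_ge0.
Qed.

Lemma bin_mean0 y g : bin_mean 0 y g = g 0%N.
Proof. by rewrite /bin_mean big_ord1 /bin_weight bin0 !expr0 !mulr1 mul1r. Qed.

(** Conditioning on one of the m + 1 trials. Most inductions on binomial means below rest on this
    identity. *)
Lemma bin_meanS m y g :
  bin_mean m.+1 y g = y * bin_mean m y (g \o S) + (1 - y) * bin_mean m y g.
Proof.
rewrite /bin_mean big_ord_recl/=.
have -> : \sum_(i < m.+1) bin_weight m.+1 y (bump 0 i) * g (bump 0 i) =
  y * (\sum_(j < m.+1) bin_weight m y j * g j.+1) +
  \sum_(j < m.+1) 'C(m, j.+1)%:R * y ^+ j.+1 * (1 - y) ^+ (m - j) * g j.+1.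
  rewrite mulr_sumr -big_split/=; apply: eq_bigr => j _.
  rewrite /bump/= add1n /bin_weight subSS binS natrD exprS; ring.
rewrite addrCA; congr (_ + _).
rewrite [X in _ + X]big_ord_recr/= bin_small// !mul0r addr0.
rewrite [in RHS]big_ord_recl/= mulrDr; congr (_ + _).
  by rewrite /bin_weight !bin0 !expr0 !subn0 exprS; ring.
rewrite mulr_sumr; apply: eq_bigr => j _.
rewrite /bin_weight /bump/= add1n.
have -> : (m - j = (m - j.+1).+1)%N by rewrite -subSn// subSS.
by rewrite [(1 - y) ^+ _.+1]exprS; ring.
Qed.

Lemma bin_mean_le m y g h : 0 <= y <= 1 ->
  (forall j, (j <= m)%N -> g j <= h j) -> bin_mean m y g <= bin_mean m y h.
Proof.
move=> y01 gh; apply: ler_sum => j _.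
by rewrite ler_wpM2l ?bin_weight_ge0// gh// -ltnS.
Qed.

Lemma bin_meanD m y g h :
  bin_mean m y (fun j => g j + h j) = bin_mean m y g + bin_mean m y h.
Proof. by rewrite /bin_mean -big_split/=; apply: eq_bigr => j _; rewrite mulrDr. Qed.

Lemma bin_meanZ m y c g : bin_mean m y (fun j => c * g j) = c * bin_mean m y g.
Proof. by rewrite /bin_mean mulr_sumr; apply: eq_bigr => j _; rewrite mulrCA. Qed.

Lemma bin_mean_cst m y c : bin_mean m y (fun=> c) = c.
Proof.
elim: m => [|m IH]; first by rewrite bin_mean0.
by rewrite bin_meanS /comp IH; ring.
Qed.

Lemma bin_mean_id m y : bin_mean m y (fun j => j%:R) = m%:R * y.
Proof.
elim: m => [|m IH]; first by rewrite bin_mean0 mul0r.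
rewrite bin_meanS IH (_ : bin_mean m y _ = m%:R * y + 1).
  by rewrite -natr1; ring.
rewrite -[X in _ = _ + X](bin_mean_cst m y 1) -IH -bin_meanD.
by congr bin_mean; apply/funext => j /=; rewrite natr1.
Qed.

(** The centre [c] is kept free because conditioning on one trial shifts it by 1. *)
Lemma bin_mean_sqr m y c : bin_mean m y (fun j => (j%:R - c) ^+ 2) =
  (m%:R * y - c) ^+ 2 + m%:R * y * (1 - y).
Proof.
elim: m c => [|m IH] c; first by rewrite bin_mean0; ring.
rewrite bin_meanS IH.
have -> : (fun j => (j%:R - c) ^+ 2) \o S = (fun j => (j%:R - (c - 1)) ^+ 2).
  by apply/funext => j /=; rewrite -natr1; ring.
by rewrite IH -natr1; ring.
Qed.

End binomial_expectation.

Section bounded_continuous_approximation.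
Context {R : realType} (k : nat).
Implicit Types (x : 'rV[R]_k) (f : 'rV[R]_k -> R).

(** Compactness of the cube gives uniformity; only [x] is confined to the cube, while [y] may leave
    it. *)
Lemma continuous_unif_cube f (rho e : R) : continuous f -> 0 < e ->
  exists2 d : R, 0 < d & forall x y : 'rV[R]_k, (forall i, `|x 0 i| <= rho) ->
    (forall i, `|x 0 i - y 0 i| < d) -> `|f x - f y| < e.
Proof.
move=> cf e0.
have K : compact [set v : 'rV[R]_k | forall i, `[- rho, rho]%classic (v ord0 i)].
  by apply: (@rV_compact R k (fun=> `[- rho, rho]%classic)) => i; exact: segment_compact.
move/compact_near_coveringP: K.
move=> /(_ R (0^'+) (fun d (x : 'rV[R]_k) => forall y : 'rV[R]_k, (forall i, `|x 0 i - y 0 i| < d) -> `|f x - f y| < e)).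
have : forall x : 'rV_k, [set v | forall i, `[- rho, rho]%classic (v ord0 i)] x ->
  \forall x' \near x & i \near 0^'+, forall y : 'rV[R]_k, (forall j, `|(x' : 'rV[R]_k) 0 j - y 0 j| < i) -> `|f x' - f y| < e.
  move=> x _.
  have e2 : 0 < e / 2 by rewrite divr_gt0.
  have /cvgr_dist_lt/(_ _ e2) := cf x.
  rewrite -nbhs_ballE => -[r/= r0 hr].
  have r2 : 0 < r / 2 by rewrite divr_gt0.
  exists (ball x (r / 2), [set d | d < r / 2]).
    split => /=; first exact: nbhsx_ballx.
    by apply: nbhs_right_lt.
  move=> -[x' d] /= [xx' dr] y hy.
  have h1 : `|f x - f x'| < e / 2.
    by apply: hr; apply: le_ball xx'; rewrite ler_pdivrMr// ler_peMr ?ler1n// ltW.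
  have h2 : `|f x - f y| < e / 2.
    apply: hr; split => // i j; rewrite (ord1 i).
    rewrite [r]splitr; case: xx' => _ /(_ 0 j) xx'; apply: ball_triangle xx' _.
    by rewrite /ball/= (lt_trans (hy j)).
  rewrite [e]splitr -(subrK (f x) (f x')) -addrA.
  by rewrite (le_lt_trans (ler_normD _ _))// ltrD// distrC.
move=> h /(_ _ h) {}h.
have [d [d0 hd]] : exists d : R, 0 < d /\
   [set v : 'rV_k | forall i, `[- rho, rho]%classic (v ord0 i)] `<=`
   [set x : 'rV[R]_k | forall y : 'rV[R]_k, (forall i, `|x 0 i - y 0 i| < d) -> `|f x - f y| < e].
  near (0 : R)^'+ => d; exists d; split; first by near: d; exact: nbhs_right_gt.
  by near: d; apply: h.
exists d => // x y hx; apply: hd => i /=.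
by rewrite in_itv/= -ler_norml.
Unshelve. all: by end_near.
Qed.

Definition scaled_sin (M : R) x : 'rV[R]_k := \row_i (M * sin (M^-1 * x 0 i)).

(** Where [norm1 x] exceeds [rho], the weight e^(norm1 x) alone beats 2 C; elsewhere M sin(t / M) is
    uniformly close to t for large [M], and uniform continuity applies. *)
Lemma scaled_sin_approx f (C e : R) : continuous f -> (forall x, `|f x| <= C) ->
  0 < e -> exists2 M : R, 0 < M &
    forall x, `|f x - f (scaled_sin M x)| <= e * expR (norm1 x).
Proof.
move=> cf fC e0.
have C0 : 0 <= C by exact: le_trans (normr_ge0 _) (fC 0).
pose rho := 2 * C / e.
have rho0 : 0 <= rho by rewrite !mulr_ge0// invr_ge0 ltW.
have [d d0 hd] := continuous_unif_cube rho cf e0.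
pose M := 1 + rho ^+ 2 * expR rho / d.
have M1 : 1 <= M by rewrite lerDl divr_ge0 ?(ltW d0)// mulr_ge0 ?expR_ge0 ?exprn_ge0.
have M0 : 0 < M by exact: lt_le_trans M1.
exists M => // x; have [xr|xr] := leP (norm1 x) rho; last first.
  apply: le_trans (ler_normB _ _) _; apply: le_trans (lerD (fC _) (fC _)) _.
  apply: le_trans (_ : e * rho <= _).
    by rewrite /rho mulrC divfK ?gt_eqF//; lra.
  rewrite ler_pM2l//; apply: le_trans (ltW xr) _.
  by apply: le_trans (expR_ge1Dx _); rewrite lerDr.
apply: le_trans (_ : e * 1 <= _); last first.
  by rewrite ler_pM2l// -expR0 ler_expR norm1_ge0.
rewrite mulr1; apply/ltW/hd => i; first by apply: le_trans (norm1_coord _ _) xr.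
rewrite mxE; set t := x 0 i.
have tr : `|t| <= rho by apply: le_trans (norm1_coord _ _) xr.
have -> : t - M * sin (M^-1 * t) = M * (M^-1 * t - sin (M^-1 * t)).
  by field; rewrite gt_eqF.
rewrite normrM (gtr0_norm M0) distrC.
apply: le_lt_trans (_ : M * (`|M^-1 * t| ^+ 2 * expR `|M^-1 * t|) < _).
  by rewrite ler_pM2l// sin_taylor.
have MV : `|M^-1 * t| = M^-1 * `|t| by rewrite normrM gtr0_norm ?invr_gt0.
have Mt : `|M^-1 * t| <= rho.
  rewrite MV; apply: le_trans tr; rewrite ler_piMl// invf_le1//.
apply: le_lt_trans (_ : M * ((M^-1 * rho) ^+ 2 * expR rho) < _).
  rewrite ler_pM2l// ler_pM ?expR_ge0 ?ler_expR// MV.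
  by rewrite ler_pM ?mulr_ge0 ?invr_ge0 ?(ltW M0)// ler_pM2l ?invr_gt0.
have -> : M * ((M^-1 * rho) ^+ 2 * expR rho) = rho ^+ 2 * expR rho / M.
  by field; rewrite gt_eqF.
rewrite ltr_pdivrMr// /M mulrDr mulr1 mulrCA divff ?gt_eqF// mulr1.
by rewrite ltrDr.
Qed.

Definition bernstein (F : ('I_k -> nat) -> R) m (y : 'I_k -> R) : R :=
  \sum_(j : {ffun 'I_k -> 'I_m.+1}) F (fun i => j i) * \prod_i bin_weight m (y i) (j i).

Lemma prod_bin_weight m (y : 'I_k -> R) (G : 'I_k -> nat -> R) :
  \sum_(j : {ffun 'I_k -> 'I_m.+1}) \prod_i (bin_weight m (y i) (j i) * G i (j i))
  = \prod_i bin_mean m (y i) (G i).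
Proof.
by rewrite /bin_mean (bigA_distr_bigA (fun i (j : 'I_m.+1) => bin_weight m (y i) j * G i j)).
Qed.

(** Bernstein's probabilistic argument: continuity handles the grid points near [y], and Chebyshev's
    inequality in each of the [k] coordinates handles the others. The unit cube is rescaled to the
    cube of radius [M], where the scaled sines take their values. *)
Lemma bernstein_approx f (C M e : R) : continuous f -> (forall x, `|f x| <= C) ->
  0 < e -> 0 < M -> exists m, forall y : 'I_k -> R, (forall i, 0 <= y i <= 1) ->
  `|f (\row_i (M * (2 * y i - 1))) -
    bernstein (fun j => f (\row_i (M * (2 * ((j i)%:R / m%:R) - 1)))) m y| <= e.
Proof.
move=> cf fC e0 M0.
have C0 : 0 <= C by exact: le_trans (normr_ge0 _) (fC 0).
have e20 : 0 < e / 2 by rewrite divr_gt0.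
have [d d0 hd] := continuous_unif_cube M cf e20.
(* If some rescaled coordinate is at distance at least d, then (2 M / d)^2 (j / m - y)^2 >= 1, and
   the trivial bound 2 C is at most D (j / m - y)^2. *)
pose D := 2 * C * (2 * M / d) ^+ 2.
have D0 : 0 <= D.
  apply: mulr_ge0; first exact: mulr_ge0.
  apply: exprn_ge0; apply: divr_ge0; last exact: ltW.
  by apply: mulr_ge0 => //; exact: ltW.
have [m m0 hm] : exists2 m : nat, (0 < m)%N & D * k%:R / m%:R <= e / 2.
  exists (Num.truncn (D * k%:R / (e / 2))).+1 => //.
  rewrite ler_pdivrMr ?ltr0n// [leRHS]mulrC -ler_pdivrMr//.
  by apply/ltW; rewrite truncnS_gt.
exists m => y y01.
have mn0 : m%:R != 0 :> R by rewrite pnatr_eq0 -lt0n.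
pose Y (i : 'I_k) := y i.
set fy := f _.
have fyE : fy = \sum_(j : {ffun 'I_k -> 'I_m.+1}) fy * \prod_i bin_weight m (y i) (j i).
  rewrite -mulr_sumr.
  under eq_bigr do under eq_bigr do rewrite -[bin_weight _ _ _]mulr1.
  rewrite (prod_bin_weight m y (fun _ _ => 1)) big1 ?mulr1// => i _.
  exact: bin_mean_cst.
rewrite fyE /bernstein -sumrB.
apply: le_trans (ler_norm_sum _ _ _) _.
have w0 (j : {ffun 'I_k -> 'I_m.+1}) : 0 <= \prod_i bin_weight m (y i) (j i).
  by apply: prodr_ge0 => i _; exact: bin_weight_ge0.
apply: le_trans (_ : \sum_(j : {ffun 'I_k -> 'I_m.+1})
   (e / 2 + D * \sum_l ((j l)%:R / m%:R - y l) ^+ 2) * \prod_i bin_weight m (y i) (j i) <= _).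
  apply: ler_sum => j _; rewrite -mulrBl normrM (ger0_norm (w0 j)) ler_wpM2r//.
  have S0 : 0 <= \sum_l ((j l)%:R / m%:R - y l) ^+ 2.
    by apply: sumr_ge0 => l _; exact: sqr_ge0.
  have [near|/existsNP[l /negP far]] := pselect (forall l, `|M * (2 * y l - 1) - M * (2 * ((j l)%:R / m%:R) - 1)| < d).
    apply: le_trans (_ : e / 2 + 0 <= _); last by rewrite lerD2l mulr_ge0.
    rewrite addr0; apply/ltW/hd => i; rewrite !mxE//.
    rewrite normrM (gtr0_norm M0) ger_pMr// ler_norml.
    by have /andP[] := y01 i; lra.
  apply: le_trans (ler_normB _ _) _; apply: le_trans (lerD (fC _) (fC _)) _.
  apply: le_trans (_ : 0 + D * ((j l)%:R / m%:R - y l) ^+ 2 <= _); last first.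
    rewrite lerD ?(ltW e20)// ler_wpM2l// [leRHS](bigD1 l)//= lerDl.
    by apply: sumr_ge0 => i _; exact: sqr_ge0.
  rewrite add0r /D -mulrA -exprMn.
  apply: le_trans (_ : 2 * C * 1 <= _); first by lra.
  rewrite ler_wpM2l ?mulr_ge0// -[leRHS]ger0_norm ?sqr_ge0// normrX.
  rewrite exprn_ege1// mulrAC normrM [X in _ * X]gtr0_norm ?invr_gt0//.
  rewrite ler_pdivlMr// mul1r; move: far; rewrite -leNgt => far.
  apply: le_trans far _; rewrite -[leRHS]normrN le_eqVlt; apply/orP; left; apply/eqP.
  by congr `|_|; ring.
under eq_bigr do rewrite mulrDl.
rewrite big_split/= -mulr_sumr.
have -> : \sum_(j : {ffun 'I_k -> 'I_m.+1}) \prod_i bin_weight m (y i) (j i) = 1.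
  under eq_bigr do under eq_bigr do rewrite -[bin_weight _ _ _]mulr1.
  rewrite (prod_bin_weight m y (fun _ _ => 1)) big1// => i _.
  exact: bin_mean_cst.
rewrite mulr1 [leRHS]splitr lerD2l; apply: le_trans hm.
under eq_bigr do rewrite -mulrA mulr_suml.
rewrite -mulr_sumr exchange_big/= -mulrA ler_wpM2l//.
apply: le_trans (_ : \sum_(l < k) m%:R^-1 <= _); last first.
  by rewrite sumr_const card_ord -[leLHS]mulr_natl.
apply: ler_sum => l _.
under eq_bigr => j _.
  rewrite [X in _ * X](bigD1 l)//= mulrA [X in X * _]mulrC.
  rewrite (_ : \prod_(i < k | i != l) _ = \prod_(i < k | i != l) (bin_weight m (y i) (j i) * (if i == l then ((j i)%:R / m%:R - y i) ^+ 2 else 1))); last first.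
    by apply: eq_bigr => i /negPf ->; rewrite mulr1.
  over.
rewrite /=.
rewrite (_ : \sum_(j : {ffun 'I_k -> 'I_m.+1}) _ = \sum_(j : {ffun 'I_k -> 'I_m.+1}) \prod_i (bin_weight m (y i) (j i) * (fun i n => if i == l then (n%:R / m%:R - y i) ^+ 2 else 1) i (j i))); last first.
  by apply: eq_bigr => j _; rewrite [RHS](bigD1 l)//= eqxx.
rewrite (prod_bin_weight m y (fun i n => if i == l then (n%:R / m%:R - y i) ^+ 2 else 1)).
rewrite (bigD1 l)//= eqxx big1 ?mulr1; last first.
  by move=> i /negPf ->; exact: bin_mean_cst.
have -> : (fun n : nat => (n%:R / m%:R - y l) ^+ 2) = (fun n => m%:R ^- 2 * (n%:R - m%:R * y l) ^+ 2).
  by apply/funext => n; field.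
rewrite bin_meanZ bin_mean_sqr subrr expr0n/= add0r.
have -> : m%:R ^- 2 * (m%:R * y l * (1 - y l)) = m%:R^-1 * (y l * (1 - y l)) by field.
rewrite ler_piMr ?invr_ge0//; have /andP[? ?] := y01 l.
by rewrite mulr_ile1// ?subr_ge0//; lra.
Qed.

Lemma exp_approx_prod (I : Type) (s : seq I) (F : I -> 'rV[R]_k -> R) :
  (forall i, exists b, exp_approx b (F i)) ->
  exists b, exp_approx b (fun x => \prod_(i <- s) F i x).
Proof.
move=> hF; elim: s => [|i s [b IH]].
  by exists 0; apply: (exp_approx_ext (exp_approx_cst k 1)) => x; rewrite big_nil.
have [b' hb'] := hF i; exists (b' + b).
by apply: (exp_approx_ext (exp_approxM hb' IH)) => x; rewrite big_cons.
Qed.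

Lemma exp_approx_sumE (I : Type) (s : seq I) (F : I -> 'rV[R]_k -> R) :
  (forall i, exists b, exp_approx b (F i)) ->
  exists b, exp_approx b (fun x => \sum_(i <- s) F i x).
Proof.
move=> hF; elim: s => [|i s [b IH]].
  by exists 0; apply: (exp_approx_ext (exp_approx_cst k 0)) => x; rewrite big_nil.
have [b' hb'] := hF i; exists (Num.max b' b).
have h1 : b' <= Num.max b' b by rewrite le_max lexx.
have h2 : b <= Num.max b' b by rewrite le_max lexx orbT.
apply: (exp_approx_ext (exp_approxD (exp_approx_mono h1 hb') (exp_approx_mono h2 IH))) => x.
by rewrite big_cons.
Qed.

Lemma exp_approxX (h : 'rV[R]_k -> R) n : (exists b, exp_approx b h) ->
  exists b, exp_approx b (fun x => h x ^+ n).
Proof.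
move=> hb; have [b] := @exp_approx_prod nat (iota 0 n) (fun=> h) (fun=> hb).
move=> H; exists b; apply: (exp_approx_ext H) => x.
by rewrite big_const_seq count_predT size_iota iter_mulr_1.
Qed.

(* Substituting M sin(x / M) for x maps f to a function on a cube, where it is a
   uniform limit of polynomials in the bounded functions sin(x_i / M). *)
Lemma bounded_continuous_exp_approx f (C : R) : continuous f ->
  (forall x, `|f x| <= C) -> forall e, 0 < e -> exists b g,
    exp_approx b g /\ forall x, `|f x - g x| <= e * expR (norm1 x).
Proof.
move=> cf fC e e0; have e20 : 0 < e / 2 by rewrite divr_gt0.
have [M M0 hM] := scaled_sin_approx cf fC e20.
have [m hm] := bernstein_approx cf fC e20 M0.
pose y (x : 'rV[R]_k) i := (1 + sin (M^-1 * x 0 i)) / 2.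
pose g x := bernstein (fun j => f (\row_i (M * (2 * ((j i)%:R / m%:R) - 1)))) m (y x).
have [b hb] : exists b, exp_approx b g.
  have hy i : exists b, exp_approx b (fun x => y x i).
    exists (2 * M^-1).
    have h0 : 0 <= 2 * M^-1 by rewrite mulr_ge0// invr_ge0 ltW.
    have MV : 0 < M^-1 by rewrite invr_gt0.
    apply: (exp_approx_ext (exp_approxZ (2^-1) (exp_approxD (exp_approx_mono h0 (exp_approx_cst k 1)) (exp_approx_sin i MV)))) => x.
    by rewrite mulrC.
  have h1y i : exists b, exp_approx b (fun x => 1 - y x i).
    have [b hb] := hy i; exists (0 + Num.max b 0).
    have hb0 : b <= 0 + Num.max b 0 by rewrite add0r le_max lexx.
    have h00 : 0 <= 0 + Num.max b 0 by rewrite add0r le_max lexx orbT.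
    apply: (exp_approx_ext (exp_approxD (exp_approx_mono h00 (exp_approx_cst k 1)) (exp_approxZ (-1) (exp_approx_mono hb0 hb)))) => x.
    by rewrite mulN1r.
  rewrite /g /bernstein; apply: exp_approx_sumE => j.
  have [b hb] : exists b, exp_approx b (fun x => \prod_i bin_weight m (y x i) (j i)).
    apply: exp_approx_prod => i; rewrite /bin_weight.
    have [b1 hb1] := exp_approxX (j i) (hy i).
    have [b2 hb2] := exp_approxX (m - j i) (h1y i).
    exists (b1 + b2).
    by apply: exp_approxM hb2; apply: exp_approxZ.
  by exists b; apply: exp_approxZ.
exists b, g; split=> // x.
rewrite -[f x](subrK (f (scaled_sin M x))) -addrA.
rewrite (le_trans (ler_normD _ _))// [e]splitr mulrDl lerD//.
apply: le_trans (_ : e / 2 * 1 <= _); last first.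
  by rewrite ler_pM2l// -expR0 ler_expR norm1_ge0.
rewrite mulr1.
have -> : scaled_sin M x = \row_i (M * (2 * y x i - 1)).
  by apply/rowP => i; rewrite !mxE /y; congr (_ * _); field.
apply: hm => i; rewrite /y.
have /andP[h1 h2] : -1 <= sin (M^-1 * x 0 i) <= 1 by rewrite -ler_norml sin_max.
by apply/andP; split; lra.
Qed.

End bounded_continuous_approximation.

Section exponential_moments.
Context {d : measure_display} {T : measurableType d} {R : realType} {k : nat}.
Variables (P : probability T R) (Y : T -> 'rV[R]_k).
Implicit Types (b e : R) (h : 'rV[R]_k -> R).

(** Measurability is required of the coordinates only; that of bounded continuous functions of [Y]
    is derived by approximation in [measurable_bounded_continuous]. *)
Definition exp_integrable : Prop :=
  (forall i, measurable_fun setT (fun w => Y w 0 i)) /\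
  (forall a, P.-integrable setT (fun w => (expR (dotr a (Y w)))%:E)).

Hypothesis YP : exp_integrable.

Lemma integrable_exp_poly p : P.-integrable setT (fun w => (exp_poly p (Y w))%:E).
Proof.
rewrite /exp_poly; under eq_fun do rewrite -sumEFin.
apply: integrable_sum => //= q _.
under eq_fun do rewrite EFinM; apply: integrableZl => //; exact: YP.2.
Qed.

(** The product over the coordinates of the bounds e^(b |t|) <= e^(b t) + e^(- b t), expanded into
    an exponential polynomial. *)
Lemma exp_norm1_le b : exists p, forall x : 'rV[R]_k, expR (b * norm1 x) <= exp_poly p x.
Proof.
have H (s : seq 'I_k) : exists p, forall x : 'rV[R]_k,
    expR (b * \sum_(i <- s) `|x 0 i|) <= exp_poly p x.
  elim: s => [|i s [p IH]].
    exists [:: (1, 0)] => x; rewrite big_nil mulr0 expR0 /exp_poly big_seq1/= mul1r.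
    by rewrite /dotr big1 ?expR0// => j _; rewrite mxE mul0r.
  pose e0 c : 'rV[R]_k := \row_j (c *+ (j == i)).
  have e0E c (x : 'rV[R]_k) : dotr (e0 c) x = c * x 0 i.
    rewrite /dotr (bigD1 i)//= mxE eqxx mulr1n big1 ?addr0// => j /negPf ji.
    by rewrite mxE ji mulr0n mul0r.
  exists [seq (u.1 * v.1, u.2 + v.2) | u <- [:: (1, e0 b); (1, e0 (- b))], v <- p] => x.
  rewrite -exp_polyM big_cons mulrDr expRD; apply: ler_pM => //.
  rewrite /exp_poly big_cons big_seq1/= !mul1r !e0E.
  have [x0|x0] := leP 0 (x 0 i); first by rewrite (ger0_norm x0) lerDl expR_ge0.
  by rewrite (ltr0_norm x0) mulrN mulNr lerDr expR_ge0.
by have [p hp] := H (index_enum 'I_k); exists p.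
Qed.

Lemma measurable_norm1 : measurable_fun setT (fun w => norm1 (Y w)).
Proof.
rewrite /norm1; apply: measurable_sum => i.
by apply: measurableT_comp => //; exact: YP.1.
Qed.

Lemma integrable_exp_norm1 b : P.-integrable setT (fun w => (expR (b * norm1 (Y w)))%:E).
Proof.
have [p hp] := exp_norm1_le b.
apply: le_integrable (integrable_exp_poly p) => //.
  apply/measurable_EFinP; apply: measurableT_comp => //.
  by apply: measurable_funM => //; exact: measurable_norm1.
move=> w _ /=; rewrite lee_fin ger0_norm ?expR_ge0//.
by apply: le_trans (hp _) (ler_norm _).
Qed.

(** At a fixed point the weight is a constant, so that [h \o Y] is the pointwise limit of measurable
    exponential polynomials. *)
Lemma measurable_exp_approx b h : exp_approx b h -> measurable_fun setT (h \o Y).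
Proof.
move=> [_ H].
have e0 n : 0 < n.+1%:R^-1 :> R by rewrite invr_gt0.
pose p n := projT1 (cid (H _ (e0 n))).
have hp n x := projT2 (cid (H _ (e0 n))) x.
apply: (@measurable_fun_cvg _ _ _ setT (fun n => exp_poly (p n) \o Y)) => //.
  move=> n; apply/measurable_EFinP; exact: measurable_int (integrable_exp_poly (p n)).
move=> w _ /=; apply/cvgrPdist_le => e e1.
have E0 := expR_gt0 (b * norm1 (Y w)).
have : (n.+1%:R : R)^-1 @[n --> \oo] --> (0 : R) by exact: cvg_harmonic.
have e20 : 0 < e / expR (b * norm1 (Y w)) by rewrite divr_gt0.
move=> /cvgr0_norm_le/(_ _ e20); apply: filterS => n.
rewrite ger0_norm ?invr_ge0// ler_pdivlMr// => hn.
by apply: le_trans (hp n (Y w)) hn.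
Qed.

Lemma integrable_growth h C b : measurable_fun setT (h \o Y) ->
  (forall x, `|h x| <= C * expR (b * norm1 x)) ->
  P.-integrable setT (EFin \o (h \o Y)).
Proof.
move=> mh hC; have iW := integrableZl _ C (integrable_exp_norm1 b).
apply: le_integrable (iW measurableT) => //; first exact/measurable_EFinP.
move=> w _ /=.
rewrite lee_fin.
by apply: le_trans (hC _) (ler_norm _).
Qed.

Lemma integrable_exp_approx b h : exp_approx b h -> P.-integrable setT (EFin \o (h \o Y)).
Proof.
move=> hh; have [[C hC] _] := hh.
exact: (integrable_growth (measurable_exp_approx hh) hC).
Qed.

Definition mean h : R := \int[P]_w h (Y w).

Lemma mean_diff_le h g e b : P.-integrable setT (EFin \o (h \o Y)) ->
  P.-integrable setT (EFin \o (g \o Y)) ->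
  (forall x, `|h x - g x| <= e * expR (b * norm1 x)) ->
  `|mean h - mean g| <= e * mean (fun x => expR (b * norm1 x)).
Proof.
move=> ih ig hg; rewrite /mean -RintegralB//.
have iB : P.-integrable setT (EFin \o (fun w => h (Y w) - g (Y w))).
  exact: (integrableB measurableT ih ig).
apply: le_trans (le_normr_Rintegral _ iB) _ => //.
rewrite -RintegralZl//; last exact: integrable_exp_norm1.
apply: le_Rintegral => //.
- exact: (integrable_norm iB).
- under [X in integrable _ _ X]eq_fun do rewrite /= EFinM.
  by apply: integrableZl => //; exact: integrable_exp_norm1.
Qed.

Lemma measurable_bounded_continuous h C : continuous h -> (forall x, `|h x| <= C) ->
  measurable_fun setT (h \o Y).
Proof.
move=> ch hC.
have e0 n : 0 < n.+1%:R^-1 :> R by rewrite invr_gt0.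
have H n : exists g : 'rV[R]_k -> R, (exists b, exp_approx b g) /\
    forall x, `|h x - g x| <= n.+1%:R^-1 * expR (norm1 x).
  have [b [g [hb hg]]] := bounded_continuous_exp_approx ch hC (e0 n).
  by exists g; split => //; exists b.
pose g n := projT1 (cid (H n)).
have hg n := projT2 (cid (H n)).
apply: (@measurable_fun_cvg _ _ _ setT (fun n => g n \o Y)) => //.
  by move=> n; have [[b hb] _] := hg n; exact: measurable_exp_approx hb.
move=> w _ /=; apply/cvgrPdist_le => e e1.
have E0 := expR_gt0 (norm1 (Y w)).
have : (n.+1%:R : R)^-1 @[n --> \oo] --> (0 : R) by exact: cvg_harmonic.
have e20 : 0 < e / expR (norm1 (Y w)) by rewrite divr_gt0.
move=> /cvgr0_norm_le/(_ _ e20); apply: filterS => n.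
rewrite ger0_norm ?invr_ge0// ler_pdivlMr// => hn.
by apply: le_trans ((hg n).2 (Y w)) hn.
Qed.

Lemma integrable_bounded_continuous h C : continuous h -> (forall x, `|h x| <= C) ->
  P.-integrable setT (EFin \o (h \o Y)).
Proof.
move=> ch hC; apply: (@integrable_growth _ C 0).
  exact: measurable_bounded_continuous hC.
by move=> x; rewrite mul0r expR0 mulr1.
Qed.

Lemma mean_exp_poly p : mean (exp_poly p) =
  \sum_(q <- p) q.1 * mean (fun x => expR (dotr q.2 x)).
Proof.
elim: p => [|q p IH].
  rewrite big_nil /mean (_ : (fun w => _) = fun=> 0) ?Rintegral_cst ?mul0r//.
  by apply/funext => w; rewrite /exp_poly big_nil.
rewrite big_cons -IH /mean.
rewrite (_ : (fun w => _) = (fun w => q.1 * expR (dotr q.2 (Y w)) + exp_poly p (Y w))); last first.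
  by apply/funext => w; rewrite /exp_poly big_cons.
rewrite RintegralD//; last exact: integrable_exp_poly.
  by rewrite RintegralZl//; exact: YP.2.
under [X in integrable _ _ X]eq_fun do rewrite /= EFinM.
by apply: integrableZl => //; exact: YP.2.
Qed.

End exponential_moments.

Lemma cvg_approx {R : realType} (u : nat -> R) (l C : R) : 0 <= C ->
  (forall e, 0 < e -> exists (v : nat -> R) lv, [/\ v @ \oo --> lv, `|l - lv| <= e * C &
     \forall n \near \oo, `|u n - v n| <= e * C]) -> u @ \oo --> l.
Proof.
move=> C0 H; apply/cvgrPdist_le => e e0.
have C1 : 0 < C + 1 by rewrite ltr_wpDl.
pose e' := e / (3 * (C + 1)).
have e'0 : 0 < e' by rewrite divr_gt0// mulr_gt0.
have e'C : e' * C <= e / 3.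
  rewrite /e' invfM mulrA -mulrA ler_piMr ?divr_ge0 ?(ltW e0)//.
  by rewrite mulrC ler_pdivrMr// mul1r lerDl.
have [v [lv [vlv hl hu]]] := H _ e'0.
have e30 : 0 < e / 3 by rewrite divr_gt0.
move/cvgrPdist_le: vlv => /(_ _ e30) hv.
near=> n.
have -> : l - u n = (l - lv) + (lv - v n) - (u n - v n) by ring.
have -> : e = e / 3 + e / 3 + e / 3 by field.
rewrite (le_trans (ler_normB _ _))// lerD//.
  rewrite (le_trans (ler_normD _ _))// lerD//; first exact: le_trans e'C.
  by near: n.
apply: le_trans e'C; by near: n.
Unshelve. all: by end_near.
Qed.

Section continuity_theorem.
Context {d d' : measure_display} {T : measurableType d} {T' : measurableType d'}.
Context {R : realType} {k : nat}.
Variables (P : probability T R) (Q : probability T' R).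
Variables (X : nat -> T -> 'rV[R]_k) (Z : T' -> 'rV[R]_k).
Hypothesis XP : forall n, exp_integrable P (X n).
Hypothesis ZQ : exp_integrable Q Z.
Hypothesis XZ : forall a, mean P (X n) (fun x => expR (dotr a x)) @[n --> \oo] -->
  mean Q Z (fun x => expR (dotr a x)).

Lemma cvg_mean_exp_poly p : mean P (X n) (exp_poly p) @[n --> \oo] --> mean Q Z (exp_poly p).
Proof.
rewrite mean_exp_poly//; under eq_fun do rewrite mean_exp_poly//.
apply: (@list_ind _ (fun p => (\sum_(q <- p) q.1 * mean P (X n) (fun x => expR (dotr q.2 x)))
  @[n --> \oo] --> \sum_(q <- p) q.1 * mean Q Z (fun x => expR (dotr q.2 x)))) => [|q {}p IH].
  by rewrite big_nil; under eq_cvg do rewrite big_nil; exact: cvg_cst.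
rewrite big_cons; under eq_cvg do rewrite big_cons.
by apply: cvgD => //; apply: cvgM; [exact: cvg_cst|exact: XZ].
Qed.

(** The weight is dominated by one exponential polynomial, whose means converge. This makes every
    weighted approximation uniform in n. *)
Lemma mean_exp_norm1_bound b : exists2 C : R, 0 <= C &
  mean Q Z (fun x => expR (b * norm1 x)) <= C /\
  \forall n \near \oo, mean P (X n) (fun x => expR (b * norm1 x)) <= C.
Proof.
have [p hp] := @exp_norm1_le R k b.
have le d0 (S : measurableType d0) (P0 : probability S R) (Y : S -> 'rV[R]_k) :
    exp_integrable P0 Y -> mean P0 Y (fun x => expR (b * norm1 x)) <= mean P0 Y (exp_poly p).
  move=> YP; apply: le_Rintegral => //.
  - exact: integrable_exp_norm1.
  - exact: integrable_exp_poly.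
exists (mean Q Z (exp_poly p) + 1).
  rewrite addr_ge0//; apply: le_trans (le _ _ _ _ ZQ).
  by apply: Rintegral_ge0 => w _; exact: expR_ge0.
split; first by apply: le_trans (le _ _ _ _ ZQ) _; rewrite lerDl.
have /cvgrPdist_le/(_ _ ltr01) := cvg_mean_exp_poly (p := p).
apply: filterS => n; rewrite ler_norml lerBlDr lerBrDr => /andP[h _].
apply: le_trans (le _ _ _ _ (XP n)) _; move: h; lra.
Qed.

Lemma cvg_mean_exp_approx b h : exp_approx b h ->
  mean P (X n) h @[n --> \oo] --> mean Q Z h.
Proof.
move=> hh; have [C C0 [hC hCn]] := mean_exp_norm1_bound b.
apply: (cvg_approx C0) => e e0.
have [p hp] := hh.2 _ e0.
exists (fun n => mean P (X n) (exp_poly p)), (mean Q Z (exp_poly p)); split.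
- exact: cvg_mean_exp_poly.
- apply: le_trans (mean_diff_le ZQ _ _ hp) _.
  + exact: integrable_exp_approx hh.
  + exact: integrable_exp_poly.
  + by rewrite ler_pM2l.
- apply: filterS hCn => n hn; apply: le_trans (mean_diff_le (XP n) _ _ hp) _.
  + exact: integrable_exp_approx hh.
  + exact: integrable_exp_poly.
  + by rewrite ler_pM2l.
Qed.

(** Convergence holds for exponential polynomials by hypothesis, extends to [exp_approx] functions,
    and from these to bounded continuous ones, which they approximate with the weight e^(norm1 x),
    hence the rate 1. *)
Theorem cvg_mean_bounded_continuous h C : continuous h -> (forall x, `|h x| <= C) ->
  mean P (X n) h @[n --> \oo] --> mean Q Z h.
Proof.
move=> ch hC; have [D D0 [hD hDn]] := mean_exp_norm1_bound 1.
apply: (cvg_approx D0) => e e0.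
have [b [g [hb hg]]] := bounded_continuous_exp_approx ch hC e0.
have hg1 x : `|h x - g x| <= e * expR (1 * norm1 x) by rewrite mul1r.
exists (fun n => mean P (X n) g), (mean Q Z g); split.
- exact: cvg_mean_exp_approx hb.
- apply: le_trans (mean_diff_le ZQ _ _ hg1) _.
  + exact: integrable_bounded_continuous hC.
  + exact: integrable_exp_approx hb.
  + by rewrite ler_pM2l.
- apply: filterS hDn => n hn; apply: le_trans (mean_diff_le (XP n) _ _ hg1) _.
  + exact: integrable_bounded_continuous hC.
  + exact: integrable_exp_approx hb.
  + by rewrite ler_pM2l.
Qed.

Lemma expectation_mean (d0 : measure_display) (S : measurableType d0)
    (P0 : probability S R) (Y : S -> 'rV[R]_k) h C : exp_integrable P0 Y ->
    continuous h -> (forall x, `|h x| <= C) ->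
  ('E_P0[fun w => h (Y w)] = (mean P0 Y h)%:E)%E.
Proof.
move=> YP ch hC; rewrite unlock fineK//.
apply: integrable_fin_num => //.
exact: (integrable_bounded_continuous YP ch hC).
Qed.

Theorem cvg_expectation_bounded_continuous h C : continuous h ->
  (forall x, `|h x| <= C) ->
  ('E_P[fun w => h (X n w)] @[n --> \oo] --> 'E_Q[fun w => h (Z w)])%E.
Proof.
move=> ch hC; rewrite (expectation_mean ZQ ch hC).
under eq_fun do rewrite (expectation_mean (XP _) ch hC).
by apply: cvg_EFin; [exact: nearW|exact: cvg_mean_bounded_continuous hC].
Qed.

End continuity_theorem.

(** * Laws determined by their moment generating functions *)

Lemma measure_ray_unique {R : realType} (m1 m2 : {measure set (measurableTypeR R) -> \bar R}) :
  (m1 setT < +oo)%E -> (forall x, m1 `]-oo, x[%classic = m2 `]-oo, x[%classic) ->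
  forall B, measurable B -> m1 B = m2 B.
Proof.
move=> fin m12 B mB.
refine (@measure_unique _ R (measurableTypeR R) (@RGenInftyO.G R) (fun k => `]-oo, k%:R[%classic) _ _ _ _ m1 m2 _ _ B mB).
- exact: RGenInftyO.measurableE.
- move=> _ _ [x ->] [y ->]; exists (Num.min x y).
  by apply/seteqP; split => z /=; rewrite !in_itv/= lt_min => /andP.
- by move=> i; exists i%:R.
- apply/seteqP; split => // x _ /=; exists (Num.truncn `|x|).+1 => //=.
  rewrite in_itv/=; apply: le_lt_trans (ler_norm _) _.
  exact: truncnS_gt.
- by move=> _ [x ->].
- move=> k; apply: le_lt_trans fin; apply: le_measure; rewrite ?inE//.
Qed.

Lemma cvg_prod_seq {R : realType} {T I : Type} (F : set_system T) {FF : Filter F}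
    (s : seq I) (f : T -> I -> R) (l : I -> R) :
  (forall i, f t i @[t --> F] --> l i) ->
  \prod_(i <- s) f t i @[t --> F] --> \prod_(i <- s) l i.
Proof.
move=> fl; apply: (@list_ind _ (fun s => (\prod_(i <- s) f t i)
  @[t --> F] --> \prod_(i <- s) l i)) => [|i {}s IH].
  by rewrite big_nil; under eq_cvg do rewrite big_nil; exact: cvg_cst.
by rewrite big_cons; under eq_cvg do rewrite big_cons; exact: cvgM.
Qed.

Section uniqueness.
Context {d d' : measure_display} {T : measurableType d} {T' : measurableType d'}.
Context {R : realType} {k : nat}.
Variables (P : probability T R) (Q : probability T' R).
Variables (X : T -> 'rV[R]_k) (Z : T' -> 'rV[R]_k).
Hypothesis XP : exp_integrable P X.
Hypothesis ZQ : exp_integrable Q Z.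
Hypothesis XZ : forall a, mean P X (fun x => expR (dotr a x)) =
  mean Q Z (fun x => expR (dotr a x)).

(** The convergence theorem for a constant sequence doubles as a uniqueness theorem. *)
Lemma mean_bounded_continuous_eq h C : continuous h -> (forall x, `|h x| <= C) ->
  mean P X h = mean Q Z h.
Proof.
move=> ch hC.
have H := @cvg_mean_bounded_continuous _ _ _ _ _ _ P Q (fun=> X) Z (fun=> XP) ZQ _ h C ch hC.
apply: (cvg_unique _ (cvg_cst _) (H _)) => // a.
by rewrite XZ; exact: cvg_cst.
Qed.

(** Truncation to the unit interval; it is also the distribution function of the uniform law. *)
Definition clamp (t : R) : R := Num.min 1 (Num.max 0 t).

Lemma clamp01 t : 0 <= clamp t <= 1.
Proof. by rewrite /clamp le_min ge_min le_max !lexx ler01. Qed.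

Lemma clamp_continuous : continuous clamp.
Proof.
move=> t; apply: continuous_min; first exact: cst_continuous.
by apply: continuous_max; [exact: cst_continuous|exact: cvg_id].
Qed.

(** A product of continuous ramps which vanishes off the open orthant below [x] and tends to its
    indicator as [m] grows. *)
Definition soft_box (x : 'rV[R]_k) (m : nat) (y : 'rV[R]_k) : R :=
  \prod_i clamp (m%:R * (x 0 i - y 0 i)).

Lemma soft_box_continuous x m : continuous (soft_box x m).
Proof.
suff H : forall y : 'rV[R]_k, soft_box x m z @[z --> y] --> soft_box x m y by [].
move=> y; rewrite /soft_box.
apply: (@cvg_prod_seq R _ _ (nbhs y) _ _ (fun z i => clamp (m%:R * (x 0 i - z 0 i)))) => i.
apply: (@cvg_comp _ _ _ (fun z : 'rV[R]_k => m%:R * (x 0 i - z 0 i)) clamp _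
  (nbhs (m%:R * (x 0 i - y 0 i)))); last exact: clamp_continuous.
apply: cvgM; first exact: cvg_cst.
by apply: cvgB; [exact: cvg_cst|exact: coord_continuous].
Qed.

Lemma soft_box01 x m y : 0 <= soft_box x m y <= 1.
Proof.
apply/andP; split; first by apply: prodr_ge0 => i _; have /andP[] := clamp01 (m%:R * (x 0 i - y 0 i)).
by apply: prodr_ile1 => i _; exact: clamp01.
Qed.

Lemma soft_box_norm x m y : `|soft_box x m y| <= 1.
Proof. by have /andP[h1 h2] := soft_box01 x m y; rewrite ger0_norm. Qed.

Definition open_box (x : 'rV[R]_k) : set 'rV[R]_k := [set y | forall i, y 0 i < x 0 i].

Lemma soft_box_cvg x y : soft_box x m y @[m --> \oo] --> (\1_(open_box x) y : R).
Proof.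
have -> : (\1_(open_box x) y : R) = \prod_i (y 0 i < x 0 i)%R%:R.
  rewrite indicE; have [xy|xy] := boolP (y \in open_box x).
    rewrite big1// => i _; move: xy; rewrite inE => /(_ i) ->//.
  have [i hi] : exists i, ~~ (y 0 i < x 0 i).
    by move: xy; rewrite notin_setE => /existsNP[i /negP]; exists i.
  by rewrite (bigD1 i)//= (negbTE hi) mul0r.
apply: cvg_prod_seq => i; have [yx|yx] := ltP (y 0 i) (x 0 i).
  apply: cvg_near_cst; near=> m.
  rewrite /clamp; have h : 1 <= m%:R * (x 0 i - y 0 i).
    rewrite -ler_pdivrMr ?subr_gt0// mul1r.
    by near: m; exact: nbhs_infty_ger.
  rewrite (max_idPr _) ?(min_idPl _)//.
  by apply: le_trans h.
apply: cvg_near_cst; near=> m.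
rewrite /clamp (max_idPl _) ?(min_idPr _)//.
by rewrite mulr_ge0_le0// subr_le0.
Unshelve. all: by end_near.
Qed.

Lemma cvg_mean_soft_box (d0 : measure_display) (S : measurableType d0)
    (P0 : probability S R) (Y : S -> 'rV[R]_k) x : exp_integrable P0 Y ->
  ((mean P0 Y (soft_box x m))%:E @[m --> \oo] --> P0 (Y @^-1` open_box x))%E.
Proof.
move=> YP.
have mf m : measurable_fun setT (soft_box x m \o Y).
  exact: (measurable_bounded_continuous YP (soft_box_continuous (m := m)) (soft_box_norm x m)).
have mB : measurable (Y @^-1` open_box x).
  rewrite (_ : _ @^-1` _ = \bigcap_(i in [set: 'I_k]) ((fun w => Y w 0 i) @^-1` `]-oo, x 0 i[)); last first.
    by apply/seteqP; split => w /= h i; [move=> _|]; have := h i; rewrite /= in_itv//=; apply.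
  apply: fin_bigcap_measurable => // i _.
  by rewrite -[X in measurable X]setTI; exact: YP.1.
have -> : P0 (Y @^-1` open_box x) = (\int[P0]_w (\1_(open_box x) (Y w))%:E)%E.
  by rewrite -(setIT (_ @^-1` _)) -(integral_indic _ measurableT).
have H := @dominated_convergence _ _ _ P0 setT measurableT
  (fun m w => (soft_box x m (Y w))%:E) (fun w => (\1_(open_box x) (Y w))%:E) (cst 1%E).
have [|||||_ _] := H.
- by move=> m; apply/measurable_EFinP; exact: mf.
- apply/measurable_EFinP; rewrite (_ : (fun w => _) = \1_(Y @^-1` open_box x))//.
- by apply/aeW => w _; apply: cvg_EFin; [exact: nearW|exact: soft_box_cvg].
- exact: finite_measure_integrable_cst.
- by apply/aeW => w m _; rewrite /= lee_fin; exact: soft_box_norm.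
apply: cvg_trans; apply: near_eq_cvg; apply: nearW => m /=.
rewrite /mean fineK//; apply: integrable_fin_num => //.
exact: (integrable_bounded_continuous YP (soft_box_continuous (m := m)) (soft_box_norm x m)).
Qed.

Theorem open_box_prob_eq x : P (X @^-1` open_box x) = Q (Z @^-1` open_box x).
Proof.
have E m : mean P X (soft_box x m) = mean Q Z (soft_box x m).
  exact: (mean_bounded_continuous_eq (soft_box_continuous (m := m)) (soft_box_norm x m)).
have HX := cvg_mean_soft_box (x := x) XP.
rewrite (_ : (fun m => _) = (fun m => (mean Q Z (soft_box x m))%:E)) in HX; last first.
  by apply/funext => m; rewrite E.
exact: (cvg_unique _ HX (cvg_mean_soft_box ZQ)).
Qed.

End uniqueness.

(** * Moment generating function of the normal law *)

Section normal_moment_generating.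
Context {R : realType}.
Implicit Types m s t : R.
Local Notation mu := (@lebesgue_measure R).

(** The normal density agrees almost everywhere with the Radon-Nikodym derivative, for which the
    change of variables holds. *)
Lemma ge0_integral_normal m s (f : R -> \bar R) : measurable_fun setT f ->
  (forall x, (0 <= f x)%E) ->
  (\int[normal_prob m s]_x f x = \int[mu]_x (f x * (normal_pdf m s x)%:E))%E.
Proof.
move=> mf f0.
pose nu : probability _ _ := normal_prob m s.
have dom : nu `<< mu by exact: normal_prob_dominates.
rewrite -(Radon_Nikodym_SigmaFinite.change_of_variables dom)//.
apply: ae_eq_integral => //.
- apply: emeasurable_funM => //.
  apply: (measurable_int mu); exact: Radon_Nikodym_SigmaFinite.f_integrable.
- by apply: emeasurable_funM => //; apply/measurable_EFinP; exact: measurable_normal_pdf.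
- apply: ae_eqe_mul2l => /=; apply: integral_ae_eq => //=.
  + exact: Radon_Nikodym_SigmaFinite.f_integrable.
  + by apply/measurable_EFinP; exact: measurable_normal_pdf.
  + by move=> E _ mE; rewrite -Radon_Nikodym_SigmaFinite.f_integral.
Qed.

(** Completing the square: exponential tilting by [t] moves the mean of the density to m + s^2 t. *)
Lemma normal_pdf_expR m s t x : s != 0 ->
  expR (t * x) * normal_pdf m s x =
  expR (t * m + s ^+ 2 * t ^+ 2 / 2) * normal_pdf (m + s ^+ 2 * t) s x.
Proof.
move=> s0; rewrite !normal_pdfE// /normal_fun.
rewrite mulrCA [in RHS]mulrCA -!expRD; congr (_ * expR _).
by field.
Qed.

Lemma integral_normal_expR m s t : s != 0 ->
  (\int[normal_prob m s]_x (expR (t * x))%:E =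
   (expR (t * m + s ^+ 2 * t ^+ 2 / 2))%:E)%E.
Proof.
move=> s0; rewrite ge0_integral_normal//; last first.
- have : measurable_fun (setT : set R) (fun x : R => expR (t * x)).
    by apply: measurableT_comp => //; exact: measurable_funM.
  by move=> H; exact/measurable_EFinP.
under eq_integral do rewrite -EFinM normal_pdf_expR// EFinM.
rewrite ge0_integralZl//=; first by rewrite integral_normal_pdf mule1.
- by apply/measurable_EFinP; exact: measurable_normal_pdf.
- by move=> x _; rewrite lee_fin normal_pdf_ge0.
Qed.

End normal_moment_generating.

(** * Gaussian sequences on the unit interval *)

Section decoupling.
Context {d d1 d2 : measure_display} {T : measurableType d}
  {T1 : measurableType d1} {T2 : measurableType d2} {R : realType}.
Variables (P : probability T R) (X : T -> T1) (Y : T -> T2).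
Hypotheses (mX : measurable_fun setT X) (mY : measurable_fun setT Y).
Hypothesis XY : forall A B, measurable A -> measurable B ->
  P (X @^-1` A `&` Y @^-1` B) = (P (X @^-1` A) * P (Y @^-1` B))%E.

(* The pushforward of P by (X, Y) is the product of the two laws. *)
Lemma decouple (F : T1 * T2 -> \bar R) : measurable_fun setT F ->
  (forall z, (0 <= F z)%E) ->
  (\int[P]_w F (X w, Y w) = \int[P]_w \int[P]_w' F (X w, Y w'))%E.
Proof.
move=> mF F0.
pose X' : {mfun T >-> T1} := HB.pack X (isMeasurableFun.Build _ _ _ _ X mX).
pose Y' : {mfun T >-> T2} := HB.pack Y (isMeasurableFun.Build _ _ _ _ Y mY).
have mXY : measurable_fun setT (fun w => (X w, Y w)) by exact: measurable_fun_pair.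
pose XY' : {mfun T >-> (T1 * T2)%type} := HB.pack (fun w => (X w, Y w))
  (isMeasurableFun.Build _ _ _ _ (fun w => (X w, Y w)) mXY).
transitivity (\int[distribution P XY']_z F z)%E.
  by rewrite ge0_integral_distribution.
transitivity (\int[(distribution P X' \x distribution P Y')%E]_z F z)%E.
  apply: eq_measure_integral => C mC _; apply/esym.
  apply: (@product_measure_unique _ _ _ _ _ (distribution P X') (distribution P Y')
    (distribution P XY')) mC => A B mA mB.
  by rewrite /distribution/= /pushforward/= -XY.
rewrite fubini_tonelli1// ge0_integral_distribution//; last first.
- by move=> x; apply: integral_ge0.
- exact: measurable_fun_fubini_tonelli_F.
apply: eq_integral => w _ /=; rewrite /fubini_F ge0_integral_distribution//.
by apply: measurableT_comp => //; exact: measurable_pair1.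
Qed.

Lemma decoupleM (f : T1 -> R) (g : T2 -> R) : measurable_fun setT f ->
  measurable_fun setT g -> (forall x, 0 <= f x) -> (forall x, 0 <= g x) ->
  (\int[P]_w (f (X w) * g (Y w))%:E =
   \int[P]_w (f (X w))%:E * \int[P]_w (g (Y w))%:E)%E.
Proof.
move=> mf mg f0 g0.
have mF : measurable_fun setT (fun z : T1 * T2 => (f z.1 * g z.2)%:E).
  by apply/measurable_EFinP; apply: measurable_funM; apply: measurableT_comp.
rewrite (decouple mF)/=; last by move=> z; rewrite lee_fin mulr_ge0.
have mgY : measurable_fun setT (fun w => (g (Y w))%:E).
  by apply/measurable_EFinP; apply: measurableT_comp.
have mfX : measurable_fun setT (fun w => (f (X w))%:E).
  by apply/measurable_EFinP; apply: measurableT_comp.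
under eq_integral => w _.
  under eq_integral do rewrite EFinM.
  rewrite ge0_integralZl//; first over.
    by move=> x _; rewrite lee_fin.
  by rewrite lee_fin.
rewrite ge0_integralZr//; last by apply: integral_ge0 => x _; rewrite lee_fin.
by move=> x _; rewrite lee_fin.
Qed.

End decoupling.

Section uniform_bits.
Context {R : realType}.
Local Notation mR := (measurableTypeR R).
Definition unif01 : probability mR R := uniform_prob (@ltr01 R).

Lemma unif01_ray (x : R) : unif01 `]-oo, x[%classic = (clamp x)%:E.
Proof.
have -> : unif01 `]-oo, x[%classic = (\int[unif01]_y (\1_(`]-oo, x[%classic) y)%:E)%E.
  by rewrite integral_indic// setIT.
rewrite integral_uniform//; last first.
  by apply/measurable_EFinP; apply: measurable_indic.
rewrite subr0 invr1 mul1e integral_indic//.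
(* The uniform law lives on a closed interval while the ray is open, hence the extra point 1 when
   [x] exceeds 1; it has measure 0. *)
rewrite (_ : _ `&` _ = [set` Interval (BLeft 0) (BLeft (clamp x))] `|` (if 1 < x then [set 1] else set0)); last first.
  apply/seteqP; split => y /=; rewrite !in_itv/= /clamp.
    move=> [yx /andP[y0 y1]].
    case: ifPn => [x1|]; last first.
      rewrite -leNgt => x1; left; rewrite y0/= lt_min lt_max yx orbT andbT.
      exact: lt_le_trans yx x1.
    have [->|y1'] := eqVneq y 1; [by right|left].
    by rewrite y0/= lt_min lt_max yx orbT andbT lt_neqAle y1' y1.
  move=> [/andP[y0]|].
    rewrite lt_min lt_max => /andP[y1 /orP[|yx]]; first by rewrite ltNge y0.
    by rewrite y0 yx (ltW y1).
  by case: ifPn => // x1 ->; rewrite x1 ler01 lexx.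
rewrite measureU//=; last 2 first.
- by case: ifP.
- apply/seteqP; split => // y /=; case: ifP => //= x1; last by move=> [].
  by rewrite in_itv/= => -[/andP[_ +] y1]; rewrite y1 /clamp lt_min ltxx.
have -> : lebesgue_measure (if 1 < x then [set 1] else set0) = 0%E :> \bar R.
  by case: ifP => // _; exact: lebesgue_measure_set1.
rewrite adde0 lebesgue_measure_itv/= lte_fin.
have /andP[c0 c1] := clamp01 x.
case: ifPn => [_|]; first by rewrite oppr0 adde0.
by rewrite -leNgt => cle; congr EFin; apply/eqP; rewrite eq_le c0 cle.
Qed.

Definition bit (x : R) : R := (2^-1 <= x)%R%:R.
(** The doubling map, which drops the first binary digit. It maps the closed unit interval into
    itself and fixes 1. *)
Definition tail_bits (x : R) : R := 2 * x - bit x.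

Lemma measurable_bit : measurable_fun (setT : set mR) bit.
Proof.
rewrite /bit (_ : (fun _ => _) = \1_(`[2^-1, +oo[%classic)).
  by apply: measurable_indic.
by apply/funext => x; rewrite indicE mem_setE in_itv/= andbT.
Qed.

Lemma measurable_shift : measurable_fun (setT : set mR) (tail_bits : mR -> mR).
Proof.
apply: measurable_funB; last exact: measurable_bit.
exact: measurable_funM.
Qed.

Lemma bit01 x : 0 <= bit x <= 1.
Proof. by rewrite /bit; case: (2^-1 <= x); rewrite ?lexx ?ler01. Qed.

Lemma shift_ray_low (y : R) :
  unif01 (`]-oo, 2^-1[%classic `&` tail_bits @^-1` `]-oo, y[%classic) = (2^-1 * clamp y)%:E.
Proof.
rewrite (_ : _ `&` _ = `]-oo, (Num.min 2^-1 (y / 2))[%classic).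
  rewrite unif01_ray; congr EFin.
  by rewrite /clamp /Num.max /Num.min; repeat case: ifPn; rewrite -?leNgt; lra.
apply/seteqP; split => x /=; rewrite !in_itv/= /tail_bits /bit lt_min.
  by move=> [x2]; rewrite leNgt x2/=; lra.
by move=> /andP[x2 xy]; rewrite x2 leNgt x2/=; split => //; lra.
Qed.

Lemma shift_ray_high (y : R) :
  unif01 (`[2^-1, +oo[%classic `&` tail_bits @^-1` `]-oo, y[%classic) = (2^-1 * clamp y)%:E.
Proof.
have -> : `[2^-1, +oo[%classic `&` tail_bits @^-1` `]-oo, y[%classic =
    `]-oo, ((y + 1) / 2)[%classic `\` `]-oo, (Num.min 2^-1 ((y + 1) / 2))[%classic.
  apply/seteqP; split => x /=; rewrite !in_itv/= /tail_bits /bit lt_min andbT.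
    move=> [x2]; rewrite x2/= => xy; split; first by lra.
    by move=> /andP[]; rewrite ltNge x2.
  move=> [xy /negP]; rewrite negb_and -!leNgt => /orP[x2|]; last by lra.
  by rewrite x2/=; split => //; lra.
rewrite measureD//; last by rewrite [X in (X < _)%E]unif01_ray ltry.
rewrite (setIidr _); last first.
  by move=> x /=; rewrite !in_itv/= lt_min => /andP[].
rewrite [X in (X - _)%E](unif01_ray _) [X in (_ - X)%E](unif01_ray _) -EFinB; congr EFin.
by rewrite /clamp /Num.max /Num.min; repeat case: ifPn; rewrite -?leNgt; lra.
Qed.

(** Both sides are finite measures in [B], so that agreement on rays suffices. *)
Lemma shift_half (D : set mR) : measurable D ->
  (forall y, unif01 (D `&` tail_bits @^-1` `]-oo, y[%classic) = (2^-1 * clamp y)%:E) ->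
  forall B : set mR, measurable B ->
    unif01 (D `&` tail_bits @^-1` B) = (2^-1%:E * unif01 B)%E.
Proof.
move=> mD hD B mB.
have h0 : 0 <= 2^-1 :> R by rewrite invr_ge0.
have := @measure_ray_unique R (pushforward (mrestr unif01 mD) (tail_bits : mR -> mR)) (mscale (NngNum h0) unif01).
rewrite /pushforward/= /mrestr/mscale/=.
move=> /(_ measurable_shift _ _ B mB); rewrite setIC; apply.
- apply: le_lt_trans (ltry 1); rewrite -[leRHS](@probability_setT _ _ _ unif01).
  by rewrite /pushforward/= preimage_setT; apply: le_measure; rewrite ?inE//; apply: measurableI.
- move=> x; rewrite /pushforward/= [X in uniform_prob _ X]setIC.
  by have := hD x; rewrite EFinM -unif01_ray.
Qed.

Lemma bit_shift_low (B : set mR) : measurable B ->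
  unif01 (`]-oo, 2^-1[%classic `&` tail_bits @^-1` B) = (2^-1%:E * unif01 B)%E.
Proof. by apply: shift_half => //; exact: shift_ray_low. Qed.

Lemma bit_shift_high (B : set mR) : measurable B ->
  unif01 (`[2^-1, +oo[%classic `&` tail_bits @^-1` B) = (2^-1%:E * unif01 B)%E.
Proof. by apply: shift_half => //; exact: shift_ray_high. Qed.

Lemma bit_cases (A : set R) (C : set mR) : bit @^-1` A `&` C =
  (if 0 \in A then `]-oo, 2^-1[%classic `&` C else set0) `|`
  (if 1 \in A then `[2^-1, +oo[%classic `&` C else set0).
Proof.
apply/seteqP; split => x /=.
  rewrite /bit; case: (leP 2^-1 x) => x2/= [Ax Cx].
    by right; rewrite mem_set//=; split => //=; rewrite in_itv/= x2.
  by left; rewrite mem_set//=; split => //=; rewrite in_itv/= x2.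
move=> [|]; case: ifPn => //; rewrite inE => hA [/=]; rewrite in_itv/= /bit.
  by move=> x2 Cx; rewrite leNgt x2.
by rewrite andbT => -> Cx.
Qed.

Lemma bit_shift_prob (A : set R) (B : set mR) : measurable B ->
  unif01 (bit @^-1` A `&` tail_bits @^-1` B) =
  ((((0 \in A)%:R + (1 \in A)%:R) / 2)%:E * unif01 B)%E.
Proof.
move=> mB; have mS : measurable (tail_bits @^-1` B : set mR).
  by rewrite -[X in measurable X]setTI; exact: measurable_shift.
rewrite bit_cases measureU//; last 3 first.
- by case: ifP => // _; exact: measurableI.
- by case: ifP => // _; exact: measurableI.
- apply/seteqP; split => // x /= [h1 h2]; move: h1 h2.
  case: ifP => // _ /= [x1 _]; case: ifP => // _ /= [x2 _].
  by move: x1 x2; rewrite !in_itv/= andbT leNgt => ->.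
have fB : unif01 B \is a fin_num by rewrite fin_num_measure.
have vE := fineK fB; set v := fine _ in vE.
case: ifP => _; case: ifP => _.
- by rewrite [X in (X + _)%E]bit_shift_low// [X in (_ + X)%E]bit_shift_high// -vE -!EFinM -EFinD; congr EFin; rewrite /=; lra.
- by rewrite measure0 [X in (X + _)%E]bit_shift_low// adde0 -vE -!EFinM; congr EFin; rewrite /=; lra.
- by rewrite measure0 [X in (_ + X)%E]bit_shift_high// add0e -vE -!EFinM; congr EFin; rewrite /=; lra.
- by rewrite !measure0 adde0 addr0 mul0r mul0e.
Qed.

(** On either half of the unit interval, where [bit] is constant, [tail_bits] carries one half of
    the uniform law. *)
Lemma bit_shift_indep (A : set R) (B : set mR) : measurable A -> measurable B ->
  unif01 (bit @^-1` A `&` tail_bits @^-1` B) =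
  (unif01 (bit @^-1` A) * unif01 (tail_bits @^-1` B))%E.
Proof.
move=> mA mB; rewrite bit_shift_prob//.
have hA := @bit_shift_prob A setT measurableT.
rewrite preimage_setT setIT probability_setT mule1 in hA; rewrite hA.
have hB := @bit_shift_prob setT B mB.
rewrite preimage_setT setTI in hB; rewrite hB.
by rewrite !in_setT (_ : true%:R + true%:R = 2)// divff// mul1e.
Qed.

Lemma shift_preserves (B : set mR) : measurable B ->
  unif01 (tail_bits @^-1` B) = unif01 B.
Proof.
move=> mB; have := @bit_shift_prob setT B mB.
rewrite preimage_setT setTI => ->.
by rewrite !in_setT (_ : true%:R + true%:R = 2)// divff// mul1e.
Qed.

Lemma integral_preserving (s : mR -> mR) (f : mR -> \bar R) : measurable_fun setT s ->
  (forall B, measurable B -> unif01 (s @^-1` B) = unif01 B) ->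
  measurable_fun setT f -> (forall x, (0 <= f x)%E) ->
  (\int[unif01]_x f (s x) = \int[unif01]_x f x)%E.
Proof.
move=> ms hs mf f0.
pose s' : {mfun mR >-> mR} := HB.pack s (isMeasurableFun.Build _ _ _ _ s ms).
transitivity (\int[distribution unif01 s']_x f x)%E.
  by rewrite ge0_integral_distribution.
by apply: eq_measure_integral => C mC _; rewrite /distribution/= /pushforward hs.
Qed.

(* Reads every other binary digit. *)
Fixpoint digits (n : nat) (x : R) : R :=
  if n is n'.+1 then (bit x + digits n' (tail_bits (tail_bits x))) / 2 else 0.

Lemma digits01 n x : 0 <= digits n x <= 1.
Proof.
elim: n x => [|n IH] x /=; first by rewrite lexx ler01.
have := IH (tail_bits (tail_bits x)); have := bit01 x.
by move=> /andP[? ?] /andP[? ?]; apply/andP; split; lra.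
Qed.

Lemma digits_nondecreasing x : nondecreasing_seq (digits ^~ x).
Proof.
apply/nondecreasing_seqP => n; elim: n x => [|n IH] x.
  by have /andP[] := digits01 1 x.
by rewrite [leLHS]/= [leRHS]/= ler_pM2r ?invr_gt0// lerD2l.
Qed.

Definition odd_digits x : R := limn (digits ^~ x).

Lemma digits_cvg x : digits ^~ x @ \oo --> odd_digits x.
Proof.
apply: nondecreasing_is_cvgn; first exact: digits_nondecreasing.
by exists 1 => _ [n _ <-]; have /andP[] := digits01 n x.
Qed.

Lemma odd_digits01 x : 0 <= odd_digits x <= 1.
Proof.
apply/andP; split.
  by apply: limr_ge; [exact: digits_cvg|apply: nearW => n; have /andP[] := digits01 n x].
by apply: limr_le; [exact: digits_cvg|apply: nearW => n; have /andP[] := digits01 n x].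
Qed.

Lemma odd_digits_rec x : odd_digits x = (bit x + odd_digits (tail_bits (tail_bits x))) / 2.
Proof.
have h1 : digits n.+1 x @[n --> \oo] --> odd_digits x.
  by rewrite (cvg_shiftS (digits ^~ x)); exact: digits_cvg.
apply: (cvg_unique _ h1) => //=.
by apply: cvgM; [apply: cvgD; [exact: cvg_cst|exact: digits_cvg]|exact: cvg_cst].
Qed.

Lemma measurable_odd_digits : measurable_fun (setT : set mR) odd_digits.
Proof.
apply: (@measurable_fun_cvg _ mR R setT (fun n => digits n)).
  elim => [|n IH]/=; first exact: measurable_cst.
  apply: measurable_funM => //; apply: measurable_funD; first exact: measurable_bit.
  apply: (measurableT_comp IH); apply: measurableT_comp; exact: measurable_shift.
by move=> x _; exact: digits_cvg.
Qed.

End uniform_bits.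

Section real_variables.
Context {d : measure_display} {T : measurableType d} {R : realType}.
Variable P : probability T R.

Lemma bounded_integrable (V : T -> R) (c : R) : measurable_fun setT V ->
  (forall w, `|V w| <= c) -> P.-integrable setT (EFin \o V).
Proof.
move=> mV Vc; apply: (@measurable_bounded_integrable _ _ _ P) => //.
  exact: le_lt_trans (probability_le1 P measurableT) (ltry _).
by exists c; split; [exact: num_real|move=> x cx w _; exact: le_trans (Vc w) (ltW cx)].
Qed.

Lemma measurable_expR_comp (V : T -> R) : measurable_fun setT V ->
  measurable_fun setT (fun w => expR (V w)).
Proof. by move=> mV; apply: measurableT_comp. Qed.

Lemma expR_bounded_integrable (V : T -> R) (c : R) : measurable_fun setT V ->
  (forall w, `|V w| <= c) -> P.-integrable setT (fun w => (expR (V w))%:E).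
Proof.
move=> mV Vc; apply: (@bounded_integrable (fun w => expR (V w)) (expR c)).
  exact: measurable_expR_comp.
move=> w; rewrite ger0_norm ?expR_ge0// ler_expR.
by apply: le_trans (Vc w); exact: ler_norm.
Qed.

Lemma Rintegral_prob_cst (r : R) : \int[P]_w r = r.
Proof. by have := expectation_cst P r; rewrite unlock /Rintegral => ->. Qed.

Lemma mgf_near1 (V : T -> R) (c : R) : measurable_fun setT V -> (forall w, `|V w| <= c) ->
  `|\int[P]_w expR (V w) - 1| <= c * expR c.
Proof.
move=> mV Vc.
have i1 : P.-integrable setT (EFin \o (fun=> 1 : R)).
  by apply: (@bounded_integrable _ 1) => // w; rewrite normr1.
have iV := expR_bounded_integrable mV Vc.
have E1 := Rintegral_prob_cst.
rewrite -{1}(E1 1) -RintegralB//.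
have iB : P.-integrable setT (EFin \o (fun w => expR (V w) - 1)).
  exact: (integrableB measurableT iV i1).
apply: le_trans (le_normr_Rintegral _ iB) _ => //.
rewrite -(E1 (c * expR c)); apply: le_Rintegral => //.
- exact: (integrable_norm iB).
- by apply: (@bounded_integrable _ `|c * expR c|).
- move=> w _; apply: le_trans (expR_taylor1 _) _.
  by apply: ler_pM => //; rewrite ler_expR.
Qed.

Lemma mgf_le (V : T -> R) (c : R) : measurable_fun setT V -> (forall w, `|V w| <= c) ->
  0 <= \int[P]_w expR (V w) <= expR c.
Proof.
move=> mV Vc; apply/andP; split.
  by apply: Rintegral_ge0 => w _; exact: expR_ge0.
have E1 := Rintegral_prob_cst.
rewrite -(E1 (expR c)); apply: le_Rintegral => //.
- exact: expR_bounded_integrable Vc.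
- by apply: (@bounded_integrable _ `|expR c|).
- by move=> w _; rewrite ler_expR; apply: le_trans (Vc w); exact: ler_norm.
Qed.

(** With one event fixed, both sides are finite measures in the other and agree on rays; the
    argument is applied once to each variable. *)
Lemma indep_rays (X Y : T -> R) : measurable_fun setT X -> measurable_fun setT Y ->
  (forall x y, P (X @^-1` `]-oo, x[ `&` Y @^-1` `]-oo, y[) =
     (P (X @^-1` `]-oo, x[) * P (Y @^-1` `]-oo, y[))%E) ->
  forall A B : set R, measurable A -> measurable B ->
  P (X @^-1` A `&` Y @^-1` B) = (P (X @^-1` A) * P (Y @^-1` B))%E.
Proof.
move=> mX mY XY A B mA mB.
have mXA (C : set R) : measurable C -> measurable (X @^-1` C).
  by move=> mC; rewrite -[X in measurable X]setTI; exact: mX.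
have mYA (C : set R) : measurable C -> measurable (Y @^-1` C).
  by move=> mC; rewrite -[X in measurable X]setTI; exact: mY.
have key (V W : T -> R) (mV : measurable_fun setT V) (E : set T) (mE : measurable E) :
    (forall x, P (V @^-1` `]-oo, x[ `&` E) = (P (V @^-1` `]-oo, x[) * P E)%E) ->
    forall C : set R, measurable C -> P (V @^-1` C `&` E) = (P (V @^-1` C) * P E)%E.
  move=> h C mC.
  have fE : P E \is a fin_num by exact: fin_num_measure.
  have pE0 : 0 <= fine (P E) by exact: fine_ge0.
  have mV' : measurable_fun setT (V : T -> measurableTypeR R) by exact: mV.
  pose V' : {mfun T >-> measurableTypeR R} := HB.pack (V : T -> measurableTypeR R)
    (isMeasurableFun.Build _ _ _ _ (V : T -> measurableTypeR R) mV').
  have := @measure_ray_unique R (pushforward (mrestr P mE) (V : T -> measurableTypeR R))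
    (mscale (NngNum pE0) (distribution P V')).
  rewrite /distribution/= /mscale/= /pushforward/= /mrestr/=.
  move=> /(_ mV' _ _ C mC); rewrite muleC fineK//; apply.
  - apply: le_lt_trans (ltry 1); apply: probability_le1.
    by rewrite preimage_setT setTI.
  - by move=> x; rewrite h muleC.
apply: (key X X mX) => [|x|//]; first exact: mYA.
rewrite setIC muleC; apply: (key Y X mY) => [|y|//]; first exact: mXA.
by rewrite setIC muleC.
Qed.

Lemma law_rays (X : T -> R) (Q : probability (measurableTypeR R) R) : measurable_fun setT X ->
  (forall x, P (X @^-1` `]-oo, x[) = Q `]-oo, x[%classic) ->
  forall A : set R, measurable A -> P (X @^-1` A) = Q A.
Proof.
move=> mX h A mA.
have mX' : measurable_fun setT (X : T -> measurableTypeR R) by exact: mX.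
have := @measure_ray_unique R (pushforward P (X : T -> measurableTypeR R)) Q.
rewrite /pushforward/= => /(_ mX' _ h A mA); apply.
apply: le_lt_trans (ltry 1); apply: probability_le1.
by rewrite preimage_setT.
Qed.

End real_variables.

Section splitting.
Context {R : realType}.
Local Notation mR := (measurableTypeR R).
Local Notation U := (@unif01 R).

Definition even_digits (x : R) : R := odd_digits (tail_bits x).

Lemma even_digits01 x : 0 <= even_digits x <= 1.
Proof. exact: odd_digits01. Qed.

Lemma odd_digitsE x : odd_digits x = (bit x + even_digits (tail_bits x)) / 2.
Proof. exact: odd_digits_rec. Qed.

Lemma measurable_even_digits : measurable_fun (setT : set mR) (even_digits : mR -> R).
Proof.
by apply: (measurableT_comp (@measurable_odd_digits R)); exact: measurable_shift.
Qed.

Lemma measurable_clamp : measurable_fun (setT : set mR) (@clamp R : mR -> R).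
Proof.
have : measurable_fun (setT : set R) (@clamp R).
  by apply: continuous_measurable_fun; exact: clamp_continuous.
by [].
Qed.

Definition bit_mgf (a : R) : R := \int[U]_x expR (a / 2 * bit x).
Definition digits_mgf (a b : R) : R :=
  \int[U]_x expR (a * odd_digits x + b * even_digits x).
Definition clamp_mgf (a : R) : R := \int[U]_x expR (a * clamp x).

Lemma norm_mul01 (a x : R) : 0 <= x <= 1 -> `|a * x| <= `|a|.
Proof. by move=> /andP[x0 x1]; rewrite normrM (ger0_norm x0) ler_piMr. Qed.

Lemma measurable_bit_mul (a : R) : measurable_fun (setT : set mR) (fun x : mR => a * bit x : R).
Proof. by apply: measurable_funM => //; exact: measurable_bit. Qed.

(** The first digit is independent of the others, and these again form a uniform variable. *)
Lemma integral_split_bit (H : mR -> R) (a C : R) : measurable_fun setT H ->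
  (forall x, 0 <= H x <= C) ->
  \int[U]_x (expR (a / 2 * bit x) * H (tail_bits x)) = bit_mgf a * \int[U]_x H x.
Proof.
move=> mH H0; rewrite /bit_mgf /Rintegral.
have mf : measurable_fun (setT : set R) (fun z : R => expR (a / 2 * z)).
  by apply: measurable_expR_comp; exact: measurable_funM.
have H00 x : 0 <= H x by have /andP[] := H0 x.
have := @decoupleM _ _ _ mR R mR R U bit tail_bits (@measurable_bit R) (@measurable_shift R)
  (@bit_shift_indep R) (fun z => expR (a / 2 * z)) H mf mH (fun z => expR_ge0 _) H00.
move=> ->; rewrite (@integral_preserving R tail_bits (fun x => (H x)%:E))//; last first.
- exact/measurable_EFinP.
- exact: shift_preserves.
- exact: measurable_shift.
rewrite fineM//.
  apply: integrable_fin_num => //.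
  apply: (@expR_bounded_integrable _ mR R U _ `|a / 2|).
    exact: measurable_bit_mul.
  by move=> x; apply: norm_mul01; exact: bit01.
apply: integrable_fin_num => //; apply: (@bounded_integrable _ mR R U _ C) => // x.
by have /andP[h1 h2] := H0 x; rewrite ger0_norm.
Qed.

Lemma measurable_digits_comb (a b : R) : measurable_fun (setT : set mR)
  (fun x : mR => a * odd_digits x + b * even_digits x : R).
Proof.
apply: measurable_funD; apply: measurable_funM => //.
- exact: measurable_odd_digits.
- exact: measurable_even_digits.
Qed.

Lemma digits_comb_norm (a b x : R) :
  `|a * odd_digits x + b * even_digits x| <= `|a| + `|b|.
Proof.
apply: le_trans (ler_normD _ _) _; apply: lerD; apply: norm_mul01.
- exact: odd_digits01.
- exact: even_digits01.
Qed.

(** Dropping the first digit turns the even digits into odd ones, and the odd ones, deprived of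
    their leading digit and halved, into even ones; hence (a, b) becomes (b, a / 2). *)
Lemma digits_mgf_rec (a b : R) : digits_mgf a b = bit_mgf a * digits_mgf b (a / 2).
Proof.
rewrite /digits_mgf -(@integral_split_bit (fun x => expR (b * odd_digits x + a / 2 * even_digits x))
  a (expR (`|b| + `|a / 2|))).
- apply: eq_Rintegral => x _; rewrite -expRD; congr expR.
  by rewrite odd_digitsE /even_digits; ring.
- by apply: measurable_expR_comp; exact: measurable_digits_comb.
- move=> x; rewrite expR_ge0/= ler_expR.
  exact: le_trans (ler_norm _) (digits_comb_norm _ _ _).
Qed.

Lemma integral_unif01_eq (f g : mR -> R) : measurable_fun setT f -> measurable_fun setT g ->
  (forall x, 0 <= f x) -> (forall x, 0 <= g x) ->
  (forall x, 0 <= x <= 1 -> f x = g x) -> \int[U]_x f x = \int[U]_x g x.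
Proof.
move=> mf mg f0 g0 fg; rewrite /Rintegral; congr fine.
rewrite !integral_uniform//; [|exact/measurable_EFinP|exact/measurable_EFinP].
congr (_ * _)%E; apply: eq_integral => x; rewrite inE/= in_itv/= => x01.
by rewrite fg.
Qed.

Lemma clamp_id (x : R) : 0 <= x <= 1 -> clamp x = x.
Proof. by move=> /andP[x0 x1]; rewrite /clamp (max_idPr x0) (min_idPr x1). Qed.

(** On the unit interval x = (bit x + tail_bits x) / 2. The clamp is the identity there and keeps
    the integrand bounded on the whole line. *)
Lemma clamp_mgf_rec (a : R) : clamp_mgf a = bit_mgf a * clamp_mgf (a / 2).
Proof.
have mc (c : R) : measurable_fun (setT : set mR) (fun x : mR => c * clamp x : R).
  by apply: measurable_funM => //; exact: measurable_clamp.
rewrite /clamp_mgf -(@integral_split_bit (fun x => expR (a / 2 * clamp x)) a (expR `|a / 2|)).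
- apply: integral_unif01_eq => //.
  + exact: measurable_expR_comp.
  + apply: measurable_funM; apply: measurable_expR_comp; first exact: measurable_bit_mul.
    apply: measurable_funM => //; apply: (measurableT_comp measurable_clamp).
    exact: measurable_shift.
  + move=> x /andP[x0 x1]; rewrite -expRD; congr expR.
    rewrite clamp_id ?x0// clamp_id; first by rewrite /tail_bits; lra.
    rewrite /tail_bits /bit; case: (leP 2^-1 x) => /= x2; apply/andP; split; lra.
- exact: measurable_expR_comp.
- move=> x; rewrite expR_ge0/= ler_expR; apply: le_trans (ler_norm _) _.
  by apply: norm_mul01; exact: clamp01.
Qed.

Lemma bit_mgf_le (a : R) : 0 <= bit_mgf a <= expR (`|a| / 2).
Proof.
have -> : `|a| / 2 = `|a / 2| by rewrite normrM normfV normr_nat.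
apply: mgf_le; first exact: measurable_bit_mul.
by move=> x; apply: norm_mul01; exact: bit01.
Qed.

(* The two terms satisfy the same recursion, which halves the parameters; hence
   the gap is controlled by its values near 0. *)
Definition mgf_gap (a b : R) : R := `|digits_mgf a b - clamp_mgf a * clamp_mgf b|.

Lemma mgf_gap_rec (a b : R) : mgf_gap a b = bit_mgf a * mgf_gap b (a / 2).
Proof.
rewrite /mgf_gap digits_mgf_rec (clamp_mgf_rec a).
have /andP[c0 _] := bit_mgf_le a.
rewrite -[X in _ = X * _](ger0_norm c0) -normrM; congr `|_|; ring.
Qed.

Lemma mgf_gap_halve (a b : R) : mgf_gap a b <= expR ((`|a| + `|b|) / 2) * mgf_gap (a / 2) (b / 2).
Proof.
rewrite mgf_gap_rec mgf_gap_rec mulrA mulrDl expRD ler_wpM2r ?normr_ge0//.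
have /andP[a0 a1] := bit_mgf_le a; have /andP[b0 b1] := bit_mgf_le b.
exact: ler_pM.
Qed.

Lemma mgf_gap_iter n (a b : R) :
  mgf_gap a b <= expR (`|a| + `|b|) * mgf_gap (a / 2 ^+ n) (b / 2 ^+ n).
Proof.
elim: n a b => [|n IH] a b.
  by rewrite expr0 !divr1 ler_peMl ?normr_ge0// -[leLHS]expR0 ler_expR addr_ge0.
apply: le_trans (mgf_gap_halve a b) _.
have := IH (a / 2) (b / 2).
have h2 (x : R) : `|x / 2| = `|x| / 2 by rewrite normrM normfV normr_nat.
have hn (x : R) : x / 2 / 2 ^+ n = x / 2 ^+ n.+1 by rewrite exprS invfM mulrA.
rewrite !h2 !hn -mulrDl => H.
apply: le_trans (ler_wpM2l (expR_ge0 _) H) _.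
by rewrite mulrA -expRD -splitr.
Qed.

Lemma mgf_gap_small (a b : R) : `|a| + `|b| <= 1 -> mgf_gap a b <= (`|a| + `|b|) * (2 * expR 1).
Proof.
move=> ab1; pose t : R := `|a| + `|b|.
rewrite -/t; have a1 : `|a| <= 1 by apply: le_trans ab1; rewrite lerDl.
have b1 : `|b| <= 1 by apply: le_trans ab1; rewrite lerDr.
have mc (c : R) : measurable_fun (setT : set mR) (fun x : mR => c * clamp x : R).
  by apply: measurable_funM => //; exact: measurable_clamp.
have hc (c x : R) : `|c * clamp x| <= `|c| by apply: norm_mul01; exact: clamp01.
have hd : `|digits_mgf a b - 1| <= t * expR 1.
  apply: le_trans (mgf_near1 U (measurable_digits_comb a b) (digits_comb_norm a b)) _.
  by rewrite ler_wpM2l ?addr_ge0// ler_expR.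
have ha : `|clamp_mgf a - 1| <= `|a| * expR `|a| by apply: mgf_near1.
have hb : `|clamp_mgf b - 1| <= `|b| * expR `|b| by apply: mgf_near1.
have /andP[mb0 mb1] : 0 <= clamp_mgf b <= expR `|b| by apply: mgf_le.
rewrite /mgf_gap.
have -> : digits_mgf a b - clamp_mgf a * clamp_mgf b =
  (digits_mgf a b - 1) - ((clamp_mgf a - 1) * clamp_mgf b + (clamp_mgf b - 1)) by ring.
apply: le_trans (ler_normB _ _) _.
have -> : t * (2 * expR 1) = t * expR 1 + t * expR 1 by ring.
apply: lerD => //; apply: le_trans (ler_normD _ _) _; rewrite /t [leRHS]mulrDl; apply: lerD.
  rewrite normrM (ger0_norm mb0).
  apply: le_trans (_ : `|a| * expR `|a| * expR `|b| <= _); first exact: ler_pM.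
  by rewrite -mulrA -expRD ler_wpM2l// ler_expR.
by apply: le_trans hb _; rewrite ler_wpM2l// ler_expR.
Qed.

(** After n halvings of both parameters the gap is O(2^-n), while the accumulated factor stays below
    e^(|a| + |b|). *)
Lemma digits_mgfE (a b : R) : digits_mgf a b = clamp_mgf a * clamp_mgf b.
Proof.
set t := `|a| + `|b|; have t0 : 0 <= t by rewrite addr_ge0.
suff : mgf_gap a b <= 0 by rewrite normr_le0 subr_eq0 => /eqP.
have h : expR t * (t / 2 ^+ n * (2 * expR 1)) @[n --> \oo] --> expR t * (t * 0 * (2 * expR 1)).
  apply: cvgM; first exact: cvg_cst.
  apply: cvgM; last exact: cvg_cst.
  apply: cvgM; first exact: cvg_cst.
  under eq_fun do rewrite -exprVn.
  by apply: cvg_expr; rewrite ger0_norm ?invr_ge0// invf_lt1// ltr1n.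
rewrite mulr0 mul0r mulr0 in h.
apply: (cvgr_to_ge h); near=> n.
apply: le_trans (mgf_gap_iter n a b) _; rewrite ler_wpM2l ?expR_ge0//.
have hn (x : R) : `|x / 2 ^+ n| = `|x| / 2 ^+ n.
  by rewrite normrM normfV normrX normr_nat.
have -> : t / 2 ^+ n = `|a / 2 ^+ n| + `|b / 2 ^+ n| by rewrite !hn -mulrDl.
apply: mgf_gap_small; rewrite !hn -mulrDl -/t.
rewrite ler_pdivrMr ?exprn_gt0// mul1r -natrX.
near: n; have := nbhs_infty_ger t; apply: filterS => n tn.
apply: le_trans tn _; rewrite ler_nat; apply: ltnW; exact: ltn_expl.
Unshelve. all: by end_near.
Qed.

Lemma open_box2 (x y : R) (v : 'rV[R]_2) :
  open_box (\row_(i < 2) if i == 0 then x else y) v <-> v 0 0 < x /\ v 0 1 < y.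
Proof.
split => [h|[h1 h2] i].
  by have := h 0; have := h 1; rewrite !mxE.
by rewrite mxE; have [->|] := eqVneq i 0; [|case: i => [[|[]]]//= ? _; rewrite (_ : Ordinal _ = 1)//; exact: val_inj].
Qed.

(** The joint moment generating function is that of two independent uniform variables, realised on
    the product space; uniqueness transfers the probabilities of orthants. *)
Lemma digits_joint (x y : R) :
  U (odd_digits @^-1` `]-oo, x[ `&` even_digits @^-1` `]-oo, y[) = (clamp x * clamp y)%:E.
Proof.
pose X (w : mR) : 'rV[R]_2 := \row_(i < 2) if i == 0 then odd_digits w else even_digits w.
pose Z (w : mR * mR) : 'rV[R]_2 := \row_(i < 2) if i == 0 then clamp w.1 else clamp w.2.
have mc1 : measurable_fun (setT : set (mR * mR)) (fun w => clamp w.1 : R).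
  by apply: (measurableT_comp measurable_clamp).
have mc2 : measurable_fun (setT : set (mR * mR)) (fun w => clamp w.2 : R).
  by apply: (measurableT_comp measurable_clamp).
have dotE (a v : 'rV[R]_2) : dotr a v = a 0 0 * v 0 0 + a 0 1 * v 0 1.
  by rewrite /dotr big_ord_recl big_ord1; congr (_ + a 0 _ * v 0 _); exact: val_inj.
have XP : exp_integrable U X.
  split => [i|a].
    rewrite /X; under eq_fun do rewrite mxE.
    by case: (i == 0); [exact: measurable_odd_digits|exact: measurable_even_digits].
  under eq_fun do rewrite dotE !mxE/=.
  apply: expR_bounded_integrable; first exact: measurable_digits_comb.
  by move=> w; exact: digits_comb_norm.
have mcc (a b : R) : measurable_fun (setT : set (mR * mR)) (fun w => a * clamp w.1 + b * clamp w.2).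
  by apply: measurable_funD; apply: measurable_funM.
have ZQ : exp_integrable (U \x U)%E Z.
  split => [i|a].
    by rewrite /Z; under eq_fun do rewrite mxE; case: (i == 0).
  under eq_fun do rewrite dotE !mxE/=.
  apply: (@expR_bounded_integrable _ _ _ _ _ (`|a 0 0| + `|a 0 1|)); first exact: mcc.
  move=> w; apply: le_trans (ler_normD _ _) _.
  by apply: lerD; apply: norm_mul01; exact: clamp01.
have XZ a : mean U X (fun x => expR (dotr a x)) = mean (U \x U)%E Z (fun x => expR (dotr a x)).
  rewrite /mean; under eq_Rintegral do rewrite dotE !mxE/=.
  rewrite -/(digits_mgf _ _) digits_mgfE.
  under [RHS]eq_Rintegral do rewrite dotE !mxE/=.
  rewrite /Rintegral fubini_tonelli1//; last first.
    by apply/measurable_EFinP; apply: measurable_expR_comp; exact: mcc.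
  have me (b : R) : measurable_fun (setT : set mR) (fun x : mR => expR (b * clamp x)).
    by apply: measurable_expR_comp; apply: measurable_funM => //; exact: measurable_clamp.
  have fe (b : R) : (\int[U]_x (expR (b * clamp x))%:E)%E = (clamp_mgf b)%:E.
    rewrite fineK//; apply: integrable_fin_num => //.
    apply: (@expR_bounded_integrable _ mR R U _ `|b|).
      by apply: measurable_funM => //; exact: measurable_clamp.
    by move=> w; apply: norm_mul01; exact: clamp01.
  rewrite /fubini_F/=.
  under eq_integral => w _.
    under eq_integral do rewrite expRD EFinM.
    rewrite ge0_integralZl//; last exact/measurable_EFinP.
    rewrite fe; over.
  rewrite ge0_integralZr//; [by rewrite fe|exact/measurable_EFinP|].
  by rewrite lee_fin; apply: Rintegral_ge0 => w _; exact: expR_ge0.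
have := open_box_prob_eq XP ZQ XZ (\row_(i < 2) if i == 0 then x else y).
have -> : X @^-1` open_box (\row_(i < 2) (if i == 0 then x else y)) =
    odd_digits @^-1` `]-oo, x[ `&` even_digits @^-1` `]-oo, y[.
  apply/seteqP; split => w /=; rewrite open_box2 !mxE/= !in_itv/=.
    by [].
  by [].
move=> ->.
have -> : Z @^-1` open_box (\row_(i < 2) (if i == 0 then x else y)) =
    (clamp @^-1` `]-oo, x[) `*` (clamp @^-1` `]-oo, y[).
  by apply/seteqP; split => w /=; rewrite open_box2 !mxE/= !in_itv/=.
have mcl (z : R) : measurable (clamp @^-1` `]-oo, z[ : set mR).
  by rewrite -[X in measurable X]setTI; apply: measurable_clamp.
transitivity (U (clamp @^-1` `]-oo, x[) * U (clamp @^-1` `]-oo, y[))%E.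
  exact: product_measure1E.
suff cl z : U (clamp @^-1` `]-oo, z[) = (clamp z)%:E by rewrite !cl.
have [z0|z0] := leP z 0.
  rewrite (_ : clamp @^-1` _ = set0) ?measure0.
    by rewrite /clamp (max_idPl z0) (min_idPr ler01).
  apply/seteqP; split => // w /=; rewrite in_itv/=; have /andP[w0 _] := clamp01 w.
  by move=> wz; have := le_lt_trans w0 wz; rewrite ltNge z0.
have [z1|z1] := ltP 1 z.
  rewrite (_ : clamp @^-1` _ = setT).
    by rewrite [LHS](@probability_setT _ _ _ U) /clamp (min_idPl _)// le_max (ltW z1) orbT.
  apply/seteqP; split => // w _ /=; rewrite in_itv/=; have /andP[_ w1] := clamp01 w.
  exact: le_lt_trans w1 z1.
rewrite -unif01_ray; congr (U _); apply/seteqP; split => w /=; rewrite !in_itv/= /clamp.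
  by rewrite gt_min gt_max => /orP[|/andP[]//]; rewrite ltNge z1.
by move=> wz; rewrite gt_min gt_max z0 wz orbT.
Qed.

Lemma odd_digits_law : forall B : set R, measurable B -> U (odd_digits @^-1` B) = U B.
Proof.
apply: law_rays; first exact: measurable_odd_digits.
move=> x; rewrite unif01_ray; have := digits_joint x 2.
rewrite (_ : even_digits @^-1` _ = setT) ?setIT.
  move=> ->; rewrite (_ : clamp 2 = 1) ?mulr1//.
  by rewrite /clamp (max_idPr (ler0n R 2)) (min_idPl _)// ler1n.
apply/seteqP; split => // w _ /=; rewrite in_itv/=; have /andP[_ h] := even_digits01 w.
by apply: le_lt_trans h _; rewrite ltr1n.
Qed.

Lemma even_digits_law : forall B : set R, measurable B -> U (even_digits @^-1` B) = U B.
Proof.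
move=> B mB; rewrite /even_digits -(odd_digits_law mB).
have := @shift_preserves R (odd_digits @^-1` B); apply.
by rewrite -[X in measurable X]setTI; apply: measurable_odd_digits.
Qed.

Lemma digits_indep (A B : set R) : measurable A -> measurable B ->
  U (odd_digits @^-1` A `&` even_digits @^-1` B) =
  (U (odd_digits @^-1` A) * U (even_digits @^-1` B))%E.
Proof.
move: A B; apply: indep_rays.
- exact: measurable_odd_digits.
- exact: measurable_even_digits.
- move=> x y; rewrite digits_joint odd_digits_law// even_digits_law//.
  by rewrite !unif01_ray.
Qed.

End splitting.

Section quantile.
Context {R : realType}.
Local Notation mR := (measurableTypeR R).
Local Notation U := (@unif01 R).
Variable Q : probability mR R.

Definition ray_prob (x : R) : R := fine (Q `]-oo, x[%classic).

Lemma ray_probE x : Q `]-oo, x[%classic = (ray_prob x)%:E.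
Proof. by rewrite fineK//; exact: fin_num_measure. Qed.

Lemma ray_prob01 x : 0 <= ray_prob x <= 1.
Proof.
by rewrite -!lee_fin -ray_probE measure_ge0/=; exact: probability_le1.
Qed.

Lemma ray_prob_mono x y : x <= y -> ray_prob x <= ray_prob y.
Proof.
move=> xy; rewrite -lee_fin -!ray_probE; apply: le_measure; rewrite ?inE//.
by move=> z /=; rewrite !in_itv/= => /lt_le_trans; apply.
Qed.

Lemma ray_prob_sup (x : nat -> R) (B : set mR) (u : R) : measurable B ->
  {homo x : n m / (n <= m)%N >-> n <= m} ->
  \bigcup_n `]-oo, x n[%classic = B -> (forall n, ray_prob (x n) <= u) ->
  (Q B <= u%:E)%E.
Proof.
move=> mB ndx xB hu.
have := @nondecreasing_cvg_mu _ _ _ Q (fun n => `]-oo, x n[%classic).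
move=> /(_ _ _ _) h; rewrite -xB.
have {}h := h (fun=> measurable_itv _).
rewrite xB in h *; have {}h := h mB.
have hmono : {homo (fun n => `]-oo, x n[%classic : set mR) : n m / (n <= m)%N >-> (n <= m)%O}.
  move=> n m nm; apply/subsetPset => z /=; rewrite !in_itv/= => /lt_le_trans; apply.
  exact: ndx.
have {}h := h hmono.
apply: (cvge_to_le h); apply: nearW => n /=; rewrite ray_probE lee_fin; exact: hu.
Qed.

(** The supremum of the x with [ray_prob x <= u] works: [ray_prob] is defined with open rays, hence
    left-continuous, and is still at most [u] at the supremum. *)
Lemma quantile_exists (u : R) : 0 < u < 1 ->
  exists v, forall x, (v < x) = (u < ray_prob x).
Proof.
move=> /andP[u0 u1].
pose E := [set x | ray_prob x <= u].
have [n0 hn0] : exists n : nat, ray_prob (- n%:R) <= u.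
  apply: contrapT => /forallNP H.
  have h := @nonincreasing_cvg_mu _ _ _ Q (fun n => `]-oo, - n%:R[%classic).
  have I0 : \bigcap_n (`]-oo, (- n%:R : R)[%classic) = set0.
    apply/seteqP; split => // x /= /(_ (Num.truncn `|x|).+1 I); rewrite /= in_itv/=.
    rewrite ltrNr => h1; have := truncnS_gt `|x|; have := ler_norm (- x).
    rewrite normrN => h2 h3; have := lt_le_trans h1 h2; move: h3; lra.
  have : (Q \o (fun n => `]-oo, (- n%:R : R)[%classic)) x @[x --> \oo] --> 0%E.
    rewrite -(measure0 Q) -I0; apply: h => //.
    - by rewrite [X in (X < _)%E]ray_probE ltry.
    - by rewrite I0.
    - move=> n m nm; apply/subsetPset => z /=; rewrite !in_itv/= => /lt_le_trans; apply.
      by rewrite lerN2 ler_nat.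
  move=> hc; have : (u%:E <= 0)%E; last by rewrite lee_fin leNgt u0.
  apply: (cvge_to_ge hc); apply: nearW => n /=; rewrite ray_probE lee_fin.
  by have /negP := H n; rewrite -ltNge => /ltW.
have [n1 hn1] : exists n : nat, u < ray_prob n%:R.
  apply: contrapT => /forallNP H.
  have : (Q setT <= u%:E)%E.
    apply: (@ray_prob_sup (fun n => n%:R)) => //.
    - by move=> n m nm; rewrite ler_nat.
    - apply/seteqP; split => // x _; exists (Num.truncn `|x|).+1 => //=.
      rewrite in_itv/=; apply: le_lt_trans (ler_norm _) _; exact: truncnS_gt.
    - by move=> n; rewrite leNgt; apply/negP; exact: H.
  by rewrite [X in (X <= _)%E]probability_setT lee_fin leNgt u1.
have E0 : E !=set0 by exists (- n0%:R).
have ubE : ubound E n1%:R.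
  move=> x /= xu; rewrite leNgt; apply/negP => xn.
  by have := lt_le_trans hn1 (ray_prob_mono (ltW xn)); rewrite ltNge xu.
have supE : has_sup E by split => //; exists n1%:R.
exists (sup E) => x; apply/idP/idP => [sx|ux].
  rewrite ltNge; apply/negP => xu.
  by have := ub_le_sup (ex_intro _ _ ubE) xu; rewrite leNgt sx.
rewrite ltNge; apply/negP => xs.
have : ray_prob (sup E) <= u; last first.
  by move=> /(le_trans (ray_prob_mono xs)); rewrite leNgt ux.
rewrite -lee_fin -ray_probE.
have xle (n m : nat) : (n <= m)%N -> sup E - n.+1%:R^-1 <= sup E - m.+1%:R^-1.
  by move=> nm; rewrite lerD2l lerN2 lef_pV2 ?posrE ?ltr0n// ler_nat ltnS.
apply: (@ray_prob_sup (fun n => sup E - n.+1%:R^-1)) => //.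
- apply/seteqP; split => z /=; rewrite in_itv/=.
    move=> [n _]; rewrite /= in_itv/= => /lt_trans; apply.
    by rewrite ltrBlDr ltrDl invr_gt0.
  rewrite -subr_gt0 => zs; exists (Num.truncn (sup E - z)^-1) => //=.
  rewrite in_itv/= ltrBrDr -ltrBrDl -[ltRHS]invrK ltf_pV2 ?posrE ?invr_gt0 ?ltr0n//.
  exact: truncnS_gt.
- move=> n; have e0 : 0 < n.+1%:R^-1 :> R by rewrite invr_gt0.
  have [y Ey hy] := sup_adherent e0 supE.
  exact: le_trans (ray_prob_mono (ltW hy)) Ey.
Qed.

(** The value 0 outside the open unit interval is a convention on a null set of the uniform law. *)
Definition quantile (u : R) : R :=
  xget 0 [set v | 0 < u < 1 /\ forall x, (v < x) = (u < ray_prob x)].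

Lemma quantileP u x : 0 < u < 1 -> (quantile u < x) = (u < ray_prob x).
Proof.
move=> u01; rewrite /quantile; case: xgetP => [v _ [_ ->]//|H].
by have [v hv] := quantile_exists u01; have := H v; case.
Qed.

Lemma quantile_out u : ~~ (0 < u < 1) -> quantile u = 0.
Proof. by move=> u01; rewrite /quantile; case: xgetP => // v _ [h]; rewrite h in u01. Qed.

Lemma quantile_ray x : quantile @^-1` `]-oo, x[%classic =
  (`]0, 1[%classic `&` `]-oo, ray_prob x[%classic) `|`
  (~` `]0, 1[%classic `&` (if 0 < x then setT else set0)).
Proof.
apply/seteqP; split => u /=; rewrite !in_itv/=.
  have [u01|u01] := boolP (0 < u < 1); first by rewrite quantileP//; left.
  by rewrite quantile_out// => ->; right.
move=> [[u01]|[/negP u01]]; first by rewrite quantileP.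
by rewrite quantile_out//; case: ifP.
Qed.

Lemma measurable_quantile : measurable_fun (setT : set mR) (quantile : mR -> R).
Proof.
apply: (@measurability _ _ mR mR setT quantile (@RGenInftyO.G R) (RGenInftyO.measurableE R)).
move=> _ [_ [x ->] <-]; rewrite setTI quantile_ray.
apply: measurableU; apply: measurableI => //; first exact: measurableC.
by case: ifP.
Qed.

Lemma unif01_interior (A B : set mR) : measurable A -> measurable B ->
  A `&` `]0, 1[%classic = B `&` `]0, 1[%classic -> U A = U B.
Proof.
move=> mA mB AB.
have H (C : set mR) : measurable C -> U C = lebesgue_measure (C `&` `]0, 1[%classic).
  move=> mC.
  have -> : U C = (\int[U]_y (\1_C y)%:E)%E by rewrite integral_indic// setIT.
  rewrite integral_uniform//; last by apply/measurable_EFinP; exact: measurable_indic.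
  rewrite subr0 invr1 mul1e (@integral_itv_bndoo _ 0 1 _ true false); last first.
    by apply/measurable_EFinP; exact: measurable_indic.
  by rewrite integral_indic.
by rewrite !H// AB.
Qed.

Lemma quantile_law (B : set R) : measurable B -> U (quantile @^-1` B) = Q B.
Proof.
move: B; apply: law_rays; first exact: measurable_quantile.
move=> x; rewrite ray_probE.
have -> : ray_prob x = clamp (ray_prob x) by rewrite clamp_id// ray_prob01.
rewrite -unif01_ray; apply: unif01_interior => //.
  by rewrite -[X in measurable X]setTI; apply: measurable_quantile.
apply/seteqP; split => u /=; rewrite !in_itv/= => -[h u01]; split => //.
  by rewrite -quantileP.
by rewrite quantileP.
Qed.

Lemma integral_quantile (f : R -> \bar R) : measurable_fun (setT : set R) f ->
  (forall x, (0 <= f x)%E) ->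
  (\int[U]_u f (quantile u) = \int[Q]_x f x)%E.
Proof.
move=> mf f0.
pose q : {mfun mR >-> mR} := HB.pack (quantile : mR -> mR)
  (isMeasurableFun.Build _ _ _ _ (quantile : mR -> mR) measurable_quantile).
transitivity (\int[distribution U q]_x f x)%E.
  by rewrite ge0_integral_distribution.
by apply: eq_measure_integral => C mC _; exact: quantile_law.
Qed.

End quantile.

Section gaussian_noise.
Context {R : realType}.
Local Notation mR := (measurableTypeR R).
Local Notation U := (@unif01 R).

(** Splitting off the odd digits again and again yields infinitely many independent uniform
    variables from a single one; the quantile function makes them standard normal. *)
Definition noise (j : nat) (x : mR) : R :=
  quantile (normal_prob 0 1) (odd_digits (iter j even_digits x)).

Lemma measurable_noise j : measurable_fun (setT : set mR) (noise j).
Proof.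
have mi : measurable_fun (setT : set mR) (iter j even_digits : mR -> mR).
  elim: j => [|j IH]; first exact: measurable_id.
  exact: (measurableT_comp (@measurable_even_digits R) IH).
apply: (measurableT_comp (@measurable_quantile R _)).
exact: (measurableT_comp (@measurable_odd_digits R) mi).
Qed.

Lemma measurable_noise_comb L (c : nat -> R) :
  measurable_fun (setT : set mR) (fun x => \sum_(j < L) c j * noise j x).
Proof.
by apply: measurable_sum => j; apply: measurable_funM => //; exact: measurable_noise.
Qed.

(** The noise 0 depends on the odd digits and all others on the even ones. Decoupling them gives an
    induction on [L] with shifted coefficients. *)
Lemma noise_mgf L (c : nat -> R) :
  (\int[U]_x (expR (\sum_(j < L) c j * noise j x))%:E =
   (expR (\sum_(j < L) c j ^+ 2 / 2))%:E)%E.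
Proof.
elim: L c => [|L IH] c.
  under eq_integral do rewrite big_ord0.
  by rewrite big_ord0 expR0 integral_cst// mul1e [LHS](@probability_setT _ _ _ U).
pose f (z : R) := expR (c 0%N * quantile (normal_prob 0 1) z).
pose g (z : R) := expR (\sum_(j < L) c j.+1 * noise j z).
have mf : measurable_fun (setT : set R) f.
  apply: measurable_expR_comp; apply: measurable_funM => //; exact: measurable_quantile.
have mg : measurable_fun (setT : set R) g.
  by apply: measurable_expR_comp; exact: (measurable_noise_comb L (c \o S)).
transitivity (\int[U]_x (f (odd_digits x) * g (even_digits x))%:E)%E.
  apply: eq_integral => x _; rewrite /f /g -expRD big_ord_recl/=; congr (expR (_ + _))%:E.
  by apply: eq_bigr => j _; rewrite (_ : bump 0 j = j.+1)// /noise iterSr.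
have := @decoupleM _ _ _ mR R R R U odd_digits even_digits (@measurable_odd_digits R)
  (@measurable_even_digits R) (@digits_indep R) f g mf mg (fun=> expR_ge0 _) (fun=> expR_ge0 _).
move=> ->.
rewrite (@integral_preserving R odd_digits (fun x => (f x)%:E)); last 4 first.
- exact: measurable_odd_digits.
- exact: odd_digits_law.
- exact/measurable_EFinP.
- by move=> x; rewrite lee_fin expR_ge0.
rewrite (@integral_preserving R even_digits (fun x => (g x)%:E)); last 4 first.
- exact: measurable_even_digits.
- exact: even_digits_law.
- exact/measurable_EFinP.
- by move=> x; rewrite lee_fin expR_ge0.
rewrite /g (IH (c \o S)) /f.
rewrite (@integral_quantile R (normal_prob 0 1) (fun y => (expR (c 0%N * y))%:E)); last 2 first.
- by apply/measurable_EFinP; apply: measurable_expR_comp; exact: measurable_funM.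
- by move=> x; rewrite lee_fin expR_ge0.
rewrite integral_normal_expR ?oner_neq0// -EFinM -expRD big_ord_recl/=.
by rewrite mulr0 add0r expr1n mul1r.
Qed.

End gaussian_noise.

(** * Gaussian laws recognised by their moment generating functions *)

Section gaussian_mgf.
Context {d : measure_display} {T : measurableType d} {R : realType}.
Variable P : probability T R.
Local Notation mR := (measurableTypeR R).

Lemma law_of_mgf (X : T -> R) (N : probability mR R) (F : R -> R) :
  measurable_fun setT X ->
  (forall t, (\int[P]_w (expR (t * X w))%:E = (F t)%:E)%E) ->
  (forall t, (\int[N]_x (expR (t * x))%:E = (F t)%:E)%E) ->
  forall B : set R, measurable B -> P (X @^-1` B) = N B.
Proof.
move=> mX hX hN.
have dot1 (a x : 'rV[R]_1) : dotr a x = a 0 0 * x 0 0 by rewrite /dotr big_ord1.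
have XP : exp_integrable P (fun w => \row_(i < 1) X w).
  split => [i|a]; first by under eq_fun do rewrite mxE.
  under eq_fun do rewrite dot1 mxE.
  apply/integrableP; split.
    by apply/measurable_EFinP; apply: measurable_expR_comp; exact: measurable_funM.
  under eq_integral do rewrite gee0_abs ?lee_fin ?expR_ge0//.
  by rewrite hX ltry.
have ZN : exp_integrable N (fun x : mR => \row_(i < 1) (x : R)).
  split => [i|a]; first by under eq_fun do rewrite mxE; exact: measurable_id.
  under eq_fun do rewrite dot1 mxE.
  apply/integrableP; split.
    apply/measurable_EFinP; apply: measurable_expR_comp; apply: measurable_funM => //.
  under eq_integral do rewrite gee0_abs ?lee_fin ?expR_ge0//.
  by rewrite hN ltry.
apply: law_rays => // x.
have := open_box_prob_eq XP ZN _ (\row_(i < 1) x).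
have E (S : Type) (Y : S -> R) : (fun w => \row_(i < 1) Y w) @^-1` open_box (\row_(i < 1) x)
    = Y @^-1` `]-oo, x[.
  apply/seteqP; split => w /=; rewrite in_itv/=.
    by move=> /(_ 0); rewrite !mxE.
  by move=> h i; rewrite !mxE.
rewrite (E T X) (E mR idfun) => -> // a.
rewrite /mean /Rintegral.
under eq_integral do rewrite dot1 mxE.
under [in RHS]eq_integral do rewrite dot1 mxE.
by rewrite hX hN.
Qed.

Variables (X : T -> R) (v : R).
Hypothesis mX : measurable_fun setT X.
Hypothesis Xmgf : forall t, (\int[P]_w (expR (t * X w))%:E = (expR (t ^+ 2 * v / 2))%:E)%E.

Lemma mgf_integrable t : P.-integrable setT (fun w => (expR (t * X w))%:E).
Proof.
apply/integrableP; split.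
  by apply/measurable_EFinP; apply: measurable_expR_comp; exact: measurable_funM.
under eq_integral do rewrite gee0_abs ?lee_fin ?expR_ge0//.
by rewrite Xmgf ltry.
Qed.

Lemma Rintegral_of_mgf t : \int[P]_w (expR (t * X w)) = expR (t ^+ 2 * v / 2).
Proof. by rewrite /Rintegral Xmgf. Qed.

Lemma expR_abs_le (t y : R) : 0 <= t -> expR (t * `|y|) <= expR (t * y) + expR (- t * y).
Proof.
move=> t0; have [y0|y0] := leP 0 y.
  by rewrite (ger0_norm y0) lerDl expR_ge0.
by rewrite (ltr0_norm y0) mulrN mulNr lerDr expR_ge0.
Qed.

Lemma exp_abs_integrable t : 0 <= t -> P.-integrable setT (fun w => (expR (t * `|X w|))%:E).
Proof.
move=> t0; have i := integrableD measurableT (mgf_integrable t) (mgf_integrable (- t)).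
apply: le_integrable i => //.
  apply/measurable_EFinP; apply: measurable_expR_comp; apply: measurable_funM => //.
  exact: measurableT_comp.
move=> w _ /=; rewrite lee_fin ger0_norm ?expR_ge0//.
by apply: le_trans (ler_norm _); exact: expR_abs_le.
Qed.

Lemma dominated_integrable (f : T -> R) C t : measurable_fun setT f -> 0 <= t ->
  (forall w, `|f w| <= C * expR (t * `|X w|)) -> P.-integrable setT (EFin \o f).
Proof.
move=> mf t0 hf; have i := integrableZl _ C (exp_abs_integrable t0).
apply: le_integrable (i measurableT) => //; first exact/measurable_EFinP.
by move=> w _ /=; rewrite lee_fin; apply: le_trans (hf w) (ler_norm _).
Qed.

Lemma integrable_of_mgf : P.-integrable setT (EFin \o X).
Proof.
apply: (@dominated_integrable _ 1 1) => // w; rewrite !mul1r.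
by apply: le_trans (expR_ge1Dx _); rewrite lerDr.
Qed.

Lemma sqr_integrable_of_mgf : P.-integrable setT (EFin \o (fun w => X w ^+ 2)).
Proof.
apply: (@dominated_integrable _ 2 1) => //; first exact: measurable_funX.
move=> w; rewrite mul1r normrX; have := @exp_term_le R 2 _ (normr_ge0 (X w)).
by rewrite (_ : 2`! = 2)%N// ler_pdivrMr// mulrC.
Qed.

(** So far [v] is a mere parameter; the bound E(e^X + e^-X) >= 2 excludes negative values. *)
Lemma gaussian_variance_ge0 : 0 <= v.
Proof.
have h : 2 <= expR (1 ^+ 2 * v / 2) + expR ((-1) ^+ 2 * v / 2).
  rewrite -!Rintegral_of_mgf -RintegralD//; [|exact: mgf_integrable..].
  rewrite -(Rintegral_prob_cst P 2); apply: le_Rintegral => //.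
  - by apply: (@bounded_integrable _ _ _ _ _ 2) => // w; rewrite normr_nat.
  - exact: (integrableD measurableT (mgf_integrable _) (mgf_integrable _)).
  - move=> w _; apply: le_trans (lerD (expR_ge1Dx _) (expR_ge1Dx _)); lra.
move: h; rewrite sqrrN expr1n mul1r => h.
have : 1 <= expR (v / 2) by lra.
rewrite -{1}(@expR0 R) ler_expR => ?; lra.
Qed.

(** The case [v = 0] is separate because the law is then the point mass at 0. *)
Lemma gaussian_has_law : has_law P X (gaussian_law 0 (Num.sqrt v)).
Proof.
split => // B mB; rewrite /gaussian_law.
have v0 := gaussian_variance_ge0.
case: ifPn => [|s0].
  rewrite sqrtr_eq0 => v0'.
  have {v0'}v0 : v = 0 by apply/eqP; rewrite eq_le v0 v0'.
  apply: (@law_of_mgf X (\d_(0 : mR)) (fun=> 1)) => // t.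
    by rewrite Xmgf v0 mulr0 mul0r expR0.
  rewrite integral_dirac//; last first.
    by apply/measurable_EFinP; apply: measurable_expR_comp; exact: measurable_funM.
  by rewrite diracT mul1e mulr0 expR0.
apply: (@law_of_mgf X (normal_prob 0 (Num.sqrt v)) (fun t => expR (t ^+ 2 * v / 2))) => // t.
by rewrite integral_normal_expR// mulr0 add0r sqr_sqrtr// [v * _]mulrC.
Qed.

(** From 1 + t X <= e^(t X) follows t E X <= e^(t^2 v / 2) - 1 = O(t^2) for both signs of t; it
    remains to divide by t and let it tend to 0. *)
Lemma gaussian_mean0 : \int[P]_w X w = 0.
Proof.
have v0 := gaussian_variance_ge0.
have key t : t * \int[P]_w X w <= t ^+ 2 * (v / 2 * expR (t ^+ 2 * (v / 2))).
  have h : 1 + t * \int[P]_w X w <= expR (t ^+ 2 * v / 2).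
    rewrite -Rintegral_of_mgf -RintegralZl//; last exact: integrable_of_mgf.
    have itX : P.-integrable setT (EFin \o (fun w => t * X w)).
      exact: (integrableZl measurableT t integrable_of_mgf).
    have i1 : P.-integrable setT (EFin \o (fun=> 1 : R)).
      by apply: (@bounded_integrable _ _ _ _ _ 1) => // w; rewrite normr1.
    rewrite -{1}(Rintegral_prob_cst P 1) -RintegralD//.
    apply: le_Rintegral => //.
    - exact: (integrableD measurableT i1 itX).
    - exact: mgf_integrable.
    - by move=> w _; exact: expR_ge1Dx.
  have := expR_taylor1 (t ^+ 2 * (v / 2)).
  have tv : 0 <= t ^+ 2 * (v / 2) by rewrite mulr_ge0 ?sqr_ge0 ?divr_ge0.
  rewrite [`|_ - 1|]ger0_norm; last first.
    by rewrite subr_ge0; apply: le_trans (expR_ge1Dx _); rewrite lerDl.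
  rewrite (ger0_norm tv) -[in X in _ <= X]mulrA.
  move: h; rewrite -mulrA; lra.
have bound t : 0 < t <= 1 -> `|\int[P]_w X w| <= t * (v / 2 * expR (v / 2)).
  move=> /andP[t0 t1].
  have e1 : expR (t ^+ 2 * (v / 2)) <= expR (v / 2).
    by rewrite ler_expR ler_piMl ?divr_ge0// exprn_ile1// ltW.
  have e2 : t ^+ 2 * (v / 2 * expR (t ^+ 2 * (v / 2))) <= t * (t * (v / 2 * expR (v / 2))).
    rewrite [leRHS]mulrA -expr2 ler_wpM2l ?sqr_ge0//.
    by rewrite ler_wpM2l ?divr_ge0.
  rewrite ler_norml; apply/andP; split.
    have := le_trans (key (- t)) _; rewrite sqrrN => /(_ _ e2).
    by rewrite mulNr -mulrN ler_pM2l// lerNl.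
  by have := le_trans (key t) e2; rewrite ler_pM2l.
have cv : n.+1%:R^-1 * (v / 2 * expR (v / 2)) @[n --> \oo] --> 0 * (v / 2 * expR (v / 2)).
  by apply: cvgM; [exact: cvg_harmonic|exact: cvg_cst].
rewrite mul0r in cv; apply/eqP; rewrite -normr_le0.
apply: (cvgr_to_ge cv); apply: nearW => n; apply: bound.
by rewrite invr_gt0 ltr0n/= invf_le1// ler1n.
Qed.

(** The second difference e^(t X) + e^(- t X) - 2 has mean 2 (e^(t^2 v / 2) - 1) and differs from
    t^2 X^2 by O(t^3) in mean; division by t^2 gives the limit. *)
Lemma gaussian_second_moment : \int[P]_w (X w ^+ 2) = v.
Proof.
have v0 := gaussian_variance_ge0.
pose D := 2 * \int[P]_w (`|X w| ^+ 3 * expR `|X w|).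
have iD : P.-integrable setT (EFin \o (fun w => `|X w| ^+ 3 * expR `|X w|)).
  apply: (@dominated_integrable _ 6 2) => //.
    apply: measurable_funM; first by apply: measurable_funX; exact: measurableT_comp.
    by apply: measurable_expR_comp; exact: measurableT_comp.
  move=> w; rewrite ger0_norm ?mulr_ge0 ?exprn_ge0 ?expR_ge0//.
  have := @exp_term_le R 3 _ (normr_ge0 (X w)).
  rewrite (_ : 3`! = 6)%N// ler_pdivrMr// mulrC => h.
  apply: le_trans (ler_wpM2r (expR_ge0 _) h) _.
  have -> : 2 * `|X w| = `|X w| + `|X w| by ring.
  by rewrite expRD mulrA.
pose C := D + v ^+ 2 * expR v.
have bound t : 0 < t <= 1 -> `|\int[P]_w (X w ^+ 2) - v| <= t * C.
  move=> /andP[t0 t1].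
  have t20 : 0 < t ^+ 2 by rewrite exprn_gt0.
  have t21 : t ^+ 2 <= 1 by rewrite exprn_ile1// ltW.
  have h1 : `|t ^+ 2 * \int[P]_w (X w ^+ 2) - 2 * (expR (t ^+ 2 * v / 2) - 1)| <= t ^+ 3 * D.
    have -> : 2 * (expR (t ^+ 2 * v / 2) - 1) =
        expR (t ^+ 2 * v / 2) + expR ((- t) ^+ 2 * v / 2) - 2 by rewrite sqrrN; ring.
    have i2 : P.-integrable setT (EFin \o (fun=> 2 : R)).
      by apply: (@bounded_integrable _ _ _ _ _ 2) => // w; rewrite normr_nat.
    have iE : P.-integrable setT (EFin \o (fun w => expR (t * X w) + expR (- t * X w))).
      exact: (integrableD measurableT (mgf_integrable t) (mgf_integrable (- t))).
    have iE2 : P.-integrable setT (EFin \o (fun w => expR (t * X w) + expR (- t * X w) - 2)).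
      exact: (integrableB measurableT iE i2).
    have it2 : P.-integrable setT (EFin \o (fun w => t ^+ 2 * X w ^+ 2)).
      exact: (integrableZl measurableT (t ^+ 2) sqr_integrable_of_mgf).
    rewrite -!Rintegral_of_mgf -RintegralD//; [|exact: mgf_integrable..].
    rewrite -(Rintegral_prob_cst P 2) -RintegralB//.
    rewrite -RintegralZl//; last exact: sqr_integrable_of_mgf.
    rewrite -RintegralB//.
    have iB : P.-integrable setT (EFin \o (fun w => t ^+ 2 * X w ^+ 2 -
       (expR (t * X w) + expR (- t * X w) - 2))) by exact: (integrableB measurableT it2 iE2).
    apply: le_trans (le_normr_Rintegral _ iB) _ => //.
    have -> : t ^+ 3 * D = \int[P]_w (2 * (t ^+ 3 * (`|X w| ^+ 3 * expR `|X w|))).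
      rewrite RintegralZl//; last exact: (integrableZl measurableT (t ^+ 3) iD).
      by rewrite RintegralZl// /D; ring.
    apply: le_Rintegral => //.
    - exact: (integrable_norm iB).
    - have i3 := integrableZl measurableT 2 (integrableZl measurableT (t ^+ 3) iD).
      exact: i3.
    - move=> w _.
      have -> : t ^+ 2 * X w ^+ 2 - (expR (t * X w) + expR (- t * X w) - 2) =
        - ((expR (t * X w) - (1 + t * X w + (t * X w) ^+ 2 / 2)) +
           (expR (- t * X w) - (1 + - t * X w + (- t * X w) ^+ 2 / 2))).
        by field.
      rewrite normrN; apply: le_trans (ler_normD _ _) _.
      apply: le_trans (lerD (expR_taylor3 _) (expR_taylor3 _)) _.
      have n1 : `|t * X w| = t * `|X w| by rewrite normrM (gtr0_norm t0).
      have n2 : `|- t * X w| = t * `|X w| by rewrite mulNr normrN.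
      rewrite n1 n2 -mulr2n -[leLHS]mulr_natl ler_pM2l// exprMn -mulrA.
      rewrite ler_wpM2l ?exprn_ge0 ?(ltW t0)// ler_wpM2l ?exprn_ge0// ler_expR.
      by rewrite ler_piMl.
  have h2 : `|2 * (expR (t ^+ 2 * v / 2) - 1) - t ^+ 2 * v| <= t ^+ 3 * (v ^+ 2 * expR v).
    have := expR_taylor2 (t ^+ 2 * v / 2).
    have tv0 : 0 <= t ^+ 2 * v / 2.
      by apply: divr_ge0 => //; apply: mulr_ge0 => //; exact: sqr_ge0.
    rewrite (ger0_norm tv0) => h.
    have -> : 2 * (expR (t ^+ 2 * v / 2) - 1) - t ^+ 2 * v =
      2 * (expR (t ^+ 2 * v / 2) - (1 + t ^+ 2 * v / 2)) by field.
    rewrite normrM normr_nat; apply: le_trans (ler_wpM2l _ h) _ => //.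
    apply: le_trans (_ : 2 * ((t ^+ 2 * v / 2) ^+ 2 * expR v) <= _).
      rewrite ler_pM2l// ler_wpM2l ?sqr_ge0// ler_expR -mulrA.
      apply: le_trans (_ : 1 * (v / 2) <= _); last by rewrite mul1r; lra.
      by rewrite ler_wpM2r// divr_ge0.
    have -> : 2 * ((t ^+ 2 * v / 2) ^+ 2 * expR v) =
      t ^+ 3 * (t / 2) * (v ^+ 2 * expR v) by field.
    rewrite ler_wpM2r ?mulr_ge0 ?sqr_ge0 ?expR_ge0//.
    by rewrite ler_piMr ?exprn_ge0 ?(ltW t0)//; lra.
  rewrite -(ler_pM2l t20) -{1}(gtr0_norm t20) -normrM.
  have -> : t ^+ 2 * (\int[P]_w (X w ^+ 2) - v) =
    (t ^+ 2 * \int[P]_w (X w ^+ 2) - 2 * (expR (t ^+ 2 * v / 2) - 1)) +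
    (2 * (expR (t ^+ 2 * v / 2) - 1) - t ^+ 2 * v) by ring.
  apply: le_trans (ler_normD _ _) _; apply: le_trans (lerD h1 h2) _.
  by rewrite /C -mulrDr [leRHS]mulrA -exprSr.
have cv : n.+1%:R^-1 * C @[n --> \oo] --> 0 * C.
  by apply: cvgM; [exact: cvg_harmonic|exact: cvg_cst].
rewrite mul0r in cv; apply/eqP; rewrite -subr_eq0 -normr_le0.
apply: (cvgr_to_ge cv); apply: nearW => n; apply: bound.
by rewrite invr_gt0 ltr0n/= invf_le1// ler1n.
Qed.

End gaussian_mgf.

Section gaussian_sequence_of_mgf.
Context {d : measure_display} {T : measurableType d} {R : realType}.
Variables (P : probability T R) (Z : nat -> T -> R) (Sigma : nat -> nat -> R).
Hypothesis mZ : forall i, measurable_fun setT (Z i).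
Hypothesis SigmaC : forall i j, Sigma i j = Sigma j i.

Definition quad k (a : 'I_k -> R) : R := \sum_(i < k) \sum_(j < k) a i * a j * Sigma i j.

Hypothesis Zmgf : forall k (a : 'I_k -> R),
  (\int[P]_w (expR (\sum_(i < k) a i * Z i w))%:E = (expR (quad a / 2))%:E)%E.

Lemma combination_mgf k (a : 'I_k -> R) t :
  (\int[P]_w (expR (t * \sum_(i < k) a i * Z i w))%:E = (expR (t ^+ 2 * quad a / 2))%:E)%E.
Proof.
under eq_integral do rewrite mulr_sumr.
under eq_integral do under eq_bigr do rewrite mulrA.
rewrite (Zmgf (fun i => t * a i)); congr (expR (_ / 2))%:E.
rewrite /quad mulr_sumr; apply: eq_bigr => i _.
by rewrite mulr_sumr; apply: eq_bigr => j _; ring.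
Qed.

Lemma measurable_combination k (a : 'I_k -> R) :
  measurable_fun setT (fun w => \sum_(i < k) a i * Z i w).
Proof. by apply: measurable_sum => i; exact: measurable_funM. Qed.

Lemma sum_delta (k i : nat) (F : nat -> R) : (i < k)%N ->
  \sum_(l < k) (nat_of_ord l == i)%:R * F l = F i.
Proof.
move=> ik; rewrite (bigD1 (Ordinal ik))//= eqxx mul1r big1 ?addr0// => l.
by rewrite -val_eqE/= => /negPf ->; rewrite mul0r.
Qed.

Lemma coordinate_mgf i t : (\int[P]_w (expR (t * Z i w))%:E = (expR (t ^+ 2 * Sigma i i / 2))%:E)%E.
Proof.
have := @combination_mgf i.+1 (fun l => (nat_of_ord l == i)%:R) t.
under eq_integral do rewrite (sum_delta (Z^~ _))//.
move=> ->; congr (expR (_ * _ / 2))%:E; rewrite /quad.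
under eq_bigr do under eq_bigr do rewrite -mulrA.
under eq_bigr do rewrite -mulr_sumr (sum_delta (fun l => Sigma _ l))//.
by rewrite (sum_delta (fun l => Sigma l i)).
Qed.

Lemma coordinate_sum_mgf i j t : (\int[P]_w (expR (t * (Z i w + Z j w)))%:E =
  (expR (t ^+ 2 * (Sigma i i + 2 * Sigma i j + Sigma j j) / 2))%:E)%E.
Proof.
pose k := (maxn i j).+1.
have ik : (i < k)%N by rewrite ltnS leq_maxl.
have jk : (j < k)%N by rewrite ltnS leq_maxr.
pose a (l : 'I_k) : R := (nat_of_ord l == i)%:R + (nat_of_ord l == j)%:R.
have sa (F : nat -> R) : \sum_(l < k) a l * F l = F i + F j.
  under eq_bigr do rewrite mulrDl.
  by rewrite big_split/= !sum_delta.
have := combination_mgf a t.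
under eq_integral do rewrite (sa (Z^~ _)).
move=> ->; congr (expR (_ * _ / 2))%:E; rewrite /quad.
under eq_bigr do under eq_bigr do rewrite -mulrA.
under eq_bigr do rewrite -mulr_sumr (sa (fun l => Sigma _ l)).
by rewrite (sa (fun l => Sigma l i + Sigma l j)) (SigmaC j i); ring.
Qed.

(** Covariances come from polarisation: the variance of [Z i + Z j] is read off its moment
    generating function. *)
Lemma centred_gaussian_sequence_of_mgf : centred_gaussian_sequence P Sigma Z.
Proof.
have E0 i : ('E_P[Z i] = 0)%E.
  rewrite unlock -[LHS]fineK; last first.
    by apply: integrable_fin_num => //; exact: integrable_of_mgf (mZ i) (coordinate_mgf i).
  by have := gaussian_mean0 (mZ i) (coordinate_mgf i); rewrite /Rintegral => ->.
split => //.
  move=> k a; exists 0, (Num.sqrt (quad a)).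
  exact: (gaussian_has_law (measurable_combination a) (combination_mgf a)).
move=> i j.
have mD : measurable_fun setT (fun w => Z i w + Z j w) by exact: measurable_funD.
have i2 l := sqr_integrable_of_mgf (mZ l) (coordinate_mgf l).
have iD2 := sqr_integrable_of_mgf mD (coordinate_sum_mgf i j).
have sD := gaussian_second_moment mD (coordinate_sum_mgf i j).
have iB : P.-integrable setT (EFin \o (fun w => (Z i w + Z j w) ^+ 2 - Z i w ^+ 2)).
  exact: (integrableB measurableT iD2 (i2 i)).
have iC : P.-integrable setT (EFin \o (fun w => (Z i w + Z j w) ^+ 2 - Z i w ^+ 2 - Z j w ^+ 2)).
  exact: (integrableB measurableT iB (i2 j)).
rewrite unlock !E0/= unlock.
transitivity (\int[P]_w (2^-1 * ((Z i w + Z j w) ^+ 2 - Z i w ^+ 2 - Z j w ^+ 2))%:E)%E.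
  apply: eq_integral => w _; rewrite -[LHS]/(((Z i w - 0) * (Z j w - 0))%:E).
  by congr EFin; field.
rewrite -[LHS]fineK; last first.
  apply: integrable_fin_num => //; exact: (integrableZl measurableT 2^-1 iC).
congr (_%:E); rewrite -/(Rintegral _ _ _) RintegralZl// RintegralB// RintegralB//.
by rewrite sD !(gaussian_second_moment (mZ _) (coordinate_mgf _)); field.
Qed.

End gaussian_sequence_of_mgf.

Section limit_sequence.
Context {R : realType}.
Local Notation mR := (measurableTypeR R).
Local Notation U := (@unif01 R).
Variables p m1 : R.
Hypotheses (p0 : 0 <= p) (m10 : 0 <= m1).

(** The noise 0, shared by all coordinates, produces the rank-one part of the covariance; a noise
    proper to each coordinate produces the diagonal part. *)
Definition limit_sequence (j : nat) (x : mR) : R :=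
  Num.sqrt p / j.+1%:R * noise 0 x + Num.sqrt (j.+1%:R * m1)^-1 * noise j.+1 x.

Definition limit_sigma (i j : nat) : R :=
  p * (i.+1 * j.+1)%:R^-1 + (i.+1 == j.+1)%:R * (j.+1%:R * m1)^-1.

Lemma measurable_limit_sequence j : measurable_fun (setT : set mR) (limit_sequence j).
Proof.
by apply: measurable_funD; apply: measurable_funM => //; exact: measurable_noise.
Qed.

Lemma limit_sigmaC i j : limit_sigma i j = limit_sigma j i.
Proof.
rewrite /limit_sigma mulnC (eq_sym i.+1).
by have [->|] := eqVneq j.+1 i.+1; rewrite ?mul0r.
Qed.

Lemma quad_limit_sigma k (a : 'I_k -> R) : quad limit_sigma a =
  p * (\sum_(i < k) a i / i.+1%:R) ^+ 2 + \sum_(i < k) a i ^+ 2 / (i.+1%:R * m1).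
Proof.
rewrite /quad; under eq_bigr => i _.
  under eq_bigr => j _.
    rewrite /limit_sigma mulrDr.
    over.
  rewrite big_split/=.
  over.
rewrite big_split/=; congr (_ + _).
  rewrite expr2 mulr_suml mulr_sumr; apply: eq_bigr => i _.
  rewrite !mulr_sumr; apply: eq_bigr => j _.
  by rewrite natrM invfM; ring.
apply: eq_bigr => i _; rewrite (bigD1 i)//= eqxx mul1r big1 ?addr0 ?expr2// => j /negPf ji.
by rewrite eqSS eq_sym; move: ji; rewrite -val_eqE/= => ->; rewrite mul0r mulr0.
Qed.

Lemma limit_sequence_mgf k (a : 'I_k -> R) :
  (\int[U]_w (expR (\sum_(i < k) a i * limit_sequence i w))%:E =
   (expR (quad limit_sigma a / 2))%:E)%E.
Proof.
pose A := \sum_(i < k) a i / i.+1%:R.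
(* Coefficient of the noise [l]: index 0 collects the shared part, index i + 1 belongs to the
   coordinate i. The default 0 is not reached for l <= k. *)
pose c (l : nat) : R := if l is l'.+1 then
    (if insub l' is Some i then a i * Num.sqrt (l'.+1%:R * m1)^-1 else 0)
  else Num.sqrt p * A.
have cE (i : 'I_k) : c i.+1 = a i * Num.sqrt (i.+1%:R * m1)^-1.
  by rewrite /c valK.
transitivity (\int[U]_x (expR (\sum_(l < k.+1) c l * noise l x))%:E)%E.
  apply: eq_integral => x _; congr (expR _)%:E.
  have -> : \sum_(l < k.+1) c l * noise l x = Num.sqrt p * A * noise 0 x +
      \sum_(i < k) a i * Num.sqrt (i.+1%:R * m1)^-1 * noise i.+1 x.
    by rewrite big_ord_recl; congr (_ + _); apply: eq_bigr => i _; rewrite lift0 cE.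
  rewrite /A mulr_sumr mulr_suml -big_split/=.
  apply: eq_bigr => i _; rewrite /limit_sequence.
  by rewrite mulrDr !mulrA; congr (_ * _ + _); ring.
rewrite noise_mgf; congr (expR _)%:E; rewrite -mulr_suml; congr (_ / 2).
rewrite quad_limit_sigma big_ord_recl/= exprMn sqr_sqrtr//; congr (_ + _).
apply: eq_bigr => i _; rewrite [LHS](_ : _ = c i.+1 ^+ 2)// cE exprMn sqr_sqrtr//.
by rewrite invr_ge0 mulr_ge0.
Qed.

End limit_sequence.

(** * Blocks and cells *)

Section gaps.
Context {R : realType}.
Variables (s : R -> R) (n : nat) (u : 'I_n -> R).

(** Connected subsets of the line are intervals, which replaces components by a condition on the
    segment between two points. A dyadic grid can test this condition. *)
Lemma same_gapP i j : same_gap s u i j <->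
  [/\ 0 <= u i <= 1, 0 <= u j <= 1 &
      forall x, Num.min (u i) (u j) <= x <= Num.max (u i) (u j) -> ~ closed_range s x].
Proof.
set A := `[0, 1]%classic `\` closed_range s.
split.
  move=> [G [[x0 Ax0 <-] Gi Gj]].
  have GA := @connected_component_sub _ A x0.
  have /connected_intervalP iG : connected (connected_component A x0).
    exact: component_connected.
  have [hi _] := GA _ Gi; have [hj _] := GA _ Gj.
  split; [by move: hi; rewrite /= in_itv/=|by move: hj; rewrite /= in_itv/=|].
  move=> x xij; have : connected_component A x0 x; last by move=> /GA[].
  case: (leP (u i) (u j)) xij => ij h; first exact: iG Gi Gj x h.
  exact: iG Gj Gi x h.
move=> [hi hj h].
have Bij (x : R) : `[Num.min (u i) (u j), Num.max (u i) (u j)]%classic x -> A x.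
  rewrite /= in_itv/= => xij; split; last exact: h.
  move: xij => /andP[x1 x2]; rewrite /= in_itv/=.
  have /andP[i0 i1] := hi; have /andP[j0 j1] := hj.
  by rewrite (le_trans _ x1) ?le_min ?i0//= (le_trans x2)// ge_max i1.
have ui : `[Num.min (u i) (u j), Num.max (u i) (u j)]%classic (u i).
  by rewrite /= in_itv/= ge_min le_max lexx.
have uj : `[Num.min (u i) (u j), Num.max (u i) (u j)]%classic (u j).
  by rewrite /= in_itv/= ge_min le_max lexx !orbT.
exists (connected_component A (u i)); split.
- by exists (u i) => //; exact: Bij.
- by apply: (connected_component_max ui) => //; apply/connected_intervalP; exact: interval_is_interval.
- by apply: (connected_component_max ui) => //; apply/connected_intervalP; exact: interval_is_interval.
Qed.

Lemma parts_equalE r :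
  parts_equal s u r = (\sum_(B in blocks s u) (#|B| == r))%N.
Proof.
rewrite /parts_equal /composition count_map.
rewrite (permP (permEl (perm_sort _ _))) -size_filter -sum1_size big_filter big_enum_cond/=.
rewrite big_mkcondr/=; apply: eq_bigr => B _ /=.
by case: eqVneq.
Qed.

(** Empty fibres of the labelling contribute z(0) = 1. For i = j the hypothesis says that every
    point lies in a gap, so that each point has its block. *)
Lemma prod_blocks (m : nat) (c : 'I_n -> 'I_m) (z : nat -> R) : z 0%N = 1 ->
  (forall i j, `[< same_gap s u i j >] = (c i == c j)) ->
  \prod_(B in blocks s u) z #|B| = \prod_(k < m) z #|[set i | c i == k]%SET|.
Proof.
move=> z0 ec.
pose fib k : {set 'I_n} := [set i | c i == k]%SET.
have -> : blocks s u = [set fib k | k : 'I_m & fib k != finset.set0]%SET.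
  apply/setP => B; rewrite in_setD1; apply/idP/idP.
    move=> /andP[B0 /imsetP[i _ BE]]; apply/imsetP; exists (c i).
      rewrite inE; apply: contra B0 => /eqP <-; rewrite BE; apply/eqP/setP => j.
      by rewrite !inE ec eq_sym.
    by rewrite BE; apply/setP => j; rewrite !inE ec eq_sym.
  move=> /imsetP[k]; rewrite inE => k0 ->; rewrite k0/=.
  have [i] := set0Pn _ k0; rewrite inE => /eqP ci.
  apply/imsetP; exists i => //; apply/setP => j.
  by rewrite !inE ec ci eq_sym.
rewrite big_imset/=; last first.
  move=> k l; rewrite !inE => /set0Pn[i]; rewrite inE => /eqP ci _ /setP/(_ i).
  by rewrite !inE ci eqxx => /esym/eqP.
rewrite [RHS](bigID (fun k => fib k != finset.set0))/= [X in _ = _ * X]big1 ?mulr1.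
  by apply: eq_bigl => k; rewrite inE.
by move=> k; rewrite negbK => /eqP; rewrite /fib => ->; rewrite cards0.
Qed.

End gaps.

Section finite_valued.
Context {d : measure_display} {T : measurableType d} {R : realType}.

Lemma measurable_finite_valued (F : finType) (X : T -> F) (g : F -> R) :
  (forall x, measurable (X @^-1` [set x])) -> measurable_fun setT (g \o X).
Proof.
move=> mX.
have -> : g \o X = (fun w => \sum_(x : F) g x * \1_(X @^-1` [set x]) w).
  apply/funext => w /=; rewrite (bigD1 (X w))//= indicE mem_set// mulr1 big1 ?addr0//.
  move=> x xw; rewrite indicE memNset ?mulr0//= => Xx.
  by rewrite Xx eqxx in xw.
by apply: measurable_sum => x; apply: measurable_funM.
Qed.

(** Whatever is computed from finitely many measurable tests is measurable; the combinatorial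
    functionals of the composition are of this kind. *)
Lemma measurable_ffun_valued (I : finType) (X : I -> T -> bool) (g : {ffun I -> bool} -> R) :
  (forall i, measurable [set w | X i w]) ->
  measurable_fun setT (fun w => g [ffun i => X i w]).
Proof.
move=> mX; apply: (measurable_finite_valued (X := fun w => [ffun i => X i w])) => x.
rewrite (_ : _ @^-1` _ = \bigcap_(i in [set: I])
  (if x i then [set w | X i w] else ~` [set w | X i w])).
  apply: fin_bigcap_measurable; first exact: finite_finset.
  by move=> i _; case: ifP => _ //; exact: measurableC.
apply/seteqP; split => w /=.
  by move=> <- i _; rewrite ffunE; case: ifP => //= /negP.
move=> h; apply/ffunP => i; rewrite ffunE; have := h i Logic.I.
by case: (x i) => //= /negP/negbTE.
Qed.

End finite_valued.

Section grid.
Context {R : realType}.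

Definition grid (N k : nat) : R := k%:R / 2 ^+ N.

Lemma grid_ge0 N k : 0 <= grid N k.
Proof. by rewrite divr_ge0// exprn_ge0. Qed.

Lemma grid_scale N m k : grid (N + m) (k * 2 ^ m) = grid N k.
Proof.
rewrite /grid exprD natrM natrX.
by rewrite invfM mulrACA divff ?mulr1// expf_neq0// pnatr_eq0.
Qed.

Lemma grid_mono N k l : (k <= l)%N -> grid N k <= grid N l.
Proof. by move=> kl; rewrite ler_pM2r ?invr_gt0 ?exprn_gt0// ler_nat. Qed.

Lemma grid_dense (t e : R) : 0 <= t -> 0 < e -> exists N k, t < grid N k < t + e.
Proof.
move=> t0 e0.
have [N hN] : exists N : nat, (2 ^+ N)^-1 < e.
  have : 2 ^- n @[n --> \oo] --> (0 : R).
    under eq_fun do rewrite -exprVn.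
    by apply: cvg_expr; rewrite ger0_norm ?invr_ge0// invf_lt1// ltr1n.
  move=> /cvgr0_norm_lt/(_ _ e0)[N _ /(_ N (leqnn N))].
  by rewrite ger0_norm ?invr_ge0 ?exprn_ge0//; exists N.
have p0 : 0 < 2 ^+ N :> R by rewrite exprn_gt0.
exists N, (Num.truncn (t * 2 ^+ N)).+1; rewrite /grid.
have := @truncn_itv R (t * 2 ^+ N); rewrite mulr_ge0 ?(ltW p0)// => /(_ isT)/andP[h1 h2].
rewrite ltr_pdivlMr// h2/= ltr_pdivrMr// mulrDl.
apply: le_lt_trans (_ : t * 2 ^+ N + 1 < _); first by rewrite -natr1 lerD2r.
rewrite ltrD2l; move: hN; rewrite -ltr_pdivrMr ?invr_gt0//.
by rewrite div1r.
Qed.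

End grid.

Section paths.
Context {R : realType}.
Variable s : R -> R.
Hypothesis s_mono : forall a b, 0 <= a -> a <= b -> s a <= s b.
Hypothesis s_rc : forall t, 0 <= t -> s x @[x --> t^'+] --> s t.

Definition frag (t : R) : R := 1 - expR (- s t).

Lemma frag_mono a b : 0 <= a -> a <= b -> frag a <= frag b.
Proof. by move=> a0 ab; rewrite lerD2l lerN2 ler_expR lerN2 s_mono. Qed.

Lemma frag_rc t : 0 <= t -> frag x @[x --> t^'+] --> frag t.
Proof.
move=> t0; apply: cvgB; first exact: cvg_cst.
apply: (@cvg_comp _ _ _ (fun x => - s x) expR _ (nbhs (- s t))).
  by apply: cvgN; exact: s_rc.
exact: continuous_expR.
Qed.

(** By right-continuity and monotonicity, dyadic times shortly after [t] have values barely above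
    [frag t], if at all. *)
Lemma frag_grid (t a b : R) : 0 <= t -> a < frag t < b ->
  exists N k, [/\ (0 < k)%N, t < grid N k & a < frag (grid N k) < b].
Proof.
move=> t0 /andP[at_ tb].
have : \forall x \near t^'+, frag x < b by exact: cvgr_lt (frag_rc t0) _ tb.
rewrite near_withinE -nbhs_ballE => -[e /= e0 he].
have [N [k /andP[h1 h2]]] := grid_dense t0 e0.
exists N, k; split => //.
  by rewrite lt0n; apply/eqP => k0; move: h1; rewrite k0 /grid mul0r ltNge t0.
apply/andP; split; first by apply: lt_le_trans at_ _; apply: frag_mono => //; exact: ltW.
apply: he => //=; rewrite /ball/= distrC ger0_norm ?subr_ge0 ?ltW// ltrBlDl//.
Qed.

Lemma closed_rangeP x : closed_range s x <->
  forall e, 0 < e -> exists t, 0 <= t /\ x - e < frag t < x + e.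
Proof.
split.
  move=> /(_ (ball x _)) h e e0; have [y [[t]]] := h _ (nbhsx_ballx x e e0).
  rewrite /= in_itv/= andbT => t0 <-; rewrite /ball/= => he; exists t; split => //.
  by move: he; rewrite distrC ltr_distl.
move=> h B; rewrite -nbhs_ballE => -[e /= e0 eB].
have [t [t0 ht]] := h e e0; exists (frag t); split.
  by exists t => //=; rewrite in_itv/= t0.
by apply: eB; rewrite /ball/= distrC ltr_distl.
Qed.

(** Compactness of [a, b] upgrades avoidance of a closed set to a positive distance, and
    right-continuity restricts the times to dyadic ones. Only countable operations remain, as
    measurability requires. *)
Lemma avoidP (a b : R) : (forall x, a <= x <= b -> ~ closed_range s x) <->
  (b < a \/ exists m : nat, forall N k, ~ (a - m.+1%:R^-1 < frag (grid N k) < b + m.+1%:R^-1)).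
Proof.
split; last first.
  move=> [ba x /andP[ax xb]|[m h] x /andP[ax xb]].
    by move: (le_lt_trans xb ba); rewrite ltNge ax.
  have e0 : 0 < m.+1%:R^-1 :> R by rewrite invr_gt0.
  move=> /closed_rangeP/(_ _ e0)[t [t0 /andP[h1 h2]]].
  have : a - m.+1%:R^-1 < frag t < b + m.+1%:R^-1.
    by apply/andP; split; [apply: le_lt_trans h1|apply: lt_le_trans h2 _]; rewrite lerD2r.
  by move=> /(frag_grid t0)[N [k [_ _]]]; exact: h.
move=> h; have [ab|ba] := leP a b; [right|by left].
have K : compact `[a, b]%classic by exact: segment_compact.
move/compact_near_coveringP: K => /(_ nat \oo
  (fun m x => forall t, 0 <= t -> ~ (x - m.+1%:R^-1 < frag t < x + m.+1%:R^-1))).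
move=> /(_ _ _)[x|m _ hm].
  rewrite /= in_itv/= => xab; have := h x xab.
  move=> nx; have : exists2 e, 0 < e & forall t, 0 <= t -> ~ (x - e < frag t < x + e).
    apply: contrapT => /forall2NP nh; apply: nx; apply/closed_rangeP => e e0.
    have [//|/existsNP[t]] := nh e.
    by move=> /not_implyP[t0 /contrapT ht]; exists t.
  move=> [e e0 he]; have e20 : 0 < e / 2 by rewrite divr_gt0.
  exists (ball x (e / 2), [set m | m.+1%:R^-1 < e / 2]).
    split; first exact: (nbhsx_ballx x _ e20).
    have := @cvg_harmonic R; move=> /cvgr0_norm_lt/(_ _ e20).
    by apply: filterS => m /=; rewrite ger0_norm.
  move=> [y m] /= [xy me] t t0 /andP[h1 h2]; apply: (he t t0).
  move: xy; rewrite /ball/= ltr_distl => /andP[h3 h4].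
  move: (frag t) (m.+1%:R^-1 : R) me h1 h2 => f c me h1 h2.
  by apply/andP; split; lra.
exists m => N k /andP[h1 h2]; pose f := frag (grid N k).
have /= := hm m (leqnn m).
have e0 : 0 < m.+1%:R^-1 :> R by rewrite invr_gt0.
have [fa|fa] := ltP f a.
  move=> /(_ a); rewrite /= in_itv/= lexx ab => /(_ isT _ (grid_ge0 N k)); apply.
  by rewrite h1/= (lt_trans fa)// ltrDl.
have [fb|fb] := ltP b f.
  move=> /(_ b); rewrite /= in_itv/= lexx ab => /(_ isT _ (grid_ge0 N k)); apply.
  by rewrite h2 andbT; apply: lt_trans fb; rewrite gtrBl.
move=> /(_ f); rewrite /= in_itv/= fa fb => /(_ isT _ (grid_ge0 N k)); apply.
by rewrite gtrBl e0/= ltrDl.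
Qed.

(** Index of the cell of [x] when the unit interval is cut at the values of the path at the grid
    points 1, ..., 4^N. The last of them is the time 2^N: the mesh shrinks and the horizon grows
    with [N]. *)
Definition cell (N : nat) (x : R) : nat :=
  \sum_(1 <= k < (4 ^ N).+1) (frag (grid N k) < x)%R.

Lemma cell_le N x : (cell N x <= 4 ^ N)%N.
Proof.
rewrite /cell; apply: (leq_trans (_ : _ <= \sum_(1 <= k < (4 ^ N).+1) 1)%N).
  by apply: leq_sum => k _; case: (_ < _).
by rewrite sum_nat_const_nat muln1 subn1.
Qed.

(** Termwise ordered sums of indicators can agree only if all their terms do. *)
Lemma cell_eq N x y : x <= y -> cell N x = cell N y ->
  forall k, (0 < k <= 4 ^ N)%N -> (frag (grid N k) < x) = (frag (grid N k) < y).
Proof.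
move=> xy; rewrite /cell => E k /andP[k0 k4].
have le l : ((frag (grid N l) < x)%R <= (frag (grid N l) < y)%R)%N.
  by case: (ltP (frag (grid N l)) x) => // h; rewrite (lt_le_trans h xy).
move: E; rewrite (bigD1_seq k)/= ?iota_uniq ?mem_index_iota ?k0 ?ltnS//.
rewrite [in RHS](bigD1_seq k)/= ?iota_uniq ?mem_index_iota ?k0 ?ltnS// => E.
have le2 : (\sum_(1 <= i < (4 ^ N).+1 | i != k) (frag (grid N i) < x)%R <=
            \sum_(1 <= i < (4 ^ N).+1 | i != k) (frag (grid N i) < y)%R)%N.
  by apply: leq_sum => i _; exact: le.
move: E (le k); case: (frag (grid N k) < x)%R; case: (frag (grid N k) < y)%R => //= E _.
by move: le2; rewrite add0n in E; rewrite E add1n ltnn.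
Qed.

Lemma cell_of_eq N x y : (forall k, (frag (grid N k) < x) = (frag (grid N k) < y)) ->
  cell N x = cell N y.
Proof. by move=> h; rewrite /cell; apply: eq_bigr => k _; rewrite h. Qed.

(** If the range meets the segment, it does so strictly inside, as both ends avoid it. Some dyadic
    time then has its value strictly between them and separates the cells on every finer grid. *)
Lemma cells_cvg (x y : R) : 0 <= x <= 1 -> 0 <= y <= 1 ->
  ~ closed_range s x -> ~ closed_range s y ->
  exists N0, forall N, (N0 <= N)%N ->
    (cell N x == cell N y) =
    `[< forall z, Num.min x y <= z <= Num.max x y -> ~ closed_range s z >].
Proof.
wlog xy : x y / x <= y => [hw x01 y01 nx ny|].
  have /orP[xy|yx] := le_total x y; first exact: hw.
  have [N0 h] := hw y x yx y01 x01 ny nx; exists N0 => N /h.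
  by rewrite eq_sym minC maxC.
move=> x01 y01 nx ny; rewrite (min_idPl xy) (max_idPr xy).
have [av|nav] := pselect (forall z, x <= z <= y -> ~ closed_range s z).
  exists 0%N => N _; rewrite (asboolT av); apply/eqP/cell_of_eq => k.
  have nk : ~ (x <= frag (grid N k) <= y).
    move=> h; apply: (av _ h); apply/closed_rangeP => e e0; exists (grid N k).
    by rewrite grid_ge0 gtrBl e0/= ltrDl e0.
  apply/idP/idP => [h|h]; first exact: lt_le_trans h xy.
  by rewrite ltNge; apply/negP => h2; apply: nk; rewrite h2 ltW.
rewrite (asboolF nav).
move/existsNP : nav => [z /not_implyP[/andP[xz zy] /contrapT zR]].
have {xz}xz : x < z by rewrite lt_neqAle xz andbT; apply/eqP => E; apply: nx; rewrite E.
have {zy}zy : z < y by rewrite lt_neqAle zy andbT; apply/eqP => E; apply: ny; rewrite -E.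
have e0 : 0 < Num.min (z - x) (y - z) by rewrite lt_min !subr_gt0 xz.
have /closed_rangeP/(_ _ e0)[t [t0 /andP[h1 h2]]] := zR.
have : x < frag t < y.
  apply/andP; split.
    apply: le_lt_trans h1; rewrite lerBrDr -lerBrDl ge_min lexx//.
  by apply: lt_le_trans h2 _; rewrite -lerBrDl ge_min lexx orbT.
move=> /(frag_grid t0)[m [k [k0 _ /andP[h3 h4]]]].
(* [N >= m] makes the dyadic time a grid point, and [N >= k] gives k 2^(N - m) <= 4^N, so that it
   lies within the horizon. *)
exists (m + k)%N => N mN; apply/negP => /eqP E.
pose l := (k * 2 ^ (N - m))%N.
have mN' : (m <= N)%N by apply: leq_trans mN; exact: leq_addr.
have gl : grid N l = grid m k :> R by rewrite -{1}(subnKC mN') grid_scale.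
have l4 : (0 < l <= 4 ^ N)%N.
  rewrite muln_gt0 k0 expn_gt0/= (_ : 4 = 2 * 2)%N// expnMn leq_mul//.
    apply: leq_trans (ltnW (ltn_expl k (isT : 1 < 2)%N)) _.
    by rewrite leq_exp2l// (leq_trans _ mN)// leq_addl.
  by rewrite leq_exp2l// leq_subr.
have := cell_eq xy E l4; rewrite gl h4 ltNge (ltW h3)//.
Qed.

End paths.

(** * The composition along a dyadic grid *)

Section stick_breaking.
Context {R : realType}.
Implicit Types (y : nat -> R) (z : nat -> nat -> R).

(** Stick-breaking weights with fractions [y]; the index [M] receives all that remains. *)
Definition stick M y k : R := (\prod_(j < k) (1 - y j)) * (if k == M then 1 else y k).

Lemma stick0 M y : stick M.+1 y 0 = y 0%N.
Proof. by rewrite /stick big_ord0 mul1r. Qed.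

Lemma stickS M y k : stick M.+1 y k.+1 = (1 - y 0%N) * stick M (y \o S) k.
Proof. by rewrite /stick big_ord_recl eqSS mulrA. Qed.

(** For n balls falling independently into boxes with the stick-breaking weights, the mean of the
    product of [z k] at the number of balls in box k: the first box receives a binomial number and
    the others share the rest. This reading is justified by [sum_stick]. *)
Fixpoint stick_mean M z n y : R :=
  if M is M'.+1 then
    bin_mean n (y 0%N) (fun m => z 0%N m * stick_mean M' (z \o S) (n - m)%N (y \o S))
  else z 0%N n.

Definition shift_at z k : nat -> nat -> R := fun j m => z j (m + (j == k))%N.

Lemma bin_mean_eq n (y : R) (g h : nat -> R) : (forall m, (m <= n)%N -> g m = h m) ->
  bin_mean n y g = bin_mean n y h.
Proof. by move=> gh; apply: eq_bigr => j _; rewrite gh// -ltnS. Qed.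

Lemma bin_mean_sum n (y : R) (I : finType) (g : I -> nat -> R) :
  bin_mean n y (fun m => \sum_i g i m) = \sum_i bin_mean n y (g i).
Proof.
by rewrite /bin_mean exchange_big/=; apply: eq_bigr => j _; rewrite mulr_sumr.
Qed.

Lemma stick_mean_eq M z z' n y : (forall k m, z k m = z' k m) ->
  stick_mean M z n y = stick_mean M z' n y.
Proof.
elim: M z z' n y => [|M IH] z z' n y zz //=.
by apply: bin_mean_eq => m _; rewrite zz (IH _ (z' \o S))// => k l; exact: zz.
Qed.

(** Conditioning on the box of one extra ball, which [shift_at] adds to the count of that box. *)
Lemma stick_meanS M z n y : stick_mean M z n.+1 y =
  \sum_(k < M.+1) stick M y k * stick_mean M (shift_at z k) n y.
Proof.
elim: M z n y => [|M IH] z n y.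
  by rewrite big_ord1 /stick big_ord0 !mul1r /= /shift_at eqxx addn1.
rewrite [LHS]/= bin_meanS big_ord_recl stick0; congr (_ * _ + _).
  apply: bin_mean_eq => m _; rewrite /shift_at/= addn1 subSS; congr (_ * _).
  by apply: stick_mean_eq => k l; rewrite /= addn0.
rewrite (eq_bigr (fun k : 'I_M.+1 => (1 - y 0%N) *
  (stick M (y \o S) k * stick_mean M.+1 (shift_at z k.+1) n y))); last first.
  by move=> k _; rewrite (lift0 k) stickS -mulrA.
rewrite -mulr_sumr; congr (_ * _).
rewrite (@bin_mean_eq n _ _ (fun m => \sum_(k < M.+1) stick M (y \o S) k *
   (z 0%N m * stick_mean M (shift_at (z \o S) k) (n - m)%N (y \o S)))); last first.
  move=> m mn; rewrite subSn// IH mulr_sumr.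
  by apply: eq_bigr => k _; rewrite mulrCA.
rewrite bin_mean_sum; apply: eq_bigr => k _; rewrite bin_meanZ/=; congr (_ * _).
apply: bin_mean_eq => m _; rewrite /shift_at addn0; congr (_ * _).
Qed.

Definition ffun_cons n (I : finType) (x : I * {ffun 'I_n -> I}) : {ffun 'I_n.+1 -> I} :=
  [ffun i => if unlift ord0 i is Some j then x.2 j else x.1].

Lemma ffun_cons0 n (I : finType) (x : I * {ffun 'I_n -> I}) : ffun_cons x ord0 = x.1.
Proof. by rewrite ffunE unlift_none. Qed.

Lemma ffun_consS n (I : finType) (x : I * {ffun 'I_n -> I}) i :
  ffun_cons x (lift ord0 i) = x.2 i.
Proof. by rewrite ffunE liftK. Qed.

Lemma ffun_cons_bij n (I : finType) : bijective (@ffun_cons n I).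
Proof.
exists (fun g : {ffun 'I_n.+1 -> I} => (g ord0, [ffun i => g (lift ord0 i)])).
  by move=> [a g]; rewrite ffun_cons0; congr pair; apply/ffunP => i; rewrite ffunE ffun_consS.
move=> g; apply/ffunP => i; rewrite ffunE.
by case: unliftP => [j ->|->] //=; rewrite ffunE.
Qed.

(** Induction on the number of balls; [z] depends on the box because a ball already placed modifies
    it through [shift_at]. *)
Lemma sum_stick M z n y :
  \sum_(g : {ffun 'I_n -> 'I_M.+1}) (\prod_i stick M y (g i)) *
    \prod_(k < M.+1) z k #|[set i | g i == k]%SET| = stick_mean M z n y.
Proof.
elim: n z => [|n IH] z.
  rewrite (big_pred1 [ffun i => ord0]); last first.
    by move=> g; apply/esym/eqP/ffunP => -[].
  rewrite big_ord0 mul1r (eq_bigr (fun k : 'I_M.+1 => z k 0%N)); last first.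
    by move=> k _; congr z; apply: eq_card0 => -[].
  elim: M z y => [|M IH] z y; first by rewrite big_ord1.
  by rewrite big_ord_recl /= bin_mean0 subn0 -IH.
rewrite stick_meanS (reindex _ (onW_bij _ (ffun_cons_bij n _)))/=.
rewrite -(pair_bigA _ (fun (k : 'I_M.+1) (g : {ffun 'I_n -> 'I_M.+1}) => (\prod_i stick M y (ffun_cons (k, g) i)) *
  \prod_(l < M.+1) z l #|[set i | ffun_cons (k, g) i == l]%SET|))/=.
apply: eq_bigr => k _; rewrite -IH mulr_sumr; apply: eq_bigr => g _.
rewrite [X in X * _ = _]big_ord_recl ffun_cons0 -[LHS]mulrA; congr (_ * _).
rewrite (eq_bigr (fun i => stick M y (g i))) => [|i _]; last by rewrite ffun_consS.
congr (_ * _); apply: eq_bigr => l _; rewrite /shift_at; congr z.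
rewrite -!sum1dep_card big_mkcond big_ord_recl ffun_cons0/= addnC; congr (_ + _)%N.
  by rewrite [RHS]big_mkcond/=; apply: eq_bigr => i _; rewrite ffun_consS.
by rewrite eq_sym -val_eqE /=; case: (_ == _).
Qed.

Lemma stick_mean_ge0 M z n y : (forall k, 0 <= y k <= 1) ->
  (forall k m, 0 <= z k m) -> 0 <= stick_mean M z n y.
Proof.
elim: M z n y => [|M IH] z n y y01 z0 //=.
by apply: sumr_ge0 => j _; rewrite mulr_ge0 ?bin_weight_ge0// mulr_ge0// IH// => k /=.
Qed.

End stick_breaking.

Section cell_probability.
Context {R : realType}.
Variable s : R -> R.
Hypothesis s0 : s 0 = 0.
Hypothesis s_mono : forall a b, 0 <= a -> a <= b -> s a <= s b.
Variable N : nat.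

Lemma cell_ge x k : (k <= 4 ^ N)%N ->
  (k <= cell s N x)%N = (k == 0)%N || (frag s (grid N k) < x).
Proof.
move=> k4; case: (posnP k) => [->//|k0] /=.
have mon l l' : (l <= l')%N -> frag s (grid N l') < x -> frag s (grid N l) < x.
  by move=> ll; apply: le_lt_trans; apply: frag_mono => //; [exact: grid_ge0|exact: grid_mono].
rewrite /cell (big_cat_nat (n := k.+1))//=; apply/idP/idP => [|fx].
  apply: contraTT => fx; rewrite -ltnNge.
  rewrite [X in (_ + X)%N]big_nat [X in (_ + X)%N]big1 ?addn0; last first.
    move=> l /andP[kl _]; case: ltP => // h; move: fx; rewrite (mon k l)//; exact: ltnW.
  rewrite big_nat_recr//= (negbTE fx) addn0.
  apply: leq_ltn_trans (_ : \sum_(1 <= i < k) 1 < _)%N.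
    by apply: leq_sum => i _; case: (_ < _)%R.
  by rewrite sum_nat_const_nat muln1; lia.
apply: leq_trans (leq_addr _ _).
rewrite [leqRHS](eq_big_nat _ _ (F2 := fun=> 1%N)); last first.
  by move=> l /andP[_]; rewrite ltnS => lk; rewrite (mon l k).
by rewrite sum_nat_const_nat muln1 subn1.
Qed.

End cell_probability.

Section bounded_variables.
Context {d : measure_display} {T : measurableType d} {R : realType}.
Implicit Types V W : T -> R.

(** A class that is stable under sums and products and on which, under a probability, integrals are
    additive without further conditions. *)
Definition bounded_mfun V : Prop :=
  measurable_fun setT V /\ exists c : R, forall w, `|V w| <= c.

Lemma bounded_mfun_cst (c : R) : bounded_mfun (fun=> c).
Proof. by split=> //; exists `|c|. Qed.

Lemma bounded_mfunD V W : bounded_mfun V -> bounded_mfun W -> bounded_mfun (fun w => V w + W w).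
Proof.
move=> [mV [a Va]] [mW [b Wb]]; split; first exact: measurable_funD.
by exists (a + b) => w; apply: le_trans (ler_normD _ _) _; rewrite lerD.
Qed.

Lemma bounded_mfunM V W : bounded_mfun V -> bounded_mfun W -> bounded_mfun (fun w => V w * W w).
Proof.
move=> [mV [a Va]] [mW [b Wb]]; split; first exact: measurable_funM.
by exists (a * b) => w; rewrite normrM ler_pM.
Qed.

Lemma bounded_mfunZ (c : R) V : bounded_mfun V -> bounded_mfun (fun w => c * V w).
Proof. exact: bounded_mfunM (bounded_mfun_cst c). Qed.

Lemma bounded_mfunB V W : bounded_mfun V -> bounded_mfun W -> bounded_mfun (fun w => V w - W w).
Proof.
move=> hV /(bounded_mfunZ (-1)) hW; rewrite (_ : (fun w => _) = fun w => V w + -1 * W w).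
  exact: bounded_mfunD.
by apply/funext => w; rewrite mulN1r.
Qed.

Lemma bounded_mfun_sum (I : Type) (s : seq I) (p : pred I) (F : I -> T -> R) :
  (forall i, bounded_mfun (F i)) -> bounded_mfun (fun w => \sum_(i <- s | p i) F i w).
Proof.
move=> hF; elim: s => [|i s IH].
  by rewrite (_ : (fun w => _) = fun=> 0); [exact: bounded_mfun_cst|apply/funext => w; rewrite big_nil].
rewrite (_ : (fun w => _) = fun w => (if p i then F i w else 0) + \sum_(j <- s | p j) F j w).
  by apply: bounded_mfunD => //; case: (p i); [exact: hF|exact: bounded_mfun_cst].
by apply/funext => w; rewrite big_cons; case: (p i) => //; rewrite add0r.
Qed.

Lemma bounded_mfun_prod (I : Type) (s : seq I) (p : pred I) (F : I -> T -> R) :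
  (forall i, bounded_mfun (F i)) -> bounded_mfun (fun w => \prod_(i <- s | p i) F i w).
Proof.
move=> hF; elim: s => [|i s IH].
  by rewrite (_ : (fun w => _) = fun=> 1); [exact: bounded_mfun_cst|apply/funext => w; rewrite big_nil].
rewrite (_ : (fun w => _) = fun w => (if p i then F i w else 1) * \prod_(j <- s | p j) F j w).
  by apply: bounded_mfunM => //; case: (p i); [exact: hF|exact: bounded_mfun_cst].
by apply/funext => w; rewrite big_cons; case: (p i) => //; rewrite mul1r.
Qed.

Lemma bounded_mfunX n V : bounded_mfun V -> bounded_mfun (fun w => V w ^+ n).
Proof.
move=> hV; rewrite (_ : (fun w => _) = fun w => \prod_(i < n) V w).
  by apply: bounded_mfun_prod.
by apply/funext => w; rewrite prodr_const card_ord.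
Qed.

Lemma bounded_mfun_indic (A : set T) : measurable A -> bounded_mfun (\1_A).
Proof.
by move=> mA; split=> //; exists 1 => w; rewrite indicE; case: (_ \in _); rewrite ?normr1// normr0.
Qed.

Lemma bounded_mfun_ffun (I : finType) (X : I -> T -> bool) (g : {ffun I -> bool} -> R) :
  (forall i, measurable [set w | X i w]) -> bounded_mfun (fun w => g [ffun i => X i w]).
Proof.
move=> mX; split; first exact: measurable_ffun_valued.
exists (\sum_f `|g f|) => w.
by rewrite (bigD1 [ffun i => X i w])//= lerDl sumr_ge0.
Qed.

Lemma bounded_mfun_bin_mean n (Y : T -> R) (F : nat -> T -> R) :
  bounded_mfun Y -> (forall j, bounded_mfun (F j)) ->
  bounded_mfun (fun w => bin_mean n (Y w) (F ^~ w)).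
Proof.
move=> hY hF; apply: bounded_mfun_sum => j; apply: bounded_mfunM => //.
apply: bounded_mfunM; last by apply: bounded_mfunX; apply: bounded_mfunB => //; exact: bounded_mfun_cst.
by apply: bounded_mfunZ; exact: bounded_mfunX.
Qed.

Variable P : probability T R.

Lemma bounded_mfun_integrable V : bounded_mfun V -> P.-integrable setT (EFin \o V).
Proof. by move=> [mV [c Vc]]; exact: (bounded_integrable _ mV Vc). Qed.

Lemma bounded_meanD V W : bounded_mfun V -> bounded_mfun W ->
  \int[P]_w (V w + W w) = \int[P]_w V w + \int[P]_w W w.
Proof. by move=> hV hW; rewrite RintegralD//; exact: bounded_mfun_integrable. Qed.

Lemma bounded_meanZ c V : bounded_mfun V -> \int[P]_w (c * V w) = c * \int[P]_w V w.
Proof. by move=> hV; rewrite RintegralZl//; exact: bounded_mfun_integrable. Qed.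

Lemma bounded_mean_sum (I : Type) (s : seq I) (F : I -> T -> R) :
  (forall i, bounded_mfun (F i)) ->
  \int[P]_w (\sum_(i <- s) F i w) = \sum_(i <- s) \int[P]_w F i w.
Proof.
move=> hF; elim: s => [|i s IH].
  by under eq_Rintegral do rewrite big_nil; rewrite big_nil Rintegral_cst// mul0r.
under eq_Rintegral do rewrite big_cons.
by rewrite big_cons bounded_meanD ?IH//; exact: bounded_mfun_sum.
Qed.

Lemma bounded_mean_le V W : bounded_mfun V -> bounded_mfun W ->
  (forall w, V w <= W w) -> \int[P]_w V w <= \int[P]_w W w.
Proof.
by move=> hV hW VW; apply: le_Rintegral => //; exact: bounded_mfun_integrable.
Qed.

Lemma mean_cst (c : R) : \int[P]_w c = c.
Proof. exact: Rintegral_prob_cst. Qed.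

Lemma mean_indic (A : set T) : measurable A -> \int[P]_w \1_A w = fine (P A).
Proof. by move=> mA; rewrite /Rintegral integral_indic// setIT. Qed.

Lemma bounded_cvg_mean (V : nat -> T -> R) (W : T -> R) (c : R) :
  (forall n, measurable_fun setT (V n)) -> measurable_fun setT W ->
  (forall n w, `|V n w| <= c) ->
  {ae P, forall w, V n w @[n --> \oo] --> W w} ->
  \int[P]_w V n w @[n --> \oo] --> \int[P]_w W w.
Proof.
move=> mV mW Vc VW.
have [|||||h1 h2 h3] := @dominated_convergence _ _ _ P setT measurableT
  (fun n w => (V n w)%:E) (fun w => (W w)%:E) (fun=> c%:E).
- by move=> n; apply/measurable_EFinP.
- exact/measurable_EFinP.
- by apply: filterS VW => w h _; apply/fine_cvgP; split; [exact: nearW|exact: h].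
- by apply: bounded_mfun_integrable; exact: bounded_mfun_cst.
- by apply: aeW => w n _; rewrite /= lee_fin.
apply: fine_cvg; move: h3; rewrite /Rintegral fineK//.
exact: (integrable_fin_num measurableT h1).
Qed.

End bounded_variables.

Section bounded_decoupling.
Context {d d1 d2 : measure_display} {T : measurableType d}
  {T1 : measurableType d1} {T2 : measurableType d2} {R : realType}.
Variables (P : probability T R) (X : T -> T1) (Y : T -> T2).
Hypotheses (mX : measurable_fun setT X) (mY : measurable_fun setT Y).
Hypothesis XY : forall A B, measurable A -> measurable B ->
  P (X @^-1` A `&` Y @^-1` B) = (P (X @^-1` A) * P (Y @^-1` B))%E.

Lemma bounded_decouple (F : T1 * T2 -> R) : bounded_mfun F -> (forall z, 0 <= F z) ->
  \int[P]_w F (X w, Y w) = \int[P]_w \int[P]_w' F (X w, Y w').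
Proof.
move=> hF F0; have [mF [c Fc]] := hF.
rewrite /Rintegral (@decouple _ _ _ _ _ _ _ P X Y mX mY XY (fun z => (F z)%:E)); last 2 first.
- exact/measurable_EFinP.
- by move=> z; rewrite lee_fin.
congr fine; apply: eq_integral => w _ /=; rewrite fineK//.
apply: integrable_fin_num => //; apply: (@bounded_integrable _ _ _ P _ c) => [|w']; last exact: Fc.
by apply: (measurableT_comp mF); apply: measurable_fun_pair => //; exact: measurable_cst.
Qed.

Lemma bounded_mfun_inner_mean (F : T1 * T2 -> R) : bounded_mfun F -> (forall z, 0 <= F z) ->
  bounded_mfun (fun w => \int[P]_w' F (X w, Y w')).
Proof.
move=> [mF [c Fc]] F0.
have iF x : P.-integrable setT (EFin \o (fun w' => F (x, Y w'))).
  apply: (@bounded_integrable _ _ _ P _ c) => [|w']; last exact: Fc.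
  by apply: (measurableT_comp mF); apply: measurable_fun_pair => //; exact: measurable_cst.
split; last first.
  exists c => w; apply: le_trans (le_normr_Rintegral _ (iF _)) _ => //.
  rewrite -[leRHS](mean_cst P c); apply: le_Rintegral => //.
  - exact: (integrable_norm (iF _)).
  - by apply: bounded_mfun_integrable; exact: bounded_mfun_cst.
pose Y' : {mfun T >-> T2} := HB.pack Y (isMeasurableFun.Build _ _ _ _ Y mY).
have mF' : measurable_fun setT (fun z => (F z)%:E) by exact/measurable_EFinP.
have h := @measurable_fun_fubini_tonelli_F _ _ _ _ _ (distribution P Y') (fun z => (F z)%:E) mF'
  (fun z => F0 z).
have := measurableT_comp h mX; rewrite (_ : _ \o _ = fun w => (\int[P]_w' F (X w, Y w'))%:E).
  by move/measurable_EFinP.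
apply/funext => w /=; rewrite /fubini_F ge0_integral_distribution//.
- by rewrite /Rintegral fineK//; exact: (integrable_fin_num measurableT (iF (X w))).
- apply: (measurableT_comp mF'); apply: measurable_fun_pair => //; exact: measurable_cst.
- by move=> y; rewrite lee_fin.
Qed.

End bounded_decoupling.

Lemma unif01_ray_closed {R : realType} (x : R) : 0 <= x <= 1 ->
  @unif01 R `]-oo, x]%classic = x%:E.
Proof.
move=> /andP[x0 x1]; have cl (y : R) : 0 <= y <= 1 -> clamp y = y by exact: clamp_id.
have le0 : (@unif01 R `]-oo, x]%classic <= x%:E)%E.
  apply/lee_addgt0Pr => e e0; rewrite -EFinD.
  apply: (@le_trans _ _ (@unif01 R `]-oo, x + e[%classic)).
    apply: le_measure; rewrite ?inE//.
    by move=> y /=; rewrite !in_itv/= => yx; rewrite (le_lt_trans yx)// ltrDl.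
  rewrite unif01_ray lee_fin /clamp ge_min ge_max (_ : 0 <= x + e)//= ?lexx ?orbT//.
  by rewrite addr_ge0// ltW.
apply/eqP; rewrite eq_le le0/= -[X in (X%:E <= _)%E]cl ?x0// -unif01_ray.
apply: le_measure; rewrite ?inE//.
by move=> y /=; rewrite !in_itv/= => /ltW.
Qed.

Section cell_law.
Context {R : realType}.
Variable s : R -> R.
Hypothesis s0 : s 0 = 0.
Hypothesis s_mono : forall a b, 0 <= a -> a <= b -> s a <= s b.
Variable N : nat.

(** Share of the uncovered part of the unit interval that the path covers between two consecutive
    grid times. *)
Definition gap_fraction k : R := 1 - expR (- (s (grid N k.+1) - s (grid N k))).

Lemma gap_fraction01 k : 0 <= gap_fraction k <= 1.
Proof.
rewrite subr_ge0 gerBl expR_ge0 andbT -expR0 ler_expR oppr_le0 subr_ge0.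
by apply: s_mono; [exact: grid_ge0|exact: grid_mono].
Qed.

Lemma prod_gap_fraction k : \prod_(j < k) (1 - gap_fraction j) = expR (- s (grid N k)).
Proof.
elim: k => [|k IH]; first by rewrite big_ord0 /grid mul0r s0 oppr0 expR0.
rewrite big_ord_recr/= IH /gap_fraction subKr -expRD; congr expR; ring.
Qed.

Let M := (4 ^ N)%N.

Lemma cell_geE k : (k <= M)%N -> [set x : R | (k <= cell s N x)%N] =
  if k == 0%N then setT else ~` `]-oo, frag s (grid N k)]%classic.
Proof.
move=> kM; apply/seteqP; split => x /=; rewrite cell_ge//.
  by case: (k == 0)%N => //= h; rewrite in_itv/= => /(lt_le_trans h); rewrite ltxx.
by case: (k == 0)%N => //=; rewrite in_itv/= => /negP; rewrite -ltNge.
Qed.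

Lemma measurable_cell_ge k : (k <= M)%N -> measurable [set x : measurableTypeR R | (k <= cell s N x)%N].
Proof. by move=> kM; rewrite cell_geE//; case: ifP => // _; apply: measurableC; exact: measurable_itv. Qed.

Lemma cell_ge_prob k : (k <= M)%N ->
  @unif01 R [set x | (k <= cell s N x)%N] = (expR (- s (grid N k)))%:E.
Proof.
move=> kM; rewrite cell_geE//; case: eqVneq => [->|k0].
  by rewrite /grid mul0r s0 oppr0 expR0 (@probability_setT _ _ _ unif01).
have e1 : expR (- s (grid N k)) <= 1.
  by rewrite -expR0 ler_expR oppr_le0 -s0 s_mono// grid_ge0.
rewrite (@probability_setC _ _ _ unif01) ?unif01_ray_closed//.
- by rewrite -EFinB subKr.
- by rewrite subr_ge0 e1 gerBl expR_ge0.
Qed.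

Lemma measurable_cell_eq k : (k <= M)%N -> measurable [set x : measurableTypeR R | cell s N x = k].
Proof.
move=> kM; rewrite (_ : mkset _ = [set x | (k <= cell s N x)%N] `\`
   if k == M then set0 else [set x | (k.+1 <= cell s N x)%N]).
  apply: measurableD; first exact: measurable_cell_ge.
  by case: ifPn => // kM'; apply: measurable_cell_ge; rewrite ltn_neqAle kM'.
apply/seteqP; split => x /=.
  by move=> xk; split; [rewrite xk|case: ifP => _ /=; [case|rewrite xk ltnn]].
move=> [kx h]; apply/eqP; rewrite eqn_leq kx andbT; move: h.
by case: ifP => [/eqP -> _|_ /negP]; [exact: cell_le|rewrite -leqNgt].
Qed.

(** The uncovered length at a grid time is a telescoping product of the complements of the
    fractions, and the lengths of the cells are its successive differences. *)
Lemma cell_prob k : (k <= M)%N ->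
  @unif01 R [set x | cell s N x = k] = (stick M gap_fraction k)%:E.
Proof.
move=> kM; rewrite /stick prod_gap_fraction; case: eqVneq => [->|kM'].
  rewrite mulr1 -cell_ge_prob//; congr (unif01 _).
  apply/seteqP; split => x /=; first by move=> ->.
  by move=> Mx; apply/eqP; rewrite eqn_leq cell_le.
have kM2 : (k < M)%N by rewrite ltn_neqAle kM'.
rewrite (_ : mkset _ = [set x | (k <= cell s N x)%N] `\` [set x | (k.+1 <= cell s N x)%N]).
  rewrite measureD ?cell_ge_prob//=; last 3 first.
  - exact: measurable_cell_ge.
  - exact: measurable_cell_ge.
  - exact: le_lt_trans (probability_le1 unif01 (measurable_cell_ge kM)) (ltry _).
  rewrite setIidr ?cell_ge_prob//; last by move=> x /=; exact: ltnW.
  rewrite -EFinB; congr EFin; rewrite /gap_fraction mulrBr mulr1 -expRD.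
  by congr (_ - expR _); ring.
apply/seteqP; split => x /=; first by move=> ->; rewrite ltnn.
by move=> [kx /negP]; rewrite -leqNgt => xk; apply/eqP; rewrite eqn_leq kx xk.
Qed.

End cell_law.

Section cell_mean.
Context {d : measure_display} {T : measurableType d} {R : realType}.
Variables (P : probability T R) (n : nat) (u : 'I_n -> T -> R).
Hypothesis u_iid : iid_uniform P u.
Variable s : R -> R.
Hypothesis s0 : s 0 = 0.
Hypothesis s_mono : forall a b, 0 <= a -> a <= b -> s a <= s b.

(* The product of [z (number of points)] over the cells of the partition by the
   values [frag s (grid N k)], [1 <= k <= 4 ^ N]. *)
Definition cell_product N (z : nat -> R) (x : 'I_n -> R) : R :=
  \prod_(k < (4 ^ N).+1) z #|[set i | cell s N (x i) == k]%SET|.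

Lemma mean_cell_product N (z : nat -> R) :
  \int[P]_w cell_product N z (u ^~ w) =
  stick_mean (4 ^ N) (fun=> z) n (gap_fraction s N).
Proof.
have [ulaw uind] := u_iid.
pose c w : {ffun 'I_n -> 'I_(4 ^ N).+1} := [ffun i => inord (cell s N (u i w))].
have cE w i : c w i = cell s N (u i w) :> nat.
  by rewrite ffunE inordK// ltnS cell_le.
have Pg g : P [set w | c w = g] = (\prod_(i < n) stick (4 ^ N)%N (gap_fraction s N) (g i))%:E.
  rewrite (_ : mkset _ = \bigcap_(i in [set: 'I_n]) (u i @^-1` [set x | cell s N x = g i])).
    rewrite uind => [|i]; last by apply: measurable_cell_eq => //; rewrite -ltnS.
    rewrite -prodEFin; apply: eq_bigr => i _.
    rewrite (ulaw i).2; last by apply: measurable_cell_eq => //; rewrite -ltnS.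
    by rewrite -cell_prob// -ltnS.
  apply/seteqP; split => w /=.
    by move=> <- i _ /=; rewrite cE.
  by move=> h; apply/ffunP => i; apply/val_inj; rewrite /= cE (h i).
have mg g : measurable [set w | c w = g].
  rewrite (_ : mkset _ = \bigcap_(i in [set: 'I_n]) (u i @^-1` [set x | cell s N x = g i])).
    apply: fin_bigcap_measurable => [|i _]; first exact: finite_finset.
    rewrite -[X in measurable X]setTI; apply: (ulaw i).1 => //.
    by apply: measurable_cell_eq => //; rewrite -ltnS.
  apply/seteqP; split => w /=.
    by move=> <- i _ /=; rewrite cE.
  by move=> h; apply/ffunP => i; apply/val_inj; rewrite /= cE (h i).
transitivity (\int[P]_w \sum_(g : {ffun 'I_n -> 'I_(4 ^ N).+1})
    (\prod_(k < (4 ^ N).+1) z #|[set i | g i == k]%SET|) * \1_[set w | c w = g] w).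
  apply: eq_Rintegral => w _; rewrite (bigD1 (c w))//= indicE mem_set// mulr1.
  rewrite [X in _ = _ + X]big1 ?addr0 => [|g gc]; last first.
    by rewrite indicE memNset ?mulr0//= => E; rewrite E eqxx in gc.
  apply: eq_bigr => k _; congr z; apply: eq_card => i.
  by rewrite !inE -val_eqE/= cE.
rewrite bounded_mean_sum => [|g]; last by apply: bounded_mfunZ; exact: bounded_mfun_indic.
rewrite -sum_stick; apply: eq_bigr => g _.
rewrite bounded_meanZ; last exact: bounded_mfun_indic.
by rewrite mean_indic// Pg/= mulrC.
Qed.

End cell_mean.

Section first_versus_rest.
Context {d : measure_display} {T : measurableType d} {R : realType}.
Variables (P : probability T R) (M : nat) (Y : nat -> T -> R).
Hypothesis mY : forall k, measurable_fun setT (Y k).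
Hypothesis Y_ind : mutually_independent P (fun (i : 'I_M.+1) => Y i).

(** A family stable under intersection which generates the events determined by [Y 1], ...,
    [Y M]. *)
Definition rectangles : set (set T) := [set E | exists B : 'I_M -> set R,
  (forall i, measurable (B i)) /\ E = \bigcap_(i in [set: 'I_M]) (Y i.+1 @^-1` B i)].

Let measurable_rect (B : 'I_M -> set R) : (forall i, measurable (B i)) ->
  measurable (\bigcap_(i in [set: 'I_M]) (Y i.+1 @^-1` B i)).
Proof.
move=> mB; apply: fin_bigcap_measurable => [|i _]; first exact: finite_finset.
by rewrite -[X in measurable X]setTI; exact: mY.
Qed.

Let rect_indep (A : set R) (B : 'I_M -> set R) : measurable A -> (forall i, measurable (B i)) ->
  P (Y 0 @^-1` A `&` \bigcap_(i in [set: 'I_M]) (Y i.+1 @^-1` B i)) =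
  (P (Y 0 @^-1` A) * \prod_(i < M) P (Y i.+1 @^-1` B i))%E.
Proof.
move=> mA mB.
pose B' (i : 'I_M.+1) := if unlift ord0 i is Some j then B j else A.
have mB' i : measurable (B' i) by rewrite /B'; case: (unlift ord0 i).
have -> : (P (Y 0 @^-1` A) * \prod_(i < M) P (Y i.+1 @^-1` B i) =
           \prod_(i < M.+1) P (Y i @^-1` B' i))%E.
  rewrite big_ord_recl /B' unlift_none; congr (_ * _)%E.
  by apply: eq_bigr => i _; rewrite liftK.
rewrite -(Y_ind mB') /B'.
congr (P _); apply/seteqP; split => w /=.
  move=> [h0 h] i _; case: unliftP => [j ->|->] //=; exact: h.
move=> h; split; first by have := h ord0 Logic.I; rewrite unlift_none.
by move=> i _; have := h (lift ord0 i) Logic.I; rewrite liftK.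
Qed.

Lemma mutually_independent_tail : mutually_independent P (fun (i : 'I_M) => Y i.+1).
Proof.
move=> B mB; have := rect_indep measurableT mB.
by rewrite preimage_setT setTI probability_setT mul1e.
Qed.

Lemma rectangles_indep (A : set R) E : measurable A -> <<s rectangles >> E ->
  P (Y 0 @^-1` A `&` E) = (P (Y 0 @^-1` A) * P E)%E.
Proof.
move=> mA.
have mYA : measurable (Y 0 @^-1` A) by rewrite -[X in measurable X]setTI; exact: mY.
have fA : P (Y 0 @^-1` A) \is a fin_num by exact: fin_num_measure.
have c0 : 0 <= fine (P (Y 0 @^-1` A)) by exact: fine_ge0.
have sub : rectangles `<=` measurable by move=> _ [B [mB ->]]; exact: measurable_rect.
have rT : rectangles setT.
  exists (fun=> setT); split => //; rewrite (_ : \bigcap_(_ in _) _ = setT)//.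
  by apply/seteqP; split.
move=> hE.
have := @g_sigma_algebra_measure_unique _ _ _ rectangles sub (fun=> setT) (fun=> rT)
  _ (mrestr P mYA) (mscale (NngNum c0) P) _ _ _ E hE.
rewrite /mrestr/= /mscale/= fineK// setIC; apply.
- by apply/seteqP; split => // w _; exists 0%N.
- move=> _ _ [B1 [m1 ->]] [B2 [m2 ->]]; exists (fun i => B1 i `&` B2 i); split.
    by move=> i; exact: measurableI.
  by apply/seteqP; split => [w [h1 h2] i _|w h]; [split; [exact: h1|exact: h2]|split => i _; case: (h i Logic.I)].
- move=> _ [B [mB ->]]; rewrite /mrestr/= setIC rect_indep//; congr (_ * _)%E.
  exact/esym/mutually_independent_tail.
- by move=> _; rewrite /mrestr/= setTI ltey_eq fA.
Qed.

End first_versus_rest.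

Section increments_mean.
Context {d : measure_display} {T : measurableType d} {R : realType}.
Variable P : probability T R.

Lemma bounded_mfun_stick_mean d' (T' : measurableType d') M (z : nat -> R) n (Y : nat -> T' -> R) :
  (forall k, (k < M)%N -> bounded_mfun (Y k)) ->
  bounded_mfun (fun w => stick_mean M (fun=> z) n (Y ^~ w)).
Proof.
elim: M n Y => [|M IH] n Y hY; first exact: bounded_mfun_cst.
apply: (@bounded_mfun_bin_mean _ _ _ n (Y 0%N)
  (fun m w => z m * stick_mean M (fun=> z) (n - m)%N ((Y \o S) ^~ w))); first exact: hY.
by move=> j; apply: bounded_mfunZ; apply: IH => k kM; exact: hY.
Qed.

(** At each of the [M] steps, j of the n remaining points are removed with probability [q n j] and
    weighted by [z j]; the points left at the end form one last block. *)
Fixpoint renewal_mean (q : nat -> nat -> R) (z : nat -> R) M n : R :=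
  if M is M'.+1 then \sum_(j < n.+1) q n j * (z j * renewal_mean q z M' (n - j)%N) else z n.

(** The first increment is independent of the later ones, and with its value fixed the mean over
    these has the same form, with [Y] shifted. *)
Lemma mean_stick_mean (z : nat -> R) (q : nat -> nat -> R) M n (Y : nat -> T -> R) :
  (forall k, 0 <= z k) ->
  (forall k, measurable_fun setT (Y k)) -> (forall k w, 0 <= Y k w <= 1) ->
  (forall m, mutually_independent P (fun (i : 'I_m) => Y i)) ->
  (forall k n j, \int[P]_w bin_weight n (Y k w) j = q n j) ->
  \int[P]_w stick_mean M (fun=> z) n (Y ^~ w) = renewal_mean q z M n.
Proof.
move=> z0; elim: M n Y => [|M IH] n Y mY Y01 Yind Yq; first by rewrite mean_cst.
have bY k : bounded_mfun (Y k).
  by split=> //; exists 1 => w; have /andP[h0 h1] := Y01 k w; rewrite ger0_norm.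
have bS m : bounded_mfun (fun w => stick_mean M (fun=> z) m ((Y \o S) ^~ w)).
  by apply: bounded_mfun_stick_mean => k _; exact: bY.
have bw j (y : R -> R) : measurable_fun setT y -> (forall x, 0 <= y x <= 1) ->
    bounded_mfun (fun x => bin_weight n (y x) j).
  move=> my y01; have by_ : bounded_mfun y.
    by split=> //; exists 1 => x; have /andP[h0 h1] := y01 x; rewrite ger0_norm.
  apply: bounded_mfunM; first by apply: bounded_mfunZ; exact: bounded_mfunX.
  by apply: bounded_mfunX; apply: bounded_mfunB => //; exact: bounded_mfun_cst.
have bW j : bounded_mfun (fun w => bin_weight n (Y 0%N w) j).
  apply: bounded_mfunM; first by apply: bounded_mfunZ; exact: bounded_mfunX.
  by apply: bounded_mfunX; apply: bounded_mfunB => //; exact: bounded_mfun_cst.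
transitivity (\int[P]_w \sum_(j < n.+1) bin_weight n (Y 0%N w) j *
    (z j * stick_mean M (fun=> z) (n - j)%N ((Y \o S) ^~ w))); first exact: eq_Rintegral.
rewrite bounded_mean_sum => [|j]; last first.
  by apply: bounded_mfunM => //; exact: bounded_mfunZ.
apply: eq_bigr => j _.
(* The same space with the sigma-algebra of the later increments only, so that [bounded_decouple]
   applies to [Y 0] and the identity. *)
pose T2 : measurableType _ := g_sigma_algebraType (rectangles M Y).
have bS2 : @bounded_mfun _ T2 R (fun w => stick_mean M (fun=> z) (n - j)%N ((Y \o S) ^~ w)).
  apply: bounded_mfun_stick_mean => k kM; split; last by case: (bY k.+1).
  move=> _ B mB; rewrite setTI; apply: sub_gen_smallest.
  exists (fun i : 'I_M => if i == Ordinal kM then B else setT); split.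
    by move=> i; case: ifP.
  apply/seteqP; split => [w /= h i _ /=|w /(_ (Ordinal kM) Logic.I)].
    by case: eqVneq => // ->.
  by rewrite /= eqxx.
have sub : rectangles M Y `<=` measurable.
  move=> _ [B [mB ->]]; apply: fin_bigcap_measurable => [|i _]; first exact: finite_finset.
  by rewrite -[X in measurable X]setTI; exact: mY.
have mid : measurable_fun setT (id : T -> T2).
  move=> _ B mB; rewrite setTI preimage_id; move: B mB.
  by apply: smallest_sub => //; exact: sigma_algebra_measurable.
(* The clamp keeps the binomial weight bounded on the whole line; it changes nothing at the values
   of [Y 0]. *)
pose F (p : R * T2) : R := bin_weight n (clamp p.1) j *
  (z j * stick_mean M (fun=> z) (n - j)%N ((Y \o S) ^~ p.2)).
have F0 p : 0 <= F p.
  apply: mulr_ge0; first by rewrite bin_weight_ge0// clamp01.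
  apply: mulr_ge0 => //; apply: stick_mean_ge0 => [k|k m] //=; exact: Y01.
have bF : bounded_mfun F.
  have bc := bw j (@clamp R) (measurable_clamp (R := R)) (@clamp01 R).
  have comp1 (V : R -> R) : bounded_mfun V -> bounded_mfun (fun p : R * T2 => V p.1).
    by move=> [mV [c Vc]]; split; [exact: measurableT_comp|exists c].
  have comp2 (V : T2 -> R) : bounded_mfun V -> bounded_mfun (fun p : R * T2 => V p.2).
    by move=> [mV [c Vc]]; split; [exact: measurableT_comp|exists c].
  apply: bounded_mfunM; first exact: comp1 bc.
  by apply: bounded_mfunZ; exact: comp2 bS2.
transitivity (\int[P]_w F (Y 0%N w, id w)).
  by apply: eq_Rintegral => w _; rewrite /F/= clamp_id.
rewrite (bounded_decouple (mY 0%N) mid _ bF F0) => [|A B mA mB]; last first.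
  by apply: (rectangles_indep mY (Yind M.+1)) => //.
have inner w : \int[P]_w' F (Y 0%N w, id w') =
    (z j * renewal_mean q z M (n - j)%N) * bin_weight n (Y 0%N w) j.
  rewrite /F /= clamp_id// bounded_meanZ; last exact: bounded_mfunZ.
  rewrite bounded_meanZ// mulrC; congr (_ * _ * _).
  apply: IH => // m.
  exact: (mutually_independent_tail (Y := Y) (M := m)).
under eq_Rintegral do rewrite inner.
by rewrite bounded_meanZ; [rewrite Yq mulrC|exact: bW].
Qed.

End increments_mean.

Lemma eq_law_mean {d : measure_display} {T : measurableType d} {R : realType}
    (P : probability T R) (X V : T -> R) (f : R -> R) :
  measurable_fun setT V -> has_law P X (fun B => P (V @^-1` B)) ->
  measurable_fun setT f -> (forall x, 0 <= f x) ->
  \int[P]_w f (X w) = \int[P]_w f (V w).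
Proof.
move=> mV [mX XV] mf f0.
pose X' : {mfun T >-> R} := HB.pack X (isMeasurableFun.Build _ _ _ _ X mX).
pose V' : {mfun T >-> R} := HB.pack V (isMeasurableFun.Build _ _ _ _ V mV).
have mf' : measurable_fun setT (EFin \o f) by exact/measurable_EFinP.
have f0' x : (0 <= (EFin \o f) x)%E by rewrite lee_fin.
have hX := @ge0_integral_distribution _ _ _ _ R P X' (EFin \o f) mf' f0'.
have hV := @ge0_integral_distribution _ _ _ _ R P V' (EFin \o f) mf' f0'.
rewrite /Rintegral; congr fine; transitivity (\int[P]_w (EFin \o f \o X') w)%E => //.
rewrite -hX; transitivity (\int[P]_w (EFin \o f \o V') w)%E => //; rewrite -hV.
by apply: eq_measure_integral => B mB _; exact: XV.
Qed.

Section joint_measurability.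
Context {d1 d2 : measure_display} {T1 : measurableType d1} {T2 : measurableType d2}.
Context {R : realType}.
Variables (S : R -> T1 -> R) (n : nat) (u : 'I_n -> T2 -> R).
Hypothesis mS : forall t, 0 <= t -> measurable_fun setT (S t).
Hypothesis mu : forall i, measurable_fun setT (u i).

Lemma measurable_frag_path (t : R) : 0 <= t ->
  measurable_fun setT (fun w : T1 => frag (S ^~ w) t).
Proof.
move=> t0; apply: measurable_funB; first exact: measurable_cst.
apply: measurable_expR_comp; apply: measurableT_comp; last exact: mS.
exact: oppr_measurable.
Qed.

(** Joint measurability in path and sample: only finitely many comparisons of sample points with
    path values are involved. *)
Lemma bounded_mfun_cell_product N (z : nat -> R) :
  bounded_mfun (fun p : T1 * T2 => cell_product (S ^~ p.1) N z (u ^~ p.2)).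
Proof.
pose g (b : {ffun 'I_n * 'I_(4 ^ N).+1 -> bool}) : R := \prod_(k < (4 ^ N).+1)
  z #|[set i | (\sum_(1 <= l < (4 ^ N).+1) b (i, inord l))%N == k]%SET|.
have := @bounded_mfun_ffun _ (T1 * T2)%type R _
  (fun (ik : 'I_n * 'I_(4 ^ N).+1) (p : T1 * T2) => frag (S ^~ p.1) (grid N ik.2) < u ik.1 p.2) g.
rewrite (_ : (fun w => g _) = (fun p => cell_product (S ^~ p.1) N z (u ^~ p.2))).
  apply=> -[i k] /=.
  have m1 := measurableT_comp (measurable_frag_path (grid_ge0 N k)) (@measurable_fst _ _ T1 T2).
  have m2 := measurableT_comp (mu i) (@measurable_snd _ _ T1 T2).
  have := measurable_fun_ltr m1 m2 measurableT (Y := [set true]).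
  by rewrite setTI; apply.
apply/funext => p; apply: eq_bigr => k _; congr z; apply: eq_card => i.
rewrite !inE; congr (_ == _); apply: eq_big_nat => l /andP[_ l4].
by rewrite ffunE /= inordK.
Qed.

End joint_measurability.

Section discretised_mean.
Context {d : measure_display} {T : measurableType d} {R : realType}.
Variables (P : probability T R) (S : R -> T -> R) (n : nat) (u : 'I_n -> T -> R).
Hypothesis S_sub : subordinator P S.
Hypothesis u_iid : iid_uniform P u.
Hypothesis u_S : independent_of_process P S u.

Let S0 w : S 0 w = 0. Proof. exact: (subordinator0 S_sub). Qed.
Let S_mono w (a b : R) : 0 <= a -> a <= b -> S a w <= S b w.
Proof. exact: (subordinator_nondecreasing S_sub). Qed.
Let mS (t : R) : 0 <= t -> measurable_fun setT (S t).
Proof. exact: (subordinator_measurable S_sub). Qed.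

Definition gap_weight N m j : R :=
  \int[P]_w bin_weight m (1 - expR (- S (grid N 1) w)) j.

Let TS : measurableType _ := g_sigma_algebraType
  (\bigcup_(t in [set t : R | 0 <= t]) preimage_set_system setT (S t) measurable).
Let Tu : measurableType _ := g_sigma_algebraType
  (\bigcup_(i in [set: 'I_n]) preimage_set_system setT (u i) measurable).

Lemma measurable_path (t : R) : 0 <= t -> measurable_fun setT (S t : TS -> R).
Proof.
move=> t0 _ B mB; rewrite setTI; apply: sub_gen_smallest; exists t => //.
by exists B => //; rewrite setTI.
Qed.

Lemma measurable_sample i : measurable_fun setT (u i : Tu -> R).
Proof.
move=> _ B mB; rewrite setTI; apply: sub_gen_smallest; exists i => //.
by exists B => //; rewrite setTI.
Qed.

Let midS : measurable_fun setT (id : T -> TS).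
Proof.
move=> _ B mB; rewrite setTI preimage_id; move: B mB.
apply: smallest_sub; first exact: sigma_algebra_measurable.
by move=> _ [t /= t0 [B mB <-]]; exact: mS.
Qed.

Let midu : measurable_fun setT (id : T -> Tu).
Proof.
move=> _ B mB; rewrite setTI preimage_id; move: B mB.
apply: smallest_sub; first exact: sigma_algebra_measurable.
by move=> _ [i _ [B mB <-]]; exact: (u_iid.1 i).1.
Qed.

(** The same space serves twice, with the sigma-algebra of the path and with that of the sample; by
    their independence the diagonal has a product law. *)
Lemma decouple_paths (F : T -> T -> R) :
  bounded_mfun (fun p : TS * Tu => F p.1 p.2) -> (forall w w', 0 <= F w w') ->
  \int[P]_w F w w = \int[P]_w \int[P]_w' F w w'.
Proof.
move=> bF F0; rewrite -(bounded_decouple midS midu _ bF) => // A B mA mB.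
by rewrite !preimage_id setIC muleC; exact: u_S.
Qed.

Lemma bounded_mfun_inner_path (F : T -> T -> R) :
  bounded_mfun (fun p : TS * Tu => F p.1 p.2) -> (forall w w', 0 <= F w w') ->
  bounded_mfun (fun w => \int[P]_w' F w w').
Proof. by move=> bF F0; exact: (bounded_mfun_inner_mean P midS midu bF (fun z => F0 z.1 z.2)). Qed.

Lemma measurable_cell_product N (z : nat -> R) :
  measurable_fun setT (fun w => cell_product (S ^~ w) N z (u ^~ w)).
Proof.
have [mF _] := bounded_mfun_cell_product measurable_path measurable_sample N z.
exact: (measurableT_comp mF (measurable_fun_pair midS midu)).
Qed.

Lemma gridS N k : grid N k.+1 = grid N k + grid N 1 :> R.
Proof. by rewrite /grid -natr1 mulrDl. Qed.

(** For a fixed path the cells are stick-breaking pieces; the mean over the path uses that the grid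
    increments are independent and stationary. *)
Lemma mean_discretised N (z : nat -> R) : (forall k, 0 <= z k) ->
  \int[P]_w cell_product (S ^~ w) N z (u ^~ w) =
  renewal_mean (gap_weight N) z (4 ^ N) n.
Proof.
move=> z0; rewrite (@decouple_paths (fun w w' => cell_product (S ^~ w) N z (u ^~ w'))
  (bounded_mfun_cell_product measurable_path measurable_sample N z)); last first.
  by move=> w w'; apply: prodr_ge0 => k _; exact: z0.
transitivity (\int[P]_w stick_mean (4 ^ N) (fun=> z) n (gap_fraction (S ^~ w) N)).
  apply: eq_Rintegral => w _; rewrite mean_cell_product// => a b a0 ab.
  exact: S_mono.
pose Y k w := gap_fraction (S ^~ w) N k.
have mX k : measurable_fun setT (fun w => S (grid N k.+1) w - S (grid N k) w).
  by apply: measurable_funB; apply: mS; exact: grid_ge0.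
have mg : measurable_fun setT (fun x : R => 1 - expR (- x)).
  apply: measurable_funB => //; apply: measurableT_comp => //.
rewrite -(mean_stick_mean (P := P) (q := gap_weight N) (z := z) (4 ^ N) n (Y := Y)) //.
- move=> k; exact: (measurableT_comp mg (mX k)).
- by move=> k w; apply: gap_fraction01 => a b; exact: S_mono.
- move=> m B mB.
  have gm : {homo (grid N : nat -> R) : i j / (i <= j)%N >-> i <= j}.
    by move=> i j; exact: grid_mono.
  have := @subordinator_independent_increments _ _ _ _ _ S_sub m (grid N) (grid_ge0 N 0) gm.
  move=> /(_ (fun i => (fun x : R => 1 - expR (- x)) @^-1` B i)).
  by apply=> i; rewrite -[X in measurable X]setTI; exact: mg.
move=> k m j; rewrite /gap_weight.
have bw01 (x : R) : 0 <= x -> clamp (1 - expR (- x)) = 1 - expR (- x).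
  move=> x0; rewrite clamp_id// subr_ge0 gerBl expR_ge0 andbT.
  by rewrite -expR0 ler_expR oppr_le0.
have := @eq_law_mean _ _ _ P (fun w => S (grid N k + grid N 1) w - S (grid N k) w)
  (S (grid N 1)) (fun x => bin_weight m (clamp (1 - expR (- x))) j)
  (mS (grid_ge0 _ _))
  (subordinator_stationary_increments S_sub (grid_ge0 _ _) (grid_ge0 _ _)).
rewrite -gridS => h.
transitivity (\int[P]_w bin_weight m (clamp (1 - expR (- (S (grid N k.+1) w - S (grid N k) w)))) j).
  apply: eq_Rintegral => w _; rewrite bw01// subr_ge0.
  by apply: S_mono; [exact: grid_ge0|exact: grid_mono].
rewrite h.
- apply: eq_Rintegral => w _; rewrite bw01//.
  by rewrite -(S0 w) S_mono// grid_ge0.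
- apply: measurable_funM; last first.
    apply: measurable_funX; apply: measurable_funB => //.
    by apply: measurableT_comp => //; exact: measurable_clamp.
  apply: measurable_funM => //; apply: measurable_funX.
  by apply: measurableT_comp => //; exact: measurable_clamp.
- by move=> x; rewrite bin_weight_ge0// clamp01.
Qed.

End discretised_mean.

Lemma geometric_sum_le {R : realFieldType} (r : R) n : 0 <= r < 1 ->
  \sum_(0 <= k < n) r ^+ k <= (1 - r)^-1.
Proof.
move=> /andP[r0 r1]; rewrite big_mkord -[leRHS]mul1r ler_pdivlMr ?subr_gt0//.
rewrite mulrC -opprB mulNr -subrX1 opprB gerBl exprn_ge0//.
Qed.

(** * Tails and exponential weights of the Lévy measure *)

Section levy_measure_integrals.
Context {R : realType}.
Variable nu : {measure set R -> \bar R}.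
Local Notation D := (`]0, +oo[%classic : set R).

Hypothesis nu_levy : levy_measure nu.

Let mD : measurable D. Proof. exact: measurable_itv. Qed.

Let mmin : measurable_fun setT (fun y : R => Num.min 1 y).
Proof. by apply: measurable_minr => //; exact: measurable_cst. Qed.

Lemma levy_ray_lty (y : R) : 0 < y -> (nu `[y, +oo[%classic < +oo)%E.
Proof.
move=> y0; have m0 : 0 < Num.min 1 y by rewrite lt_min ltr01.
have h : ((Num.min 1 y)%:E * nu `[y, +oo[%classic <= \int[nu]_(y in D) (Num.min 1 y)%:E)%E.
  have -> : nu `[y, +oo[%classic = (\int[nu]_(x in D) (\1_(`[y, +oo[%classic) x)%:E)%E.
    rewrite integral_indic//; congr (nu _); apply/seteqP.
    split => x; rewrite /= !in_itv/= !andbT; last by case.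
    by move=> yx; rewrite yx (lt_le_trans y0 yx).
  rewrite -ge0_integralZl_EFin//; last 2 first.
  - by apply/measurable_EFinP; apply: measurable_indic.
  - exact: ltW.
  apply: ge0_le_integral => //.
  - by move=> x _; rewrite mule_ge0// lee_fin// ltW.
  - by apply: emeasurable_funM => //; apply/measurable_EFinP; exact: measurable_indic.
  - by apply/measurable_EFinP; exact: measurable_funS mmin.
  move=> x; rewrite /= in_itv/= andbT => x0; rewrite indicE mem_setE in_itv/= andbT.
  case: (leP y x) => yx; last by rewrite mule0 lee_fin le_min ler01 ltW.
  by rewrite mule1 lee_fin le_min !ge_min lexx/= yx orbT.
have := le_lt_trans h nu_levy.2; case: (nu _) => [r _||//]; first exact: ltry.
by rewrite gt0_muley// lte_fin.
Qed.

Lemma levy_tailE (y : R) : 0 < y -> (levy_tail nu y)%:E = nu `[y, +oo[%classic.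
Proof. by move=> y0; rewrite /levy_tail fineK// ge0_fin_numE// levy_ray_lty. Qed.

Lemma levy_tail_ge0 (y : R) : 0 <= levy_tail nu y.
Proof. exact: fine_ge0. Qed.

(** The common dominating function of the integrals against [nu]: the factor min(1, y) serves near
    0, the exponential at infinity. *)
Definition weight (delta y : R) : R := Num.min 1 y * expR (delta * y).

Definition weight_integrable (delta : R) : Prop :=
  (\int[nu]_(y in D) (weight delta y)%:E < +oo)%E.

Lemma measurable_exp_linear (a : R) : measurable_fun setT (fun y : R => expR (a * y)).
Proof. by apply: measurableT_comp => //; exact: measurable_funM. Qed.

Lemma measurable_weight (delta : R) : measurable_fun setT (weight delta).
Proof. by apply: measurable_funM => //; exact: measurable_exp_linear. Qed.

Lemma weight_ge0 (delta y : R) : 0 < y -> 0 <= weight delta y.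
Proof. by move=> y0; rewrite mulr_ge0 ?expR_ge0// le_min ler01 ltW. Qed.

(** [delta] is half the exponent of (R). On [b + k, b + k + 1[ the weight is at most e^(delta (b + k
    + 1)) and the tail at most C e^(- 2 delta (b + k)), which gives a geometric series of ratio
    e^-delta; below b the factor min(1, y) suffices. *)
Lemma exists_weight_integrable : condition_R nu -> exists2 delta, 0 < delta & weight_integrable delta.
Proof.
move=> [e [e0 /eqO_exP[C C0 hC]]].
have {hC} [b [b1 hb]] : exists b, 1 <= b /\
    forall y, b <= y -> levy_tail nu y <= C * expR (- e * y).
  move: hC => [b0 [_ hb]]; exists (Num.max 1 (b0 + 1)); split; first by rewrite le_max lexx.
  move=> y; rewrite ge_max => /andP[y1 yb].
  have /hb : b0 < y by apply: lt_le_trans yb; rewrite ltrDl.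
  by rewrite ger0_norm ?levy_tail_ge0// ger0_norm ?expR_ge0.
have b0 : 0 < b by exact: lt_le_trans b1.
pose delta := e / 2; have d0 : 0 < delta by rewrite divr_gt0.
exists delta => //.
pose f k (y : R) : \bar R := (expR (delta * (b + k.+1%:R)) * \1_(`[b + k%:R, +oo[%classic) y)%:E.
have f0 k y : (0 <= f k y)%E by rewrite lee_fin mulr_ge0 ?expR_ge0.
have mf k : measurable_fun D (f k).
  by apply/measurable_EFinP; apply: measurable_funM => //; exact: measurable_indic.
pose g (y : R) : \bar R := ((Num.min 1 y) * expR (delta * b))%:E.
have g0 y : D y -> (0 <= g y)%E.
  by rewrite /= in_itv/= andbT => y0; rewrite lee_fin mulr_ge0 ?expR_ge0// le_min ler01 ltW.
have mg : measurable_fun D g.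
  by apply/measurable_EFinP; apply: measurable_funM => //; exact: measurable_funS mmin.
have bk0 k : 0 < b + k%:R by rewrite ltr_wpDr.
have h : (\int[nu]_(y in D) (weight delta y)%:E <=
    \int[nu]_(y in D) (g y + \sum_(0 <= k <oo) f k y))%E.
  apply: ge0_le_integral => //.
  - by move=> y; rewrite /= in_itv/= andbT => y0; rewrite lee_fin weight_ge0.
  - by apply/measurable_EFinP; apply: measurable_funS (measurable_weight delta).
  - by apply: emeasurable_funD => //; exact: ge0_emeasurable_sum.
  move=> y Dy; have y0 : 0 < y by move: Dy; rewrite /= in_itv/= andbT.
  have [yb|by_] := ltP y b.
    apply: (@le_trans _ _ (g y)).
      rewrite lee_fin ler_wpM2l ?le_min ?ler01 ?(ltW y0)// ler_expR ler_pM2l//; exact: ltW.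
    by rewrite leeDl// nneseries_ge0.
  pose k := Num.truncn (y - b).
  have := @truncn_itv R (y - b); rewrite subr_ge0 => /(_ by_)/andP[k1 k2].
  apply: (@le_trans _ _ (f k y)).
    rewrite lee_fin indicE mem_set ?mulr1; last by rewrite /= in_itv/= andbT -lerBrDl.
    apply: le_trans (_ : 1 * expR (delta * y) <= _).
      by rewrite ler_wpM2r ?expR_ge0// ge_min lexx.
    by rewrite mul1r ler_expR ler_pM2l// -lerBlDl ltW.
  apply: (@le_trans _ _ (\sum_(0 <= i <oo) f i y)%E); last by rewrite leeDr// g0.
  apply: le_trans (nneseries_lim_ge (u_ := fun i => f i y) (P := xpredT) k.+1 _) => //.
  by rewrite big_nat_recr//= leeDr// sume_ge0.
apply: le_lt_trans h _.
rewrite ge0_integralD//; last 2 first.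
- by move=> y _; exact: nneseries_ge0.
- exact: ge0_emeasurable_sum.
apply: lte_add_pinfty.
  under eq_integral do rewrite /g EFinM muleC.
  rewrite ge0_integralZl_EFin ?expR_ge0//; last 2 first.
  - by move=> y; rewrite /= in_itv/= andbT => y0; rewrite lee_fin le_min ler01 ltW.
  - by apply/measurable_EFinP; exact: measurable_funS mmin.
  by apply: lte_mul_pinfty; rewrite ?lee_fin ?expR_ge0//; exact: nu_levy.2.
rewrite integral_nneseries//.
pose C' := C * expR (delta * (b + 1)) * expR (- e * b).
pose r := expR (- delta).
have r01 : 0 <= r < 1 by rewrite expR_ge0/= /r -expR0 ltr_expR oppr_lt0.
have fk k : (\int[nu]_(y in D) f k y <= (C' * r ^+ k)%:E)%E.
  rewrite /f; under eq_integral do rewrite EFinM.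
  rewrite ge0_integralZl_EFin ?expR_ge0//; last first.
    by apply/measurable_EFinP; exact: measurable_indic.
  rewrite integral_indic//.
  rewrite (_ : _ `&` _ = `[b + k%:R, +oo[%classic); last first.
    apply/seteqP; split => x; rewrite /= !in_itv/= !andbT; first by case.
    by move=> yx; rewrite yx (lt_le_trans (bk0 k) yx).
  rewrite -levy_tailE// -EFinM lee_fin.
  apply: le_trans (_ : expR (delta * (b + k.+1%:R)) * (C * expR (- e * (b + k%:R))) <= _).
    by rewrite ler_wpM2l ?expR_ge0// hb// lerDl.
  rewrite /C' /r -expRM_natl -!mulrA mulrCA ler_wpM2l ?(ltW C0)// -!expRD ler_expR.
  by rewrite -natr1 /delta -subr_ge0 [leRHS](_ : _ = 0)//; field.
apply: (@le_lt_trans _ _ (C' * (1 - r)^-1)%:E); last exact: ltry.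
apply: lime_le; first by apply: is_cvg_nneseries => k _ _; exact: integral_ge0.
apply: nearW => n; apply: (@le_trans _ _ (\sum_(0 <= k < n) (C' * r ^+ k)%:E)%E).
  by apply: lee_sum => k _; exact: fk.
rewrite sumEFin lee_fin -mulr_sumr ler_wpM2l ?geometric_sum_le//.
by rewrite /C' !mulr_ge0 ?expR_ge0// ltW.
Qed.

(** * Integrals against the Lévy measure *)

Section weighted_integrals.
Variable delta : R.
Hypotheses (delta0 : 0 < delta) (deltaW : weight_integrable delta).
Implicit Types f g : R -> R.

(** Domination is asked for positive arguments only, since the integrals against [nu] extend over
    these. *)
Definition weight_bounded f : Prop :=
  measurable_fun setT f /\ exists C, forall y, 0 < y -> `|f y| <= C * weight delta y.

Lemma integrable_weight : nu.-integrable D (fun y => (weight delta y)%:E).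
Proof.
apply/integrableP; split.
  by apply/measurable_EFinP; exact: measurable_funS (measurable_weight delta).
under eq_integral => y.
  rewrite inE/= in_itv/= andbT => y0; rewrite ger0_norm ?weight_ge0//.
  over.
exact: deltaW.
Qed.

Lemma weight_bounded_integrable f : weight_bounded f -> nu.-integrable D (EFin \o f).
Proof.
move=> [mf [C hC]]; apply: (@le_integrable _ _ _ nu D mD _ (fun y => (C * weight delta y)%:E)).
- by apply/measurable_EFinP; exact: measurable_funS mf.
- move=> y; rewrite /= in_itv/= andbT => y0; rewrite lee_fin.
  by apply: le_trans (hC y y0) _; exact: ler_norm.
rewrite (_ : (fun y => _) = (fun y => C%:E * (weight delta y)%:E)%E)//.
by apply: integrableZl => //; exact: integrable_weight.
Qed.

Lemma weight_boundedZ c f : weight_bounded f -> weight_bounded (fun y => c * f y).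
Proof.
move=> [mf [C hC]]; split; first exact: measurable_funM.
by exists (`|c| * C) => y y0; rewrite normrM -mulrA ler_wpM2l ?hC.
Qed.

Lemma weight_boundedD f g : weight_bounded f -> weight_bounded g ->
  weight_bounded (fun y => f y + g y).
Proof.
move=> [mf [C hC]] [mg [C' hC']]; split; first exact: measurable_funD.
exists (C + C') => y y0; rewrite mulrDl; apply: le_trans (ler_normD _ _) _.
by rewrite lerD ?hC ?hC'.
Qed.

Lemma weight_boundedB f g : weight_bounded f -> weight_bounded g ->
  weight_bounded (fun y => f y - g y).
Proof.
move=> hf /(weight_boundedZ (-1)) hg.
by rewrite (_ : (fun y => _) = fun y => f y + -1 * g y);
  [exact: weight_boundedD|apply/funext => y; rewrite mulN1r].
Qed.

Lemma weight_bounded_sum (I : Type) (s : seq I) (F : I -> R -> R) :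
  (forall i, weight_bounded (F i)) -> weight_bounded (fun y => \sum_(i <- s) F i y).
Proof.
move=> hF; elim: s => [|i s IH].
  split; first by under eq_fun do rewrite big_nil; exact: measurable_cst.
  by exists 0 => y _; rewrite big_nil normr0 mul0r.
by under eq_fun do rewrite big_cons; exact: weight_boundedD.
Qed.

Lemma weight_bounded_le f g C : measurable_fun setT f -> weight_bounded g ->
  (forall y, 0 < y -> `|f y| <= C * `|g y|) -> 0 <= C -> weight_bounded f.
Proof.
move=> mf [mg [C' hC']] fg C0; split=> //; exists (C * C') => y y0.
by apply: le_trans (fg y y0) _; rewrite -mulrA ler_wpM2l// hC'.
Qed.

Definition nu_mean f : R := \int[nu]_(y in D) f y.

Lemma nu_meanD f g : weight_bounded f -> weight_bounded g ->
  nu_mean (fun y => f y + g y) = nu_mean f + nu_mean g.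
Proof. by move=> hf hg; apply: RintegralD => //; exact: weight_bounded_integrable. Qed.

Lemma nu_meanZ c f : weight_bounded f -> nu_mean (fun y => c * f y) = c * nu_mean f.
Proof. by move=> hf; apply: RintegralZl => //; exact: weight_bounded_integrable. Qed.

Lemma nu_meanB f g : weight_bounded f -> weight_bounded g ->
  nu_mean (fun y => f y - g y) = nu_mean f - nu_mean g.
Proof. by move=> hf hg; apply: RintegralB => //; exact: weight_bounded_integrable. Qed.

Lemma nu_mean_sum (I : Type) (s : seq I) (F : I -> R -> R) :
  (forall i, weight_bounded (F i)) ->
  nu_mean (fun y => \sum_(i <- s) F i y) = \sum_(i <- s) nu_mean (F i).
Proof.
move=> hF; elim: s => [|i s IH].
  by rewrite /nu_mean; under eq_Rintegral do rewrite big_nil; rewrite big_nil Rintegral_cst// mul0r.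
rewrite big_cons -IH -nu_meanD//; last exact: weight_bounded_sum.
by apply: eq_Rintegral => y _; rewrite big_cons.
Qed.

Lemma eq_nu_mean f g : (forall y, 0 < y -> f y = g y) -> nu_mean f = nu_mean g.
Proof.
by move=> fg; apply: eq_Rintegral => y; rewrite inE/= in_itv/= andbT => /fg.
Qed.

Lemma nu_mean_le f g : weight_bounded f -> weight_bounded g ->
  (forall y, 0 < y -> f y <= g y) -> nu_mean f <= nu_mean g.
Proof.
move=> hf hg fg; apply: le_Rintegral => //; try exact: weight_bounded_integrable.
by move=> y; rewrite /= in_itv/= andbT => /fg.
Qed.

Lemma nu_mean0 : nu_mean (fun=> 0) = 0.
Proof. by rewrite /nu_mean Rintegral_cst// mul0r. Qed.

Lemma nu_mean_ge0 f : (forall y, 0 < y -> 0 <= f y) -> 0 <= nu_mean f.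
Proof.
by move=> f0; apply: Rintegral_ge0 => y; rewrite /= in_itv/= andbT => /f0.
Qed.

Lemma nu_mean_norm f g : weight_bounded f -> weight_bounded g ->
  (forall y, 0 < y -> `|f y| <= g y) -> `|nu_mean f| <= nu_mean g.
Proof.
move=> hf hg fg; rewrite ler_norml; apply/andP; split.
  rewrite -mulN1r -nu_meanZ//; apply: nu_mean_le => //; first exact: weight_boundedZ.
  by move=> y /fg; rewrite mulN1r ler_norml => /andP[].
by apply: nu_mean_le => // y /fg; rewrite ler_norml => /andP[].
Qed.

Lemma weight_bounded_min : weight_bounded (fun y => Num.min 1 y).
Proof.
split=> //; exists 1 => y y0; rewrite mul1r ger0_norm ?le_min ?ler01 ?(ltW y0)//.
rewrite ler_peMr ?le_min ?ler01 ?(ltW y0)// -expR0 ler_expR mulr_ge0 ?(ltW y0)//.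
exact: ltW.
Qed.

Lemma exp_diff_min (rho y : R) : 0 <= rho -> 0 < y ->
  0 <= 1 - expR (- rho * y) <= (1 + rho) * Num.min 1 y.
Proof.
move=> r0 y0; have e1 : expR (- rho * y) <= 1.
  by rewrite -expR0 ler_expR mulNr oppr_le0 mulr_ge0// ltW.
rewrite subr_ge0 e1/=; have [y1|y1] := leP 1 y.
  by rewrite mulr1 ler_wpDr// gerBl expR_ge0.
apply: le_trans (_ : rho * y <= _); last by rewrite ler_wpM2r ?(ltW y0)// lerDr.
by rewrite lerBlDl -lerBlDr; apply: le_trans (expR_ge1Dx _); rewrite mulNr.
Qed.

Lemma measurable_exp_diff (rho : R) : measurable_fun setT (fun y : R => 1 - expR (- rho * y)).
Proof. by apply: measurable_funB => //; exact: measurable_exp_linear. Qed.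

Lemma weight_bounded_exp (rho : R) : 0 <= rho -> weight_bounded (fun y => 1 - expR (- rho * y)).
Proof.
move=> r0; apply: (@weight_bounded_le _ (fun y => Num.min 1 y) (1 + rho)).
- exact: measurable_exp_diff.
- exact: weight_bounded_min.
- move=> y y0; have /andP[h0 h1] := exp_diff_min r0 y0.
  by rewrite !ger0_norm// le_min ler01 ltW.
- by rewrite addr_ge0.
Qed.

(** Euler's constant is merged into [c], which later cancels in differences. *)
Lemma levy_tail_near0 : condition_L nu -> exists c eps C e, [/\ 0 < eps, 0 < C, 0 < e &
  forall y, 0 < y -> y < e -> `|levy_tail nu y - (- ln y + c)| <= C * y `^ eps].
Proof.
move=> [c [eps [eps0]]] /eqaddOP /bigO_exP[C C0].
move=> hn; have {hn} : nbhs (0 : R) (fun x => 0 < x ->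
  `|(levy_tail nu - (fun y : R => - ln y + c - (euler_gamma : R))) x| <= C * `|x `^ eps|) by [].
rewrite -nbhs_ballE => -[e /= e0 he].
exists (c - (euler_gamma : R)), eps, C, e; split=> // y y0 ye.
have := he y; rewrite /ball/= sub0r normrN gtr0_norm// => /(_ ye y0).
by rewrite [`|y `^ eps|]ger0_norm ?powR_ge0// => h; rewrite addrA; exact: h.
Qed.

(** By (L) the tail tends to infinity at 0, so that [nu] charges some ray. *)
Lemma laplace_exponent1_gt0 : condition_L nu -> 0 < laplace_exponent nu 1.
Proof.
move=> /levy_tail_near0[c [eps [C [e [eps0 C0 e0 he]]]]].
have [y0 [y00 ty]] : exists y0, 0 < y0 /\ 0 < levy_tail nu y0.
  (* At the point e^(-K) the main term of the tail is K + c, larger than the error bound C, and this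
     point lies below [e]. *)
  pose K := `|C - c| + `|ln e| + 1.
  have K0 : 0 < K by rewrite ltr_wpDl// addr_ge0.
  exists (expR (- K)); split; first exact: expR_gt0.
  have ye : expR (- K) < e.
    rewrite -[ltRHS]lnK ?posrE// ltr_expR ltrNl /K -addrA ltr_wpDl//.
    by apply: le_lt_trans (_ : `|ln e| < _); [rewrite -normrN ler_norm|rewrite ltrDl].
  have := he _ (expR_gt0 _) ye; rewrite expRK opprK ler_distl => /andP[h _].
  have : expR (- K) `^ eps <= 1.
    by rewrite /powR gt_eqF ?expR_gt0// expRK -expR0 ler_expR mulrN oppr_le0 mulr_ge0// ltW.
  rewrite -(ler_pM2l C0) mulr1 => h2.
  have : C - c <= `|C - c| by exact: ler_norm.
  have : 0 <= `|ln e| by [].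
  by move: h; rewrite /K; lra.
have e1 : 0 < 1 - expR (- y0) by rewrite subr_gt0 -expR0 ltr_expR oppr_lt0.
apply: (@lt_le_trans _ _ ((1 - expR (- y0)) * levy_tail nu y0)); first exact: mulr_gt0.
have mI : measurable_fun setT (\1_(`[y0, +oo[%classic) : R -> R).
  exact: measurable_indic.
have -> : levy_tail nu y0 = nu_mean (\1_(`[y0, +oo[%classic)).
  rewrite /nu_mean /Rintegral integral_indic// /levy_tail; congr (fine (nu _)).
  apply/seteqP; split => x; rewrite /= !in_itv/= !andbT; last by case.
  by move=> yx; rewrite yx (lt_le_trans y00 yx).
have wI : weight_bounded (\1_(`[y0, +oo[%classic)).
  apply: (@weight_bounded_le _ (fun y => Num.min 1 y) (Num.min 1 y0)^-1) => //.
  - exact: weight_bounded_min.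
  - move=> y yp; rewrite indicE mem_setE in_itv/= andbT.
    have m0 : 0 < Num.min 1 y0 by rewrite lt_min ltr01.
    rewrite [`|Num.min 1 y|]ger0_norm ?le_min ?ler01 ?(ltW yp)//.
    case: (leP y0 y) => yy; last by rewrite normr0 mulr_ge0 ?invr_ge0 ?(ltW m0)// le_min ler01 ltW.
    by rewrite normr1 -div1r mulrAC mul1r ler_pdivlMr// mul1r le_min !ge_min lexx/= yy orbT.
  - by rewrite invr_ge0 le_min ler01 ltW.
rewrite -nu_meanZ//; apply: nu_mean_le.
- exact: weight_boundedZ.
- exact: weight_bounded_exp.
move=> y yp; rewrite indicE mem_setE in_itv/= andbT mulN1r.
case: (leP y0 y) => yy; rewrite ?mulr1 ?mulr0.
  by rewrite lerD2l lerN2 ler_expR lerN2.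
by rewrite subr_ge0 -expR0 ler_expR oppr_le0 ltW.
Qed.

End weighted_integrals.
End levy_measure_integrals.

Lemma unif01_itv_le {R : realType} (a b : R) : 0 <= a -> b <= 1 ->
  (@unif01 R `[a, b]%classic <= (Num.max 0 (b - a))%:E)%E.
Proof.
move=> a0 b1; have [ba|ab] := ltP b a.
  rewrite set_itv_ge ?bnd_simp -?ltNge// (@measure0 _ _ _ unif01) lee_fin le_max lexx//.
have -> : `[a, b]%classic = (`]-oo, b] `\` `]-oo, a[)%classic :> set R.
  apply/seteqP; split => x; rewrite /= !in_itv/=; first by move=> /andP[ax ->]; split => //; apply/negP; rewrite -leNgt.
  by move=> [-> /negP]; rewrite -leNgt => ->.
rewrite measureD//=; last by apply: le_lt_trans (probability_le1 unif01 _) (ltry _) => //; exact: measurable_itv.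
rewrite setIidr; last by move=> x /=; rewrite !in_itv/= => /ltW/le_trans; apply.
have a1 := le_trans ab b1; have b0 := le_trans a0 ab.
have := unif01_ray a; rewrite /unif01 => ->.
have := @unif01_ray_closed R b; rewrite b0 b1 /unif01 => /(_ isT) ->.
by rewrite -EFinB clamp_id ?a0// lee_fin le_max lexx orbT.
Qed.

(** * Null events *)

Section near_grid.
Context {R : realType}.
Variable s : R -> R.
Hypothesis s0 : s 0 = 0.
Hypothesis s_mono : forall a b, 0 <= a -> a <= b -> s a <= s b.
Hypothesis s_rc : forall t, 0 <= t -> s x @[x --> t^'+] --> s t.

Definition near_grid N (eta : R) k (x : R) : bool :=
  [&& frag s (grid N k) <= x, x <= frag s (grid N k.+1) &
      (x < frag s (grid N k) + eta) || (frag s (grid N k.+1) - eta < x)].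

Lemma frag_ge0 t : 0 <= t -> 0 <= frag s t.
Proof. by move=> t0; rewrite subr_ge0 -expR0 ler_expR oppr_le0 -s0 s_mono. Qed.

Lemma frag_le1 t : frag s t <= 1.
Proof. by rewrite gerBl expR_ge0. Qed.

Lemma grid_nat N K : grid N (K * 2 ^ N) = K%:R :> R.
Proof. by rewrite -{1}[N]add0n grid_scale /grid expr0 divr1. Qed.

(** A point of the closed range is within [eta] of the value at some dyadic time, which is a grid
    value on all finer grids. By monotonicity, the end of the cell of [x] facing that value is at
    least as close to [x]. *)
Lemma closed_range_near_grid (x eta : R) (K : nat) : closed_range s x -> 0 <= x ->
  x < frag s K%:R -> 0 < eta ->
  exists N0, forall N, (N0 <= N)%N -> exists2 k, (k < K * 2 ^ N)%N & near_grid N eta k x.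
Proof.
move=> xcl x0 xK eta0.
have e0 : 0 < Num.min eta (frag s K%:R - x) by rewrite lt_min eta0 subr_gt0.
have /closed_rangeP/(_ _ e0)[t [t0 ht]] := xcl.
have [N0 [k0 [k00 tk /andP[h1 h2]]]] := frag_grid s_mono s_rc t0 ht.
have {}h1 : x < frag s (grid N0 k0) + eta.
  by rewrite -ltrBlDr; apply: le_lt_trans h1; rewrite lerD2l lerN2 ge_min lexx.
have {}h2 : frag s (grid N0 k0) - eta < x.
  by rewrite ltrBlDr; apply: lt_le_trans h2 _; rewrite lerD2l ge_min lexx.
exists N0 => N N0N; pose l := (k0 * 2 ^ (N - N0))%N.
have gl : grid N l = grid N0 k0 :> R by rewrite -{1}(subnKC N0N) grid_scale.
pose p k := frag s (grid N k) <= x.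
have p0 : p 0%N by rewrite /p /grid mul0r /frag s0 oppr0 expR0 subrr.
have pK k : p k -> (k < K * 2 ^ N)%N.
  rewrite ltnNge; apply: contraTN => Kk; rewrite /p -ltNge; apply: lt_le_trans xK _.
  by rewrite -(grid_nat N); apply: frag_mono => //; [exact: grid_ge0|exact: grid_mono].
case: (@ex_maxnP p (K * 2 ^ N) (ex_intro _ 0%N p0) (fun k h => ltnW (pK k h))) => k pk kmax.
exists k; first exact: pK.
have pk1 : x < frag s (grid N k.+1).
  by rewrite ltNge; apply/negP => /kmax; rewrite ltnn.
rewrite /near_grid -/(p k) pk (ltW pk1)/=.
have mono a b : (a <= b)%N -> frag s (grid N a) <= frag s (grid N b).
  by move=> ab; apply: frag_mono => //; [exact: grid_ge0|exact: grid_mono].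
have [lk|kl] := leqP l k; apply/orP; [left|right].
  by apply: lt_le_trans h1 _; rewrite lerD2r -gl mono.
by apply: le_lt_trans h2; rewrite lerD2r -gl mono.
Qed.

Lemma measurable_near_grid N eta k : measurable [set x : measurableTypeR R | near_grid N eta k x].
Proof.
set a := frag s (grid N k); set b := frag s (grid N k.+1).
rewrite (_ : mkset _ = (`[a, b] `&` (`]-oo, a + eta[ `|` `]b - eta, +oo[))%classic).
  apply: measurableI; first exact: measurable_itv.
  by apply: measurableU; exact: measurable_itv.
apply/seteqP; split => x /=; rewrite !in_itv/= /near_grid andbT.
  by move=> /and3P[-> -> /orP]; split.
by move=> [/andP[-> ->] /orP ->].
Qed.

(** There are two end pieces, neither longer than [eta] nor than the cell, whose length is at most
    the increment of [s]. *)
Lemma near_grid_prob N eta k : 0 < eta -> (@unif01 R [set x | near_grid N eta k x] <=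
  (2 * Num.min eta (s (grid N k.+1) - s (grid N k)))%:E)%E.
Proof.
move=> eta0.
set a := frag s (grid N k); set b := frag s (grid N k.+1).
have a0 : 0 <= a by apply: frag_ge0; exact: grid_ge0.
have b1 : b <= 1 by exact: frag_le1.
have sx : 0 <= s (grid N k.+1) - s (grid N k).
  by rewrite subr_ge0 s_mono// ?grid_ge0// grid_mono.
have ba : b - a <= s (grid N k.+1) - s (grid N k).
  have -> : b - a = expR (- s (grid N k)) * (1 - expR (- (s (grid N k.+1) - s (grid N k)))).
    have eE : expR (- s (grid N k.+1)) =
      expR (- s (grid N k)) * expR (- (s (grid N k.+1) - s (grid N k))).
      by rewrite -expRD; congr expR; ring.
    by rewrite /b /a /frag eE; ring.
  have e1 : expR (- s (grid N k)) <= 1.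
    by rewrite -expR0 ler_expR oppr_le0 -s0 s_mono// grid_ge0.
  have e2 := expR_ge1Dx (- (s (grid N k.+1) - s (grid N k))).
  have e3 : expR (- (s (grid N k.+1) - s (grid N k))) <= 1.
    by rewrite -expR0 ler_expR oppr_le0.
  apply: (@le_trans _ _ (1 * (1 - expR (- (s (grid N k.+1) - s (grid N k)))))).
    by rewrite ler_wpM2r// subr_ge0.
  by rewrite mul1r lerBlDl -lerBlDr.
have ab0 : 0 <= b - a.
  by rewrite subr_ge0; apply: frag_mono => //; [exact: grid_ge0|exact: grid_mono].
apply: (@le_trans _ _ (unif01 (`[a, Num.min b (a + eta)] `|` `[Num.max a (b - eta), b])%classic)).
  apply: le_measure; rewrite ?inE//; first exact: measurable_near_grid.
    by apply: measurableU; exact: measurable_itv.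
  move=> x /= /and3P[ax xb /orP[h|h]]; [left|right]; rewrite /= in_itv/=.
    by rewrite ax le_min xb ltW.
  by rewrite xb ge_max ax ltW.
have m0 : 0 <= Num.min eta (s (grid N k.+1) - s (grid N k)) by rewrite le_min (ltW eta0).
apply: le_trans (measureU2 _ _ _) _; [exact: measurable_itv|exact: measurable_itv|].
rewrite mulr_natl mulr2n EFinD; apply: leeD.
  apply: le_trans (unif01_itv_le a0 _) _; first by rewrite ge_min b1.
  rewrite lee_fin ge_max m0/= le_min; apply/andP; split.
    by rewrite lerBlDl ge_min lexx orbT.
  by apply: le_trans ba; rewrite lerD2r ge_min lexx.
apply: le_trans (unif01_itv_le _ b1) _; first by rewrite le_max a0.
rewrite lee_fin ge_max m0/= le_min; apply/andP; split.
  by rewrite lerBlDl -lerBlDr le_max lexx orbT.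
by apply: le_trans ba; rewrite lerD2l lerN2 le_max lexx.
Qed.

End near_grid.

Lemma indic_bool {T : Type} {R : realType} (b : T -> bool) :
  (fun w => (b w)%:R : R) = \1_[set w | b w].
Proof.
apply/funext => w; rewrite indicE; case: (boolP (b w)) => h; first by rewrite mem_set.
by rewrite memNset//=; exact/negP.
Qed.

Lemma bounded_mfun_bool {d : measure_display} {T : measurableType d} {R : realType}
  (b : T -> bool) : measurable_fun setT b -> bounded_mfun (fun w => (b w)%:R : R).
Proof.
move=> mb; rewrite indic_bool; apply: bounded_mfun_indic.
by have := mb measurableT [set true]; rewrite setTI; apply.
Qed.

Lemma bounded_mfun_near_grid {d1 d2 : measure_display} {T1 : measurableType d1}
    {T2 : measurableType d2} {R : realType} (S : R -> T1 -> R) (v : T2 -> R) N (eta : R) k :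
  (forall t, 0 <= t -> measurable_fun setT (S t)) -> measurable_fun setT v ->
  bounded_mfun (fun p : T1 * T2 => (near_grid (S ^~ p.1) N eta k (v p.2))%:R : R).
Proof.
move=> mS mv; apply: bounded_mfun_bool.
have mf k' := measurableT_comp (measurable_frag_path mS (grid_ge0 N k')) (@measurable_fst _ _ T1 T2).
have m2 := measurableT_comp mv (@measurable_snd _ _ T1 T2).
apply: measurable_and; first exact: measurable_fun_ler (mf k) m2.
apply: measurable_and; first exact: measurable_fun_ler m2 (mf k.+1).
apply: measurable_or.
  by apply: (measurable_fun_ltr m2); exact: measurable_funD (mf k) (measurable_cst _).
by apply: measurable_fun_ltr m2; exact: measurable_funB (mf k.+1) (measurable_cst _).
Qed.

Lemma bounded_mfun_above_frag {d1 d2 : measure_display} {T1 : measurableType d1}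
    {T2 : measurableType d2} {R : realType} (S : R -> T1 -> R) (v : T2 -> R) (t : R) : 0 <= t ->
  (forall t, 0 <= t -> measurable_fun setT (S t)) -> measurable_fun setT v ->
  bounded_mfun (fun p : T1 * T2 => (frag (S ^~ p.1) t <= v p.2)%R%:R : R).
Proof.
move=> t0 mS mv; apply: bounded_mfun_bool.
have m1 := measurableT_comp (measurable_frag_path mS t0) (@measurable_fst _ _ T1 T2).
have m2 := measurableT_comp mv (@measurable_snd _ _ T1 T2).
exact: measurable_fun_ler m1 m2.
Qed.

Lemma bounded_mfun_diag {d : measure_display} {T : measurableType d} {R : realType}
  (F : T * T -> R) : bounded_mfun F -> bounded_mfun (fun w => F (w, w)).
Proof.
move=> [mF [c hc]]; split; last by exists c => w.
exact: (measurableT_comp mF (measurable_fun_pair (@measurable_id _ _ setT) (@measurable_id _ _ setT))).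
Qed.

Section null_events.
Context {d : measure_display} {T : measurableType d} {R : realType}.
Variables (P : probability T R) (S : R -> T -> R) (n : nat) (u : 'I_n -> T -> R).
Variable nu : {measure set R -> \bar R}.
Hypothesis S_sub : subordinator P S.
Hypothesis S_nu : driftfree_with_levy_measure P S nu.
Hypothesis u_iid : iid_uniform P u.
Hypothesis u_S : independent_of_process P S u.

Let S0 w : S 0 w = 0. Proof. exact: (subordinator0 S_sub). Qed.
Let S_mono w (a b : R) : 0 <= a -> a <= b -> S a w <= S b w.
Proof. exact: (subordinator_nondecreasing S_sub). Qed.
Let S_rc w (t : R) : 0 <= t -> S x w @[x --> t^'+] --> S t w.
Proof. exact: (subordinator_right_continuous S_sub). Qed.
Let mS (t : R) : 0 <= t -> measurable_fun setT (S t).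
Proof. exact: (subordinator_measurable S_sub). Qed.
Let mu' i : measurable_fun setT (u i). Proof. exact: (u_iid.1 i).1. Qed.

Lemma measurable_frag (t : R) : 0 <= t -> measurable_fun setT (fun w => frag (S ^~ w) t).
Proof. by move=> t0; exact: measurable_frag_path. Qed.

Lemma measurable_avoid (V W : T -> R) : measurable_fun setT V -> measurable_fun setT W ->
  measurable [set w | forall x, V w <= x <= W w -> ~ closed_range (S ^~ w) x].
Proof.
move=> mV mW.
have lt_set (f g : T -> R) : measurable_fun setT f -> measurable_fun setT g ->
    measurable [set w | f w < g w].
  by move=> mf mg; have := measurable_fun_ltr mf mg measurableT (Y := [set true]); rewrite setTI; apply.
rewrite (_ : mkset _ = [set w | W w < V w] `|` \bigcup_m \bigcap_N \bigcap_k
  ~` ([set w | V w - m.+1%:R^-1 < frag (S ^~ w) (grid N k)] `&`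
      [set w | frag (S ^~ w) (grid N k) < W w + m.+1%:R^-1])).
  apply: measurableU; first exact: lt_set.
  apply: bigcup_measurable => m _; apply: bigcapT_measurable => N; apply: bigcapT_measurable => k.
  apply: measurableC; apply: measurableI; apply: lt_set.
  - by apply: measurable_funB.
  - by apply: measurable_frag; exact: grid_ge0.
  - by apply: measurable_frag; exact: grid_ge0.
  - by apply: measurable_funD.
apply/seteqP; split => w /=.
  move=> /(avoidP (@S_mono w) (@S_rc w))[h|[m h]]; [by left|right].
  by exists m => // N _ k _ /= [h1 h2]; apply: (h N k); rewrite h1.
move=> h; apply/(avoidP (@S_mono w) (@S_rc w)).
case: h => [h|[m _ h]]; [by left|right; exists m => N k /andP[h1 h2]].
exact: (h N Logic.I k Logic.I).
Qed.

Lemma measurable_in_closed_range i : measurable [set w | closed_range (S ^~ w) (u i w)].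
Proof.
rewrite (_ : mkset _ = ~` [set w | forall x, u i w <= x <= u i w -> ~ closed_range (S ^~ w) x]).
  by apply: measurableC; exact: measurable_avoid.
apply/seteqP; split => w /=; first by move=> h /(_ (u i w)); rewrite lexx => /(_ isT).
move=> /existsNP[x /not_implyP[/andP[h1 h2]]] /contrapT.
by rewrite (_ : x = u i w)//; apply/eqP; rewrite eq_le h1 h2.
Qed.

Lemma laplace_mean (t rho : R) : 0 <= t -> 0 <= rho ->
  \int[P]_w expR (- rho * S t w) = expR (- t * laplace_exponent nu rho).
Proof.
by move=> t0 r0; have := S_nu.2 t rho t0 r0; rewrite unlock /Rintegral => ->.
Qed.

Lemma exp_path01 (t rho : R) w : 0 <= t -> 0 <= rho -> 0 <= expR (- rho * S t w) <= 1.
Proof.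
move=> t0 r0; rewrite expR_ge0/= -expR0 ler_expR mulNr oppr_le0 mulr_ge0//.
by rewrite -(S0 w) S_mono.
Qed.

Lemma bounded_mfun_exp_path (t rho : R) : 0 <= t -> 0 <= rho ->
  bounded_mfun (fun w => expR (- rho * S t w)).
Proof.
move=> t0 r0; split; first by apply: measurable_expR_comp; apply: measurable_funM => //; exact: mS.
by exists 1 => w; have /andP[h0 h1] := exp_path01 w t0 r0; rewrite ger0_norm.
Qed.

(** Replaces a truncated increment by a Laplace functional, whose mean is explicit; the constant 2
    comes from 1 - e^-v >= v / 2 on the unit interval. *)
Lemma min_exp_le (eta x : R) : 0 < eta -> 0 <= x ->
  Num.min eta x <= 2 * eta * (1 - expR (- eta^-1 * x)).
Proof.
move=> eta0 x0; pose v := Num.min 1 (x / eta).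
have v0 : 0 <= v by rewrite le_min ler01 divr_ge0// ltW.
have v1 : v <= 1 by rewrite ge_min lexx.
have -> : Num.min eta x = eta * v.
  by rewrite /v minr_pMr ?(ltW eta0)// mulr1 mulrCA divff ?mulr1// gt_eqF.
rewrite [2 * eta]mulrC -mulrA ler_pM2l//.
apply: (@le_trans _ _ (2 * (1 - expR (- v)))); last first.
  rewrite ler_pM2l// lerD2l lerN2 ler_expR mulNr lerN2 /v mulrC.
  by rewrite ge_min lexx orbT.
have : expR (- v) <= (1 + v)^-1.
  by rewrite expRN lef_pV2 ?posrE ?expR_gt0 ?ltr_wpDr//; exact: expR_ge1Dx.
have : (1 + v)^-1 <= 1 - v / 2.
  rewrite -div1r ler_pdivrMr ?ltr_wpDr//; nra.
lra.
Qed.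

(** With the path frozen, the sample point is uniform; integrating over the sample first reduces the
    bound to fixed paths. *)
Lemma event_mean_le (b : T -> R -> bool) i (V : T -> R) :
  bounded_mfun (fun p : g_sigma_algebraType
      (\bigcup_(t in [set t : R | 0 <= t]) preimage_set_system setT (S t) measurable) *
    g_sigma_algebraType
      (\bigcup_(i in [set: 'I_n]) preimage_set_system setT (u i) measurable) =>
    (b p.1 (u i p.2))%:R : R) ->
  (forall w, measurable [set x : measurableTypeR R | b w x]) ->
  (forall w, (@unif01 R [set x | b w x] <= (V w)%:E)%E) -> bounded_mfun V ->
  \int[P]_w (b w (u i w))%:R <= \int[P]_w V w.
Proof.
move=> bb mb bV bV'.
have := @decouple_paths _ _ _ P S n u S_sub u_iid u_S (fun w w' => (b w (u i w'))%:R) bb.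
move=> -> //; apply: bounded_mean_le => //.
  exact: (@bounded_mfun_inner_path _ _ _ P S n u S_sub u_iid (fun w w' => (b w (u i w'))%:R) bb).
move=> w; rewrite -lee_fin; apply: le_trans (bV w).
rewrite (indic_bool (fun w' => b w (u i w'))).
have mi : measurable (u i @^-1` [set x | b w x]).
  by rewrite -[X in measurable X]setTI; apply: mu' => //; exact: mb.
rewrite mean_indic// fineK ?fin_num_measure//.
by rewrite -[leLHS]/(P (u i @^-1` [set x | b w x])) (u_iid.1 i).2//; exact: mb.
Qed.

(** The factor 4 is 2 for the two ends of the cell times 2 from [min_exp_le]; 1 - e^-v <= v then
    makes the bound proportional to the mesh. *)
Lemma mean_near_grid N eta k i : 0 < eta ->
  \int[P]_w (near_grid (S ^~ w) N eta k (u i w))%:R <=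
  4 * eta * (grid N 1 * laplace_exponent nu eta^-1).
Proof.
move=> eta0.
have bF : bounded_mfun (fun w => 2 * Num.min eta (S (grid N k.+1) w - S (grid N k) w)).
  apply: bounded_mfunZ; split.
    by apply: measurable_minr => //; apply: measurable_funB; apply: mS; exact: grid_ge0.
  exists eta => w; rewrite ger0_norm ?ge_min ?lexx// le_min (ltW eta0)/= subr_ge0.
  by apply: S_mono; [exact: grid_ge0|exact: grid_mono].
apply: (@le_trans _ _ (\int[P]_w (2 * Num.min eta (S (grid N k.+1) w - S (grid N k) w)))).
  apply: (@event_mean_le (fun w x => near_grid (S ^~ w) N eta k x)) => //.
  - apply: bounded_mfun_near_grid; last exact: measurable_sample.
    by move=> t t0; exact: measurable_path.
  - by move=> w; exact: measurable_near_grid.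
  - by move=> w; apply: near_grid_prob => // a c; exact: S_mono.
rewrite bounded_meanZ; last first.
  split; first by apply: measurable_minr => //; apply: measurable_funB; apply: mS; exact: grid_ge0.
  exists eta => w; rewrite ger0_norm ?ge_min ?lexx// le_min (ltW eta0)/= subr_ge0.
  by apply: S_mono; [exact: grid_ge0|exact: grid_mono].
have := @eq_law_mean _ _ _ P (fun w => S (grid N k + grid N 1) w - S (grid N k) w)
  (S (grid N 1)) (fun x => Num.max 0 (Num.min eta x))
  (mS (grid_ge0 _ _))
  (subordinator_stationary_increments S_sub (grid_ge0 _ _) (grid_ge0 _ _)).
rewrite -gridS => h.
have S10 w : 0 <= S (grid N 1) w by rewrite -(S0 w) S_mono// grid_ge0.
have -> : \int[P]_w Num.min eta (S (grid N k.+1) w - S (grid N k) w) =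
    \int[P]_w Num.min eta (S (grid N 1) w).
  transitivity (\int[P]_w Num.max 0 (Num.min eta (S (grid N k.+1) w - S (grid N k) w))).
    apply: eq_Rintegral => w _; rewrite (max_idPr _)// le_min (ltW eta0)/= subr_ge0.
    by apply: S_mono; [exact: grid_ge0|exact: grid_mono].
  rewrite h.
  - by apply: eq_Rintegral => w _; rewrite (max_idPr _)// le_min (ltW eta0)/=.
  - by apply: measurable_maxr => //; apply: measurable_minr => //; exact: measurable_cst.
  - by move=> x; rewrite le_max lexx.
have i0 : 0 <= eta^-1 by rewrite invr_ge0 ltW.
have bE := bounded_mfun_exp_path (grid_ge0 N 1) i0.
apply: (@le_trans _ _ (2 * \int[P]_w (2 * eta * (1 - expR (- eta^-1 * S (grid N 1) w))))).
  rewrite ler_pM2l//; apply: bounded_mean_le.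
  - split; first by apply: measurable_minr => //; apply: mS; exact: grid_ge0.
    by exists eta => w; rewrite ger0_norm ?ge_min ?lexx// le_min (ltW eta0)/=.
  - by apply: bounded_mfunZ; apply: bounded_mfunB => //; exact: bounded_mfun_cst.
  - by move=> w; exact: min_exp_le.
rewrite bounded_meanZ; last by apply: bounded_mfunB => //; exact: bounded_mfun_cst.
have -> : \int[P]_w (1 - expR (- eta^-1 * S (grid N 1) w)) =
    1 - expR (- grid N 1 * laplace_exponent nu eta^-1).
  rewrite (_ : (fun w => _) = fun w => 1 + -1 * expR (- eta^-1 * S (grid N 1) w)).
    rewrite bounded_meanD ?mean_cst; [|exact: bounded_mfun_cst|exact: bounded_mfunZ].
    by rewrite bounded_meanZ// laplace_mean ?grid_ge0// mulN1r.
  by apply/funext => w; rewrite mulN1r.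
rewrite (_ : 4 * eta = 2 * (2 * eta)); last by ring.
rewrite -mulrA ler_pM2l// ler_pM2l ?mulr_gt0// lerBlDr -lerBlDl.
by apply: le_trans (expR_ge1Dx _); rewrite mulNr.
Qed.

Lemma mean_above_frag (t : R) i : 0 <= t ->
  \int[P]_w (frag (S ^~ w) t <= u i w)%R%:R <= expR (- t * laplace_exponent nu 1).
Proof.
move=> t0; have bE := bounded_mfun_exp_path t0 (@ler01 R).
rewrite -laplace_mean//; apply: (@event_mean_le (fun w x => frag (S ^~ w) t <= x)) => //.
- apply: bounded_mfun_above_frag => //; last exact: measurable_sample.
  by move=> r r0; exact: measurable_path.
- move=> w; rewrite (_ : mkset _ = `[frag (S ^~ w) t, +oo[%classic); first exact: measurable_itv.
  by apply/seteqP; split => x; rewrite /= in_itv/= andbT.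
- move=> w; rewrite (_ : mkset _ = ~` `]-oo, frag (S ^~ w) t[%classic).
    rewrite (@probability_setC _ _ _ unif01) ?unif01_ray//.
    rewrite -EFinB lee_fin clamp_id ?subKr ?mulN1r//.
    by rewrite frag_le1 andbT frag_ge0//; exact: S_mono.
  by apply/seteqP; split => x; rewrite /= in_itv/= leNgt; move/negP.
Qed.

Lemma sample01 i : {ae P, forall w, 0 <= u i w <= 1}.
Proof.
exists (u i @^-1` (~` `[0, 1]%classic)); split.
- rewrite -[X in measurable X]setTI; apply: mu' => //; apply: measurableC; exact: measurable_itv.
- rewrite (u_iid.1 i).2; last by apply: measurableC; exact: measurable_itv.
  rewrite (_ : ~` _ = `]-oo, 0[%classic `|` ~` `]-oo, 1]%classic); last first.
    apply/seteqP; split => x; rewrite /= !in_itv/=.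
      have [x0|x0] := ltP x 0; [by left|move=> h; right => x1; apply: h; rewrite x1//].
    move=> [x0 /andP[]|x1 /andP[_ h]]; [by rewrite leNgt x0|exact: x1].
  have h0 : @unif01 R `]-oo, 0[%classic = 0%E by rewrite unif01_ray clamp_id// lexx ler01.
  have h1 : @unif01 R (~` `]-oo, 1]%classic) = 0%E.
    by rewrite (@probability_setC _ _ _ unif01)// unif01_ray_closed ?ler01 ?lexx// subee.
  have h2 : (@unif01 R (`]-oo, 0%R[%classic `|` ~` `]-oo, 1%R]%classic) <= 0)%E.
    apply: le_trans (measureU2 _ _ _) _; [exact: measurable_itv| |].
      by apply: measurableC; exact: measurable_itv.
    by rewrite -[X in (_ <= X)%E]adde0 -{1}h0 -h1.
  by apply/eqP; rewrite eq_le; apply/andP; split; [exact: h2|exact: (@measure_ge0 _ _ _ unif01)].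
by move=> w /= /negP h; rewrite in_itv/=; exact/negP.
Qed.

(** The K 2^N cells up to time K contribute a multiple of 2^-N each, so that the bound on their sum
    does not depend on [N]; letting [N] grow replaces the grid events by membership in the range. *)
Lemma mean_closed_range_below (K : nat) (eta : R) i : 0 < eta ->
  \int[P]_w \1_[set w | closed_range (S ^~ w) (u i w) /\ 0 <= u i w < frag (S ^~ w) K%:R] w <=
  4 * K%:R * (eta * laplace_exponent nu eta^-1).
Proof.
move=> eta0; set B := [set w | _].
have mB : measurable B.
  rewrite (_ : B = [set w | closed_range (S ^~ w) (u i w)] `&`
    ([set w | 0 <= u i w] `&` [set w | u i w < frag (S ^~ w) K%:R])).
    apply: measurableI; first exact: measurable_in_closed_range.
    apply: measurableI.
      have := measurable_fun_ler (measurable_cst (0 : R)) (mu' i) measurableT (Y := [set true]).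
      by rewrite setTI; apply.
    have := measurable_fun_ltr (mu' i) (measurable_frag (ler0n R K)) measurableT (Y := [set true]).
    by rewrite setTI; apply.
  by apply/seteqP; split => w /=; [move=> [h1 /andP[]]|move=> [h1 [h2 h3]]; split => //; rewrite h2].
pose V N w : R := \sum_(0 <= k < K * 2 ^ N) (near_grid (S ^~ w) N eta k (u i w))%:R.
have bn N k : bounded_mfun (fun w => (near_grid (S ^~ w) N eta k (u i w))%:R : R).
  exact: (bounded_mfun_diag (bounded_mfun_near_grid N eta k mS (mu' i))).
have bV N : bounded_mfun (V N) by apply: bounded_mfun_sum => k; exact: bn.
have V0 N w : 0 <= V N w by apply: sumr_ge0.
have EV N : \int[P]_w V N w <= 4 * K%:R * (eta * laplace_exponent nu eta^-1).
  rewrite bounded_mean_sum//.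
  apply: le_trans (_ : \sum_(0 <= k < K * 2 ^ N) 4 * eta * (grid N 1 * laplace_exponent nu eta^-1) <= _).
    by apply: ler_sum => k _; exact: mean_near_grid.
  rewrite sumr_const_nat subn0 -[leLHS]mulr_natl natrM natrX /grid mul1r.
  have p0 : 2 ^+ N != 0 :> R by rewrite expf_neq0.
  by rewrite le_eqVlt; apply/orP; left; apply/eqP; field.
have cv : \int[P]_w (\1_B w * Num.min 1 (V N w)) @[N --> \oo] --> \int[P]_w (\1_B w).
  apply: (@bounded_cvg_mean _ _ _ P _ _ 1).
  - move=> N; apply: measurable_funM; first exact: measurable_indic.
    by apply: measurable_minr => //; exact: (bV N).1.
  - exact: measurable_indic.
  - move=> N w; rewrite normrM -[leRHS]mulr1 ler_pM//.
      by rewrite indicE; case: (_ \in _); rewrite ?normr1// normr0.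
    by rewrite ger0_norm ?ge_min ?lexx// le_min ler01 V0.
  apply: aeW => w; rewrite indicE; case: (boolP (w \in B)) => wB; last first.
    by under eq_cvg do rewrite mul0r; exact: cvg_cst.
  move: wB; rewrite inE => -[h1 /andP[h2 h3]].
  have [N0 hN] := closed_range_near_grid (S0 w) (@S_mono w) (@S_rc w) h1 h2 h3 eta0.
  apply: cvg_near_cst; exists N0 => // N /= /hN[k kK nk].
  rewrite mul1r; apply/min_idPl; rewrite /V (bigD1_seq k)/= ?iota_uniq ?mem_index_iota//.
  by rewrite nk lerDl sumr_ge0.
rewrite -(cvg_lim (@Rhausdorff R) cv); apply: limr_le; first by apply/cvg_ex; eexists; exact: cv.
apply: nearW => N; apply: le_trans (EV N); apply: bounded_mean_le => //.
  apply: bounded_mfunM; first exact: bounded_mfun_indic.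
  split; first by apply: measurable_minr => //; exact: (bV N).1.
  by exists 1 => w; rewrite ger0_norm ?ge_min ?lexx// le_min ler01 V0.
move=> w; apply: le_trans (_ : 1 * V N w <= _); last by rewrite mul1r.
by apply: ler_pM => //; rewrite ?le_min ?ler01 ?V0 ?ge_min ?lexx ?orbT//.
Qed.

(** With eta = 1 / (m + 1) the bound up to time K is 4 K Phi(m + 1) / (m + 1), which vanishes for
    large m; the sample point lies beyond the value at time K with probability at most e^(- K
    Phi(1)). *)
Lemma sample_notin_closed_range i :
  (fun m => m.+1%:R^-1 * laplace_exponent nu m.+1%:R) @ \oo --> (0 : R) ->
  0 < laplace_exponent nu 1 ->
  {ae P, forall w, ~ closed_range (S ^~ w) (u i w)}.
Proof.
move=> Phi_small Phi1; set A := [set w | closed_range (S ^~ w) (u i w)].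
have mA : measurable A := measurable_in_closed_range i.
have PA : P A = 0%E; last first.
  by exists A; split => // w /= /contrapT.
pose N := u i @^-1` `]-oo, 0[%classic.
have mN : measurable N.
  by rewrite -[X in measurable X]setTI; apply: mu' => //; exact: measurable_itv.
have PN : P N = 0%E.
  rewrite (u_iid.1 i).2; last exact: measurable_itv.
  by have := @unif01_ray R 0; rewrite clamp_id ?lexx ?ler01.
have le K m : fine (P A) <= 4 * K%:R * (m.+1%:R^-1 * laplace_exponent nu m.+1%:R) +
    expR (- K%:R * laplace_exponent nu 1).
  have m0 : 0 < m.+1%:R^-1 :> R by rewrite invr_gt0.
  have h1 := mean_closed_range_below K i m0; rewrite invrK in h1.
  have h2 := mean_above_frag i (ler0n R K).
  set B := [set w | _] in h1.
  have mB : measurable B.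
    rewrite (_ : B = A `&` ([set w | 0 <= u i w] `&` [set w | u i w < frag (S ^~ w) K%:R])).
      apply: measurableI => //; apply: measurableI.
        have := measurable_fun_ler (measurable_cst (0 : R)) (mu' i) measurableT (Y := [set true]).
        by rewrite setTI; apply.
      have := measurable_fun_ltr (mu' i) (measurable_frag (ler0n R K)) measurableT (Y := [set true]).
      by rewrite setTI; apply.
    by apply/seteqP; split => w /=; [move=> [h /andP[]]|move=> [h [h' h3]]; split => //; rewrite h'].
  have bA := bounded_mfun_indic mA; have bB := bounded_mfun_indic mB.
  have bN := bounded_mfun_indic mN.
  have bU : bounded_mfun (fun w => (frag (S ^~ w) K%:R <= u i w)%R%:R : R).
    exact: (bounded_mfun_diag (bounded_mfun_above_frag (ler0n R K) mS (mu' i))).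
  rewrite -(mean_indic P mA).
  apply: (@le_trans _ _ (\int[P]_w ((\1_B w + (frag (S ^~ w) K%:R <= u i w)%R%:R) + \1_N w))).
    apply: bounded_mean_le => //; first by apply: bounded_mfunD => //; exact: bounded_mfunD.
    move=> w; rewrite !indicE; case: (boolP (w \in A)) => wA; last by rewrite !addr_ge0.
    have [wN|wN] := boolP (w \in N); first by rewrite lerDr addr_ge0.
    have [wU|wU] := leP (frag (S ^~ w) K%:R) (u i w); first by rewrite addr0 lerDr.
    rewrite mem_set ?addr0//; split; first by rewrite inE in wA.
    rewrite wU andbT leNgt; apply: contra wN => h; rewrite inE /N/= in_itv/=.
    exact: h.
  rewrite bounded_meanD//; last exact: bounded_mfunD.
  rewrite bounded_meanD// (mean_indic P mN) PN/= addr0.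
  exact: lerD h1 h2.
rewrite -[LHS]fineK ?fin_num_measure//; congr EFin; apply/eqP.
rewrite eq_le fine_ge0 ?andbT//; apply/ler_addgt0Pr => e e0; rewrite add0r.
pose K := (Num.truncn (2 / (e * laplace_exponent nu 1))).+1.
have ec0 : 0 < e * laplace_exponent nu 1 by rewrite mulr_gt0.
have K0 : 0 < K%:R :> R by rewrite ltr0n.
have hK : expR (- K%:R * laplace_exponent nu 1) <= e / 2.
  rewrite mulNr expRN -[leRHS]invrK lef_pV2 ?posrE ?expR_gt0 ?invr_gt0 ?divr_gt0//.
  apply: le_trans (expR_ge1Dx _); apply: (@le_trans _ _ (K%:R * laplace_exponent nu 1)).
    have /andP[_] := @truncn_itv R (2 / (e * laplace_exponent nu 1)) (ltW (divr_gt0 (@ltr0n R 2) ec0)).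
    rewrite -/K ltr_pdivrMr// => h.
    by rewrite invf_div ler_pdivrMr// -mulrA [_ * e]mulrC ltW.
  by rewrite lerDr.
have e1 : 0 < e / 2 / (4 * K%:R) by rewrite !divr_gt0// mulr_gt0.
have /cvgr0_norm_lt/(_ _ e1)[m _ /(_ m (leqnn m)) hm] := Phi_small.
apply: le_trans (le K m) _; rewrite [leRHS](splitr e); apply: lerD hK.
rewrite mulrC -ler_pdivlMr ?mulr_gt0// ltW//.
by apply: le_lt_trans hm; exact: ler_norm.
Qed.

End null_events.

Section block_limit.
Context {d : measure_display} {T : measurableType d} {R : realType}.
Variables (P : probability T R) (S : R -> T -> R) (n : nat) (u : 'I_n -> T -> R).
Hypothesis S_sub : subordinator P S.
Hypothesis u_iid : iid_uniform P u.
Hypothesis u_S : independent_of_process P S u.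

Let S0 w : S 0 w = 0. Proof. exact: (subordinator0 S_sub). Qed.
Let S_mono w (a b : R) : 0 <= a -> a <= b -> S a w <= S b w.
Proof. exact: (subordinator_nondecreasing S_sub). Qed.
Let S_rc w (t : R) : 0 <= t -> S x w @[x --> t^'+] --> S t w.
Proof. exact: (subordinator_right_continuous S_sub). Qed.
Let mu' i : measurable_fun setT (u i). Proof. exact: (u_iid.1 i).1. Qed.

Lemma measurable_same_gap i j : measurable [set w | `[< same_gap (S ^~ w) (u ^~ w) i j >]].
Proof.
have m01 k : measurable [set w | 0 <= u k w <= 1].
  rewrite (_ : mkset _ = u k @^-1` `[0, 1]%classic).
    by rewrite -[X in measurable X]setTI; apply: mu' => //; exact: measurable_itv.
  by apply/seteqP; split => w /=; rewrite in_itv.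
rewrite (_ : mkset _ = [set w | 0 <= u i w <= 1] `&` ([set w | 0 <= u j w <= 1] `&`
  [set w | forall x, Num.min (u i w) (u j w) <= x <= Num.max (u i w) (u j w) ->
    ~ closed_range (S ^~ w) x])).
  apply: measurableI => //; apply: measurableI => //.
  apply: (measurable_avoid S_sub); first exact: measurable_minr.
  exact: measurable_maxr.
apply/seteqP; split => w /=; first by move=> /asboolP /same_gapP[].
by move=> [h1 [h2 h3]]; apply/asboolP/same_gapP.
Qed.

Lemma bounded_mfun_blocks (f : {set {set 'I_n}} -> R) :
  bounded_mfun (fun w => f (blocks (S ^~ w) (u ^~ w))).
Proof.
pose g (b : {ffun 'I_n * 'I_n -> bool}) := f
  ([set [set j | b (i, j)] | i : 'I_n] :\ finset.set0)%SET.
rewrite (_ : (fun w => _) = (fun w => g [ffun ij =>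
    `[< same_gap (S ^~ w) (u ^~ w) ij.1 ij.2 >]])).
  by apply: bounded_mfun_ffun => -[i j]; exact: measurable_same_gap.
apply/funext => w; rewrite /g /blocks; congr (f (_ :\ _)%SET).
by apply: eq_imset => i; apply/setP => j; rewrite !inE ffunE.
Qed.

Definition block_product (z : nat -> R) (w : T) : R :=
  \prod_(B in blocks (S ^~ w) (u ^~ w)) z #|B|.

Lemma bounded_mfun_block_product z : bounded_mfun (block_product z).
Proof. exact: (bounded_mfun_blocks (fun b => \prod_(B in b) z #|B|)). Qed.

(** The counts of the cells add up to [n]. *)
Lemma cell_product_bound (Z : R) (z : nat -> R) (s : R -> R) N (x : 'I_n -> R) :
  (forall m, 0 <= z m <= Z ^+ m) -> 0 <= cell_product s N z x <= Z ^+ n.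
Proof.
move=> zZ; apply/andP; split.
  by apply: prodr_ge0 => k _; case/andP: (zZ #|[set i | cell s N (x i) == k]%SET|).
apply: le_trans (_ : \prod_(k < (4 ^ N).+1) Z ^+ #|[set i | cell s N (x i) == k]%SET| <= _).
  by apply: ler_prod => k _; exact: zZ.
rewrite -expr_sum (_ : (\sum_(k < _) _)%N = n)//.
pose c i : 'I_(4 ^ N).+1 := inord (cell s N (x i)).
have cE i : c i = cell s N (x i) :> nat by rewrite inordK// ltnS cell_le.
transitivity (\sum_(k < (4 ^ N).+1) \sum_(i < n | c i == k) 1)%N.
  apply: eq_bigr => k _; rewrite sum1dep_card; apply: eq_card => i.
  by rewrite !inE -val_eqE/= cE.
by rewrite -[RHS](card_ord n) -sum1_card [RHS](partition_big c xpredT).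
Qed.

(** Almost surely all sample points avoid the range; for each pair the cells then agree with the
    gaps from some [N] on, so that the sequence is eventually constant. *)
Lemma cell_product_cvg (z : nat -> R) : z 0%N = 1 ->
  (forall i, {ae P, forall w, ~ closed_range (S ^~ w) (u i w)}) ->
  {ae P, forall w, cell_product (S ^~ w) N z (u ^~ w) @[N --> \oo] --> block_product z w}.
Proof.
move=> z0 uR.
have h01 : {ae P, forall w, forall i, 0 <= u i w <= 1}.
  by apply: filter_forall => i; exact: (sample01 u_iid i).
have hR : {ae P, forall w, forall i, ~ closed_range (S ^~ w) (u i w)}.
  by apply: filter_forall => i; exact: uR.
apply: filterS2 h01 hR => w w01 wR.
have : exists N0, forall N, (N0 <= N)%N -> forall i j,
    `[< same_gap (S ^~ w) (u ^~ w) i j >] = (cell (S ^~ w) N (u i w) == cell (S ^~ w) N (u j w)).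
  have hN i j := cells_cvg (@S_mono w) (@S_rc w) (w01 i) (w01 j) (wR i) (wR j).
  have /(_ _)/cid-/all_sig : forall i, exists N0, forall N, (N0 <= N)%N -> forall j,
    `[< same_gap (S ^~ w) (u ^~ w) i j >] = (cell (S ^~ w) N (u i w) == cell (S ^~ w) N (u j w)).
    move=> i; have /choice[f hf] := hN i.
    exists (\max_j f j)%N => N hle j.
    have -> := hf j N (leq_trans (leq_bigmax j) hle).
    apply: asbool_equiv_eq; split; first by move=> /same_gapP[].
    by move=> h; apply/same_gapP; split.
  move=> [f hf]; exists (\max_i f i)%N => N hle i.
  exact: hf i N (leq_trans (leq_bigmax i) hle).
move=> [N0 hN0]; apply: cvg_near_cst; exists N0 => // N /= /hN0 h.
pose c i : 'I_(4 ^ N).+1 := inord (cell (S ^~ w) N (u i w)).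
have cE i : c i = cell (S ^~ w) N (u i w) :> nat by rewrite inordK// ltnS cell_le.
rewrite /block_product (prod_blocks (c := c))//; last first.
  by move=> i j; rewrite h -val_eqE/= !cE.
apply: eq_bigr => k _; congr z; apply: eq_card => i.
by rewrite !inE -val_eqE/= cE.
Qed.

Lemma mean_cell_product_cvg (Z : R) (z : nat -> R) : z 0%N = 1 ->
  (forall m, 0 <= z m <= Z ^+ m) ->
  (forall i, {ae P, forall w, ~ closed_range (S ^~ w) (u i w)}) ->
  renewal_mean (gap_weight P S N) z (4 ^ N) n @[N --> \oo] --> \int[P]_w block_product z w.
Proof.
move=> z0 zZ uR.
under eq_cvg => N.
  rewrite -(mean_discretised S_sub u_iid u_S N) => [|k]; last by case/andP: (zZ k).
  over.
apply: (@bounded_cvg_mean _ _ _ P _ _ (Z ^+ n)).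
- by move=> N; exact: (measurable_cell_product S_sub u_iid).
- exact: (bounded_mfun_block_product z).1.
- move=> N w; have /andP[h0 h1] := cell_product_bound (S ^~ w) N (u ^~ w) zZ.
  by rewrite ger0_norm.
- exact: cell_product_cvg.
Qed.

End block_limit.

Lemma cvg_sum_seq {R : realType} {T I : Type} (F : set_system T) {FF : Filter F}
    (s : seq I) (f : I -> T -> R) (l : I -> R) :
  (forall i, f i x @[x --> F] --> l i) ->
  \sum_(i <- s) f i x @[x --> F] --> \sum_(i <- s) l i.
Proof.
move=> fl; apply: (@list_ind _ (fun s => \sum_(i <- s) f i x @[x --> F] --> \sum_(i <- s) l i)).
  by under eq_cvg do rewrite big_nil; rewrite big_nil; exact: cvg_cst.
move=> i s' IH; under eq_cvg do rewrite big_cons; rewrite big_cons.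
by apply: cvgD.
Qed.

Lemma cvg_grid1 {R : realType} : grid N 1 @[N --> \oo] --> (0 : R).
Proof.
under eq_cvg do rewrite /grid mul1r -exprVn.
by apply: cvg_expr; rewrite ger0_norm ?invr_ge0// invf_lt1// ltr1n.
Qed.

(** * The recursion over the leftmost gap *)

Section renewal_bounds.
Context {R : realType}.
Variables (q : nat -> nat -> R) (z : nat -> R) (Z r : R).
Hypothesis q0 : forall n j, 0 <= q n j.
Hypothesis q1 : forall n, \sum_(j < n.+1) q n j = 1.
Hypothesis qr : forall n, \sum_(j < n.+1) q n j * (n - j)%:R = n%:R * r.
Hypothesis Z1 : 1 <= Z.
Hypothesis z01 : z 0%N = 1.
Hypothesis zZ : forall m, 0 <= z m <= Z ^+ m.

Lemma renewal_mean_bound M n : 0 <= renewal_mean q z M n <= Z ^+ n.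
Proof.
elim: M n => [|M IH] n /=; first exact: zZ.
apply/andP; split.
  apply: sumr_ge0 => j _; rewrite !mulr_ge0//; first by case/andP: (zZ j).
  by case/andP: (IH (n - j)%N).
rewrite -[leRHS]mul1r -(q1 n) mulr_suml; apply: ler_sum => j _.
have -> : Z ^+ n = Z ^+ j * Z ^+ (n - j) by rewrite -exprD subnKC// -ltnS.
rewrite ler_wpM2l//.
case/andP: (zZ j) => h1 h2; case/andP: (IH (n - j)%N) => h3 h4.
by rewrite ler_pM.
Qed.

Lemma renewal_mean0 M : renewal_mean q z M 0 = 1.
Proof.
elim: M => [|M IH] //=; rewrite big_ord1 IH z01 !mulr1.
by have := q1 0; rewrite big_ord1.
Qed.

(** [r] is the mean fraction of points that survive a step. One more step matters only if some point
    has survived [M] steps, and the mean number of survivors is n r^M. *)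
Lemma renewal_mean_increment M n :
  `|renewal_mean q z M.+1 n - renewal_mean q z M n| <= 2 * Z ^+ n * n%:R * r ^+ M.
Proof.
elim: M n => [|M IH] n.
  rewrite expr0 mulr1; case: n => [|n].
    by rewrite !renewal_mean0 subrr normr0 mulr0.
  apply: le_trans (ler_normB _ _) _.
  have /andP[h0 h1] := renewal_mean_bound 1 n.+1.
  have /andP[h2 h3] := renewal_mean_bound 0 n.+1.
  rewrite !ger0_norm//; apply: le_trans (lerD h1 h3) _.
  rewrite -mulr2n -[leLHS]mulr_natl -[leLHS]mulr1 ler_wpM2l ?ler1n//.
  by rewrite mulr_ge0// exprn_ge0// (le_trans ler01).
rewrite [X in `|X - _|]/= [X in `|_ - X|]/= -sumrB.
apply: le_trans (ler_norm_sum _ _ _) _.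
apply: (@le_trans _ _ (\sum_(j < n.+1) 2 * Z ^+ n * r ^+ M * (q n j * (n - j)%:R))); last first.
  by rewrite -mulr_sumr qr exprS [leRHS](_ : _ = 2 * Z ^+ n * r ^+ M * (n%:R * r))//; ring.
apply: ler_sum => j _.
have jn : (j <= n)%N by rewrite -ltnS.
rewrite -mulrBr -mulrBr !normrM (ger0_norm (q0 _ _)).
have /andP[zj0 zj1] := zZ j; rewrite (ger0_norm zj0).
have -> : 2 * Z ^+ n * r ^+ M * (q n j * (n - j)%:R) =
    q n j * (Z ^+ j * (2 * Z ^+ (n - j) * (n - j)%:R * r ^+ M)).
  by rewrite -{1}(subnKC jn) exprD; ring.
by rewrite ler_wpM2l// ler_pM//; exact: IH.
Qed.

End renewal_bounds.

Section recursion.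
Context {d : measure_display} {T : measurableType d} {R : realType}.
Variables (P : probability T R) (S : R -> T -> R).
Variable nu : {measure set R -> \bar R}.
Hypothesis S_sub : subordinator P S.
Hypothesis S_nu : driftfree_with_levy_measure P S nu.
Variable delta : R.
Hypotheses (delta0 : 0 < delta) (deltaW : weight_integrable nu delta).

Local Notation Phi := (laplace_exponent nu).
Let X N w := S (grid N 1) w.
Let S0 w : S 0 w = 0. Proof. exact: (subordinator0 S_sub). Qed.
Let S_mono w (a b : R) : 0 <= a -> a <= b -> S a w <= S b w.
Proof. exact: (subordinator_nondecreasing S_sub). Qed.

Let bX N (k : nat) : bounded_mfun (fun w => expR (- X N w) ^+ k).
Proof.
apply: bounded_mfunX; have := bounded_mfun_exp_path S_sub (grid_ge0 N 1) (@ler01 R).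
by under eq_fun do rewrite mulN1r.
Qed.

Let X01 N w : 0 <= expR (- X N w) <= 1.
Proof. by have := exp_path01 S_sub w (grid_ge0 N 1) (@ler01 R); rewrite mulN1r. Qed.

(** A polynomial in e^-X has a combination of Laplace transforms as its mean; p(1) = 0 allows these
    to be replaced by their differences from 1, which are of the order of the mesh. *)
Lemma mean_horner N (p : {poly R}) : p.[1] = 0 ->
  \int[P]_w p.[expR (- X N w)] = - \sum_(i < size p) p`_i * (1 - expR (- grid N 1 * Phi i%:R)).
Proof.
move=> p1.
transitivity (\sum_(i < size p) p`_i * expR (- grid N 1 * Phi i%:R)).
  under eq_Rintegral do rewrite horner_coef.
  rewrite bounded_mean_sum => [|i]; last exact: bounded_mfunZ.
  apply: eq_bigr => i _; rewrite bounded_meanZ//; congr (_ * _).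
  rewrite -(laplace_mean S_nu (grid_ge0 N 1) (ler0n R i)).
  by apply: eq_Rintegral => w _; rewrite -expRM_natl mulrN mulNr.
rewrite -sumrN; apply/eqP; rewrite -subr_eq0 -sumrB -[X in _ == X]p1 horner_coef.
by apply/eqP; apply: eq_bigr => i _; rewrite expr1n; ring.
Qed.

Lemma nu_mean_horner (p : {poly R}) : p.[1] = 0 ->
  nu_mean nu (fun y => p.[expR (- y)]) = - \sum_(i < size p) p`_i * Phi i%:R.
Proof.
move=> p1.
have e (y : R) : p.[expR (- y)] = \sum_(i < size p) (- p`_i) * (1 - expR (- i%:R * y)).
  rewrite -[LHS]subr0 -{1}p1 !horner_coef -sumrB; apply: eq_bigr => i _.
  by rewrite expr1n -expRM_natl mulrN mulNr; ring.
rewrite (_ : (fun y => _) = fun y => \sum_(i < size p) (- p`_i) * (1 - expR (- i%:R * y))); last exact/funext.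
have wi (i : nat) : weight_bounded delta (fun y : R => 1 - expR (- i%:R * y)).
  exact: weight_bounded_exp.
rewrite (nu_mean_sum deltaW) => [|i]; last exact: weight_boundedZ.
rewrite -sumrN; apply: eq_bigr => i _; rewrite (nu_meanZ deltaW) ?mulNr//; exact: wi.
Qed.

Definition cut_poly n j : {poly R} := 'C(n, j)%:R *: ((1 - 'X) ^+ j * 'X^(n - j)).

Lemma horner_cut_poly n j x : (cut_poly n j).[x] = bin_weight n (1 - x) j.
Proof.
rewrite /cut_poly /bin_weight subKr hornerZ hornerM hornerXn horner_exp !hornerE.
by [].
Qed.

(* A jump of size [y] covers the fraction [1 - expR (- y)] of what remains of the
   unit interval; this is the rate at which jumps cover [j] of [n] points. *)
Definition cut_rate n j : R := nu_mean nu (fun y => bin_weight n (1 - expR (- y)) j).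

Lemma cvg_exp_quotient (c : R) :
  (1 - expR (- grid N 1 * c)) / grid N 1 @[N --> \oo] --> c.
Proof.
have g0 N : 0 < grid N 1 :> R by rewrite divr_gt0// exprn_gt0.
have g1 N : grid N 1 <= 1 :> R.
  by rewrite ler_pdivrMr ?exprn_gt0// mul1r exprn_ege1// ler1n.
pose K := c ^+ 2 * expR `|c|.
have le N : `|(1 - expR (- grid N 1 * c)) / grid N 1 - c| <= grid N 1 * K.
  have -> : (1 - expR (- grid N 1 * c)) / grid N 1 - c =
      - (expR (- grid N 1 * c) - (1 + (- grid N 1 * c))) / grid N 1.
    by field; rewrite gt_eqF.
  rewrite normrM normrN normfV (gtr0_norm (g0 N)) ler_pdivrMr//.
  apply: le_trans (expR_taylor2 _) _.
  rewrite normrM normrN (gtr0_norm (g0 N)) exprMn.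
  have -> : grid N 1 * K * grid N 1 = grid N 1 ^+ 2 * `|c| ^+ 2 * expR `|c|.
    by rewrite /K real_normK ?num_real//; ring.
  rewrite ler_wpM2l ?mulr_ge0 ?exprn_ge0 ?(ltW (g0 N))// ler_expR.
  by rewrite ler_piMl.
apply: (@squeeze_cvgr _ _ _ _ (fun N => c - grid N 1 * K) (fun N => c + grid N 1 * K)).
- by apply: nearW => N; rewrite -ler_distl; exact: le.
- rewrite -[X in _ --> X]subr0 -(mul0r K); apply: cvgB; first exact: cvg_cst.
  by apply: cvgM; [exact: cvg_grid1|exact: cvg_cst].
- rewrite -[X in _ --> X]addr0 -(mul0r K); apply: cvgD; first exact: cvg_cst.
  by apply: cvgM; [exact: cvg_grid1|exact: cvg_cst].
Qed.

Lemma gap_weight_ge0 N n j : 0 <= gap_weight P S N n j.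
Proof.
apply: Rintegral_ge0 => w _; rewrite bin_weight_ge0//.
by have /andP[h0 h1] := X01 N w; rewrite subr_ge0 h1 gerBl.
Qed.

Let bW N n j : bounded_mfun (fun w => bin_weight n (1 - expR (- X N w)) j).
Proof.
have bX1 : bounded_mfun (fun w => 1 - expR (- X N w)).
  by apply: bounded_mfunB; [exact: bounded_mfun_cst|exact: bX N 1].
apply: bounded_mfunM; first by apply: bounded_mfunZ; exact: bounded_mfunX.
by apply: bounded_mfunX; apply: bounded_mfunB => //; exact: bounded_mfun_cst.
Qed.

Lemma sum_gap_weight N n : \sum_(j < n.+1) gap_weight P S N n j = 1.
Proof.
rewrite /gap_weight -bounded_mean_sum; last by move=> j; exact: bW.
rewrite -[RHS](mean_cst P 1); apply: eq_Rintegral => w _.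
transitivity (bin_mean n (1 - expR (- X N w)) (fun=> 1)); last exact: bin_mean_cst.
by apply: eq_bigr => j _; rewrite mulr1.
Qed.

Lemma sum_gap_weight_rest N n : \sum_(j < n.+1) gap_weight P S N n j * (n - j)%:R =
  n%:R * expR (- grid N 1 * Phi 1).
Proof.
rewrite -(laplace_mean S_nu (grid_ge0 N 1) (@ler01 R)).
have b1 : bounded_mfun (fun w => expR (- 1 * S (grid N 1) w)).
  by under eq_fun do rewrite mulN1r; exact: bX N 1.
rewrite -bounded_meanZ//.
transitivity (\int[P]_w \sum_(j < n.+1) (n - j)%:R * bin_weight n (1 - expR (- X N w)) j).
  rewrite bounded_mean_sum => [|j]; last exact: bounded_mfunZ.
  by apply: eq_bigr => j _; rewrite bounded_meanZ// mulrC.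
apply: eq_Rintegral => w _; rewrite mulN1r.
transitivity (bin_mean n (1 - expR (- X N w)) (fun j => n%:R + -1 * j%:R)).
  apply: eq_bigr => j _; have jn : (j <= n)%N by rewrite -ltnS.
  by rewrite [LHS]mulrC (natrB _ jn) mulN1r.
by rewrite bin_meanD bin_mean_cst bin_meanZ bin_mean_id; ring.
Qed.

(** Both sides are combinations of Laplace exponents with the same coefficients, so that only (1 -
    e^(- h c)) / h -> c as h -> 0 is left. *)
Lemma gap_weight_cvg n j : (0 < j)%N ->
  gap_weight P S N n j / grid N 1 @[N --> \oo] --> cut_rate n j.
Proof.
move=> j0.
have p1 : (cut_poly n j).[1] = 0.
  by rewrite horner_cut_poly subrr /bin_weight expr0n gtn_eqF// mulr0 mul0r.
have -> : cut_rate n j = - \sum_(i < size (cut_poly n j)) (cut_poly n j)`_i * Phi i%:R.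
  by rewrite -nu_mean_horner//; apply: eq_nu_mean => y _; rewrite horner_cut_poly.
have e N : gap_weight P S N n j / grid N 1 = - \sum_(i < size (cut_poly n j))
    (cut_poly n j)`_i * ((1 - expR (- grid N 1 * Phi i%:R)) / grid N 1).
  rewrite -[in RHS](eq_bigr _ (fun i _ => esym (mulrA _ _ _))) -mulr_suml -mulNr -mean_horner//.
  by congr (_ / _); apply: eq_Rintegral => w _; rewrite horner_cut_poly.
under eq_cvg do rewrite e.
apply: cvgN; apply: cvg_sum_seq => i; apply: cvgM; first exact: cvg_cst.
exact: cvg_exp_quotient.
Qed.

(* Two consecutive truncations [renewal_mean _ z M] differ by a quantity that is
   negligible with respect to the mesh [grid N 1]. *)
Theorem cut_recursion (Z : R) (z : nat -> R) (G : nat -> R) : 1 <= Z -> z 0%N = 1 ->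
  (forall m, 0 <= z m <= Z ^+ m) -> 0 < Phi 1 ->
  (forall n, renewal_mean (gap_weight P S N) z (4 ^ N) n @[N --> \oo] --> G n) ->
  forall n, \sum_(j < n) cut_rate n j.+1 * (z j.+1 * G (n - j.+1)%N - G n) = 0.
Proof.
move=> Z1 z01 zZ Phi1 FG n.
pose F N := renewal_mean (gap_weight P S N) z.
pose L N := \sum_(j < n) (gap_weight P S N n j.+1 / grid N 1) *
  (z j.+1 * F N (4 ^ N)%N (n - j.+1)%N - F N (4 ^ N)%N n).
have L1 : L N @[N --> \oo] --> \sum_(j < n) cut_rate n j.+1 * (z j.+1 * G (n - j.+1)%N - G n).
  apply: cvg_sum_seq => j; apply: cvgM; first exact: gap_weight_cvg.
  exact: (cvgB (cvgM (cvg_cst _) (FG (n - j.+1)%N)) (FG n)).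
have LE N : L N = (F N (4 ^ N).+1 n - F N (4 ^ N)%N n) / grid N 1.
  rewrite [F N _.+1 n]/F /= -/(F N) -[X in _ - X]mul1r -(sum_gap_weight N n) mulr_suml -sumrB.
  rewrite mulr_suml big_ord_recl/= z01 mul1r subn0 subrr mul0r add0r.
  by apply: eq_bigr => j _; rewrite /bump/= add1n /F; ring.
have g0 N : 0 < grid N 1 :> R by rewrite divr_gt0// exprn_gt0.
pose K := 2 * Z ^+ n * n%:R.
have K0 : 0 <= K by rewrite !mulr_ge0// exprn_ge0// (le_trans ler01).
have L2 : L N @[N --> \oo] --> 0.
  have Lle N : `|L N| <= K * (2 / Phi 1 ^+ 2) * grid N 1.
    rewrite LE normrM normfV (gtr0_norm (g0 N)) ler_pdivrMr//.
    apply: le_trans (@renewal_mean_increment _ _ _ Z _ (gap_weight_ge0 N) (sum_gap_weight N)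
      (sum_gap_weight_rest N) Z1 z01 zZ (4 ^ N) n) _.
    rewrite -/K -expRM_natl.
    (* 4^N steps of length 2^-N reach the time 2^N, so that the survival factor is e^-x; the bound
       e^-x <= 2 / x^2 turns it into a multiple of the squared mesh. *)
    pose x := 2 ^+ N * Phi 1 : R.
    have x0 : 0 < x by rewrite mulr_gt0// exprn_gt0.
    have p0 : 2 ^+ N != 0 :> R by rewrite expf_neq0.
    have -> : (4 ^ N)%:R * (- grid N 1 * Phi 1) = - x.
      rewrite /x /grid mul1r natrX (_ : 4 = 2 * 2 :> R) ?exprMn; last by ring.
      by field.
    have -> : K * (2 / Phi 1 ^+ 2) * grid N 1 * grid N 1 = K * (2 / x ^+ 2).
      by rewrite /x /grid mul1r; field; rewrite p0 gt_eqF.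
    rewrite ler_wpM2l// expRN -[leRHS]invrK lef_pV2 ?posrE ?expR_gt0 ?invr_gt0 ?divr_gt0 ?exprn_gt0//.
    have := exp_term_le 2 (ltW x0).
    by rewrite invf_div (_ : 2`! = 2)%N.
  apply: (@squeeze_cvgr _ _ _ _ (fun N => - (K * (2 / Phi 1 ^+ 2) * grid N 1))
    (fun N => K * (2 / Phi 1 ^+ 2) * grid N 1)).
  - by apply: nearW => N; rewrite -ler_norml.
  - rewrite -oppr0; apply: cvgN; rewrite -[X in _ --> X](mulr0 (K * (2 / Phi 1 ^+ 2))).
    by apply: cvgM; [exact: cvg_cst|exact: cvg_grid1].
  - rewrite -[X in _ --> X](mulr0 (K * (2 / Phi 1 ^+ 2))).
    by apply: cvgM; [exact: cvg_cst|exact: cvg_grid1].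
exact: (cvg_unique (@Rhausdorff R) L1 L2).
Qed.

End recursion.

Section levy_asymptotics.
Context {R : realType}.
Variable nu : {measure set R -> \bar R}.
Variable delta : R.
Hypotheses (delta0 : 0 < delta) (deltaW : weight_integrable nu delta).

Let mD : measurable (`]0, +oo[%classic : set R). Proof. exact: measurable_itv. Qed.

Let half_delta : delta / 2 < delta.
Proof. by rewrite ltr_pdivrMr// ltr_pMr// ltr1n. Qed.

(** Near 0 the power of y is below min(1, y) because k > 0; at infinity the difference delta - b
    absorbs it. *)
Lemma weight_bounded_powexp k (b : R) : b < delta -> (0 < k)%N ->
  weight_bounded delta (fun y => y ^+ k * expR (b * y)).
Proof.
move=> bd k0; split.
  apply: measurable_funM; first exact: measurable_funX.
  exact: measurable_exp_linear.
have c0 : 0 < delta - b by rewrite subr_gt0.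
pose C := k`!%:R / (delta - b) ^+ k.
have C0 : 0 <= C by rewrite divr_ge0// exprn_ge0// ltW.
exists (1 + C) => y y0; rewrite ger0_norm; last by rewrite mulr_ge0 ?expR_ge0// exprn_ge0// ltW.
rewrite /weight mulrA; have [y1|y1] := leP 1 y.
  have E : y ^+ k <= C * expR ((delta - b) * y).
    rewrite /C mulrAC ler_pdivlMr ?exprn_gt0// mulrC [leRHS]mulrC -ler_pdivrMr ?ltr0n ?fact_gt0//.
    by rewrite -exprMn; exact: exp_term_le (ltW (mulr_gt0 c0 y0)).
  rewrite mulr1 (_ : delta * y = (delta - b) * y + b * y); last by ring.
  rewrite expRD mulrA ler_wpM2r ?expR_ge0//; apply: le_trans E _.
  by rewrite ler_wpM2r ?expR_ge0// lerDr.
apply: (@le_trans _ _ (1 * y * expR (delta * y))); last first.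
  by rewrite ler_wpM2r ?expR_ge0// ler_wpM2r ?(ltW y0)// lerDl.
rewrite mul1r; apply: ler_pM; rewrite ?exprn_ge0 ?(ltW y0)//.
  case: k k0 {C C0} => // k _; rewrite exprS ler_piMr ?(ltW y0)//.
  by rewrite exprn_ile1 ?(ltW y0)// ltW.
by rewrite ler_expR ler_wpM2r ?(ltW y0)// ltW.
Qed.

Lemma weight_bounded_pow k : (0 < k)%N -> weight_bounded delta (fun y => y ^+ k).
Proof.
move=> k0; have := weight_bounded_powexp delta0 k0.
by under eq_fun do rewrite mul0r expR0 mulr1.
Qed.

Lemma cvg_nu_mean (f : nat -> R -> R) (g : R -> R) C :
  (forall n, measurable_fun setT (f n)) -> measurable_fun setT g ->
  (forall n y, 0 < y -> `|f n y| <= C * weight delta y) ->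
  (forall y, 0 < y -> f n y @[n --> \oo] --> g y) ->
  nu_mean nu (f n) @[n --> \oo] --> nu_mean nu g.
Proof.
move=> mf mg fC fg.
have [|||||h1 h2 h3] := @dominated_convergence _ _ _ nu `]0, +oo[%classic mD
  (fun n y => (f n y)%:E) (fun y => (g y)%:E) (fun y => (C * weight delta y)%:E).
- by move=> n; apply/measurable_EFinP; exact: measurable_funS (mf n).
- by apply/measurable_EFinP; exact: measurable_funS mg.
- apply: aeW => y; rewrite /= in_itv/= andbT => y0.
  by apply/fine_cvgP; split; [exact: nearW|exact: fg].
- rewrite (_ : (fun y => _) = (fun y => C%:E * (weight delta y)%:E)%E)//.
  by apply: integrableZl => //; exact: integrable_weight.
- by apply: aeW => y n; rewrite /= in_itv/= andbT => y0; rewrite lee_fin fC.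
apply: fine_cvg; move: h3; rewrite /nu_mean /Rintegral fineK//.
exact: (integrable_fin_num mD h1).
Qed.

(** Dominated convergence, as the exponent contains no linear drift term. Null events are obtained
    from this limit. *)
Lemma laplace_exponent_sublinear :
  (fun m => m.+1%:R^-1 * laplace_exponent nu m.+1%:R) @ \oo --> (0 : R).
Proof.
have e m : m.+1%:R^-1 * laplace_exponent nu m.+1%:R =
    nu_mean nu (fun y => m.+1%:R^-1 * (1 - expR (- m.+1%:R * y))).
  by rewrite (nu_meanZ deltaW)//; exact: weight_bounded_exp.
under eq_cvg do rewrite e.
have := @cvg_nu_mean (fun m y => m.+1%:R^-1 * (1 - expR (- m.+1%:R * y))) (fun=> 0) 2.
rewrite nu_mean0; apply.
- by move=> m; apply: measurable_funM => //; exact: measurable_exp_diff.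
- exact: measurable_cst.
- move=> m y y0; have /andP[h0 h1] := exp_diff_min (ler0n R m.+1) y0.
  rewrite ger0_norm ?mulr_ge0 ?invr_ge0//.
  apply: (@le_trans _ _ (2 * Num.min 1 y)); last first.
    rewrite ler_wpM2l// /weight ler_peMr ?le_min ?ler01 ?(ltW y0)//.
    by rewrite -expR0 ler_expR mulr_ge0// ltW.
  rewrite mulrC ler_pdivrMr ?ltr0n//; apply: le_trans h1 _.
  rewrite mulrAC ler_wpM2r ?le_min ?ler01 ?(ltW y0)//.
  by rewrite -natr1; have : 0 <= m%:R :> R by []; lra.
move=> y y0; apply: (@squeeze_cvgr _ _ _ _ (fun=> 0) (fun m => m.+1%:R^-1)).
- apply: nearW => m; have /andP[h0 h1] := exp_diff_min (ler0n R m.+1) y0.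
  by rewrite mulr_ge0 ?invr_ge0//= ler_piMr ?invr_ge0// gerBl expR_ge0.
- exact: cvg_cst.
- exact: cvg_harmonic.
Qed.

Lemma weight_bounded_exp_small (s : R) : `|s| <= delta / 2 ->
  weight_bounded delta (fun y => 1 - expR (- s * y)).
Proof.
move=> sd; apply: (weight_bounded_le (g := fun y => y ^+ 1 * expR (delta / 2 * y)) (C := `|s|)) => //.
- exact: measurable_exp_diff.
- by exact: weight_bounded_powexp.
move=> y y0; rewrite distrC; apply: le_trans (expR_taylor1 _) _.
rewrite expr1 [`|y * _|]ger0_norm ?mulr_ge0 ?expR_ge0 ?(ltW y0)//.
rewrite normrM normrN (gtr0_norm y0) mulrA ler_wpM2l ?mulr_ge0 ?(ltW y0)//.
by rewrite ler_expR ler_wpM2r ?(ltW y0).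
Qed.

(** Negative [s] are needed too, because linear combinations of part counts have coefficients of
    either sign; the exponential weight keeps the third-order remainder integrable up to delta /
    2. *)
Lemma laplace_exponent_taylor : exists2 C, 0 <= C & forall s, `|s| <= delta / 2 ->
  `|laplace_exponent nu s - (levy_moment nu 1 * s - levy_moment nu 2 / 2 * s ^+ 2)| <= C * `|s| ^+ 3.
Proof.
have w1 := @weight_bounded_pow 1 isT; have w2 := @weight_bounded_pow 2 isT.
have w3 : weight_bounded delta (fun y => y ^+ 3 * expR (delta / 2 * y)).
  by exact: weight_bounded_powexp.
exists (nu_mean nu (fun y => y ^+ 3 * expR (delta / 2 * y))).
  by apply: nu_mean_ge0 => y y0; rewrite mulr_ge0 ?expR_ge0// exprn_ge0// ltW.
move=> s sd; have ws := weight_bounded_exp_small sd.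
have -> : laplace_exponent nu s - (levy_moment nu 1 * s - levy_moment nu 2 / 2 * s ^+ 2) =
    nu_mean nu (fun y => (1 - expR (- s * y)) - (s * y ^+ 1 - s ^+ 2 / 2 * y ^+ 2)).
  rewrite (nu_meanB deltaW)//; last first.
    by apply: weight_boundedB; exact: weight_boundedZ.
  rewrite (nu_meanB deltaW (weight_boundedZ s w1) (weight_boundedZ (s ^+ 2 / 2) w2)).
  by rewrite !(nu_meanZ deltaW)// /laplace_exponent /levy_moment /nu_mean; ring.
rewrite [leRHS]mulrC -(nu_meanZ deltaW)//; apply: (nu_mean_norm deltaW).
- by apply: weight_boundedB => //; apply: weight_boundedB; exact: weight_boundedZ.
- exact: weight_boundedZ.
move=> y y0.
have -> : (1 - expR (- s * y)) - (s * y ^+ 1 - s ^+ 2 / 2 * y ^+ 2) =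
    - (expR (- s * y) - (1 + (- s * y) + (- s * y) ^+ 2 / 2)) by field.
rewrite normrN; apply: le_trans (expR_taylor3 _) _.
rewrite normrM normrN (gtr0_norm y0).
rewrite [leLHS](_ : _ = `|s| ^+ 3 * (y ^+ 3 * expR (`|s| * y))); last by ring.
apply: ler_wpM2l; first by rewrite exprn_ge0.
by rewrite ler_wpM2l ?exprn_ge0 ?(ltW y0)// ler_expR ler_wpM2r ?(ltW y0).
Qed.

Lemma levy_moment_ge0 k : 0 <= levy_moment nu k.
Proof. by apply: nu_mean_ge0 => y y0; rewrite exprn_ge0// ltW. Qed.

Lemma levy_moment1_gt0 : condition_L nu -> 0 < levy_moment nu 1.
Proof.
move=> nuL; apply: lt_le_trans (laplace_exponent1_gt0 delta0 deltaW nuL) _.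
apply: (nu_mean_le deltaW); [exact: weight_bounded_exp|exact: weight_bounded_pow|].
move=> y y0; rewrite mulN1r expr1 lerBlDl -lerBlDr; exact: expR_ge1Dx.
Qed.

End levy_asymptotics.

(** * Asymptotics of the cut rates *)

Section bernstein_derivative.
Context {R : realType}.
Implicit Types (f : nat -> R) (x : R).

(** The classical identity for Bernstein polynomials, by induction through [bin_meanS]. It is used
    for binomial tails and for the comparison functions. *)
Lemma is_derive_bin_mean n f x : is_derive x 1 (fun x : R => bin_mean n.+1 x f)
  (n.+1%:R * bin_mean n x (fun j => f j.+1 - f j)).
Proof.
elim: n f => [|n IH] f.
  rewrite (_ : (fun _ => _) = (fun x => x * f 1%N + (1 - x) * f 0%N)); last first.
    by apply/funext => y; rewrite bin_meanS !bin_mean0.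
  rewrite bin_mean0; apply: is_derive_eq.
  by rewrite /GRing.scale/=; ring.
rewrite (_ : (fun _ => _) = (fun x => x * bin_mean n.+1 x (f \o S) + (1 - x) * bin_mean n.+1 x f)); last first.
  by apply/funext => y; rewrite bin_meanS.
have h1 := IH (f \o S); have h2 := IH f.
apply: is_derive_eq; rewrite /GRing.scale/=.
have -> : bin_mean n.+1 x (fun j => f j.+1 - f j) = bin_mean n.+1 x (f \o S) - bin_mean n.+1 x f.
  by rewrite -mulN1r -bin_meanZ -bin_meanD; congr bin_mean; apply/funext => j; rewrite mulN1r.
have E : bin_mean n.+1 x (f \o S) - bin_mean n.+1 x f =
    x * bin_mean n x (fun j => f j.+2 - f j.+1) + (1 - x) * bin_mean n x (fun j => f j.+1 - f j).
  rewrite -[RHS](bin_meanS n x (fun j => f j.+1 - f j)) -mulN1r -bin_meanZ -bin_meanD.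
  by congr bin_mean; apply/funext => j; rewrite mulN1r.
rewrite -(natr1 n.+1) mulrDl mul1r {1}E.
have -> : bin_mean n.+1 x (f \o S) = bin_mean n.+1 x f +
    (x * bin_mean n x (fun j => f j.+2 - f j.+1) + (1 - x) * bin_mean n x (fun j => f j.+1 - f j)).
  by rewrite -E addrC subrK.
by ring.
Qed.

Lemma bin_weight_mulS n x j : j.+1%:R * bin_weight n.+1 x j.+1 = n.+1%:R * x * bin_weight n x j.
Proof.
rewrite /bin_weight subSS exprS; have := mul_bin_diag n.+1 j; rewrite /= => h.
have : n.+1%:R * 'C(n, j)%:R = j.+1%:R * 'C(n.+1, j.+1)%:R :> R by rewrite -!natrM h.
move: (x ^+ j) ((1 - x) ^+ (n - j)) => a b h2.
by rewrite !mulrA -h2; ring.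
Qed.

(** Multiplication by x restores the degree; the terms j (f j - f (j - 1)) are the ones that
    simplify for [rising_ratio]. *)
Lemma bin_mean_deriv_mul n f x : x * (n.+1%:R * bin_mean n x (fun j => f j.+1 - f j)) =
  bin_mean n.+1 x (fun j => j%:R * (f j - f j.-1)).
Proof.
rewrite /bin_mean [RHS]big_ord_recl/= mul0r mulr0 add0r mulrA !mulr_sumr.
apply: eq_bigr => j _; rewrite /bump/= add1n.
have := bin_weight_mulS n x j; move: (bin_weight n x j) (bin_weight n.+1 x j.+1) => a b h.
rewrite [RHS]mulrA [b * _]mulrC h; ring.
Qed.

(** The Beta density of the (j + 1)-st smallest of n + 1 independent uniform variables. *)
Definition bernstein_kernel n j (t : R) : R := n.+1%:R * bin_weight n t j.

Definition at_least n m (x : R) : R := bin_mean n x (fun j => (m <= j)%N%:R).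

Lemma at_leastS n m x : at_least n m x = bin_weight n x m + at_least n m.+1 x.
Proof.
rewrite /at_least /bin_mean; have [mn|mn] := leqP m n; last first.
  rewrite [bin_weight _ _ m]/bin_weight bin_small// !mul0r add0r; apply: eq_bigr => j _.
  have jm : (j < m)%N by exact: leq_trans (ltn_ord j) mn.
  by rewrite leqNgt jm ltnNge (ltnW jm).
rewrite (bigD1 (Ordinal (mn : (m < n.+1)%N)))//= leqnn mulr1; congr (_ + _).
rewrite [RHS](bigD1 (Ordinal (mn : (m < n.+1)%N)))//= ltnn mulr0 add0r.
apply: eq_bigr => j jm; rewrite leq_eqVlt; congr (_ * (nat_of_bool _)%:R).
suff -> : (m == j) = false by [].
by apply/negbTE; apply: contra jm => /eqP E; apply/eqP/val_inj; rewrite /= E.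
Qed.

Lemma is_derive_at_least n m x : (m <= n)%N ->
  is_derive x 1 (at_least n.+1 m.+1) (bernstein_kernel n m x).
Proof.
move=> mn; apply: is_derive_eq; first exact: is_derive_bin_mean.
rewrite /bernstein_kernel; congr (_ * _).
rewrite /bin_mean (bigD1 (Ordinal (mn : (m < n.+1)%N)))//= ltnS leqnn ltnn subr0 mulr1.
rewrite big1 ?addr0// => j jm; rewrite ltnS leq_eqVlt.
suff -> : (m == j) = false by rewrite subrr mulr0.
by apply/negbTE; apply: contra jm => /eqP E; apply/eqP/val_inj; rewrite /= E.
Qed.

Lemma at_least0 n m : (0 < m)%N -> at_least n m 0 = 0.
Proof.
move=> m0; rewrite /at_least /bin_mean big1// => j _.
case: j => -[|j] jn /=; first by rewrite leqn0 gtn_eqF// mulr0.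
by rewrite /bin_weight expr0n/= mulr0 !mul0r.
Qed.

Lemma at_least1 n m : (m <= n)%N -> at_least n m 1 = 1.
Proof.
move=> mn; rewrite /at_least /bin_mean (bigD1 ord_max)//= mn big1 => [|j jn].
  by rewrite addr0 mulr1 /bin_weight subrr subnn binn expr1n !mulr1.
rewrite /bin_weight subrr expr0n subn_eq0 leqNgt.
suff -> : (j < n)%N by rewrite mulr0 mul0r.
by rewrite ltn_neqAle -ltnS ltn_ord andbT; apply: contra jn => /eqP E; apply/eqP/val_inj.
Qed.

Lemma bernstein_kernel_ge0 n j (t : R) : 0 <= t <= 1 -> 0 <= bernstein_kernel n j t.
Proof. by move=> t01; rewrite mulr_ge0// bin_weight_ge0. Qed.

(** Size-biasing a Beta density gives a multiple of another one; the factor (j + 1) / (n + 2) is the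
    mean of the first. *)
Lemma bernstein_kernel_mul n j (t : R) :
  t * bernstein_kernel n j t = j.+1%:R / n.+2%:R * bernstein_kernel n.+1 j.+1 t.
Proof.
rewrite /bernstein_kernel mulrCA mulrA -bin_weight_mulS.
by rewrite [RHS]mulrA divfK// pnatr_eq0.
Qed.

Lemma continuous_bernstein_kernel n j : continuous (bernstein_kernel n j).
Proof.
move=> t; apply: cvgM; first exact: cvg_cst.
apply: cvgM; first by apply: cvgM; [exact: cvg_cst|exact: exprn_continuous].
apply: (@cvg_comp _ _ _ (fun t => 1 - t) (fun x => x ^+ (n - j)) _ (nbhs (1 - t))).
  by apply: cvgB; [exact: cvg_cst|exact: cvg_id].
exact: exprn_continuous.
Qed.

End bernstein_derivative.

Section bernstein_integrals.
Context {R : realType}.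
Local Notation mR := (measurableTypeR R).
Local Notation leb := (@lebesgue_measure R).
Local Notation I01 := (`]0, 1[%classic : set mR).

Let mI : measurable I01. Proof. exact: measurable_itv. Qed.

Lemma integral_bernstein_kernel n m (x : R) : (m <= n)%N -> 0 <= x <= 1 ->
  (\int[leb]_(t in `]0%R, x[%classic) (bernstein_kernel n m t)%:E = (at_least n.+1 m.+1 x)%:E)%E.
Proof.
move=> mn /andP[x0 x1]; move: x0; rewrite le_eqVlt => /orP[/eqP <-|x0].
  by rewrite set_itv_ge ?bnd_simp ?ltxx// integral_set0 at_least0.
have mk : measurable_fun setT (bernstein_kernel n m : mR -> R).
  by apply: continuous_measurable_fun; exact: continuous_bernstein_kernel.
transitivity (\int[leb]_(t in `[0%R, x]%classic) (bernstein_kernel n m t)%:E)%E.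
  by apply/esym/integral_itv_bndoo; apply/measurable_EFinP; exact: measurable_funS mk.
rewrite (@continuous_FTC2 _ _ (at_least n.+1 m.+1))//.
- by rewrite at_least0// sube0.
- by apply: continuous_subspaceT; exact: continuous_bernstein_kernel.
- have h (y : R) : derivable (at_least n.+1 m.+1) y 1.
    exact: (@ex_derive _ _ _ _ _ _ _ (is_derive_at_least y mn)).
  have c (y : R) : {for y, continuous (at_least n.+1 m.+1 : R -> R)}.
    by apply: differentiable_continuous; apply/derivable1_diffP; exact: h.
  split.
  + by move=> y _; exact: h.
  + by apply: cvg_at_right_filter; exact: c 0.
  + by apply: cvg_at_left_filter; exact: c x.
- by move=> y _; rewrite derive1E; exact: (@derive_val _ _ _ _ _ _ _ (is_derive_at_least y mn)).
Qed.

(** Tonelli's theorem. The weight [w] stands for a restriction or a density: it is applied to [nu]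
    on the positive half-line and to dr / r on the unit interval. *)
Lemma layer_cake {d : measure_display} {T : measurableType d}
    (mu : {sigma_finite_measure set T -> \bar R}) (w X : T -> R) (k : mR -> R) :
  measurable_fun setT w -> (forall y, 0 <= w y) ->
  measurable_fun setT X -> measurable_fun setT k -> (forall t, 0 <= k t) ->
  (\int[mu]_y ((w y)%:E * \int[leb]_t (k t * (t <= X y)%R%:R)%:E) =
   \int[leb]_t ((k t)%:E * \int[mu]_y (w y * (t <= X y)%R%:R)%:E))%E.
Proof.
move=> mw w0 mX mk k0.
pose F (p : T * mR) : \bar R := (w p.1 * (k p.2 * (p.2 <= X p.1)%R%:R))%:E.
have mle : measurable_fun setT (fun p : T * mR => ((p.2 <= X p.1)%R%:R : R)).
  have [] // := @bounded_mfun_bool _ (T * mR)%type R (fun p => p.2 <= X p.1) _.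
  apply: measurable_fun_ler; last exact: measurableT_comp.
  exact: measurable_snd.
have mF : measurable_fun setT F.
  apply/measurable_EFinP; apply: measurable_funM; first exact: measurableT_comp.
  by apply: measurable_funM => //; exact: measurableT_comp.
have F0 p : (0 <= F p)%E by rewrite lee_fin !mulr_ge0.
have le1 y : measurable_fun setT (fun t : mR => (t <= X y)%R%:R : R).
  exact: (measurableT_comp mle (measurable_fun_pair (measurable_cst y) (@measurable_id _ _ setT))).
have le2 t : measurable_fun setT (fun y : T => (t <= X y)%R%:R : R).
  exact: (measurableT_comp mle (measurable_fun_pair (@measurable_id _ _ setT) (measurable_cst t))).
transitivity (\int[mu]_y \int[leb]_t F (y, t))%E.
  apply: eq_integral => y _; rewrite -ge0_integralZl//.
  - by apply/measurable_EFinP; apply: measurable_funM => //; exact: le1.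
  - by move=> t _; rewrite lee_fin mulr_ge0.
  - by rewrite lee_fin.
rewrite (fubini_tonelli F mF F0); apply: eq_integral => t _.
rewrite -ge0_integralZl//.
- by apply: eq_integral => y _; rewrite /F/= -EFinM mulrCA.
- by apply/measurable_EFinP; apply: measurable_funM => //; exact: le2.
- by move=> y _; rewrite lee_fin mulr_ge0.
- by rewrite lee_fin.
Qed.

Definition cut_kernel n m (t : mR) : R := bernstein_kernel n m t * \1_I01 t.

Lemma measurable_cut_kernel n m : measurable_fun setT (cut_kernel n m).
Proof.
apply: measurable_funM; last exact: measurable_indic.
by apply: continuous_measurable_fun; exact: continuous_bernstein_kernel.
Qed.

Lemma cut_kernel_ge0 n m t : 0 <= cut_kernel n m t.
Proof.
rewrite /cut_kernel indicE; case: (boolP (t \in I01)) => h; last by rewrite mulr0.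
move: h; rewrite inE/= in_itv/= => /andP[t0 t1].
by rewrite mulr1 bernstein_kernel_ge0// !ltW.
Qed.

Lemma integral_cut_kernel n m (x : R) : (m <= n)%N -> 0 <= x < 1 ->
  (\int[leb]_t (cut_kernel n m t * (t <= x)%R%:R)%:E = (at_least n.+1 m.+1 x)%:E)%E.
Proof.
move=> mn /andP[x0 x1]; rewrite -integral_bernstein_kernel ?x0 ?(ltW x1)//.
have mk : measurable_fun setT (bernstein_kernel n m : mR -> R).
  by apply: continuous_measurable_fun; exact: continuous_bernstein_kernel.
transitivity (\int[leb]_(t in `]0%R, x]%classic) (bernstein_kernel n m t)%:E)%E; last first.
  by apply: integral_itv_bndoo; apply/measurable_EFinP; exact: measurable_funS mk.
rewrite [RHS]integral_mkcond; apply: eq_integral => t _.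
rewrite patchE /cut_kernel indicE !mem_setE !in_itv/=.
have [t0|t0] := ltP 0 t; last by rewrite /= mulr0 mul0r.
have [tx|tx] := leP t x; last by rewrite mulr0.
by rewrite (le_lt_trans tx x1) /= !mulr1.
Qed.

Lemma integral_cut_kernelT n m : (m <= n)%N -> (\int[leb]_t (cut_kernel n m t)%:E = 1)%E.
Proof.
move=> mn; rewrite -(@at_least1 R n.+1 m.+1)// -integral_bernstein_kernel ?ler01 ?lexx//.
rewrite [RHS]integral_mkcond; apply: eq_integral => t _.
by rewrite patchE /cut_kernel indicE; case: (_ \in _); rewrite ?mulr1 ?mulr0.
Qed.

End bernstein_integrals.

Section cut_rate_limit.
Context {R : realType}.
Local Notation mR := (measurableTypeR R).
Local Notation leb := (@lebesgue_measure R).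
Local Notation I01 := (`]0, 1[%classic : set mR).
Variable nu : {measure set R -> \bar R}.
Hypothesis nu_levy : levy_measure nu.
Variable delta : R.
Hypotheses (delta0 : 0 < delta) (deltaW : weight_integrable nu delta).

Let mI : measurable I01. Proof. exact: measurable_itv. Qed.

Lemma levy_sigma_finite : sigma_finite setT nu.
Proof.
exists (fun k : nat => (if k is k'.+1 then `[k%:R^-1, +oo[ else `]-oo, 0])%classic : set R).
  apply/seteqP; split => // x _; have [x0|x0] := leP x 0.
    by exists 0%N => //=; rewrite in_itv.
  exists (Num.truncn x^-1).+1 => //=; rewrite in_itv/= andbT.
  have /andP[_ h] := truncn_itv (ltW (etrans (invr_gt0 x) x0)).
  by rewrite invf_ple ?posrE// ltW.
move=> [|k]; split; try exact: measurable_itv.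
  by rewrite nu_levy.1.
by apply: levy_ray_lty; rewrite ?invr_gt0.
Qed.

Definition levy_sf : {sigma_finite_measure set R -> \bar R} :=
  HB.pack_for (sigma_finite_measure R R) (Measure.sort nu)
    (isSFinite.Build _ _ _ _ (sfinite_measure_sigma_finite levy_sigma_finite))
    (isSigmaFinite.Build _ _ _ _ levy_sigma_finite).

(** Rate of the jumps that cover at least the fraction [t], as 1 - e^-y >= t means y >= - ln (1 -
    t). *)
Definition tail_fraction (t : R) : R := levy_tail nu (- ln (1 - t)).

Lemma at_least_bound n m (x : R) : 0 <= x <= 1 -> 0 <= at_least n m.+1 x <= n%:R * x.
Proof.
move=> x01; rewrite -(bin_mean_id n x); apply/andP; split.
  by apply: sumr_ge0 => j _; rewrite mulr_ge0// bin_weight_ge0.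
apply: bin_mean_le => // j _; rewrite ler_nat.
by case: leqP => // h; exact: leq_trans h.
Qed.

Lemma exp_fraction01 (y : R) : 0 < y -> 0 <= 1 - expR (- y) < 1.
Proof.
by move=> y0; rewrite subr_ge0 -{1}expR0 ler_expR oppr_le0 (ltW y0) gtrBl expR_gt0.
Qed.

Lemma continuous_bin_mean n (f : nat -> R) : continuous (fun x : R => bin_mean n x f).
Proof.
case: n => [|n]; first by under eq_fun do rewrite bin_mean0; exact: cst_continuous.
move=> x; apply: differentiable_continuous; apply/derivable1_diffP.
exact: (@ex_derive _ _ _ _ _ _ _ (is_derive_bin_mean n f x)).
Qed.

Lemma measurable_bin_mean_exp n (f : nat -> R) :
  measurable_fun setT (fun y : R => bin_mean n (1 - expR (- y)) f).
Proof.
apply: (measurableT_comp (f := fun x : R => bin_mean n x f)).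
  by apply: continuous_measurable_fun; exact: continuous_bin_mean.
apply: measurable_funB => //; apply: measurable_expR_comp.
exact: oppr_measurable.
Qed.

Lemma weight_bounded_at_least n m : weight_bounded delta (fun y => at_least n m.+1 (1 - expR (- y))).
Proof.
apply: (weight_bounded_le (g := fun y => 1 - expR (- 1 * y)) (C := n%:R)) => //.
- exact: measurable_bin_mean_exp.
- exact: weight_bounded_exp.
- move=> y y0; have /andP[e0 e1] := exp_fraction01 y0.
  have /andP[h0 h1] := at_least_bound n m (introT andP (conj e0 (ltW e1))).
  by rewrite mulN1r !ger0_norm.
Qed.

(** A binomial tail at 1 - e^-y is a Beta density integrated up to that point. Exchanging the
    integrals trades [nu] for its tail function, which is what (L) describes. *)
Lemma layer_cake_levy n m : (m <= n)%N ->
  (\int[nu]_(y in `]0%R, +oo[%classic) (at_least n.+1 m.+1 (1 - expR (- y)))%:E =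
   \int[leb]_t (cut_kernel n m t * tail_fraction t)%:E)%E.
Proof.
move=> mn; have mD : measurable (`]0, +oo[%classic : set R) by exact: measurable_itv.
have mX : measurable_fun setT (fun y : R => 1 - expR (- y)).
  by apply: measurable_funB => //; apply: measurable_expR_comp; exact: oppr_measurable.
have := @layer_cake R _ _ levy_sf (\1_(`]0, +oo[%classic)) (fun y => 1 - expR (- y)) (cut_kernel n m)
  (measurable_indic mD) _ mX (measurable_cut_kernel n m) (@cut_kernel_ge0 _ n m).
move=> h; transitivity (\int[levy_sf]_y ((\1_(`]0%R, +oo[%classic) y)%:E *
  \int[leb]_t (cut_kernel n m t * (t <= 1 - expR (- y))%R%:R)%:E))%E.
  rewrite integral_mkcond; apply: eq_integral => y _.
  rewrite patchE indicE; case: ifPn => [|yD]; last by rewrite mul0e.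
  rewrite inE/= in_itv/= andbT => y0.
  by rewrite mul1e integral_cut_kernel// exp_fraction01.
rewrite h => [|y]; last by rewrite indicE.
apply: eq_integral => t _.
rewrite /cut_kernel indicE; case: (boolP (t \in I01)) => [|tI]; last by rewrite mulr0 !mul0r mul0e.
rewrite inE/= in_itv/= => /andP[t0 t1]; rewrite [RHS]EFinM; congr (_ * _)%E.
rewrite /tail_fraction levy_tailE//; last first.
  by rewrite oppr_gt0 ln_lt0// subr_gt0 t1/= gtrBl.
transitivity (\int[nu]_y (\1_(`[- ln (1 - t), +oo[%classic) y)%:E)%E.
  apply: eq_integral => y _; rewrite !indicE !mem_setE !in_itv/= !andbT; congr EFin.
  have e : (t <= 1 - expR (- y)) = (- ln (1 - t) <= y).
    by rewrite lerBrDl -lerBrDr lerNl -[in RHS]ler_expR lnK// posrE subr_gt0.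
  rewrite e; case: (ltP 0 y) => y0; first by rewrite mul1r.
  rewrite mul0r leNgt (le_lt_trans y0)// oppr_gt0 ln_lt0// subr_gt0 t1/= gtrBl//.
by rewrite integral_indic// setIT.
Qed.

(** [expR (- ln r)] is 1 / r for positive r, in a form that is nonnegative everywhere. *)
Lemma integral_inv (t : R) : 0 < t < 1 ->
  (\int[leb]_(r in `[t, 1%R[%classic) (expR (- ln r))%:E = (- ln t)%:E)%E.
Proof.
move=> /andP[t0 t1].
have mf : measurable_fun setT (fun r : R => expR (- ln r)).
  by apply: measurable_expR_comp; apply: measurableT_comp => //; exact: measurable_ln.
have mf' (A : set mR) : measurable_fun A (fun r : mR => (expR (- ln r))%:E).
  by apply/measurable_EFinP; exact: measurable_funS mf.
rewrite (integral_itv_bndoo true true (mf' _)).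
transitivity (\int[leb]_(r in `[t, 1%R]%classic) (expR (- ln r))%:E)%E.
  exact: esym (integral_itv_bndoo true false (mf' _)).
have pos (r : R) : t <= r -> 0 < r by exact: lt_le_trans.
have dln (r : R) : 0 < r -> is_derive r 1 (@ln R) (expR (- ln r)).
  by move=> r0; rewrite expRN lnK ?posrE//; exact: is_derive1_ln.
have cln (r : R) : 0 < r -> {for r, continuous (@ln R)} by exact: continuous_ln.
rewrite (@continuous_FTC2 _ _ (@ln R))//.
- by rewrite ln1 sub0e.
- apply: continuous_in_subspaceT => r; rewrite inE/= in_itv/= => /andP[/pos r0 _].
  apply: continuous_comp; last exact: continuous_expR.
  by apply: continuousN; exact: cln.
- split.
  + by move=> r; rewrite in_itv/= => /andP[/ltW/pos/dln h _]; exact: (@ex_derive _ _ _ _ _ _ _ h).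
  + by apply: cvg_at_right_filter; exact: cln.
  + by apply: cvg_at_left_filter; apply: cln; exact: ltr01.
- move=> r; rewrite in_itv/= => /andP[/ltW/pos/dln h _].
  by rewrite derive1E; exact: (@derive_val _ _ _ _ _ _ _ h).
Qed.

(** The model case: on the unit interval the measure dr / r has the tail - ln t, which is the
    leading term of (L). *)
Lemma layer_cake_log n m : (m <= n)%N ->
  (\int[leb]_r (\1_I01 r * expR (- ln r) * at_least n.+1 m.+1 r)%:E =
   \int[leb]_t (cut_kernel n m t * - ln t)%:E)%E.
Proof.
move=> mn.
have mw : measurable_fun setT (fun r : mR => \1_I01 r * expR (- ln r) : R).
  apply: measurable_funM; first exact: measurable_indic.
  by apply: measurable_expR_comp; apply: measurableT_comp => //; exact: measurable_ln.
have mid : measurable_fun setT (fun r : mR => r : R) by exact: measurable_id.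
have := @layer_cake R _ mR leb (fun r => \1_I01 r * expR (- ln r)) (fun r => r) (cut_kernel n m)
  mw _ mid (measurable_cut_kernel n m) (@cut_kernel_ge0 _ n m).
move=> h; transitivity (\int[leb]_r ((\1_I01 r * expR (- ln r))%:E *
  \int[leb]_t (cut_kernel n m t * (t <= r)%R%:R)%:E))%E.
  apply: eq_integral => r _; rewrite indicE; case: (boolP (r \in I01)) => [|rI]; last by rewrite !mul0r mul0e.
  rewrite inE/= in_itv/= => /andP[r0 r1].
  by rewrite integral_cut_kernel ?EFinM// (ltW r0).
rewrite h => [|r]; last by rewrite mulr_ge0 ?expR_ge0// indicE.
apply: eq_integral => t _.
rewrite /cut_kernel indicE; case: (boolP (t \in I01)) => [|tI]; last by rewrite mulr0 !mul0r mul0e.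
rewrite inE/= in_itv/= => /andP[t0 t1]; rewrite [RHS]EFinM; congr (_ * _)%E.
rewrite -(@integral_inv t) ?t0// [RHS]integral_mkcond; apply: eq_integral => r _.
rewrite patchE indicE !mem_setE !in_itv/=.
have [tr|tr] := leP t r; last by rewrite mulr0.
by rewrite (lt_le_trans t0 tr)/=; case: (r < 1); rewrite /= ?mulr1 ?mul1r ?mul0r.
Qed.

(** On the open unit interval [tail_fraction] is an inner integral of a product-measurable
    function. *)
Lemma measurable_cut_tail n m :
  measurable_fun setT (fun t : mR => cut_kernel n m t * tail_fraction t).
Proof.
pose F (p : R * mR) : \bar R := (\1_(`]0, +oo[%classic : set R) p.1 * (p.2 <= 1 - expR (- p.1))%R%:R)%:E.
have mD : measurable (`]0, +oo[%classic : set R) by exact: measurable_itv.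
have mX : measurable_fun setT (fun y : R => 1 - expR (- y)).
  by apply: measurable_funB => //; apply: measurable_expR_comp; exact: oppr_measurable.
have mF : measurable_fun setT F.
  apply/measurable_EFinP; apply: measurable_funM.
    by apply: measurableT_comp => //; exact: measurable_indic.
  have [] // := @bounded_mfun_bool _ (R * mR)%type R (fun p => p.2 <= 1 - expR (- p.1)) _.
  apply: measurable_fun_ler; first exact: measurable_snd.
  exact: (measurableT_comp mX).
have F0 p : (0 <= F p)%E by rewrite lee_fin mulr_ge0// indicE.
have mG := @measurable_fun_fubini_tonelli_G _ _ R mR R levy_sf F mF F0.
have mg : measurable_fun setT (fun t : mR => fine (fubini_G levy_sf F t)).
  by apply: measurableT_comp mG; exact: fine_measurable.
rewrite (_ : (fun t => _) = (fun t => cut_kernel n m t * fine (fubini_G levy_sf F t))).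
  by apply: measurable_funM => //; exact: measurable_cut_kernel.
apply/funext => t; rewrite /cut_kernel indicE.
case: (boolP (t \in I01)) => [|tI]; last by rewrite mulr0 !mul0r.
rewrite inE/= in_itv/= => /andP[t0 t1]; congr (_ * _).
rewrite /tail_fraction /levy_tail /fubini_G; congr fine.
transitivity (\int[nu]_y (\1_(`[- ln (1 - t), +oo[%classic) y)%:E)%E.
  by rewrite integral_indic// setIT.
apply/esym/eq_integral => y _; rewrite /F/= !indicE !mem_setE !in_itv/= !andbT; congr EFin.
have e : (t <= 1 - expR (- y)) = (- ln (1 - t) <= y).
  by rewrite lerBrDl -lerBrDr lerNl -[in RHS]ler_expR lnK// posrE subr_gt0.
rewrite e; case: (ltP 0 y) => y0; first by rewrite mul1r.
by rewrite mul0r leNgt (le_lt_trans y0)// oppr_gt0 ln_lt0// subr_gt0 t1/= gtrBl.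
Qed.

Lemma ge0_integrable_fin (f : mR -> R) (a : R) : measurable_fun setT f -> (forall t, 0 <= f t) ->
  (\int[leb]_t (f t)%:E = a%:E)%E -> leb.-integrable setT (EFin \o f) /\ \int[leb]_t f t = a.
Proof.
move=> mf f0 fa; split; last by rewrite /Rintegral fa.
apply/integrableP; split; first exact/measurable_EFinP.
by under eq_integral do rewrite /= ger0_norm//; rewrite fa ltry.
Qed.

Definition kernel_mean n m (f : mR -> R) : R := \int[leb]_t (cut_kernel n m t * f t).

Lemma cut_kernel_int n m : (m <= n)%N ->
  leb.-integrable setT (EFin \o cut_kernel n m) /\ \int[leb]_t cut_kernel n m t = 1.
Proof.
move=> mn; apply: ge0_integrable_fin.
- exact: measurable_cut_kernel.
- exact: cut_kernel_ge0.
- exact: integral_cut_kernelT.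
Qed.

Lemma kernel_mean_tail n m : (m <= n)%N ->
  leb.-integrable setT (fun t => (cut_kernel n m t * tail_fraction t)%:E) /\
  kernel_mean n m tail_fraction = nu_mean nu (fun y => at_least n.+1 m.+1 (1 - expR (- y))).
Proof.
move=> mn; apply: (@ge0_integrable_fin (fun t => cut_kernel n m t * tail_fraction t)).
- exact: measurable_cut_tail.
- by move=> t; rewrite mulr_ge0 ?cut_kernel_ge0// levy_tail_ge0.
rewrite -layer_cake_levy// /nu_mean /Rintegral fineK//.
apply: integrable_fin_num; first exact: measurable_itv.
exact: (weight_bounded_integrable deltaW (weight_bounded_at_least n.+1 m)).
Qed.

Definition log_mean n m : R := \int[leb]_r (\1_I01 r * expR (- ln r) * at_least n.+1 m.+1 r).

Lemma measurable_log_at_least n m :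
  measurable_fun setT (fun r : mR => \1_I01 r * expR (- ln r) * at_least n.+1 m.+1 r).
Proof.
apply: measurable_funM; first apply: measurable_funM.
- exact: measurable_indic.
- by apply: measurable_expR_comp; apply: measurableT_comp => //; exact: measurable_ln.
- by apply: continuous_measurable_fun; exact: continuous_bin_mean.
Qed.

Lemma log_at_least_bound n m r :
  0 <= \1_I01 r * expR (- ln r) * at_least n.+1 m.+1 r <= n.+1%:R * \1_I01 r.
Proof.
rewrite indicE; case: (boolP (r \in I01)) => [|rI]; last by rewrite !mul0r mulr0 lexx.
rewrite inE/= in_itv/= => /andP[r0 r1].
have /andP[h0 h1] := at_least_bound n.+1 m (introT andP (conj (ltW r0) (ltW r1))).
rewrite mul1r mulr1 mulr_ge0 ?expR_ge0//= expRN lnK ?posrE// mulrC ler_pdivrMr//.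
Qed.

Lemma log_integrable n m :
  leb.-integrable setT (fun r => (\1_I01 r * expR (- ln r) * at_least n.+1 m.+1 r)%:E).
Proof.
apply: (@le_integrable _ _ _ leb setT measurableT _ (fun r => (n.+1%:R * \1_I01 r)%:E)).
- by apply/measurable_EFinP; exact: measurable_log_at_least.
- move=> r _; have /andP[h0 h1] := log_at_least_bound n m r.
  by rewrite lee_fin ger0_norm// (le_trans h1)// ler_norm.
rewrite (_ : (fun r => _) = (fun r => n.+1%:R%:E * (\1_I01 r)%:E)%E)//.
apply: integrableZl => //; have [h _] := @cut_kernel_int 0 0 isT.
rewrite (_ : (fun r => _) = EFin \o cut_kernel 0 0)//; apply/funext => r /=.
by rewrite /cut_kernel /bernstein_kernel /bin_weight subn0 !expr0 bin0 !mul1r.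
Qed.

Lemma kernel_mean_log n m : (m <= n)%N ->
  leb.-integrable setT (fun t => (cut_kernel n m t * - ln t)%:E) /\
  kernel_mean n m (fun t => - ln t) = log_mean n m.
Proof.
move=> mn; apply: (@ge0_integrable_fin (fun t => cut_kernel n m t * - ln t)).
- apply: measurable_funM; first exact: measurable_cut_kernel.
  by apply: measurableT_comp; [exact: oppr_measurable|exact: measurable_ln].
- move=> t; rewrite /cut_kernel indicE; case: (boolP (t \in I01)) => [|tI]; last by rewrite mulr0 mul0r.
  rewrite inE/= in_itv/= => /andP[t0 t1]; rewrite mulr1 mulr_ge0 ?bernstein_kernel_ge0 ?(ltW t0) ?(ltW t1)//.
  by rewrite oppr_ge0 ln_le0// ltW.
rewrite -layer_cake_log// /log_mean /Rintegral fineK//.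
by apply: (integrable_fin_num measurableT); exact: log_integrable.
Qed.

(** A binomial weight divided by r is a Beta density divided by m + 1, and the density has mass
    1. *)
Lemma log_mean_diff n m : (m < n)%N -> log_mean n m - log_mean n m.+1 = m.+1%:R^-1.
Proof.
move=> mn; rewrite /log_mean -RintegralB//; try exact: log_integrable.
have [ik k1] := cut_kernel_int (ltnW mn).
rewrite -[RHS]mulr1 -[X in _ = _ * X]k1 -RintegralZl//; apply: eq_Rintegral => r _.
rewrite (at_leastS n.+1 m.+1) /cut_kernel indicE.
case: (boolP (r \in I01)) => [|rI]; last by rewrite !mul0r mulr0 mulr0 subr0.
rewrite inE/= in_itv/= => /andP[r0 r1].
rewrite mul1r mulr1 -mulrBr addrK expRN lnK ?posrE// /bernstein_kernel.
have r0' : r != 0 by rewrite gt_eqF.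
have m0 : m.+1%:R != 0 :> R by rewrite pnatr_eq0.
apply: (mulfI m0); rewrite mulrCA bin_weight_mulS.
by rewrite [RHS]mulrA divff// mul1r; field.
Qed.

(* With [- ln t] in place of [tail_fraction t] the difference is exactly
   [m.+1%:R^-1], see [log_mean_diff]. *)
Lemma cut_rate_tail n m : (m < n)%N ->
  cut_rate nu n.+1 m.+1 = kernel_mean n m tail_fraction - kernel_mean n m.+1 tail_fraction.
Proof.
move=> mn; rewrite (kernel_mean_tail (ltnW mn)).2 (kernel_mean_tail mn).2.
rewrite -(nu_meanB deltaW); try exact: weight_bounded_at_least.
by apply: eq_nu_mean => y y0; rewrite (at_leastS n.+1 m.+1) addrK.
Qed.

(** A bound linear in t, in the spirit of the concavity of t^eps, so that only the mean of t is
    needed afterwards. *)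
Lemma powR_tangent (eps a t : R) : 0 < eps <= 1 -> 0 < a -> 0 <= t ->
  t `^ eps <= a `^ eps * (1 + t / a).
Proof.
move=> /andP[e0 e1] a0 t0; have [ta|/ltW ta] := leP t a.
  apply: (@le_trans _ _ (a `^ eps)); first by rewrite ge0_ler_powR ?nnegrE// ltW.
  by rewrite ler_peMr ?powR_ge0// lerDl divr_ge0// ltW.
have {1}-> : t = a * (t / a) by rewrite mulrCA divff ?mulr1// gt_eqF.
rewrite powRM ?divr_ge0 ?(ltW a0)// ler_wpM2l ?powR_ge0//.
apply: le_trans (_ : t / a <= _); last by rewrite lerDr.
by apply: ler1_powR => //; rewrite ler_pdivlMr// mul1r.
Qed.

(** [powR_tangent] at the mean a = (m + 1) / (n + 2) of the Beta density; the constant and, after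
    size-biasing, the linear term each integrate to 1, whence the factor 2. *)
Lemma kernel_mean_powR n m (eps : R) : (m <= n)%N -> 0 < eps <= 1 ->
  leb.-integrable setT (fun t => (cut_kernel n m t * t `^ eps)%:E) /\
  kernel_mean n m (fun t => t `^ eps) <= 2 * (m.+1%:R / n.+2%:R) `^ eps.
Proof.
move=> mn e01; have /andP[e0 e1] := e01.
have [ik k1] := cut_kernel_int mn.
have [ik' k1'] := @cut_kernel_int n.+1 m.+1 mn.
pose a : R := m.+1%:R / n.+2%:R; have a0 : 0 < a by rewrite divr_gt0.
pose h t := a `^ eps * (cut_kernel n m t + cut_kernel n.+1 m.+1 t).
have hE t : 0 <= cut_kernel n m t * t `^ eps <= h t.
  rewrite mulr_ge0 ?cut_kernel_ge0 ?powR_ge0//=.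
  have [tI|tI] := boolP (t \in I01); last first.
    by rewrite /h /cut_kernel !indicE (negbTE tI) !mulr0 mul0r addr0 mulr0.
  move: (tI); rewrite inE/= in_itv/= => /andP[t0 t1].
  rewrite /h; have -> : cut_kernel n.+1 m.+1 t = cut_kernel n m t * (t / a).
    rewrite /cut_kernel indicE tI !mulr1; apply: (mulfI (lt0r_neq0 a0)).
    rewrite {1}/a -bernstein_kernel_mul mulrC [RHS]mulrCA; congr (_ * _).
    by rewrite mulrCA divff ?mulr1// gt_eqF.
  rewrite -{2}[cut_kernel n m t]mulr1 -mulrDr mulrCA.
  by rewrite ler_wpM2l ?cut_kernel_ge0// powR_tangent// ltW.
have ih : leb.-integrable setT (EFin \o h).
  rewrite (_ : EFin \o h = (fun t => (a `^ eps)%:E * ((EFin \o cut_kernel n m) t + (EFin \o cut_kernel n.+1 m.+1) t))%E).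
    by apply: integrableZl => //; exact: integrableD.
  by apply/funext => t; rewrite /= -EFinD -EFinM.
have ip : leb.-integrable setT (fun t => (cut_kernel n m t * t `^ eps)%:E).
  apply: (le_integrable measurableT _ _ ih).
    apply/measurable_EFinP; apply: measurable_funM; first exact: measurable_cut_kernel.
    exact: measurable_powR.
  by move=> t _; have /andP[h0 h1] := hE t; rewrite lee_fin ger0_norm// (le_trans h1)// ler_norm.
split=> //; apply: (@le_trans _ _ (\int[leb]_t h t)).
  by apply: le_Rintegral => // t _; have /andP[] := hE t.
rewrite /h RintegralZl//; last exact: (integrableD measurableT ik ik').
by rewrite RintegralD// k1 k1' mulrC.
Qed.

(** For small t the variable Y = - ln (1 - t) satisfies t <= Y <= 2 t and ln Y - ln t = O(t), so
    that (L) carries over. Away from 0 the left side is bounded and t^eps is bounded below. The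
    exponent is capped at 1 so that t^eps absorbs the O(t). *)
Lemma tail_fraction_log : condition_L nu -> exists c eps C, [/\ 0 < eps <= 1, 0 <= C &
  forall t, 0 < t < 1 -> `|tail_fraction t + ln t - c| <= C * t `^ eps].
Proof.
move=> /levy_tail_near0[c [eps0 [C0 [e [eps0_gt0 C00 e0 he]]]]].
pose eps := Num.min 1 eps0; have eps_gt0 : 0 < eps by rewrite lt_min ltr01.
have eps1 : eps <= 1 by rewrite ge_min lexx.
have epsle : eps <= eps0 by rewrite ge_min lexx orbT.
(* 2 t0 < e keeps Y <= 2 t where (L) applies, and t <= 1 / 2 gives 1 / (1 - t) <= 1 + 2 t. *)
pose t0 := Num.min (1 / 2) (e / 4).
have t00 : 0 < t0 by rewrite lt_min !divr_gt0.
have t0e : 2 * t0 < e.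
  by apply: (@le_lt_trans _ _ (2 * (e / 4))); [rewrite ler_pM2l// ge_min lexx orbT|lra].
have t02 : t0 <= 1 / 2 by rewrite ge_min lexx.
have pow1 (a b x : R) : 0 < x <= 1 -> a <= b -> x `^ b <= x `^ a.
  move=> /andP[x0 x1] ab; rewrite /powR gt_eqF// ler_expR ler_wnM2r// ln_le0//.
have lpos (t : R) : 0 < t < 1 -> 0 < - ln (1 - t).
  by move=> /andP[tp t1]; rewrite oppr_gt0 ln_lt0// subr_gt0 t1/= gtrBl.
pose C1 := tail_fraction t0 + `|ln t0| + `|c|.
have C10 : 0 <= C1 by rewrite !addr_ge0// levy_tail_ge0.
exists c, eps, (2 * C0 + 2 + C1 / t0 `^ eps); split; first by rewrite eps_gt0.
  apply: addr_ge0; last by rewrite divr_ge0// powR_ge0.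
  by rewrite addr_ge0// mulr_ge0// ltW.
move=> t /andP[tp t1].
have te0 : 0 < t `^ eps by rewrite powR_gt0.
have t0e0 : 0 < t0 `^ eps by rewrite powR_gt0.
have t01 : t0 < 1 by lra.
have [tt0|tt0] := leP t0 t.
  apply: (@le_trans _ _ C1).
    have tl : tail_fraction t <= tail_fraction t0.
      rewrite /tail_fraction -lee_fin !levy_tailE ?lpos ?tp ?t00//.
      apply: le_measure; rewrite ?inE; try exact: measurable_itv.
      move=> y; rewrite /= !in_itv/= !andbT; apply: le_trans.
      by rewrite lerN2 ler_ln ?posrE ?subr_gt0// lerD2l lerN2.
    have ll : `|ln t| <= `|ln t0|.
      by rewrite !ler0_norm ?ln_le0 ?(ltW t1) ?(ltW t01)// lerN2 ler_ln.
    apply: le_trans (ler_normB _ _) _; rewrite lerD2r.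
    apply: le_trans (ler_normD _ _) _; apply: lerD ll.
    by rewrite ger0_norm// levy_tail_ge0.
  apply: (@le_trans _ _ (C1 / t0 `^ eps * t `^ eps)); last first.
    by rewrite ler_wpM2r ?(ltW te0)// lerDr addr_ge0// mulr_ge0// ltW.
  rewrite -mulrA ler_peMr// ler_pdivlMl// mulr1 ge0_ler_powR ?nnegrE ?(ltW eps_gt0)// ltW//.
pose Y := - ln (1 - t).
have s0 : 0 < 1 - t by rewrite subr_gt0.
have YE : expR Y = (1 - t)^-1 by rewrite /Y expRN lnK// posrE.
have tY : t <= Y.
  by rewrite /Y lerNr -ler_expR lnK ?posrE//; exact: expR_ge1Dx.
have i2 : (1 - t)^-1 <= 1 + 2 * t.
  by rewrite -div1r ler_pdivrMr//; nra.
have Y2 : Y <= 2 * t.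
  have := expR_ge1Dx Y; rewrite YE; lra.
have Y0 : 0 < Y by exact: lt_le_trans tY.
have Y1 : Y <= 1 by lra.
have Ye : Y < e by apply: le_lt_trans Y2 _; lra.
have h1 : `|tail_fraction t - (- ln Y + c)| <= 2 * C0 * t `^ eps.
  apply: le_trans (he Y Y0 Ye) _; rewrite [2 * C0]mulrC -mulrA ler_pM2l//.
  apply: (@le_trans _ _ (Y `^ eps)); first by apply: pow1 => //; rewrite Y0.
  apply: (@le_trans _ _ ((2 * t) `^ eps)).
    by rewrite ge0_ler_powR ?nnegrE ?(ltW eps_gt0) ?(ltW Y0)// mulr_ge0// ltW.
  rewrite powRM ?(ltW tp)// ler_wpM2r ?(ltW te0)//.
  by apply: ler1_powR => //; rewrite ler1n.
have h2 : `|ln t - ln Y| <= 2 * t `^ eps.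
  have -> : ln t - ln Y = - ln (Y / t) by rewrite ln_div ?posrE// opprB.
  have yt1 : 1 <= Y / t by rewrite ler_pdivlMr// mul1r.
  rewrite normrN ger0_norm ?ln_ge0//.
  apply: (@le_trans _ _ (2 * t)).
    have : Y / t <= (1 - t)^-1.
      rewrite ler_pdivrMr//; have := expR_ge1Dx Y; rewrite YE.
      have : (1 - t)^-1 * t = (1 - t)^-1 - 1 by field; rewrite gt_eqF.
      lra.
    have := expR_ge1Dx (ln (Y / t)); rewrite lnK ?posrE ?divr_gt0//; lra.
  rewrite ler_pM2l// -{1}[t]powRr1 ?(ltW tp)//; apply: pow1 => //.
  by rewrite tp ltW.
apply: (@le_trans _ _ ((2 * C0 + 2) * t `^ eps)); last first.
  by rewrite ler_wpM2r ?(ltW te0)// lerDl divr_ge0// ltW.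
rewrite mulrDl; apply: le_trans (lerD h1 h2).
by apply: le_trans (ler_normD _ _); rewrite le_eqVlt; apply/orP; left; apply/eqP; congr (`|_|); ring.
Qed.

Definition decay (eps : R) (n : nat) : R := n.+1%:R `^ (- eps).

(** In the difference of two Beta means the constant of (L) cancels and the logarithm gives exactly
    1 / (m + 1). The remainder is bounded by Beta means of t^eps, of order n^-eps for fixed [m]. *)
Theorem cut_rate_cvg : condition_L nu -> exists eps, 0 < eps <= 1 /\
  forall m, exists2 C, 0 <= C & forall n,
    `|cut_rate nu n m.+1 - m.+1%:R^-1| <= C * decay eps n.
Proof.
move=> /tail_fraction_log[c [eps [C [e01 C0 hC]]]]; exists eps; split=> // m.
have /andP[e0 e1] := e01.
have main n : (m < n)%N -> `|cut_rate nu n.+1 m.+1 - m.+1%:R^-1| <=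
    4 * C * m.+2%:R `^ eps * decay eps n.+1.
  move=> mn; have mn' := ltnW mn.
  rewrite (cut_rate_tail mn) -(log_mean_diff mn) -(kernel_mean_log mn').2 -(kernel_mean_log mn).2.
  have err j : (j <= n)%N -> (j <= m.+1)%N -> `|kernel_mean n j tail_fraction - kernel_mean n j (fun t => - ln t) - c| <=
      2 * C * m.+2%:R `^ eps * decay eps n.+1.
    move=> jn jm; have [i1 _] := kernel_mean_tail jn; have [i2 _] := kernel_mean_log jn.
    have [i3 k1] := cut_kernel_int jn; have [i4 k4] := kernel_mean_powR jn e01.
    have i5 : leb.-integrable setT (fun t => (C * (cut_kernel n j t * t `^ eps))%:E).
      by rewrite (_ : (fun t => _) = (fun t => C%:E * (cut_kernel n j t * t `^ eps)%:E)%E)//; exact: integrableZl.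
    have i6 : leb.-integrable setT (fun t => (c * cut_kernel n j t)%:E).
      by rewrite (_ : (fun t => _) = (fun t => c%:E * (cut_kernel n j t)%:E)%E)//; exact: integrableZl.
    have i7 := integrableB measurableT i1 i2.
    have i8 := integrableB measurableT i7 i6.
    have -> : kernel_mean n j tail_fraction - kernel_mean n j (fun t => - ln t) - c =
        \int[leb]_t (cut_kernel n j t * tail_fraction t - cut_kernel n j t * - ln t - c * cut_kernel n j t).
      by rewrite RintegralB// RintegralB// RintegralZl// k1 mulr1.
    apply: le_trans (le_normr_Rintegral _ i8) _ => //.
    apply: (@le_trans _ _ (\int[leb]_t (C * (cut_kernel n j t * t `^ eps)))).
      apply: le_Rintegral => //; first exact: (integrable_norm i8).
      move=> t _.
      have [tI|tI] := boolP (t \in I01); last first.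
        by rewrite /cut_kernel indicE (negbTE tI) !mulr0 !mul0r !mulr0 !subr0 normr0.
      move: tI; rewrite inE/= in_itv/= => t01.
      have -> : cut_kernel n j t * tail_fraction t - cut_kernel n j t * - ln t - c * cut_kernel n j t =
        cut_kernel n j t * (tail_fraction t + ln t - c) by ring.
      rewrite normrM (ger0_norm (cut_kernel_ge0 _ _ _)) [leRHS]mulrCA.
      by rewrite ler_wpM2l ?cut_kernel_ge0//; exact: hC.
    rewrite RintegralZl// [leRHS](_ : _ = C * (2 * m.+2%:R `^ eps * decay eps n.+1)); last by ring.
    rewrite ler_wpM2l//; apply: le_trans k4 _.
    rewrite -[leRHS]mulrA ler_pM2l// powRM ?invr_ge0// /decay -powR_inv1// -powRrM mulN1r ler_wpM2r ?powR_ge0//.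
    by rewrite ge0_ler_powR ?nnegrE ?(ltW e0)// ler_nat.
  have h1 := err m mn' (leqnSn m); have h2 := err m.+1 mn (leqnn _).
  rewrite [X in `|X|](_ : _ = (kernel_mean n m tail_fraction - kernel_mean n m (fun t => - ln t) - c) -
    (kernel_mean n m.+1 tail_fraction - kernel_mean n m.+1 (fun t => - ln t) - c)); last by ring.
  apply: le_trans (ler_normB _ _) _; apply: le_trans (lerD h1 h2) _.
  by rewrite le_eqVlt; apply/orP; left; apply/eqP; ring.
have d0 n : 0 < decay eps n by rewrite powR_gt0.
(* Absorbs the finitely many n not covered by [main] into the constant. *)
pose B := \sum_(i < m.+2) `|cut_rate nu i m.+1 - m.+1%:R^-1| / decay eps i.
have B0 : 0 <= B by apply: sumr_ge0 => i _; rewrite divr_ge0// ltW.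
have K0 : 0 <= 4 * C * m.+2%:R `^ eps by rewrite !mulr_ge0 ?powR_ge0.
exists (4 * C * m.+2%:R `^ eps + B); first exact: addr_ge0.
move=> n; have [nm|mn] := ltnP n m.+2.
  apply: (@le_trans _ _ (B * decay eps n)); last by rewrite ler_wpM2r ?(ltW (d0 n))// lerDr.
  rewrite -ler_pdivrMr// /B (bigD1 (Ordinal nm))//= lerDl.
  by apply: sumr_ge0 => i _; rewrite divr_ge0// ltW.
case: n mn => // n mn; apply: le_trans (main n mn) _.
by rewrite ler_wpM2r ?(ltW (d0 _))// lerDl.
Qed.

End cut_rate_limit.

(** * Comparison functions *)

Section rising_ratio.
Context {R : realType}.
Implicit Types (s x : R) (n : nat).

Lemma inv_1B_bounds x : `|x| <= 1 / 2 -> expR x <= (1 - x)^-1 <= expR (x + 2 * x ^+ 2).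
Proof.
rewrite ler_norml => /andP[x1 x2]; have p : 0 < 1 - x by lra.
apply/andP; split.
  rewrite -[leLHS]invrK -expRN lef_pV2 ?posrE ?expR_gt0//; exact: expR_ge1Dx.
have -> : (1 - x)^-1 = 1 + x / (1 - x) by field; rewrite gt_eqF.
apply: le_trans (expR_ge1Dx _) _; rewrite ler_expR ler_pdivrMr//.
have -> : (x + 2 * x ^+ 2) * (1 - x) = x + x ^+ 2 * (1 - 2 * x) by ring.
by rewrite lerDl mulr_ge0 ?sqr_ge0//; lra.
Qed.

Definition harm n : R := \sum_(i < n) i.+1%:R^-1.

Lemma harm_ge0 n : 0 <= harm n.
Proof. by apply: sumr_ge0 => i _; rewrite invr_ge0. Qed.

Lemma harmS n : harm n.+1 = harm n + n.+1%:R^-1.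
Proof. by rewrite /harm big_ord_recr. Qed.

Lemma ln_natS k : k.+2%:R^-1 <= ln (k.+2%:R : R) - ln k.+1%:R <= k.+1%:R^-1.
Proof.
have p j : 0 < j.+1%:R :> R by rewrite ltr0n.
have q0 : 0 < k.+2%:R / k.+1%:R :> R by rewrite divr_gt0.
rewrite -ln_div ?posrE//; apply/andP; split.
  have := expR_ge1Dx (- ln (k.+2%:R / k.+1%:R) : R); rewrite expRN lnK ?posrE// invf_div.
  have -> : k.+1%:R / k.+2%:R = 1 - k.+2%:R^-1 :> R.
    by rewrite -[k.+2%:R]natr1; move: (k.+1%:R) (p k) => x x0; field; rewrite gt_eqF// addr_gt0.
  by rewrite lerD2l lerN2.
have := expR_ge1Dx (ln (k.+2%:R / k.+1%:R) : R); rewrite lnK ?posrE//.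
have -> : k.+2%:R / k.+1%:R = 1 + k.+1%:R^-1 :> R.
  by rewrite -[k.+2%:R]natr1; move: (k.+1%:R) (p k) => x x0; field; rewrite gt_eqF.
by rewrite lerD2l.
Qed.

Lemma harm_ln n : ln n.+1%:R <= harm n.+1 <= 1 + ln n.+1%:R.
Proof.
apply/andP; split.
  apply: (@le_trans _ _ (ln n.+2%:R)); first by rewrite ler_ln ?posrE ?ltr0n// ler_nat.
  elim: n => [|n IH].
    by rewrite harmS /harm big_ord0 add0r; have /andP[_] := ln_natS 0; rewrite ln1 subr0.
  rewrite harmS; have /andP[_] := ln_natS n.+1.
  move: (ln n.+3%:R) (ln n.+2%:R) (n.+2%:R^-1) IH => x y z; lra.
elim: n => [|n IH]; first by rewrite harmS /harm big_ord0 add0r ln1 invr1 addr0.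
rewrite harmS; have /andP[+ _] := ln_natS n.
move: (ln n.+2%:R) (ln n.+1%:R) (n.+2%:R^-1) IH => x y z; lra.
Qed.

Lemma harm_le n : harm n <= 1 + ln n.+1%:R.
Proof.
case: n => [|n]; first by rewrite /harm big_ord0 addr_ge0// ln_ge0.
have /andP[_ h] := harm_ln n; apply: le_trans h _.
by rewrite lerD2l ler_ln ?posrE ?ltr0n// ler_nat.
Qed.

(* [n! / ((1 - s) (2 - s) ... (n - s))]: the eigenfunctions of the limiting
   recursion. *)
Definition rising_ratio s n : R := \prod_(j < n) (1 - s / j.+1%:R)^-1.

Lemma rising_ratio0 s : rising_ratio s 0 = 1.
Proof. by rewrite /rising_ratio big_ord0. Qed.

Section small.
Variable s : R.
Hypothesis s2 : `|s| <= 1 / 2.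

Let sj j : `|s / j.+1%:R| <= 1 / 2.
Proof.
rewrite normrM normfV normr_nat; apply: le_trans s2.
by rewrite ler_pdivrMr ?ltr0n// ler_peMr// ler1n.
Qed.

Let sj0 j : 0 < 1 - s / j.+1%:R.
Proof. by have := sj j; move: (s / _) => x; rewrite ler_norml => /andP[]; lra. Qed.

Lemma rising_ratio_gt0 n : 0 < rising_ratio s n.
Proof. by rewrite /rising_ratio; apply: prodr_gt0 => j _; rewrite invr_gt0. Qed.

(** Discrete analogue of the equation x f' = s f, solved by x^s. *)
Lemma rising_ratio_diff j :
  j.+1%:R * (rising_ratio s j.+1 - rising_ratio s j) = s * rising_ratio s j.+1.
Proof.
rewrite {1 3}/rising_ratio big_ord_recr/= -/(rising_ratio s j).
have h := sj0 j; move: (rising_ratio s j) => r; field.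
have -> : 1 + j%:R = j.+1%:R :> R by rewrite addrC natr1.
rewrite pnatr_eq0/= -(mulr1 j.+1%:R) subr_eq0; apply: contraTneq h.
by rewrite mulr1 => <-; rewrite divff ?pnatr_eq0// subrr ltxx.
Qed.

Lemma rising_ratio_ge n : expR (s * harm n) <= rising_ratio s n.
Proof.
rewrite /harm mulr_sumr expR_sum; apply: ler_prod => j _.
by rewrite expR_ge0/=; have /andP[] := inv_1B_bounds (sj j).
Qed.

Lemma sum_inv_sqr n : \sum_(j < n) j.+1%:R ^- 2 <= 2 :> R.
Proof.
case: n => [|n]; first by rewrite big_ord0.
suff : \sum_(j < n.+1) j.+1%:R ^- 2 <= 2 - n.+1%:R^-1 :> R.
  by move=> /le_trans; apply; rewrite gerBl invr_ge0.
elim: n => [|n IH]; first by rewrite big_ord_recr/= big_ord0 add0r expr1n invr1; lra.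
rewrite big_ord_recr/=; apply: le_trans (lerD IH (lexx _)) _.
have p k : 0 < k.+1%:R :> R by rewrite ltr0n.
suff : n.+2%:R ^- 2 <= n.+1%:R^-1 - n.+2%:R^-1 :> R by move: (n.+1%:R^-1) (n.+2%:R^-1) (n.+2%:R ^- 2) => x y z; lra.
have -> : n.+1%:R^-1 - n.+2%:R^-1 = (n.+1%:R * n.+2%:R)^-1 :> R.
  by rewrite -[n.+2%:R]natr1; move: (n.+1%:R) (p n) => x x0; field; rewrite !gt_eqF// addr_gt0.
by rewrite lef_pV2 ?posrE ?mulr_gt0 ?exprn_gt0// expr2 ler_wpM2r// ler_nat.
Qed.

Lemma rising_ratio_le n : rising_ratio s n <= expR (s * harm n + 4 * s ^+ 2).
Proof.
apply: (@le_trans _ _ (expR (\sum_(j < n) (s / j.+1%:R + 2 * (s / j.+1%:R) ^+ 2)))).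
  rewrite expR_sum; apply: ler_prod => j _.
  by rewrite invr_ge0 (ltW (sj0 j))/=; have /andP[] := inv_1B_bounds (sj j).
rewrite ler_expR big_split/= -mulr_sumr lerD2l.
under eq_bigr do rewrite exprMn exprVn mulrCA.
rewrite -mulr_sumr -mulr_sumr.
have := ler_wpM2l (sqr_ge0 s) (sum_inv_sqr n).
by move: (s ^+ 2) (\sum_(_ < _) _) => x y; lra.
Qed.

Lemma rising_ratio_pow (eps : R) n : 2 * `|s| <= eps ->
  rising_ratio s n <= expR 3 * n.+1%:R `^ eps.
Proof.
move=> se; apply: le_trans (rising_ratio_le n) _.
rewrite /powR pnatr_eq0/= -expRD ler_expR.
have h := harm_le n; have h0 := harm_ge0 n.
have l0 : 0 <= ln n.+1%:R :> R by rewrite ln_ge0// ler1n.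
have hs : s * harm n <= `|s| * (1 + ln n.+1%:R).
  apply: (@le_trans _ _ (`|s| * harm n)); first by rewrite ler_wpM2r// ler_norm.
  by rewrite ler_wpM2l.
have s22 : s ^+ 2 <= 1 / 4.
  by rewrite -real_normK ?num_real//; have := normr_ge0 s; move: `|s| s2 => a *; nra.
have := mulr_ge0 (normr_ge0 s) l0; have := normr_ge0 s; have := ler_wpM2r l0 se.
move: (ln _) (s ^+ 2) (s * harm n) `|s| s2 l0 hs s22 => l q t a; lra.
Qed.

End small.
End rising_ratio.

Section rising_ratio_bin_mean.
Context {R : realType}.
Variable s : R.
Hypothesis s2 : `|s| <= 1 / 2.
Local Notation f := (rising_ratio s).

Lemma bin_mean_indic0 n (x : R) : bin_mean n x (fun j => (j == 0)%N%:R) = (1 - x) ^+ n.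
Proof.
rewrite /bin_mean big_ord_recl/= big1 => [|j _]; last by rewrite /bump/= mulr0.
by rewrite addr0 mulr1 /bin_weight bin0 expr0 subn0 !mul1r.
Qed.

Lemma bin_mean_at1 n g : bin_mean n 1 g = g n :> R.
Proof.
elim: n g => [|n IH] g; first by rewrite bin_mean0.
by rewrite bin_meanS !IH subrr mul0r addr0 mul1r.
Qed.

(* The binomial mean [D] of [f] satisfies [x * D' x = s * (D x - (1 - x) ^+ n)],
   so that it is close to a multiple of [x `^ s]. *)
Lemma is_derive_rising_mean n (y : R) :
  is_derive y 1 (fun y => expR (s * y) * bin_mean n.+1 (expR (- y)) f)
    (s * expR (s * y) * (1 - expR (- y)) ^+ n.+1).
Proof.
have h := @is_derive_bin_mean R n f (expR (- y)).
have h1 : is_derive y 1 (fun y : R => expR (- y)) (- expR (- y)).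
  by apply: is_derive_eq; rewrite /GRing.scale/=; ring.
have h2 := @is_derive1_comp _ (bin_mean n.+1 ^~ f) (fun y => expR (- y)) _ _ _ h h1.
have h3 : is_derive y 1 (fun y : R => expR (s * y)) (s * expR (s * y)).
  by apply: is_derive_eq; rewrite /GRing.scale/=; ring.
apply: (@is_derive_eq _ _ _ _ _ _ _ _ (is_deriveM h3 h2)); rewrite /GRing.scale/=.
have := bin_mean_deriv_mul n f (expR (- y)).
have -> : bin_mean n.+1 (expR (- y)) (fun j => j%:R * (f j - f j.-1)) =
    s * bin_mean n.+1 (expR (- y)) f - s * (1 - expR (- y)) ^+ n.+1.
  rewrite -bin_mean_indic0 -mulNr -!bin_meanZ -bin_meanD; congr bin_mean; apply/funext => -[|j].
    by rewrite mul0r rising_ratio0 eqxx mulr1 mulr1 subrr.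
  by rewrite rising_ratio_diff// mulr0 addr0.
move: (n.+1%:R * _) => D E.
by rewrite mulrN [D * _]mulrC E; ring.
Qed.

(** (1 - x)^n is at most e^(1 - (n + 1) x), and e^-v <= v^-del for del <= 1: decay in n is bought
    with a singularity at x = 0. *)
Lemma pow_1B_le (del x : R) n : 0 < del <= 1 -> 0 < x <= 1 ->
  (1 - x) ^+ n <= expR 1 * decay del n * x `^ (- del).
Proof.
move=> /andP[d0 d1] /andP[x0 x1].
have nx0 : 0 < n.+1%:R * x by rewrite mulr_gt0// ltr0n.
apply: (@le_trans _ _ (expR (1 - n.+1%:R * x))).
  apply: (@le_trans _ _ (expR (- (n%:R * x)))).
    by rewrite -mulrN expRM_natl lerXn2r ?nnegrE ?subr_ge0 ?expR_ge0//; exact: expR_ge1Dx.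
  by rewrite ler_expR -natr1; move: (n%:R) => k; lra.
rewrite /decay -mulrA -powRM ?(ltW x0)// expRD ler_pM2l ?expR_gt0//.
rewrite powRN expRN lef_pV2 ?posrE ?powR_gt0 ?expR_gt0//.
rewrite /powR gt_eqF// ler_expR.
apply: (@le_trans _ _ (del * (n.+1%:R * x))); last by rewrite ler_piMl// ltW.
rewrite ler_pM2l//; have := expR_ge1Dx (ln (n.+1%:R * x)); rewrite lnK ?posrE//.
by rewrite [leRHS](_ : _ = 1 + (n.+1%:R * x - 1))// ?lerD2l; [move=> /le_trans; apply; rewrite gerBl|ring].
Qed.

(** Mean value theorem for the function of [is_derive_rising_mean], whose value at 0 is f(n + 1).
    The singularity of [pow_1B_le] becomes the factor e^(del y). *)
Lemma rising_mean_diff (del y : R) n : 0 < del <= 1 -> `|s| <= del -> 0 <= y ->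
  `|bin_mean n.+1 (expR (- y)) f - expR (- s * y) * f n.+1| <=
    `|s| * (expR 1 * decay del n.+1 * (y * expR (del * y))).
Proof.
move=> d01 sd; have /andP[d0 d1] := d01.
rewrite le_eqVlt => /orP[/eqP <-|y0].
  rewrite oppr0 expR0 bin_mean_at1 mulr0 expR0 mul1r subrr normr0.
  by rewrite !mulr_ge0 ?expR_ge0 ?powR_ge0.
have cf : {within `[0, y], continuous (fun y => expR (s * y) * bin_mean n.+1 (expR (- y)) f)}.
  apply: continuous_subspaceT => x; apply: differentiable_continuous; apply/derivable1_diffP.
  exact: (@ex_derive _ _ _ _ _ _ _ (is_derive_rising_mean n x)).
have [c /[!in_itv]/= /andP[c0 cy]] := MVT y0 (fun x _ => is_derive_rising_mean n x) cf.
rewrite mulr0 oppr0 addr0 expR0 mul1r bin_mean_at1 => E.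
have -> : bin_mean n.+1 (expR (- y)) f - expR (- s * y) * f n.+1 =
   expR (- s * y) * (s * expR (s * c) * (1 - expR (- c)) ^+ n.+1 * y).
  by rewrite -E mulrBr mulrA -expRD mulNr addNr expR0 mul1r.
have ec : 0 < expR (- c) <= 1 by rewrite expR_gt0 -expR0 ler_expR oppr_le0 ltW.
have h := pow_1B_le n.+1 d01 ec.
have p0 : 0 <= (1 - expR (- c)) ^+ n.+1 by rewrite exprn_ge0// subr_ge0; case/andP: ec.
rewrite !normrM !(ger0_norm (expR_ge0 _)) (gtr0_norm y0) (ger0_norm p0).
have -> : expR (- s * y) * (`|s| * expR (s * c) * (1 - expR (- c)) ^+ n.+1 * y) =
  `|s| * ((1 - expR (- c)) ^+ n.+1 * (expR (- s * y) * expR (s * c) * y)) by ring.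
rewrite ler_wpM2l//; apply: le_trans (ler_wpM2r _ h) _.
  by rewrite !mulr_ge0 ?expR_ge0// ltW.
rewrite -!mulrA ler_wpM2l ?expR_ge0// ler_wpM2l ?powR_ge0//.
rewrite [leRHS]mulrC !mulrA ler_wpM2r ?(ltW y0)//.
rewrite -expRM -!expRD ler_expR.
have : 0 <= (del + s) * (y - c).
  rewrite mulr_ge0 ?subr_ge0 ?(ltW cy)//; move: sd; rewrite ler_norml => /andP[]; lra.
lra.
Qed.

End rising_ratio_bin_mean.

Lemma bin_mean_rev {R : realFieldType} n (x : R) f :
  bin_mean n (1 - x) f = \sum_(j < n.+1) bin_weight n x j * f (n - j)%N.
Proof.
rewrite /bin_mean (reindex_inj rev_ord_inj)/=; apply: eq_bigr => j _.
have jn : (j <= n)%N by rewrite -ltnS.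
rewrite subSS /bin_weight subKr subKn// bin_sub//.
by rewrite (mulrAC 'C(n, j)%:R).
Qed.

(** Counting the points removed instead of those kept makes the term without removal drop out. *)
Lemma bin_mean_defect {R : realFieldType} n (x : R) f :
  f n - bin_mean n (1 - x) f =
  \sum_(j < n) bin_weight n x j.+1 * (f n - f (n - j.+1)%N).
Proof.
rewrite bin_mean_rev -[X in X - _](bin_mean_cst n x) /bin_mean -sumrB big_ord_recl/=.
rewrite subn0 subrr add0r; apply: eq_bigr => j _.
by rewrite /bump/= add1n mulrBr.
Qed.

Section cut_drift.
Context {R : realType}.
Variable nu : {measure set R -> \bar R}.
Variable delta : R.
Hypotheses (delta0 : 0 < delta) (deltaW : weight_integrable nu delta).
Implicit Types (f : nat -> R) (n : nat).

Lemma cut_rate_ge0 n j : 0 <= cut_rate nu n j.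
Proof.
apply: nu_mean_ge0 => y y0; rewrite bin_weight_ge0// subr_ge0 gerBl expR_ge0 andbT.
by rewrite -expR0 ler_expR oppr_le0 ltW.
Qed.

Lemma cut_rate_small n j : (n < j)%N -> cut_rate nu n j = 0.
Proof.
move=> nj; rewrite /cut_rate (_ : (fun _ => _) = fun=> 0) ?nu_mean0//.
by apply/funext => y; rewrite /bin_weight bin_small// !mul0r.
Qed.

Lemma weight_bounded_bin_weight n j :
  weight_bounded delta (fun y : R => bin_weight n (1 - expR (- y)) j.+1).
Proof.
rewrite (_ : (fun _ => _) = fun y => at_least n j.+1 (1 - expR (- y)) - at_least n j.+2 (1 - expR (- y))).
  by apply: weight_boundedB; exact: weight_bounded_at_least.
by apply/funext => y; rewrite [at_least n j.+1 _]at_leastS addrK.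
Qed.

(** Minus the generator of the chain of the number of uncovered points, which loses j + 1 points at
    rate [cut_rate nu n j.+1]. *)
Definition cut_drift f n : R := \sum_(j < n) cut_rate nu n j.+1 * (f n - f (n - j.+1)%N).

Lemma weight_bounded_defect f n :
  weight_bounded delta (fun y => f n - bin_mean n (expR (- y)) f).
Proof.
rewrite (_ : (fun _ => _) = fun y =>
    \sum_(j < n) (f n - f (n - j.+1)%N) * bin_weight n (1 - expR (- y)) j.+1).
  by apply: weight_bounded_sum => j; apply: weight_boundedZ; exact: weight_bounded_bin_weight.
by apply/funext => y; under eq_bigr do rewrite mulrC; rewrite -bin_mean_defect subKr.
Qed.

Lemma cut_driftE f n :
  cut_drift f n = nu_mean nu (fun y => f n - bin_mean n (expR (- y)) f).
Proof.
rewrite /cut_drift; under eq_bigr => j _ do rewrite mulrC -(nu_meanZ deltaW _ (weight_bounded_bin_weight n j)).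
rewrite -(nu_mean_sum deltaW) => [|j]; last by apply: weight_boundedZ; exact: weight_bounded_bin_weight.
apply: eq_nu_mean => y _; rewrite -{2}[expR (- y)](subKr 1) bin_mean_defect.
by apply: eq_bigr => j _; rewrite mulrC.
Qed.

(** The total rate is the drift of the indicator of n + 1; the integrand 1 - x^(n + 1), with x =
    e^-y, is at least 1 - x, whose integral is Phi(1). *)
Lemma sum_cut_rate_gt0 n : 0 < laplace_exponent nu 1 -> 0 < \sum_(j < n.+1) cut_rate nu n.+1 j.+1.
Proof.
move=> Phi1.
have -> : \sum_(j < n.+1) cut_rate nu n.+1 j.+1 = cut_drift (fun j => (j == n.+1)%:R) n.+1.
  apply: eq_bigr => j _; rewrite eqxx (_ : (_ == _) = false) ?subr0 ?mulr1//.
  by apply/negbTE; rewrite neq_ltn subSS ltnS leq_subr.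
rewrite cut_driftE; apply: lt_le_trans Phi1 _; apply: (nu_mean_le deltaW).
- exact: weight_bounded_exp.
- exact: (weight_bounded_defect (fun j => (j == n.+1)%:R) n.+1).
move=> y y0; rewrite eqxx lerD2l lerN2 mulN1r.
rewrite /bin_mean big_ord_recr/= eqxx mulr1 big1 ?add0r => [|j _]; last first.
  by rewrite ltn_eqF ?mulr0.
rewrite /bin_weight binn subnn expr0 mulr1 mul1r exprS ler_piMr ?expR_ge0//.
by rewrite exprn_ile1 ?expR_ge0// -expR0 ler_expR oppr_le0 ltW.
Qed.

(** Integrates [rising_mean_diff] against [nu]; del < delta makes y e^(del y) integrable. *)
Lemma cut_drift_rising (del : R) : 0 < del <= 1 -> del < delta -> del <= delta / 2 ->
  exists2 C, 0 <= C & forall s n, `|s| <= 1 / 2 -> `|s| <= del ->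
    `|cut_drift (rising_ratio s) n.+1 - laplace_exponent nu s * rising_ratio s n.+1|
      <= C * `|s| * decay del n.+1.
Proof.
move=> d01 dd dd2.
have wp : weight_bounded delta (fun y : R => y ^+ 1 * expR (del * y)).
  exact: weight_bounded_powexp.
exists (expR 1 * nu_mean nu (fun y => y ^+ 1 * expR (del * y))).
  by rewrite mulr_ge0 ?expR_ge0//; apply: nu_mean_ge0 => y y0; rewrite mulr_ge0 ?expR_ge0// exprn_ge0// ltW.
move=> s n s2 sd.
have ws : weight_bounded delta (fun y => 1 - expR (- s * y)).
  by apply: weight_bounded_exp_small => //; exact: le_trans dd2.
have wd := weight_bounded_defect (rising_ratio s) n.+1.
have -> : cut_drift (rising_ratio s) n.+1 - laplace_exponent nu s * rising_ratio s n.+1 =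
  nu_mean nu (fun y => (rising_ratio s n.+1 - bin_mean n.+1 (expR (- y)) (rising_ratio s)) -
     rising_ratio s n.+1 * (1 - expR (- s * y))).
  rewrite (nu_meanB deltaW wd); last exact: weight_boundedZ.
  by rewrite -cut_driftE (nu_meanZ deltaW)// mulrC.
have -> : expR 1 * nu_mean nu (fun y => y ^+ 1 * expR (del * y)) * `|s| * decay del n.+1 =
   nu_mean nu (fun y => (expR 1 * `|s| * decay del n.+1) * (y ^+ 1 * expR (del * y))).
  by rewrite (nu_meanZ deltaW)//; ring.
apply: (nu_mean_norm deltaW).
- by apply: weight_boundedB => //; exact: weight_boundedZ.
- exact: weight_boundedZ.
move=> y y0.
have -> : rising_ratio s n.+1 - bin_mean n.+1 (expR (- y)) (rising_ratio s) -
     rising_ratio s n.+1 * (1 - expR (- s * y)) =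
   - (bin_mean n.+1 (expR (- y)) (rising_ratio s) - expR (- s * y) * rising_ratio s n.+1) by ring.
rewrite normrN; apply: le_trans (rising_mean_diff s2 n d01 sd (ltW y0)) _.
by rewrite le_eqVlt; apply/orP; left; apply/eqP; rewrite expr1; ring.
Qed.

Lemma powRN_tangent (del r : R) : 0 < r -> 0 <= del -> 1 - del * (r - 1) <= r `^ (- del).
Proof.
move=> r0 d0; rewrite /powR gt_eqF//; apply: le_trans (expR_ge1Dx _).
rewrite lerD2l mulNr lerN2 ler_wpM2l//.
have := expR_ge1Dx (ln r); rewrite lnK ?posrE//; lra.
Qed.

(** By convexity (k + 1)^-del lies above its tangent at k = n + 1, which is linear in k and has an
    explicit binomial mean. The factor 1 / 2 bounds (n + 1) / (n + 2) from below. *)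
Lemma cut_drift_decay (del : R) n : 0 <= del ->
  cut_drift (decay del) n.+1 <= - (del * laplace_exponent nu 1 / 2) * decay del n.+1.
Proof.
move=> d0.
have -> : - (del * laplace_exponent nu 1 / 2) * decay del n.+1 =
    nu_mean nu (fun y => - (del / 2 * decay del n.+1) * (1 - expR (- 1 * y))).
  rewrite (nu_meanZ deltaW); last exact: weight_bounded_exp.
  by rewrite [nu_mean _ _](_ : _ = laplace_exponent nu 1)//; ring.
rewrite cut_driftE; apply: (nu_mean_le deltaW).
- exact: weight_bounded_defect.
- by apply: weight_boundedZ; exact: weight_bounded_exp.
move=> y y0; rewrite mulN1r; set x := expR (- y).
have x01 : 0 <= x <= 1 by rewrite expR_ge0 -expR0 ler_expR oppr_le0 ltW.
have p k : 0 < k.+1%:R :> R by rewrite ltr0n.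
set D := decay del n.+1; have D0 : 0 <= D by rewrite powR_ge0.
pose a := D * (1 + del) - D * del / n.+2%:R; pose b := - (D * del / n.+2%:R).
have h : bin_mean n.+1 x (fun k => a + b * k%:R) <= bin_mean n.+1 x (decay del).
  apply: bin_mean_le => // k kn.
  have -> : decay del k = D * (k.+1%:R / n.+2%:R) `^ (- del).
    by rewrite /D /decay -powRM ?divr_ge0// mulrC divfK// gt_eqF.
  have -> : a + b * k%:R = D * (1 - del * (k.+1%:R / n.+2%:R - 1)).
    by rewrite /a /b -[k.+1%:R]natr1; move: (n.+2%:R) (p n.+1) => z z0; field; rewrite gt_eqF.
  by rewrite ler_wpM2l// powRN_tangent// divr_gt0.
rewrite bin_meanD bin_mean_cst bin_meanZ bin_mean_id in h.
have e : D - (a + b * (n.+1%:R * x)) = - (D * del * (1 - x) * (n.+1%:R / n.+2%:R)).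
  have -> : n.+1%:R = n.+2%:R - 1 :> R by rewrite -[n.+2%:R]natr1 addrK.
  by rewrite /a /b; move: (n.+2%:R) (p n.+1) => z z0; field; rewrite gt_eqF.
apply: (@le_trans _ _ (D - (a + b * (n.+1%:R * x)))); first by rewrite lerD2l lerN2.
rewrite e [leRHS](_ : _ = - (D * del * (1 - x) * (1 / 2))); last by field.
rewrite lerN2 ler_wpM2l//; first by rewrite !mulr_ge0// subr_ge0; case/andP: x01.
rewrite ler_pdivrMr// mulrAC ler_pdivlMr// mul1r -natrM ler_nat; lia.
Qed.

End cut_drift.

Section decay.
Context {R : realType}.
Implicit Types (del : R) (n m : nat).

Lemma decay_gt0 del n : 0 < decay del n.
Proof. by rewrite powR_gt0. Qed.

Lemma decay_le1 del n : 0 <= del -> decay del n <= 1.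
Proof.
move=> d0; rewrite /decay powRN invf_le1 ?powR_gt0//.
by have := @ge0_ler_powR R _ d0 1 n.+1%:R; rewrite powR1; apply; rewrite ?nnegrE ?ler1n.
Qed.

(** n + 1 <= (m + 1) (n - m + 1), also for the truncated difference. *)
Lemma decay_shift del n m : 0 <= del -> decay del (n - m)%N <= m.+1%:R `^ del * decay del n.
Proof.
move=> d0; rewrite /decay !powRN ler_pdivlMr ?powR_gt0// mulrC ler_pdivrMr ?powR_gt0//.
rewrite -powRM//; apply: ge0_ler_powR; rewrite ?nnegrE ?mulr_ge0//.
by rewrite -natrM ler_nat; nia.
Qed.

End decay.

Lemma sum_bounded {R : realDomainType} {X : Type} (D : X -> Prop) (B : X -> R)
    (F : nat -> X -> R) K :
  (forall j, exists2 C, 0 <= C & forall x, D x -> `|F j x| <= C * B x) ->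
  exists2 C, 0 <= C & forall x, D x -> `|\sum_(j < K) F j x| <= C * B x.
Proof.
move=> h; elim: K => [|K [C C0 hC]].
  by exists 0 => // x _; rewrite big_ord0 normr0 mul0r.
have [C' C'0 hC'] := h K; exists (C + C'); first exact: addr_ge0.
move=> x Dx; rewrite big_ord_recr/= mulrDl; apply: le_trans (ler_normD _ _) _.
by rewrite lerD ?hC ?hC'.
Qed.

Section rising_increments.
Context {R : realType}.
Variable del : R.
Hypothesis d02 : 0 < del <= 1 / 2.
Let d0 : 0 < del. Proof. by case/andP: d02. Qed.

Let small (s : R) : 2 * `|s| <= del -> `|s| <= 1 / 2.
Proof. by case/andP: d02; lra. Qed.

(** The increment is s f(n + 1) / (n + 1), of order n^(del - 1), and del <= 1 / 2 makes this at most
    of order n^-del. *)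
Lemma rising_increment s n : 2 * `|s| <= del ->
  `|rising_ratio s n.+1 - rising_ratio s n| <= 2 * expR 3 * decay del n.+1.
Proof.
move=> sd; have s2 := small sd.
have p k : 0 < k.+1%:R :> R by rewrite ltr0n.
have -> : rising_ratio s n.+1 - rising_ratio s n = s / n.+1%:R * rising_ratio s n.+1.
  by rewrite mulrAC -rising_ratio_diff// mulrC mulKf ?gt_eqF.
rewrite !normrM normfV normr_nat (gtr0_norm (rising_ratio_gt0 s2 _)).
have h := rising_ratio_pow s2 n.+1 sd.
have s1 : `|s| / n.+1%:R <= 2 / n.+2%:R.
  rewrite ler_pdivrMr// mulrAC ler_pdivlMr//.
  apply: (@le_trans _ _ (1 * n.+2%:R)); first by rewrite ler_wpM2r//; lra.
  by rewrite mul1r -natrM ler_nat; lia.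
apply: (@le_trans _ _ (2 / n.+2%:R * (expR 3 * n.+2%:R `^ del))).
  by apply: ler_pM; rewrite ?mulr_ge0 ?invr_ge0// ltW// rising_ratio_gt0.
rewrite [leLHS](_ : _ = 2 * expR 3 * (n.+2%:R^-1 * n.+2%:R `^ del)); last by ring.
rewrite ler_wpM2l ?mulr_ge0 ?expR_ge0// -powR_inv1// -powRD ?pnatr_eq0 ?implybT//.
by rewrite /decay ler_powR ?ler1n//; case/andP: d02; lra.
Qed.

Lemma rising_shift m : exists2 C, 0 <= C & forall s n, 2 * `|s| <= del ->
  `|rising_ratio s n - rising_ratio s (n - m)%N| <= C * decay del n.
Proof.
elim: m => [|m [C C0 hC]].
  by exists 0 => // s n _; rewrite subn0 subrr normr0 mul0r.
exists (C + 2 * expR 3 * m.+1%:R `^ del).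
  by rewrite addr_ge0// !mulr_ge0 ?expR_ge0 ?powR_ge0.
move=> s n sd; rewrite -(subrKA (rising_ratio s (n - m)%N)).
apply: le_trans (ler_normD _ _) _; rewrite mulrDl lerD ?hC//.
case E : (n - m)%N => [|k].
  rewrite (_ : (n - m.+1)%N = 0%N); last by lia.
  by rewrite subrr normr0 !mulr_ge0 ?expR_ge0 ?powR_ge0.
rewrite (_ : (n - m.+1)%N = k); last by lia.
apply: le_trans (rising_increment _ sd) _; rewrite -E -!mulrA !ler_wpM2l ?expR_ge0//.
by rewrite decay_shift// ltW.
Qed.

End rising_increments.

(** * The tilted recursion *)

Section perturbed_recursion.
Context {R : realType}.
Variables (q : nat -> nat -> R) (Phi : R -> R) (m1 m2 del : R).
Hypothesis q0 : forall n j, 0 <= q n j.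
Hypothesis q_small : forall n j, (n < j)%N -> q n j = 0.
Hypothesis q_pos : forall n, 0 < \sum_(j < n.+1) q n.+1 j.+1.
Hypothesis d02 : 0 < del <= 1 / 2.
(** The exponent is 2 del because these errors multiply comparison functions of size n^del and
    should leave n^-del. *)
Hypothesis q_lim : forall m, exists2 C, 0 <= C & forall n,
  `|q n m.+1 - m.+1%:R^-1| <= C * decay (2 * del) n.
Local Notation g := (decay del).
Local Notation f := rising_ratio.

Let d0 : 0 < del. Proof. by case/andP: d02. Qed.

Definition drift (h : nat -> R) n : R := \sum_(j < n) q n j.+1 * (h n - h (n - j.+1)%N).

Hypothesis drift_f : exists2 C, 0 <= C & forall s n, `|s| <= 1 / 2 -> `|s| <= del ->
  `|drift (f s) n.+1 - Phi s * f s n.+1| <= C * `|s| * g n.+1.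
Hypothesis drift_g : exists2 c, 0 < c & forall n, drift g n.+1 <= - c * g n.+1.
Hypothesis Phi_taylor : exists2 C, 0 <= C & forall s, `|s| <= del ->
  `|Phi s - (m1 * s - m2 / 2 * s ^+ 2)| <= C * `|s| ^+ 3.
Hypothesis m10 : 0 < m1.

Variables (a : nat -> R) (K : nat).
Hypothesis a_small : forall j, (K < j)%N -> a j = 0.

Let A1 := \sum_(j < K) a j.+1 / j.+1%:R.
Let A2 := \sum_(j < K) a j.+1 ^+ 2 / j.+1%:R.

(** It vanishes on the solutions of the recursion with weights e^(t a_m). *)
Definition tilted_drift (t : R) (h : nat -> R) n : R :=
  \sum_(j < n) q n j.+1 * (h n - expR (t * a j.+1) * h (n - j.+1)%N).

(** The contribution of the tilt, as a sum of fixed length [K]: convergence of the rates for each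
    fixed m then suffices. *)
Let excess (t : R) (h : nat -> R) n : R :=
  \sum_(j < K) q n j.+1 * (expR (t * a j.+1) - 1) * h (n - j.+1)%N.

Lemma tilted_driftE t h n : tilted_drift t h n = drift h n - excess t h n.
Proof.
have -> : excess t h n = \sum_(j < n) q n j.+1 * (expR (t * a j.+1) - 1) * h (n - j.+1)%N.
  rewrite /excess.
  rewrite (big_ord_widen (K + n) (fun j => q n j.+1 * (expR (t * a j.+1) - 1) * h (n - j.+1)%N)) ?leq_addr//.
  rewrite [RHS](big_ord_widen (K + n) (fun j => q n j.+1 * (expR (t * a j.+1) - 1) * h (n - j.+1)%N)) ?leq_addl//.
  rewrite big_mkcond [RHS]big_mkcond/=; apply: eq_bigr => j _.
  case: ltnP => jK; case: ltnP => jn //.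
    by rewrite q_small// !mul0r.
  by rewrite a_small// mulr0 expR0 subrr mulr0 mul0r.
by rewrite -sumrB; apply: eq_bigr => j _; ring.
Qed.

Lemma tilted_drift_lin t x y h k n :
  tilted_drift t (fun j => x * h j + y * k j) n =
  x * tilted_drift t h n + y * tilted_drift t k n.
Proof. by rewrite /tilted_drift !mulr_sumr -big_split/=; apply: eq_bigr => j _; ring. Qed.

(** Maximum principle: the coefficients e^(t a_m) q(n, m) of the earlier values are nonnegative, so
    that by strong induction the total rate times w(n) dominates the drift; the total rate is
    positive. *)
Lemma tilted_drift_comparison t w : 0 <= w 0%N ->
  (forall n, 0 <= tilted_drift t w n.+1) -> forall n, 0 <= w n.
Proof.
move=> w0 hw n; elim/ltn_ind: n => -[//|n IH].
rewrite -(pmulr_rge0 _ (q_pos n)); apply: le_trans (hw n) _.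
rewrite mulr_suml; apply: ler_sum => j _; rewrite ler_wpM2l// gerBl mulr_ge0 ?expR_ge0//.
by apply: IH; rewrite subSS ltnS leq_subr.
Qed.

Let expB1 (x t : R) : 0 < t <= 1 -> `|expR (t * x) - 1| <= (`|x| * expR `|x|) * t.
Proof.
move=> /andP[t0 t1]; apply: le_trans (expR_taylor1 _) _.
rewrite normrM (gtr0_norm t0) [leRHS]mulrC -mulrA ler_wpM2l ?(ltW t0)// ler_wpM2l//.
by rewrite ler_expR ler_piMl.
Qed.

Let q_bounded j : exists2 C, 0 <= C & forall n, q n j.+1 <= C.
Proof.
have [C C0 hC] := q_lim j; exists (j.+1%:R^-1 + C); first by rewrite addr_ge0// invr_ge0.
move=> n; have := hC n; rewrite ler_distl => /andP[_ h]; apply: le_trans h _.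
by rewrite lerD2l ler_piMr// decay_le1// mulr_ge0// ltW.
Qed.

Let excess_g : exists2 C, 0 <= C & forall x : R * nat, 0 < x.1 <= 1 ->
  `|excess x.1 g x.2| <= C * (x.1 * g x.2).
Proof.
apply: (@sum_bounded _ _ (fun x => 0 < x.1 <= 1) (fun x : R * nat => x.1 * g x.2)
  (fun j x => q x.2 j.+1 * (expR (x.1 * a j.+1) - 1) * g (x.2 - j.+1)%N)) => j.
have [C C0 hC] := q_bounded j.
exists (C * (`|a j.+1| * expR `|a j.+1|) * j.+2%:R `^ del).
  by rewrite !mulr_ge0 ?expR_ge0 ?powR_ge0.
move=> [t n]/= t01; rewrite !normrM (ger0_norm (q0 _ _)) (gtr0_norm (decay_gt0 _ _)).
have -> : C * (`|a j.+1| * expR `|a j.+1|) * j.+2%:R `^ del * (t * g n) =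
  C * ((`|a j.+1| * expR `|a j.+1|) * t) * (j.+2%:R `^ del * g n) by ring.
apply: ler_pM; rewrite ?mulr_ge0 ?(ltW (decay_gt0 _ _))//.
  by apply: ler_pM => //; exact: expB1.
by rewrite decay_shift// ltW.
Qed.

(** The tilt perturbs the negative drift of the barrier by O(t) times the barrier; half of the drift
    survives for small t. *)
Let tilted_g : exists2 c, 0 < c & exists2 t0, 0 < t0 & forall t n, 0 < t <= t0 ->
  tilted_drift t g n.+1 <= - c * g n.+1.
Proof.
have [c c0 hc] := drift_g; have [C C0 hC] := excess_g.
exists (c / 2); first by rewrite divr_gt0.
exists (Num.min 1 (c / 2 / (C + 1))).
  by rewrite lt_min ltr01 !divr_gt0// ltr_wpDl.
move=> t n /andP[tp]; rewrite le_min => /andP[t1 tc].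
rewrite tilted_driftE; have := hC (t, n.+1); rewrite /= tp t1 => /(_ isT).
rewrite ler_norml => /andP[h _]; have := hc n.
have g0 := decay_gt0 del n.+1.
have : (C + 1) * t <= c / 2 by rewrite mulrC -ler_pdivlMr// ltr_wpDl.
move: (drift _ _) (excess _ _ _) h g0 => D E; move: (g _) => G.
move: tp C0; nra.
Qed.

(** Replacing q(n, m) by 1 / m costs n^(- 2 del) times f, and replacing f(n - m) by f(n) costs
    n^-del; the tilt supplies the factor t. *)
Let excess_f : exists2 C, 0 <= C & forall x : R * R * nat, 0 < x.1.1 <= 1 /\ 2 * `|x.1.2| <= del ->
  `|excess x.1.1 (f x.1.2) x.2 - (\sum_(j < K) (expR (x.1.1 * a j.+1) - 1) / j.+1%:R) * f x.1.2 x.2|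
    <= C * (x.1.1 * g x.2).
Proof.
have [|C C0 hC] := @sum_bounded _ _ (fun x => 0 < x.1.1 <= 1 /\ 2 * `|x.1.2| <= del) (fun x : R * R * nat => x.1.1 * g x.2)
  (fun j x => (expR (x.1.1 * a j.+1) - 1) * (q x.2 j.+1 * f x.1.2 (x.2 - j.+1)%N - j.+1%:R^-1 * f x.1.2 x.2)) K _; last first.
  exists C => // x Dx; apply: le_trans (hC x Dx); rewrite mulr_suml -sumrB le_eqVlt; apply/orP; left.
  by apply/eqP; congr (`|_|); apply: eq_bigr => j _; ring.
move=> j; have [C C0 hC] := q_lim j; have [C' C'0 hC'] := @rising_shift _ _ d02 j.+1.
exists ((`|a j.+1| * expR `|a j.+1|) * (C * expR 3 + C')).
  by rewrite mulr_ge0// ?mulr_ge0 ?addr_ge0 ?mulr_ge0 ?expR_ge0.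
move=> [[t s] n]/= [t01 sd]; rewrite normrM.
have s2 : `|s| <= 1 / 2 by case/andP: d02; lra.
have -> : (`|a j.+1| * expR `|a j.+1|) * (C * expR 3 + C') * (t * g n) =
  ((`|a j.+1| * expR `|a j.+1|) * t) * ((C * expR 3 + C') * g n) by ring.
apply: ler_pM => //; first exact: expB1.
have -> : q n j.+1 * f s (n - j.+1)%N - j.+1%:R^-1 * f s n =
  (q n j.+1 - j.+1%:R^-1) * f s (n - j.+1)%N - j.+1%:R^-1 * (f s n - f s (n - j.+1)%N) by ring.
apply: le_trans (ler_normB _ _) _; rewrite [leRHS]mulrDl; apply: lerD; rewrite normrM.
  rewrite (gtr0_norm (rising_ratio_gt0 s2 _)).
  apply: (@le_trans _ _ (C * decay (2 * del) n * (expR 3 * n.+1%:R `^ del))).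
    apply: ler_pM => //; first by rewrite ltW// rising_ratio_gt0.
    apply: le_trans (rising_ratio_pow s2 _ sd) _.
    rewrite ler_wpM2l ?expR_ge0// ge0_ler_powR ?nnegrE ?(ltW d0)// ler_nat ltnS leq_subr//.
  rewrite -!mulrA ler_wpM2l// mulrCA ler_wpM2l ?expR_ge0// /decay -powRD ?pnatr_eq0 ?implybT//.
  by rewrite (_ : - (2 * del) + del = - del)//; ring.
apply: le_trans (hC' s n sd); rewrite ger0_norm ?invr_ge0//.
by rewrite ler_piMl// invf_le1 ?ler1n.
Qed.

Let expB2 (x t : R) : 0 < t <= 1 ->
  `|expR (t * x) - 1 - (t * x + (t * x) ^+ 2 / 2)| <= `|x| ^+ 3 * expR `|x| * t ^+ 3.
Proof.
move=> /andP[t0 t1].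
have -> : expR (t * x) - 1 - (t * x + (t * x) ^+ 2 / 2) = expR (t * x) - (1 + t * x + (t * x) ^+ 2 / 2) by ring.
apply: le_trans (expR_taylor3 _) _.
rewrite normrM (gtr0_norm t0) exprMn [leRHS]mulrC -mulrA ler_wpM2l ?exprn_ge0 ?(ltW t0)//.
rewrite ler_wpM2l ?exprn_ge0//.
by rewrite ler_expR ler_piMl.
Qed.

Let excess_coef : exists2 C, 0 <= C & forall t : R, 0 < t <= 1 ->
  `|\sum_(j < K) (expR (t * a j.+1) - 1) / j.+1%:R - (t * A1 + t ^+ 2 * A2 / 2)| <= C * t ^+ 3.
Proof.
have [|C C0 hC] := @sum_bounded _ _ (fun t : R => 0 < t <= 1) (fun t => t ^+ 3)
  (fun j t => (expR (t * a j.+1) - 1 - (t * a j.+1 + (t * a j.+1) ^+ 2 / 2)) / j.+1%:R) K _; last first.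
  exists C => // t tt; apply: le_trans (hC t tt); rewrite /A1 /A2 mulr_sumr.
  rewrite [t ^+ 2 * _]mulr_sumr mulr_suml -big_split/= -sumrB le_eqVlt; apply/orP; left.
  by apply/eqP; congr (`|_|); apply: eq_bigr => j _; field; rewrite addrC natr1.
move=> j; exists (`|a j.+1| ^+ 3 * expR `|a j.+1|); first by rewrite mulr_ge0 ?expR_ge0 ?exprn_ge0.
move=> t tt; rewrite normrM normfV normr_nat; apply: le_trans (expB2 (a j.+1) tt).
by rewrite ler_piMr// invf_le1 ?ltr0n// ler1n.
Qed.

Definition tilt_exponent (b t : R) : R := t * (A1 / m1) + t ^+ 2 * b.
(** The value of b for which the terms of order t^2 in Phi(s) and in the excess cancel. *)
Definition tilt_variance : R := A2 / (2 * m1) + m2 * A1 ^+ 2 / (2 * m1 ^+ 3).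

Let tilt_exponent_le b t : 0 < t <= 1 -> `|tilt_exponent b t| <= (`|A1 / m1| + `|b|) * t.
Proof.
move=> /andP[t0 t1]; apply: le_trans (ler_normD _ _) _.
rewrite (normrM t) (normrM (t ^+ 2)) normrX (gtr0_norm t0) mulrDl (mulrC t) lerD2l mulrC.
by rewrite ler_wpM2l// expr2 ler_piMl// ltW.
Qed.

Let coef_expansion b : exists2 C, 0 <= C & forall t : R, 0 < t <= 1 -> `|tilt_exponent b t| <= del ->
  `|Phi (tilt_exponent b t) - \sum_(j < K) (expR (t * a j.+1) - 1) / j.+1%:R
     - t ^+ 2 * (m1 * (b - tilt_variance))| <= C * t ^+ 3.
Proof.
have [C C0 hC] := excess_coef; have [C' C'0 hC'] := Phi_taylor.
pose u := `|A1 / m1| + `|b|; have u0 : 0 <= u by rewrite addr_ge0.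
pose v := `|m2 * (A1 / m1) * b| + `|m2 / 2 * b ^+ 2|; have v0 : 0 <= v by rewrite addr_ge0.
exists (C' * u ^+ 3 + C + v); first by rewrite !addr_ge0// mulr_ge0 ?exprn_ge0.
move=> t t01 sd; have /andP[t0 t1] := t01.
set s := tilt_exponent b t; set E := \sum_(j < K) _.
have -> : Phi s - E - t ^+ 2 * (m1 * (b - tilt_variance)) =
   (Phi s - (m1 * s - m2 / 2 * s ^+ 2)) - (E - (t * A1 + t ^+ 2 * A2 / 2))
   - t ^+ 3 * (m2 * (A1 / m1) * b + t * (m2 / 2 * b ^+ 2)).
  by rewrite /s /tilt_exponent /tilt_variance; field; rewrite gt_eqF.
rewrite !mulrDl; apply: le_trans (ler_normB _ _) _; apply: lerD.
  apply: le_trans (ler_normB _ _) _; apply: lerD; last exact: hC.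
  apply: le_trans (hC' s sd) _; rewrite -mulrA ler_wpM2l// -exprMn.
  by rewrite lerXn2r ?nnegrE ?normr_ge0 ?mulr_ge0 ?(ltW t0)//; exact: tilt_exponent_le.
rewrite normrM normrX (gtr0_norm t0) mulrC -mulrDl ler_wpM2r ?exprn_ge0 ?(ltW t0)//.
apply: le_trans (ler_normD _ _) _; rewrite lerD2l normrM (gtr0_norm t0) ler_piMl//.
Qed.

(* [f s] with [s = tilt_exponent b t] is an approximate solution of the tilted
   recursion, up to the sign of [b - tilt_variance]. *)
Let tilted_f b : exists2 C, 0 <= C & forall t n, 0 < t <= 1 -> 2 * `|tilt_exponent b t| <= del ->
  exists e1 e2, [/\ `|e1| <= C * t ^+ 3, `|e2| <= C * (t * g n.+1) &
    tilted_drift t (f (tilt_exponent b t)) n.+1 =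
      (t ^+ 2 * (m1 * (b - tilt_variance)) + e1) * f (tilt_exponent b t) n.+1 + e2].
Proof.
have [C C0 hC] := coef_expansion b; have [C' C'0 hC'] := excess_f; have [D D0 hD] := drift_f.
pose u := `|A1 / m1| + `|b|; have u0 : 0 <= u by rewrite addr_ge0.
exists (C + (C' + D * u)); first by rewrite !addr_ge0// mulr_ge0.
move=> t n t01 sd; have /andP[t0 t1] := t01; set s := tilt_exponent b t.
have sd1 : `|s| <= del by have := normr_ge0 s; move: sd; rewrite -/s; lra.
have s2 : `|s| <= 1 / 2 by apply: le_trans sd1 _; case/andP: d02.
have g0 := ltW (decay_gt0 del n.+1).
exists (Phi s - \sum_(j < K) (expR (t * a j.+1) - 1) / j.+1%:R - t ^+ 2 * (m1 * (b - tilt_variance))).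
exists ((drift (f s) n.+1 - Phi s * f s n.+1) -
  (excess t (f s) n.+1 - (\sum_(j < K) (expR (t * a j.+1) - 1) / j.+1%:R) * f s n.+1)); split.
- apply: le_trans (hC t t01 sd1) _; rewrite ler_wpM2r ?exprn_ge0 ?(ltW t0)// lerDl.
  by rewrite addr_ge0// mulr_ge0.
- apply: le_trans (ler_normB _ _) _.
  have h1 := hD s n s2 sd1; have h2 := hC' (t, s, n.+1) (conj t01 sd).
  apply: le_trans (lerD h1 h2) _; rewrite /= [leRHS]mulrDl addrC -[leLHS]add0r.
  rewrite lerD ?mulr_ge0 ?(ltW t0)// mulrDl lerD2l.
  rewrite -!mulrA ler_wpM2l// mulrA ler_wpM2r//; exact: tilt_exponent_le.
by rewrite tilted_driftE; ring.
Qed.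

Let small_tilt b : \forall t \near 0^'+, 2 * `|tilt_exponent b t| <= del.
Proof.
pose u := `|A1 / m1| + `|b|; have u0 : 0 <= u by rewrite addr_ge0.
near=> t; have t0 : 0 < t by near: t; exact: nbhs_right_gt.
have t1 : 0 < t <= 1 by rewrite t0/=; near: t; exact: nbhs_right_le.
apply: (@le_trans _ _ (2 * (u * t))); first by rewrite ler_pM2l//; exact: tilt_exponent_le.
have : t <= del / (2 * (u + 1)) by near: t; apply: nbhs_right_le; rewrite divr_gt0// mulr_gt0// ltr_wpDl.
rewrite ler_pdivlMr ?mulr_gt0// ?ltr_wpDl// => h; apply: le_trans h.
by rewrite (_ : t * (2 * (u + 1)) = 2 * (u * t) + 2 * t) ?lerDl ?mulr_ge0 ?(ltW t0)//; ring.
Unshelve. all: by end_near.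
Qed.

Variable kappa : R.
Hypothesis kappa0 : 0 < kappa.

(** Above the critical value, f has tilted drift at least - C t g, and subtracting (C / c) t g
    compensates this because the tilted drift of g is at most - c g. The factor 1 - D t makes the
    comparison start from equality at n = 0. *)
Theorem tilted_recursion_le : exists2 D, 0 <= D & \forall t \near 0^'+, D * t < 1 /\
  forall G, G 0%N = 1 -> (forall n, tilted_drift t G n.+1 = 0) ->
  forall n, (1 - D * t) * G n <= f (tilt_exponent (tilt_variance + kappa) t) n.
Proof.
have [c c0 [t0 t00 hg]] := tilted_g; have [C C0 hC] := tilted_f (tilt_variance + kappa).
exists (C / c); first by rewrite divr_ge0// ltW.
near=> t; have tp : 0 < t by near: t; exact: nbhs_right_gt.
have t1 : 0 < t <= 1 by rewrite tp/=; near: t; exact: nbhs_right_le.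
have tt0 : 0 < t <= t0 by rewrite tp/=; near: t; exact: nbhs_right_le.
have sd : 2 * `|tilt_exponent (tilt_variance + kappa) t| <= del by near: t; exact: small_tilt.
have tk : C * t <= m1 * kappa.
  have : t <= m1 * kappa / (C + 1) by near: t; apply: nbhs_right_le; rewrite divr_gt0 ?mulr_gt0// ltr_wpDl.
  by rewrite ler_pdivlMr ?ltr_wpDl// mulrDr mulr1 mulrC; move: (C * t) (m1 * kappa) tp => x y; lra.
have tC : C / c * t < 1.
  have : t < (C / c + 1)^-1 by near: t; apply: nbhs_right_lt; rewrite invr_gt0 ltr_wpDl// divr_ge0// ltW.
  rewrite -div1r ltr_pdivlMr ?ltr_wpDl ?divr_ge0 ?(ltW c0)// mulrDr mulr1 mulrC; move: (C / c * t) tp => x; lra.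
split=> // G G0 hG n; set s := tilt_exponent _ _.
have s2 : `|s| <= 1 / 2 by have := normr_ge0 s; case/andP: d02 => _; move: sd; rewrite -/s; lra.
have w : forall n, 0 <= 1 * f s n + (-1) * (C / c * t * g n + (1 - C / c * t) * G n).
  apply: (@tilted_drift_comparison t (fun n => 1 * f s n + (-1) * (C / c * t * g n + (1 - C / c * t) * G n))).
    rewrite rising_ratio0 G0 /decay powR1; lra.
  move=> k; rewrite tilted_drift_lin (tilted_drift_lin t (C / c * t) (1 - C / c * t) g G) hG mulr0 addr0.
  have [e1 [e2 [h1 h2 ->]]] := hC t k t1 sd.
  have := hg t k tt0; rewrite -/s.
  have f0 := rising_ratio_gt0 s2 k.+1.
  have p1 : 0 <= (t ^+ 2 * (m1 * (tilt_variance + kappa - tilt_variance)) + e1) * f s k.+1.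
    rewrite mulr_ge0 ?(ltW f0)//.
    move: h1; rewrite ler_norml => /andP[h1 _].
    have : t ^+ 2 * (C * t) <= t ^+ 2 * (m1 * kappa) by rewrite ler_wpM2l ?sqr_ge0.
    rewrite (_ : tilt_variance + kappa - tilt_variance = kappa); last by ring.
    rewrite (_ : C * t ^+ 3 = t ^+ 2 * (C * t)) in h1; last by ring.
    lra.
  move: h2; rewrite ler_norml => /andP[h2 _] hgk.
  have : C / c * t * tilted_drift t g k.+1 <= C / c * t * (- c * g k.+1).
    by rewrite ler_wpM2l// mulr_ge0 ?divr_ge0// ltW.
  rewrite (_ : C / c * t * (- c * g k.+1) = - (C * (t * g k.+1))); last by field; rewrite gt_eqF.
  lra.
have := w n; have : 0 <= C / c * t * g n by rewrite mulr_ge0 ?(ltW (decay_gt0 _ _))// mulr_ge0 ?divr_ge0 ?(ltW tp) ?(ltW c0).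
lra.
Unshelve. all: by end_near.
Qed.

(** Mirror image: below the critical value, f has tilted drift at most C t g, and the barrier is
    subtracted from the multiple of G. *)
Theorem tilted_recursion_ge : exists2 D, 0 <= D & \forall t \near 0^'+,
  forall G, G 0%N = 1 -> (forall n, tilted_drift t G n.+1 = 0) ->
  forall n, f (tilt_exponent (tilt_variance - kappa) t) n <= (1 + D * t) * G n.
Proof.
have [c c0 [t0 t00 hg]] := tilted_g; have [C C0 hC] := tilted_f (tilt_variance - kappa).
exists (C / c); first by rewrite divr_ge0// ltW.
near=> t; have tp : 0 < t by near: t; exact: nbhs_right_gt.
have t1 : 0 < t <= 1 by rewrite tp/=; near: t; exact: nbhs_right_le.
have tt0 : 0 < t <= t0 by rewrite tp/=; near: t; exact: nbhs_right_le.
have sd : 2 * `|tilt_exponent (tilt_variance - kappa) t| <= del by near: t; exact: small_tilt.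
have tk : C * t <= m1 * kappa.
  have : t <= m1 * kappa / (C + 1) by near: t; apply: nbhs_right_le; rewrite divr_gt0 ?mulr_gt0// ltr_wpDl.
  by rewrite ler_pdivlMr ?ltr_wpDl// mulrDr mulr1 mulrC; move: (C * t) (m1 * kappa) tp => x y; lra.
move=> G G0 hG n; set s := tilt_exponent _ _.
have s2 : `|s| <= 1 / 2 by have := normr_ge0 s; case/andP: d02 => _; move: sd; rewrite -/s; lra.
have w : forall n, 0 <= (-1) * f s n + 1 * (- (C / c * t) * g n + (1 + C / c * t) * G n).
  apply: (@tilted_drift_comparison t (fun n => (-1) * f s n + 1 * (- (C / c * t) * g n + (1 + C / c * t) * G n))).
    rewrite rising_ratio0 G0 /decay powR1; lra.
  move=> k; rewrite tilted_drift_lin (tilted_drift_lin t (- (C / c * t)) (1 + C / c * t) g G) hG mulr0 addr0.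
  have [e1 [e2 [h1 h2 ->]]] := hC t k t1 sd.
  have := hg t k tt0; rewrite -/s.
  have f0 := rising_ratio_gt0 s2 k.+1.
  have p1 : 0 <= - (t ^+ 2 * (m1 * (tilt_variance - kappa - tilt_variance)) + e1) * f s k.+1.
    rewrite mulr_ge0 ?(ltW f0)//.
    move: h1; rewrite ler_norml => /andP[_ h1].
    have : t ^+ 2 * (C * t) <= t ^+ 2 * (m1 * kappa) by rewrite ler_wpM2l ?sqr_ge0.
    rewrite (_ : m1 * (tilt_variance - kappa - tilt_variance) = - (m1 * kappa)); last by ring.
    rewrite (_ : C * t ^+ 3 = t ^+ 2 * (C * t)) in h1; last by ring.
    lra.
  move: h2; rewrite ler_norml => /andP[_ h2] hgk.
  have : C / c * t * tilted_drift t g k.+1 <= C / c * t * (- c * g k.+1).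
    by rewrite ler_wpM2l// mulr_ge0 ?divr_ge0// ltW.
  rewrite (_ : C / c * t * (- c * g k.+1) = - (C * (t * g k.+1))); last by field; rewrite gt_eqF.
  lra.
have := w n; have : 0 <= C / c * t * g n by rewrite mulr_ge0 ?(ltW (decay_gt0 _ _))// mulr_ge0 ?divr_ge0 ?(ltW tp) ?(ltW c0).
lra.
Unshelve. all: by end_near.
Qed.

End perturbed_recursion.

(** * The scale sqrt(log n) *)

Section inv_sqrt_ln.
Context {R : realType}.

Definition root_ln n : R := Num.sqrt (ln n%:R).

Lemma root_ln_gt (A : R) : \forall n \near \oo, A < root_ln n.
Proof.
near=> n.
have : expR (A ^+ 2) < n%:R by near: n; exact: nbhs_infty_gtr.
rewrite -ltr_ln ?posrE ?expR_gt0//; last first.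
  by rewrite ltr0n; near: n; exact: nbhs_infty_gt.
rewrite expRK => h; apply: le_lt_trans (ler_norm A) _.
by rewrite -sqrtr_sqr ltr_sqrt// (le_lt_trans (sqr_ge0 A)).
Unshelve. all: by end_near.
Qed.

Lemma root_ln_sqr n : root_ln n.+1 ^+ 2 = ln n.+1%:R.
Proof. by rewrite sqr_sqrtr// ln_ge0// ler1n. Qed.

Lemma inv_root_ln_cvg : (root_ln n)^-1 @[n --> \oo] --> (0 : R)^'+.
Proof.
move=> P [e /= e0 eP]; change (\forall n \near \oo, P (root_ln n)^-1); near=> n.
have h1 : e^-1 < root_ln n by near: n; exact: root_ln_gt.
have h0 : 0 < root_ln n by apply: lt_trans h1; rewrite invr_gt0.
apply: eP; last by rewrite invr_gt0.
rewrite /ball/= sub0r normrN gtr0_norm ?invr_gt0//.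
by rewrite -[ltRHS]invrK ltf_pV2// posrE// invr_gt0.
Unshelve. all: by end_near.
Qed.

Lemma inv_root_ln_cvg0 : (root_ln n)^-1 @[n --> \oo] --> (0 : R).
Proof. exact: (cvg_trans inv_root_ln_cvg (cvg_within _)). Qed.

(** s log n equals x sqrt(log n) + b exactly; the harmonic number differs from log n by at most 1,
    which is negligible after multiplication by s -> 0. *)
Lemma rising_ratio_cvg (x b : R) :
  rising_ratio (x / root_ln n + b / root_ln n ^+ 2) n * expR (- x * root_ln n) @[n --> \oo] --> expR b.
Proof.
pose s n := x / root_ln n + b / root_ln n ^+ 2.
have s0 : s n @[n --> \oo] --> 0.
  rewrite -[X in _ --> X](_ : x * 0 + b * 0 ^+ 2 = 0); last by rewrite expr0n/= !mulr0 addr0.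
  under eq_cvg do rewrite /s -exprVn.
  apply: cvgD; apply: cvgM; try exact: cvg_cst; first exact: inv_root_ln_cvg0.
  exact: (@cvg_comp _ _ _ (fun n => (root_ln n)^-1) (fun y => y ^+ 2) _ (nbhs 0) _ inv_root_ln_cvg0 (@exprn_continuous _ 2 0)).
have ns0 : `|s n| @[n --> \oo] --> 0 by rewrite -(normr0 R); exact: cvg_norm.
have ec : continuous (@expR R) by exact: continuous_expR.
have sqr0 : `|s n| ^+ 2 @[n --> \oo] --> 0.
  rewrite -[X in _ --> X](expr0n R 2).
  exact: (@cvg_comp _ _ _ (fun n => `|s n|) (fun y => y ^+ 2) _ (nbhs 0) _ ns0 (@exprn_continuous _ 2 0)).
have c1 : b - `|s n| @[n --> \oo] --> b.
  by rewrite -[X in _ --> X]subr0; apply: cvgB => //; exact: cvg_cst.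
have c2 : b + `|s n| + 4 * `|s n| ^+ 2 @[n --> \oo] --> b.
  rewrite -[X in _ --> X](_ : b + 0 + 4 * 0 = b); last by ring.
  apply: cvgD; first by apply: cvgD => //; exact: cvg_cst.
  by apply: cvgM => //; exact: cvg_cst.
apply: (@squeeze_cvgr _ _ _ _ (fun n => expR (b - `|s n|)) (fun n => expR (b + `|s n| + 4 * `|s n| ^+ 2))).
- near=> n.
  have r0 : 0 < root_ln n by near: n; exact: root_ln_gt.
  have s2 : `|s n| <= 1 / 2 by near: n; move/cvgr_le : ns0; apply; rewrite divr_gt0.
  have n0 : (0 < n)%N by near: n; exact: nbhs_infty_gt.
  have [k nk] : exists k, n = k.+1 by exists n.-1; rewrite prednK.
  have /andP[h1 h2] := harm_ln (R := R) k; rewrite -nk in h1 h2.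
  have e : s n * ln n%:R = x * root_ln n + b.
    rewrite nk -root_ln_sqr -nk /s; field; rewrite gt_eqF//.
  have sh : `|s n * (harm n - ln n%:R)| <= `|s n|.
    rewrite normrM ler_piMr// ler_norml; lra.
  have lo := rising_ratio_ge s2 n; have up := rising_ratio_le s2 n.
  have -> : b - `|s n| = (b + x * root_ln n - `|s n|) + - x * root_ln n by ring.
  have -> : b + `|s n| + 4 * `|s n| ^+ 2 = (b + x * root_ln n + `|s n| + 4 * s n ^+ 2) + - x * root_ln n.
    by rewrite real_normK ?num_real//; ring.
  rewrite !(expRD _ (- x * root_ln n)) !(ler_pM2r (expR_gt0 _)).
  move: sh; rewrite ler_norml mulrBr e => /andP[sh1 sh2]; apply/andP; split.
    by apply: le_trans lo; rewrite ler_expR; lra.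
  by apply: le_trans up _; rewrite ler_expR; lra.
- exact: (@cvg_comp _ _ _ (fun n => b - `|s n|) expR _ (nbhs b) _ c1 (ec b)).
- exact: (@cvg_comp _ _ _ (fun n => b + `|s n| + 4 * `|s n| ^+ 2) expR _ (nbhs b) _ c2 (ec b)).
Unshelve. all: by end_near.
Qed.

(** A squeeze whose bounds may lose an arbitrarily small [e] in the exponent. *)
Lemma cvg_between (X : nat -> R) (h : R -> nat -> R) (k : R -> nat -> R) (b : R) :
  (forall e, 0 < e -> h e n @[n --> \oo] --> expR (b + e)) ->
  (forall e, 0 < e -> k e n @[n --> \oo] --> expR (b - e)) ->
  (forall e, 0 < e -> \forall n \near \oo, k e n <= X n <= h e n) ->
  X n @[n --> \oo] --> expR b.
Proof.
move=> hh hk hX; apply/cvgrPdist_lt => eps eps0.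
have /cvgrPdist_lt/(_ _ eps0) [d /= d0 dP] := @continuous_expR R b.
pose e := d / 2; have e0 : 0 < e by rewrite divr_gt0.
have ed : e < d by rewrite /e; lra.
have h1 : expR (b + e) < expR b + eps.
  have := dP (b + e); rewrite /ball/= opprD addrA subrr sub0r normrN gtr0_norm// => /(_ ed).
  by rewrite ltr_distlC => /andP[].
have h2 : expR b - eps < expR (b - e).
  have := dP (b - e); rewrite /ball/= opprB addrCA subrr addr0 gtr0_norm// => /(_ ed).
  by rewrite ltr_distlC => /andP[].
near=> n.
have /andP[x1 x2] : k e n <= X n <= h e n by near: n; exact: hX.
have y1 : h e n < expR b + eps by near: n; move: (hh e e0) => /cvgr_lt; apply.
have y2 : expR b - eps < k e n by near: n; move: (hk e e0) => /cvgr_gt; apply.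
rewrite ltr_distlC; lra.
Unshelve. all: by end_near.
Qed.

End inv_sqrt_ln.

Section tilted_mean.
Context {R : realType}.
Variable nu : {measure set R -> \bar R}.
Hypothesis nu_levy : levy_measure nu.
Variable delta : R.
Hypotheses (delta0 : 0 < delta) (deltaW : weight_integrable nu delta).
Hypothesis nu_L : condition_L nu.
Variables (a : nat -> R) (K : nat).
Hypothesis a_small : forall j, (K < j)%N -> a j = 0.
Local Notation m1 := (levy_moment nu 1).
Local Notation m2 := (levy_moment nu 2).
Let A1 := \sum_(j < K) a j.+1 / j.+1%:R.
Let A2 := \sum_(j < K) a j.+1 ^+ 2 / j.+1%:R.

Theorem tilted_mean_cvg (G : R -> nat -> R) : (forall t, G t 0%N = 1) ->
  (forall t n, \sum_(j < n) cut_rate nu n j.+1 * (expR (t * a j.+1) * G t (n - j.+1)%N - G t n) = 0) ->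
  G (root_ln n)^-1 n * expR (- (A1 / m1) * root_ln n) @[n --> \oo]
    --> expR (A2 / (2 * m1) + m2 * A1 ^+ 2 / (2 * m1 ^+ 3)).
Proof.
move=> G0 hG.
have m10 : 0 < m1 := (levy_moment1_gt0 delta0 deltaW nu_L).
have Phi1 := laplace_exponent1_gt0 delta0 deltaW nu_L.
have [eps [/andP[e0 e1] qlim]] := cut_rate_cvg nu_levy delta0 deltaW nu_L.
(* [eps / 2] turns the rate n^-eps of [cut_rate_cvg] into n^(- 2 del); [delta / 2] keeps e^(del y)
   and the Taylor expansion of the exponent in the integrable range. *)
pose del := Num.min (eps / 2) (delta / 2).
have d0 : 0 < del by rewrite lt_min !divr_gt0.
have de : del <= eps / 2 by rewrite ge_min lexx.
have dd : del <= delta / 2 by rewrite ge_min lexx orbT.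
have d02 : 0 < del <= 1 / 2 by rewrite d0/=; lra.
have d01 : 0 < del <= 1 by rewrite d0/=; lra.
have ddl : del < delta by lra.
have qlim' m : exists2 C, 0 <= C & forall n,
    `|cut_rate nu n m.+1 - m.+1%:R^-1| <= C * decay (2 * del) n.
  have [C C0 hC] := qlim m; exists C => // n; apply: le_trans (hC n) _.
  by rewrite ler_wpM2l// ler_powR ?ler1n// lerN2; lra.
have hf : exists2 C, 0 <= C & forall s n, `|s| <= 1 / 2 -> `|s| <= del ->
    `|drift (cut_rate nu) (rising_ratio s) n.+1 - laplace_exponent nu s * rising_ratio s n.+1| <= C * `|s| * decay del n.+1.
  exact: (cut_drift_rising delta0 deltaW d01 ddl dd).
have hg : exists2 c, 0 < c & forall n, drift (cut_rate nu) (decay del) n.+1 <= - c * decay del n.+1.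
  exists (del * laplace_exponent nu 1 / 2); first by rewrite divr_gt0// mulr_gt0.
  by move=> n; apply: (cut_drift_decay delta0 deltaW); exact: ltW.
have hPhi : exists2 C, 0 <= C & forall s, `|s| <= del ->
    `|laplace_exponent nu s - (m1 * s - m2 / 2 * s ^+ 2)| <= C * `|s| ^+ 3.
  have [C C0 hC] := laplace_exponent_taylor delta0 deltaW.
  by exists C => // s sd; apply: hC; exact: le_trans dd.
have qpos n := sum_cut_rate_gt0 delta0 deltaW n Phi1.
have hG' t n : tilted_drift (cut_rate nu) a t (G t) n.+1 = 0.
  rewrite -[RHS]oppr0 -(hG t n.+1) -sumrN; apply: eq_bigr => j _; ring.
have up kappa (k0 : 0 < kappa) := tilted_recursion_le (@cut_rate_ge0 _ nu) (@cut_rate_small _ nu) qpos d02 qlim' hf hg hPhi m10 a_small k0.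
have lo kappa (k0 : 0 < kappa) := tilted_recursion_ge (@cut_rate_ge0 _ nu) (@cut_rate_small _ nu) qpos d02 qlim' hf hg hPhi m10 a_small k0.
pose V := tilt_variance m1 m2 a K.
have E b n : tilt_exponent m1 a K b (root_ln n)^-1 = A1 / m1 / root_ln n + b / root_ln n ^+ 2.
  by rewrite /tilt_exponent exprVn mulrC [_ * b]mulrC.
have lim x D : rising_ratio (A1 / m1 / root_ln n + x / root_ln n ^+ 2) n * expR (- (A1 / m1) * root_ln n)
      / (1 + D * (root_ln n)^-1) @[n --> \oo] --> expR x.
  rewrite -[X in _ --> X](_ : expR x / (1 + D * 0) = expR x); last by rewrite mulr0 addr0 divr1.
  apply: cvgM; first exact: rising_ratio_cvg.
  apply: cvgV; first by rewrite mulr0 addr0 oner_eq0.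
  by apply: cvgD; [exact: cvg_cst|apply: cvgM; [exact: cvg_cst|exact: inv_root_ln_cvg0]].
(* The constants of the comparison theorems depend on [e], and the squeezing bounds must be
   functions of [e]; 0 is a default for nonpositive [e]. *)
pose Du e := if pselect (0 < e) is left e0 then sval (cid2 (up e e0)) else 0.
pose Dl e := if pselect (0 < e) is left e0 then sval (cid2 (lo e e0)) else 0.
apply: (@cvg_between _ _
  (fun e n => rising_ratio (A1 / m1 / root_ln n + (V + e) / root_ln n ^+ 2) n * expR (- (A1 / m1) * root_ln n)
      / (1 + - Du e * (root_ln n)^-1))
  (fun e n => rising_ratio (A1 / m1 / root_ln n + (V - e) / root_ln n ^+ 2) n * expR (- (A1 / m1) * root_ln n)
      / (1 + Dl e * (root_ln n)^-1))).
- by move=> e _; exact: lim.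
- by move=> e _; exact: lim.
move=> e ep; rewrite /Du /Dl; case: pselect => // ep'.
case: cid2 => D' /= D'0 hD'; case: cid2 => D /= D0 hD.
have hu : \forall n \near \oo, _ := inv_root_ln_cvg hD.
have hl : \forall n \near \oo, _ := inv_root_ln_cvg hD'.
near=> n.
have t0 : 0 < (root_ln n)^-1 :> R by rewrite invr_gt0; near: n; exact: root_ln_gt.
have [D1 h1] : D * (root_ln n)^-1 < 1 /\ forall G : nat -> R, G 0%N = 1 ->
    (forall k, tilted_drift (cut_rate nu) a (root_ln n)^-1 G k.+1 = 0) ->
    forall k, (1 - D * (root_ln n)^-1) * G k <= rising_ratio (tilt_exponent m1 a K (V + e) (root_ln n)^-1) k.
  by near: n; exact: hu.
have h2 : forall G : nat -> R, G 0%N = 1 ->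
    (forall k, tilted_drift (cut_rate nu) a (root_ln n)^-1 G k.+1 = 0) ->
    forall k, rising_ratio (tilt_exponent m1 a K (V - e) (root_ln n)^-1) k <= (1 + D' * (root_ln n)^-1) * G k.
  by near: n; exact: hl.
have {}h1 := h1 _ (G0 (root_ln n)^-1) (hG' _) n.
have {}h2 := h2 _ (G0 (root_ln n)^-1) (hG' _) n.
rewrite !E in h1 h2.
have p2 : 0 < 1 + D' * (root_ln n)^-1 by rewrite ltr_wpDr// mulr_ge0// ltW.
apply/andP; split.
  by rewrite ler_pdivrMr// [leRHS]mulrAC ler_pM2r ?expR_gt0// [leRHS]mulrC.
rewrite ler_pdivlMr ?mulNr ?subr_gt0//.
by rewrite [leLHS]mulrAC ler_pM2r ?expR_gt0// [leLHS]mulrC.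
Unshelve. all: by end_near.
Qed.

End tilted_mean.

(** * Part counts *)

Section part_counts.
Context {d : measure_display} {T : measurableType d} {R : realType}.
Variables (P : probability T R) (S : R -> T -> R) (nu : {measure set R -> \bar R}).
Variable u : forall n : nat, 'I_n -> T -> R.
Arguments u : clear implicits.
Hypothesis S_sub : subordinator P S.
Hypothesis S_nu : driftfree_with_levy_measure P S nu.
Hypothesis nu_L : condition_L nu.
Hypothesis nu_R : condition_R nu.
Hypothesis u_uniform : forall n, iid_uniform P (u n).
Hypothesis u_S : forall n, independent_of_process P S (u n).
Local Notation m1 := (levy_moment nu 1).
Local Notation m2 := (levy_moment nu 2).

Lemma part_countE n r w :
  part_count S (u n) r w = \sum_(B in blocks (S ^~ w) (u n ^~ w)) (#|B| == r)%:R.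
Proof. by rewrite /part_count parts_equalE natr_sum. Qed.

(** [h] is arbitrary because the counts are determined by the set of blocks, which has finitely many
    possible values. *)
Lemma bounded_mfun_part_counts n (h : (nat -> R) -> R) :
  bounded_mfun (fun w => h (fun r => part_count S (u n) r w)).
Proof.
have := bounded_mfun_blocks S_sub (u_uniform n)
  (fun b => h (fun r => \sum_(B in b) (#|B| == r)%:R)).
congr (bounded_mfun _); apply/funext => w; congr h; apply/funext => r.
exact/esym/part_countE.
Qed.

Variables (a : nat -> R) (K : nat).
Hypothesis a0 : a 0%N = 0.
Hypothesis a_small : forall j, (K < j)%N -> a j = 0.
Let A1 := \sum_(j < K) a j.+1 / j.+1%:R.
Let A2 := \sum_(j < K) a j.+1 ^+ 2 / j.+1%:R.

(** The blocks are grouped by size; those larger than [K] have weight 1. *)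
Lemma block_product_exp t n w :
  block_product S (u n) (fun m => expR (t * a m)) w =
  expR (t * \sum_(j < K) a j.+1 * part_count S (u n) j.+1 w).
Proof.
rewrite /block_product -expR_sum -mulr_sumr; congr (expR (t * _)).
under [RHS]eq_bigr do rewrite part_countE mulr_sumr.
rewrite exchange_big/=; apply: eq_bigr => B _.
have [B0|] := posnP #|B|; first by rewrite B0 a0 big1// => j _; rewrite mulr0.
move=> B0; have [BK|BK] := ltnP K #|B|.
  rewrite a_small// big1// => j _; rewrite gtn_eqF ?mulr0//.
  by rewrite (leq_ltn_trans _ BK).
have jB : (#|B|.-1 < K)%N by rewrite prednK.
rewrite (bigD1 (Ordinal jB))//= prednK// eqxx mulr1 big1 ?addr0// => j jn.
rewrite (_ : _ == _ = false) ?mulr0//; apply: contraNF jn => /eqP E.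
by apply/eqP/val_inj; rewrite /= E.
Qed.

Lemma part_count_mgf_cvg :
  (\int[P]_w expR (\sum_(j < K) a j.+1 * part_count S (u n) j.+1 w / root_ln n)) *
    expR (- (A1 / m1) * root_ln n) @[n --> \oo]
  --> expR (A2 / (2 * m1) + m2 * A1 ^+ 2 / (2 * m1 ^+ 3)).
Proof.
have nu_levy := S_nu.1.
have [delta delta0 deltaW] := exists_weight_integrable nu_levy nu_R.
have Phi1 := laplace_exponent1_gt0 delta0 deltaW nu_L.
have sub := laplace_exponent_sublinear delta0 deltaW.
pose G t n := \int[P]_w block_product S (u n) (fun m => expR (t * a m)) w.
have GE n : \int[P]_w expR (\sum_(j < K) a j.+1 * part_count S (u n) j.+1 w / root_ln n) = G (root_ln n)^-1 n.
  by apply: eq_Rintegral => w _; rewrite block_product_exp mulr_sumr; congr expR;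
    apply: eq_bigr => j _; rewrite mulrC.
under eq_cvg do rewrite GE.
apply: (tilted_mean_cvg nu_levy delta0 deltaW nu_L a_small) => [t|t n].
  rewrite -[RHS](mean_cst P 1); apply: eq_Rintegral => w _.
  rewrite /block_product big1// => B; rewrite inE => /andP[B0 _].
  by move: B0; rewrite inE => /finset.set0Pn[[]].
(* A common bound of all |a_m|: with Z = e^(|t| s), the weight of a block of size m is at most Z^m,
   as [cut_recursion] requires. *)
pose s := \sum_(j < K.+1) `|a j|.
have s0 : 0 <= s by exact: sumr_ge0.
have as_ m : `|a m| <= s.
  have [mK|mK] := ltnP K m; first by rewrite a_small// normr0.
  by rewrite /s (bigD1 (Ordinal (mK : (m < K.+1)%N)))//= lerDl sumr_ge0.
pose Z := expR (`|t| * s).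
have Z1 : 1 <= Z by rewrite -expR0 ler_expR mulr_ge0.
have zZ m : 0 <= expR (t * a m) <= Z ^+ m.
  rewrite expR_ge0/=; case: m => [|m]; first by rewrite a0 mulr0 expR0 expr0.
  apply: (@le_trans _ _ Z); last by rewrite exprS ler_peMr ?expR_ge0// exprn_ege1.
  by rewrite ler_expR (le_trans (ler_norm _))// normrM ler_wpM2l.
have z0 : expR (t * a 0%N) = 1 by rewrite a0 mulr0 expR0.
apply: (@cut_recursion _ _ _ _ _ _ S_sub S_nu delta delta0 deltaW Z (fun m => expR (t * a m)) (G t) Z1 z0 zZ Phi1).
move=> k; have uR (i : 'I_k) := sample_notin_closed_range S_sub S_nu (u_uniform k) (@u_S k) i sub Phi1.
exact: (mean_cell_product_cvg S_sub (u_uniform k) (@u_S k) z0 zZ uR).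
Qed.

(** Centred at log n / ((j + 1) m_1), the asymptotic mean, instead of the expectation;
    [centred_part_count_mean_cvg] reconciles the two. *)
Definition centred_part_count n j w : R :=
  part_count S (u n) j.+1 w / root_ln n - root_ln n / (j.+1%:R * m1).

Lemma centred_part_count_mgf :
  \int[P]_w expR (\sum_(j < K) a j.+1 * centred_part_count n j w) @[n --> \oo]
  --> expR (quad (limit_sigma (m2 / m1 ^+ 3) m1) (fun j : 'I_K => a j.+1) / 2).
Proof.
have [delta delta0 deltaW] := exists_weight_integrable S_nu.1 nu_R.
have m10 := levy_moment1_gt0 delta0 deltaW nu_L.
have -> : quad (limit_sigma (m2 / m1 ^+ 3) m1) (fun j : 'I_K => a j.+1) / 2 =
    A2 / (2 * m1) + m2 * A1 ^+ 2 / (2 * m1 ^+ 3).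
  rewrite quad_limit_sigma -/A1 (_ : \sum_(i < K) _ = A2 / m1); last first.
    by rewrite /A2 mulr_suml; apply: eq_bigr => j _; rewrite invfM mulrA.
  by field; rewrite gt_eqF.
have E n : \int[P]_w expR (\sum_(j < K) a j.+1 * centred_part_count n j w) =
  (\int[P]_w expR (\sum_(j < K) a j.+1 * part_count S (u n) j.+1 w / root_ln n)) *
    expR (- (A1 / m1) * root_ln n).
  rewrite mulrC -bounded_meanZ; last first.
    exact: (bounded_mfun_part_counts n (fun k => expR (\sum_(j < K) a j.+1 * k j.+1 / root_ln n))).
  apply: eq_Rintegral => w _; rewrite -expRD; congr expR.
  rewrite /A1 !mulr_suml -sumrN mulr_suml -big_split/=; apply: eq_bigr => j _.
  by rewrite /centred_part_count invfM; ring.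
by under eq_cvg do rewrite E; exact: part_count_mgf_cvg.
Qed.

End part_counts.

Section normalised_part_counts.
Context {d : measure_display} {T : measurableType d} {R : realType}.
Variables (P : probability T R) (S : R -> T -> R) (nu : {measure set R -> \bar R}).
Variable u : forall n : nat, 'I_n -> T -> R.
Arguments u : clear implicits.
Hypothesis S_sub : subordinator P S.
Hypothesis S_nu : driftfree_with_levy_measure P S nu.
Hypothesis nu_L : condition_L nu.
Hypothesis nu_R : condition_R nu.
Hypothesis u_uniform : forall n, iid_uniform P (u n).
Hypothesis u_S : forall n, independent_of_process P S (u n).
Local Notation m1 := (levy_moment nu 1).
Local Notation m2 := (levy_moment nu 2).
Local Notation Y := (centred_part_count S nu u).

Lemma bounded_mfun_centred n (h : (nat -> R) -> R) :
  bounded_mfun (fun w => h (fun j => Y n j w)).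
Proof.
exact: (bounded_mfun_part_counts S_sub u_uniform n (fun k => h (fun j => k j.+1 / root_ln n - root_ln n / (j.+1%:R * m1)))).
Qed.

Let m10 : 0 < m1.
Proof.
have [delta delta0 deltaW] := exists_weight_integrable S_nu.1 nu_R.
exact: levy_moment1_gt0 delta0 deltaW nu_L.
Qed.

Lemma centred_part_count_mgf1 j : exists2 v, 0 <= v & forall t : R,
  \int[P]_w expR (t * Y n j w) @[n --> \oo] --> expR (t ^+ 2 * v).
Proof.
exists ((m2 / m1 ^+ 3 / j.+1%:R ^+ 2 + (j.+1%:R * m1)^-1) / 2).
  have p0 : 0 <= m2 / m1 ^+ 3 by rewrite divr_ge0 ?exprn_ge0 ?levy_moment_ge0 ?(ltW m10).
  rewrite divr_ge0// addr_ge0//; first by rewrite divr_ge0// exprn_ge0.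
  by rewrite invr_ge0 mulr_ge0// ltW.
move=> t; pose a (l : nat) : R := (l == j.+1)%:R * t.
have sa (F : nat -> R) : \sum_(l < j.+1) a l.+1 * F l = t * F j.
  under eq_bigr do rewrite /a -mulrA.
  by under eq_bigr do rewrite eqSS; rewrite (sum_delta (fun l => t * F l)).
have a_small l : (j.+1 < l)%N -> a l = 0 by move=> jl; rewrite /a gtn_eqF ?mul0r.
have := @centred_part_count_mgf _ _ _ _ _ _ _ S_sub S_nu nu_L nu_R u_uniform u_S a j.+1 (mul0r _) a_small.
have -> : quad (limit_sigma (m2 / m1 ^+ 3) m1) (fun l : 'I_j.+1 => a l.+1) / 2 =
    t ^+ 2 * ((m2 / m1 ^+ 3 / j.+1%:R ^+ 2 + (j.+1%:R * m1)^-1) / 2).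
  rewrite quad_limit_sigma (sa (fun l => l.+1%:R^-1)).
  under eq_bigr do rewrite expr2 -mulrA.
  rewrite (sa (fun l => a l.+1 * (l.+1%:R * m1)^-1)) /a eqxx mul1r exprMn exprVn; ring.
by under eq_cvg do under eq_Rintegral do rewrite (sa (fun l => Y _ l _)).
Qed.

(** 1 + t E Y <= E e^(t Y), and the right side tends to 1 + O(t^2); for small t of either sign this
    makes the mean eventually O(|t|). *)
Lemma centred_part_count_mean_cvg j : \int[P]_w Y n j w @[n --> \oo] --> 0.
Proof.
have [v v0 hv] := centred_part_count_mgf1 j.
pose C := v * expR v + 1; have C1 : 0 < C by rewrite ltr_wpDl// mulr_ge0 ?expR_ge0.
have bt n t : bounded_mfun (fun w => expR (t * Y n j w)).
  exact: (bounded_mfun_centred n (fun y => expR (t * y j))).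
have bY n : bounded_mfun (Y n j) by exact: (bounded_mfun_centred n (fun y => y j)).
have up t : 0 < `|t| <= 1 -> \forall n \near \oo, t * \int[P]_w Y n j w <= t ^+ 2 * C.
  move=> /andP[t0 t1]; have t20 : 0 < t ^+ 2 by rewrite exprn_even_gt0// -normr_gt0.
  near=> n.
  have h : \int[P]_w expR (t * Y n j w) <= expR (t ^+ 2 * v) + t ^+ 2.
    by near: n; move: (hv t) => /cvgr_le; apply; rewrite ltrDl.
  have h2 : 1 + t * \int[P]_w Y n j w <= \int[P]_w expR (t * Y n j w).
    rewrite -{1}(mean_cst P 1) -bounded_meanZ// -bounded_meanD//; [|exact: bounded_mfun_cst|exact: bounded_mfunZ].
    apply: bounded_mean_le => //; first by apply: bounded_mfunD; [exact: bounded_mfun_cst|exact: bounded_mfunZ].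
    by move=> w; exact: expR_ge1Dx.
  have tv : 0 <= t ^+ 2 * v by rewrite mulr_ge0// ltW.
  have h3 := expR_taylor1 (t ^+ 2 * v); rewrite (ger0_norm tv) in h3.
  have h4 : expR (t ^+ 2 * v) - 1 <= t ^+ 2 * (v * expR v).
    apply: le_trans (ler_norm _) _; apply: le_trans h3 _.
    rewrite -mulrA ler_wpM2l ?(ltW t20)// ler_wpM2l// ler_expR ler_piMl//.
    by rewrite -real_normK ?num_real// exprn_ile1.
  rewrite /C; lra.
apply/cvgr0Pnorm_lt => e e0.
pose t := Num.min 1 (e / 2 / C).
have t0 : 0 < t by rewrite lt_min ltr01 !divr_gt0.
have t1 : t <= 1 by rewrite ge_min lexx.
have tC : t * C < e.
  apply: (@le_lt_trans _ _ (e / 2)); last by lra.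
  by rewrite -ler_pdivlMr// ge_min lexx orbT.
have u1 : \forall n \near \oo, t * \int[P]_w Y n j w <= t ^+ 2 * C.
  by apply: up; rewrite gtr0_norm// t0.
have u2 : \forall n \near \oo, - t * \int[P]_w Y n j w <= t ^+ 2 * C.
  by rewrite -sqrrN; apply: up; rewrite normrN gtr0_norm// t0.
near=> n.
have h1 : t * \int[P]_w Y n j w <= t ^+ 2 * C by near: n.
have h2 : - t * \int[P]_w Y n j w <= t ^+ 2 * C by near: n.
move: h1 h2; rewrite mulNr -mulrN !expr2 -!mulrA !ler_pM2l// => h1 h2.
by rewrite ltr_norml; apply/andP; split; lra.
Unshelve. all: by end_near.
Qed.

Lemma normalised_part_countE n j w :
  normalised_part_count P S (u n) j.+1 w = Y n j w - \int[P]_w Y n j w.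
Proof.
have bk : bounded_mfun (part_count S (u n) j.+1).
  exact: (bounded_mfun_part_counts S_sub u_uniform n (fun k => k j.+1)).
rewrite /normalised_part_count unlock /centred_part_count.
have -> : \int[P]_w (part_count S (u n) j.+1 w / root_ln n - root_ln n / (j.+1%:R * m1)) =
    \int[P]_w part_count S (u n) j.+1 w / root_ln n - root_ln n / (j.+1%:R * m1).
  transitivity (\int[P]_w ((root_ln n)^-1 * part_count S (u n) j.+1 w + - (root_ln n / (j.+1%:R * m1)))).
    by apply: eq_Rintegral => w' _; rewrite mulrC.
  rewrite bounded_meanD; [|exact: bounded_mfunZ|exact: bounded_mfun_cst].
  by rewrite bounded_meanZ// mean_cst mulrC.
by rewrite mulrBl opprB addrA subrK.
Qed.

(** The two centrings differ by a deterministic quantity tending to 0, which multiplies the moment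
    generating function by a factor tending to 1. *)
Lemma normalised_part_count_mgf (a : nat -> R) K : a 0%N = 0 ->
  (forall j, (K < j)%N -> a j = 0) ->
  \int[P]_w expR (\sum_(j < K) a j.+1 * normalised_part_count P S (u n) j.+1 w) @[n --> \oo]
  --> expR (quad (limit_sigma (m2 / m1 ^+ 3) m1) (fun j : 'I_K => a j.+1) / 2).
Proof.
move=> a0 aK.
have h := centred_part_count_mgf S_sub S_nu nu_L nu_R u_uniform u_S a0 aK.
have E n : \int[P]_w expR (\sum_(j < K) a j.+1 * normalised_part_count P S (u n) j.+1 w) =
  (\int[P]_w expR (\sum_(j < K) a j.+1 * Y n j w)) *
  expR (- \sum_(j < K) a j.+1 * \int[P]_w Y n j w).
  rewrite mulrC -bounded_meanZ; last first.
    exact: (bounded_mfun_centred n (fun y => expR (\sum_(j < K) a j.+1 * y j))).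
  apply: eq_Rintegral => w _; rewrite -expRD; congr expR.
  rewrite addrC -sumrB; apply: eq_bigr => j _.
  by rewrite normalised_part_countE mulrBr.
under eq_cvg do rewrite E.
have s0 : - (\sum_(j < K) a j.+1 * \int[P]_w Y n j w) @[n --> \oo] --> - (\sum_(j < K) a j.+1 * 0).
  apply: cvgN; apply: cvg_sum_seq => j; apply: cvgM; first exact: cvg_cst.
  exact: centred_part_count_mean_cvg.
have s1 := @cvg_comp _ _ _ _ expR _ (nbhs (- (\sum_(j < K) a j.+1 * 0))) _ s0 (@continuous_expR R _).
have e0 : - (\sum_(j < K) a j.+1 * 0) = 0 by rewrite big1 ?oppr0// => j _; rewrite mulr0.
rewrite e0 expR0 in s1.
rewrite -[expR (quad _ _ / 2)]mulr1; exact: (cvgM h s1).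
Qed.

End normalised_part_counts.

Unset Implicit Arguments.

(* The sequences indexed by r = 1, 2, ... are shifted: their component i is the
   one with r = i.+1. *)
Theorem theorem14 (R : realType) (d : measure_display) (T : measurableType d)
    (P : probability T R) (S : R -> T -> R) (nu : {measure set R -> \bar R})
    (u : forall n : nat, 'I_n -> T -> R)
    (S_subordinator : subordinator P S)
    (S_nu : driftfree_with_levy_measure P S nu)
    (nu_density : continuous_density nu)
    (nu_L : condition_L nu)
    (nu_R : condition_R nu)
    (u_uniform : forall n, iid_uniform P (u n))
    (u_S : forall n, independent_of_process P S (u n)) :
  exists (d' : measure_display) (T' : measurableType d') (Q : probability T' R)
    (Z : nat -> T' -> R),
    centred_gaussian_sequence Q
      (fun i j => limit_covariance nu i.+1 j.+1) Z /\
    fdd_converges P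
      (fun n i => normalised_part_count P S (u n) i.+1) Q Z.
Proof.
pose m1 := levy_moment nu 1; pose p := levy_moment nu 2 / m1 ^+ 3.
have m10 : 0 <= m1 := levy_moment_ge0 nu 1.
have p0 : 0 <= p by rewrite divr_ge0 ?exprn_ge0// levy_moment_ge0.
have mZ := measurable_limit_sequence p m1.
exists _, (measurableTypeR R), (@unif01 R), (limit_sequence p m1); split.
  apply: centred_gaussian_sequence_of_mgf => //; first exact: limit_sigmaC.
  exact: limit_sequence_mgf.
have bN n (h : (nat -> R) -> R) : bounded_mfun (fun w => h (fun j => normalised_part_count P S (u n) j.+1 w)).
  exact: (bounded_mfun_part_counts S_subordinator u_uniform n (fun k => h (fun j =>
    (k j.+1 - fine ('E_P[part_count S (u n) j.+1])%E) / Num.sqrt (ln n%:R)))).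
split=> [n i|k r f fc [M fM]]; first exact: (bN n (fun x => x i)).1.
(* Several indices may share the same [r i]: their coefficients are added. Indexing by the part size
   [(r i).+1] makes [a c] vanish at 0. *)
pose a (c : 'rV[R]_k) (m : nat) : R := \sum_i (m == (r i).+1)%:R * c 0 i.
pose K := (\max_i r i).+1.
have collect (c : 'rV[R]_k) (h : nat -> R) : \sum_i c 0 i * h (r i) = \sum_(j < K) a c j.+1 * h j.
  under [RHS]eq_bigr do rewrite mulr_suml; rewrite exchange_big/=; apply: eq_bigr => i _.
  under eq_bigr do rewrite eqSS -mulrA.
  rewrite (sum_delta (fun j => c 0 i * h j))// ltnS; exact: leq_bigmax.
have ca0 c : a c 0%N = 0 by rewrite /a big1// => i _; rewrite mul0r.
have caK c j : (K < j)%N -> a c j = 0.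
  move=> Kj; rewrite /a big1// => i _; rewrite gtn_eqF ?mul0r//.
  by apply: leq_ltn_trans Kj; rewrite ltnS; exact: leq_bigmax.
have mgfZ c : (\int[unif01]_w (expR (dotr c (\row_i limit_sequence p m1 (r i) w)))%:E =
    (expR (quad (limit_sigma p m1) (fun j : 'I_K => a c j.+1) / 2))%:E)%E.
  rewrite -(limit_sequence_mgf p0 m10); apply: eq_integral => w _; congr (expR _)%:E.
  rewrite -(collect c (fun j => limit_sequence p m1 j w)) /dotr.
  by apply: eq_bigr => i _; rewrite mxE.
apply: (@cvg_expectation_bounded_continuous _ _ _ _ _ _ P unif01
  (fun n w => \row_i normalised_part_count P S (u n) (r i).+1 w)
  (fun w => \row_i limit_sequence p m1 (r i) w) _ _ _ f M) => //.
- move=> n; split=> [i|c].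
    under eq_fun do rewrite mxE; exact: (bN n (fun x => x (r i))).1.
  apply: bounded_mfun_integrable.
  under eq_fun do rewrite /dotr; under eq_fun do under eq_bigr do rewrite mxE.
  exact: (bN n (fun x => expR (\sum_i c 0 i * x (r i)))).
- have mrow (i : 'I_k) : measurable_fun setT (fun w => (\row_i limit_sequence p m1 (r i) w) 0 i).
    by under eq_fun do rewrite mxE; exact: mZ.
  split=> // c; apply/integrableP; split.
    apply/measurable_EFinP; apply: measurableT_comp => //.
    by apply: measurable_sum => i; exact: measurable_funM.
  under eq_integral do rewrite gee0_abs ?lee_fin ?expR_ge0//.
  by rewrite mgfZ ltry.
move=> c; rewrite /mean {2}/Rintegral mgfZ/=.
have h := normalised_part_count_mgf S_subordinator S_nu nu_L nu_R u_uniform u_S (ca0 c) (caK c).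
under eq_cvg => n.
  under eq_Rintegral => w _.
    rewrite (_ : dotr _ _ = \sum_(j < K) a c j.+1 * normalised_part_count P S (u n) j.+1 w); last first.
      rewrite -(collect c (fun j => normalised_part_count P S (u n) j.+1 w)) /dotr.
      by apply: eq_bigr => i _; rewrite mxE.
    over.
  over.
exact: h.
Qed.
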